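(* Let $\Omega\subset\mathbb{R}^n$ be open, $T>0$, and let $$H(t,x,p)=\tfrac12\langle A(t,x)p,p\rangle+V(t,x),\qquad (t,x)\in[0,T]\times\Omega,\ p\in\mathbb{R}^n,$$ where $V:[0,T]\times\Omega\to\mathbb{R}$ is of class $C^2$ and $A(t,x)$ is a family of symmetric positive definite matrices with $C^2$ coefficients such that, as quadratic forms, $c_1I<A(t,x)<c_2I$ for every $(t,x)\in[0,T]\times\Omega$, for suitable positive constants $c_1,c_2$. Let $u_0:\Omega\to\mathbb{R}$ be locally semiconcave on $\Omega$, and let $u:[0,T[\times\Omega\to\mathbb{R}$ be a continuous viscosity solution of $$\partial_t u+H(t,x,D_xu)=0 \ \text{ in } ]0,T[\times\Omega,\qquad u(0,x)=u_0(x)\ \text{ in }\Omega.$$ Let $y_0\in\Omega$ be a point at which $u_0$ is not differentiable. Then the generalized characteristic $\gamma$ associated with $u$ starting at $y_0$ at time $0$ (it exists and is unique, in the sense that any two of them coincide on their common interval of definition) is singular: $u$ is not differentiable at $(t,\gamma(t))$ for every $t>0$ in the interval of definition of $\gamma$.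
   Context: Notation: $]a,b[$ and $[a,b[$ denote open and right-open intervals. A function $v$ is (locally) semiconcave if it can be locally represented as $v=v_1+v_2$ with $v_1$ concave and $v_2\in C^2$. The (Fréchet) superdifferential in space is $D^+_xu(t,x)=\{p\in\mathbb{R}^n:\ \limsup_{y\to x}\frac{u(t,y)-u(t,x)-\langle p,y-x\rangle}{|y-x|}\le 0\}$. A generalized characteristic associated with $u$ is a Lipschitz curve $\gamma:[t_0,t_1]\to\Omega$ (with $t_0<t_1$), with $(t,\gamma(t))\in[0,T[\times\Omega$, such that $\dot\gamma(t)\in \mathrm{co}\, D_pH(t,\gamma(t),D^+_xu(t,\gamma(t)))$ for a.e. $t\in[t_0,t_1]$ (co = convex hull); for the present $H$ this reads $\dot\gamma(t)\in A(t,\gamma(t))D^+_xu(t,\gamma(t))$. A curve on $[0,\sigma[$ is a generalized characteristic if its restriction to every compact subinterval is one. It starts at $y_0$ (at time $0$) if $t_0=0$ and $\gamma(0)=y_0$. *)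

(* Defs.v *)
(* Vectors of R^n are row vectors 'rV[R]_n. The norm
   and topology that the library puts on 'rV[R]_n come from the sup norm, which
   is equivalent to the Euclidean one: openness, differentiability and Lipschitz
   continuity do not depend on that choice. *)
From HB Require Import structures.
From mathcomp Require Import all_boot all_order all_algebra.
From mathcomp Require Import all_classical all_reals all_analysis.

Set Implicit Arguments.
Unset Strict Implicit.
Unset Printing Implicit Defensive.

Import Order.TTheory GRing.Theory Num.Theory.
Import numFieldNormedType.Exports.

Local Open Scope classical_set_scope.
Local Open Scope ring_scope.

Section Euclidean.
Context {R : realType} {n : nat}.

Definition dotp (p q : 'rV[R]_n) : R := \sum_(i < n) p 0 i * q 0 i.

Definition enorm (p : 'rV[R]_n) : R := Num.sqrt (dotp p p).

(* The product M p of a matrix with the column vector p, written as a row. *)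
Definition mxact (M : 'M[R]_n) (p : 'rV[R]_n) : 'rV[R]_n := (M *m p^T)^T.

Definition grad (f : 'rV[R]_n -> R) (x : 'rV[R]_n) : 'rV[R]_n :=
  \row_(i < n) 'D_(delta_mx 0 i) f x.

End Euclidean.

Section Smoothness.
Context {R : realType} {E : normedModType R}.

(* Meant for open sets U. *)
Definition C1_on (U : set E) (f : E -> R) : Prop :=
  (forall x, U x -> differentiable f x) /\
  (forall v x, U x -> {for x, continuous ('D_v f)}).

Definition C2_on (U : set E) (f : E -> R) : Prop :=
  C1_on U f /\ forall v, C1_on U ('D_v f).

(* Class C^2 on a set that need not be open, such as [0, T] x Omega: f agrees
   on it with a function of class C^2 on an open neighbourhood. The values of f
   outside D play no role. *)
Definition C2_near (D : set E) (f : E -> R) : Prop :=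
  exists (U : set E) (g : E -> R),
    [/\ open U, D `<=` U, C2_on U g & {in D, f =1 g}].

Definition concave_on (D : set E) (f : E -> R) : Prop :=
  @convex_function R E D (fun x => - f x).

Definition locally_semiconcave (D : set E) (v : E -> R) : Prop :=
  forall x, D x -> exists (r : R) (v1 v2 : E -> R),
    [/\ 0 < r, ball x r `<=` D, concave_on (ball x r) v1, C2_on (ball x r) v2
      & forall y, ball x r y -> v y = v1 y + v2 y].

Definition convex_hull (S : set E) : set E := smallest (@convex_set R E) S.

End Smoothness.

Section HamiltonJacobi.
Context {R : realType} {n : nat}.
Implicit Types (u : R * 'rV[R]_n -> R) (H : R -> 'rV[R]_n -> 'rV[R]_n -> R).
Implicit Types (Om : set 'rV[R]_n) (gam : R -> 'rV[R]_n).

Definition closed_cylinder (T : R) Om : set (R * 'rV[R]_n) :=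
  [set z | 0 <= z.1 <= T /\ Om z.2].

Definition ropen_cylinder (T : R) Om : set (R * 'rV[R]_n) :=
  [set z | 0 <= z.1 < T /\ Om z.2].

Definition open_cylinder (T : R) Om : set (R * 'rV[R]_n) :=
  [set z | 0 < z.1 < T /\ Om z.2].

Definition quadratic_ham (A : R * 'rV[R]_n -> 'M[R]_n) (V : R * 'rV[R]_n -> R)
    (t : R) (x p : 'rV[R]_n) : R :=
  2^-1 * dotp (mxact (A (t, x)) p) p + V (t, x).

(* phi_t + H (t, x, D_x phi) at z = (t, x). *)
Definition HJ_operator H (phi : R * 'rV[R]_n -> R) (z : R * 'rV[R]_n) : R :=
  derive1 (fun s => phi (s, z.2)) z.1 + H z.1 z.2 (grad (fun y => phi (z.1, y)) z.2).

Definition viscosity_subsolution H (Q : set (R * 'rV[R]_n)) u : Prop :=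
  forall phi, C1_on Q phi -> forall z, Q z ->
    (\forall w \near z, u w - phi w <= u z - phi z) -> HJ_operator H phi z <= 0.

Definition viscosity_supersolution H (Q : set (R * 'rV[R]_n)) u : Prop :=
  forall phi, C1_on Q phi -> forall z, Q z ->
    (\forall w \near z, u z - phi z <= u w - phi w) -> 0 <= HJ_operator H phi z.

Definition viscosity_solution H (Q : set (R * 'rV[R]_n)) u : Prop :=
  viscosity_subsolution H Q u /\ viscosity_supersolution H Q u.

(* The limsup as y tends to x is taken along punctured neighbourhoods of x;
   when x lies in the open set Omega it only involves points y of Omega. *)
Definition superdiff_x u (t : R) (x : 'rV[R]_n) : set 'rV[R]_n :=
  [set p | (limf_esup
     (fun y => ((u (t, y) - u (t, x) - dotp p (y - x)) / enorm (y - x))%:E)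
     (x^') <= 0)%E].

(* The values of gam outside [t0, t1] may affect its derivative only at the
   two end points, which form a null set. *)
Definition gen_characteristic H (T : R) Om u (t0 t1 : R) gam : Prop :=
  [/\ t0 < t1,
      forall t, t \in `[t0, t1] -> ropen_cylinder T Om (t, gam t),
      [lipschitz gam t | t in [set` `[t0, t1]]]
    & {ae @lebesgue_measure R, forall t, t \in `[t0, t1] ->
        derivable gam t 1 /\
        convex_hull (grad (H t (gam t)) @` superdiff_x u t (gam t))
          (derive1 gam t)}].

(* gam is a generalized characteristic with interval of definition J, where
   J = [0, s] or J = [0, s[ with s > 0, and gam 0 = y0. For J = [0, s] the last
   clause amounts to gen_characteristic H T Om u 0 s gam. *)
Definition gen_characteristic_from H (T : R) Om u (y0 : 'rV[R]_n)
    (J : interval R) gam : Prop :=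
  [/\ exists2 s : R, 0 < s & J = `[0, s] \/ J = `[0, s[,
      gam 0 = y0
    & forall a b, a < b -> [set` `[a, b]] `<=` [set` J] ->
        gen_characteristic H T Om u a b gam].

End HamiltonJacobi.

(* Main.v *)
(* The subsolution property gives u (t2, gam t2) - u (t1, gam t1) <= the action
   of gam, for every curve gam, with the Lagrangian L = <A^-1 v, v> / 2 - V,
   while the supersolution property provides almost minimizing chains reaching
   any point. Moving such a chain shows that u (t, .) is locally semiconcave,
   uniformly up to t = 0, so the superdifferentials D^+_x u are nonempty and
   (p, x) |-> A p is one-sided Lipschitz in the metric A^-1: this is
   uniqueness. Existence follows from Euler polygons.

   Along a characteristic let delta = L (gam, gam') - d/dt u (t, gam t) >= 0.
   Since gam' = A p with p in D^+_x u, semiconcavity and a variation of gam give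
   int_t^e delta >= (e - t) (1 - k (e - t)) delta t, so the mean of delta over
   [t, e], up to a factor 1 + O (e - t), is nondecreasing in t. If u is
   differentiable at (e, gam e), this mean tends to 0 as t tends to e, hence
   delta = 0 on an interval [t, e]; repeating this from any t in the interval
   carries delta = 0 back to time 0. Then u0 is touched from below by a
   quadratic function at y0, and being semiconcave it is differentiable
   there. *)
Require Import Defs.
From HB Require Import structures.
From mathcomp Require Import all_boot all_order all_algebra.
From mathcomp Require Import all_classical all_reals all_analysis.
From mathcomp Require Import measurable_realfun.
From mathcomp Require Import ring lra.

Set Implicit Arguments.
Unset Strict Implicit.
Unset Printing Implicit Defensive.

Import Order.TTheory GRing.Theory Num.Theory.
Import numFieldNormedType.Exports.

Local Open Scope classical_set_scope.
Local Open Scope ring_scope.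

(** * One-dimensional Rademacher theorem *)

(** No representation formula for [u] is available: the solution is only local, and nothing is known
    at the lateral boundary. So all estimates are made on small boxes, with constants uniform on the
    box, and the two viscosity inequalities stand in for a value function. Their test functions come
    from minimizing [u] or [- u] plus a penalty attached to a moving point. One semiconcavity proof
    serves all times: at a positive time the shift of the chain fades out at an auxiliary initial
    time, at time 0 it is kept constant and [u0] takes over. In the calibration step the derivative
    of u along a characteristic with velocity v = A p is <sig, v> - H (sig), where sig need not be
    p, and the defect is <A (sig - p), sig - p> / 2. The obstacle is the unknown linear term in the
    expansion of the action; it is controlled by choosing sig in a prescribed half space. Calculus
    along Lipschitz curves is reduced to one fact: a Lipschitz function whose derivative is
    nonnegative almost everywhere is nondecreasing. *)

Section Rademacher.
Context {R : realType}.
Let mu := @lebesgue_measure R.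

Lemma lebesgue_measure_itvoc_fin (u v : R) : (mu `]u, v]%classic < +oo)%E.
Proof.
have := lebesgue_measure_itv `]u, v]; rewrite /mu => ->.
by case: ifP => // _; rewrite -EFinB ltry.
Qed.

Lemma lebesgue_measure_itvocE (u v : R) : u <= v -> fine (mu `]u, v]%classic) = v - u.
Proof.
move=> uv; have := lebesgue_measure_itv `]u, v]; rewrite /mu => ->.
rewrite [`]u, v].1]/= [`]u, v].2]/= lte_fin; case: ltP => //= vu.
by have /eqP -> : u == v by [rewrite eq_le uv vu]; rewrite subrr.
Qed.

Lemma ae_impl (P Q : R -> Prop) : (forall t, P t -> Q t) ->
  {ae mu, forall t, P t} -> {ae mu, forall t, Q t}.
Proof. by move=> PQ; apply: filterS PQ; exact: (ae_filter_ringOfSetsType mu). Qed.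

Lemma ae_and (P Q : R -> Prop) : {ae mu, forall t, P t} ->
  {ae mu, forall t, Q t} -> {ae mu, forall t, P t /\ Q t}.
Proof. exact: (@filterI _ _ (ae_filter_ringOfSetsType mu)). Qed.

Lemma derive1_near_affine (F f : R -> R) (c k t l : R) :
  derivable F t 1 -> derive1 F t = l ->
  (\forall x \near t, c + F x - k * x = f x) ->
  derivable f t 1 /\ derive1 f t = l - k.
Proof.
move=> dF Fl fE.
have isF : is_derive t 1 F l by apply: DeriveDef; rewrite // -derive1E.
have isg : is_derive t 1 (fun x => c + F x - k * x) (l - k).
  have := is_deriveB (is_deriveD (is_derive_cst c t 1) isF) (is_deriveZ k (is_derive_id t 1)).
  by rewrite add0r /GRing.scale/= mulr1.
have isf := near_eq_is_derive fE isg.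
by split; [exact: ex_derive|rewrite derive1E; exact: derive_val].
Qed.

(** Absolute continuity of the Stieltjes measure: a cover of [A] by half-open intervals of total
    length below [e / K] has total Stieltjes length at most [e], by comparison interval by
    interval. *)
Lemma stieltjes_lipschitz_dominated (f : cumulative R R) (K : R) :
  0 < K -> (forall x y, x <= y -> f y - f x <= K * (y - x)) ->
  forall A : set R, mu A = 0%E -> lebesgue_stieltjes_measure f A = 0%E.
Proof.
move=> K0 fK A A0; apply/eqP; rewrite eq_le outer_measure_ge0 andbT.
apply/lee_addgt0Pr => e e0; rewrite add0e.
have : (mu A < (e / K)%:E)%E by rewrite A0 lte_fin divr_gt0.
move=> /ereal_inf_lt[z [/= M [mM AM] <-] zlt].
apply: (@le_trans _ _ (\sum_(0 <= k <oo) wlength f (M k))%E).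
  by apply: ereal_inf_lbound; exists M.
apply: (@le_trans _ _ (\sum_(0 <= k <oo) (K%:E * wlength idfun (M k)))%E).
  apply: lee_nneseries => k _; first by move=> _; exact: measure_ge0.
  have /ocitvP[->|[[a b] /= ab ->]] := mM k; first by rewrite !wlength0 mule0.
  by rewrite !wlength_itv_bnd ?(ltW ab)// -EFinM lee_fin fK// ltW.
rewrite nneseriesZl; last by move=> k _; exact: measure_ge0.
rewrite -[e](@mulrVK _ K) ?unitfE ?gt_eqF// mulrC EFinM lee_pmul2l//.
exact: ltW.
Qed.

Lemma stieltjes_itvoc (f : cumulative R R) (a b : R) : a <= b ->
  lebesgue_stieltjes_measure f `]a, b]%classic = (f b - f a)%:E.
Proof.
move=> ab; rewrite /lebesgue_stieltjes_measure /measure_extension.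
rewrite measurable_mu_extE; last exact: is_ocitv.
exact: (@wlength_itv_bnd R f).
Qed.

(** Adding a linear function turns [f] into a nondecreasing Lipschitz function, whose Stieltjes
    measure is absolutely continuous. Its Radon-Nikodym density is the derivative almost everywhere,
    by Lebesgue differentiation of the primitive. *)
Lemma lipschitz_ae_derive (f : R -> R) (a b K : R) : a < b ->
  (forall x y, a <= x -> x <= y -> y <= b -> `|f y - f x| <= K * (y - x)) ->
  exists h : R -> R, [/\ mu.-integrable `]a, b] (EFin \o h),
    f b - f a = \int[mu]_(t in `]a, b]) h t &
    {ae mu, forall t, a < t < b -> derivable f t 1 /\ derive1 f t = h t}].
Proof.
move=> ab fK.
(* Freezing [f] outside [a, b] makes it Lipschitz on the whole line; [g] below is monotone because
   the slope [K'] of its linear part dominates the Lipschitz constant. *)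
pose c t := Num.max a (Num.min t b).
have cV t : [\/ t <= a /\ c t = a, a <= t <= b /\ c t = t | b <= t /\ c t = b].
  rewrite /c; have [?|?] := leP t b; [have [?|?] := leP a t|have [?|?] := leP a b].
  - by constructor 2; split=> //; lra.
  - by constructor 1; split=> //; lra.
  - by constructor 3; split=> //; lra.
  - by lra.
have cP t : a <= c t <= b by case: (cV t) => -[? ->]; lra.
have c_mono x y : x <= y -> c x <= c y.
  by case: (cV x) => -[? ->]; case: (cV y) => -[? ->]; lra.
have c_lip x y : x <= y -> c y - c x <= y - x.
  by case: (cV x) => -[? ->]; case: (cV y) => -[? ->]; lra.
have cE t : a <= t <= b -> c t = t by by case: (cV t) => -[? ->]; lra.
pose K' : R := `|K| + 1.
have K'0 : 0 < K' by rewrite /K' ltr_wpDl.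
have fK' x y : x <= y -> `|f (c y) - f (c x)| <= K' * (c y - c x).
  move=> xy; have /andP[? ?] := cP x; have /andP[? ?] := cP y.
  apply: (le_trans (fK _ _ _ (c_mono _ _ xy) _)) => //.
  apply: ler_wpM2r; first by rewrite subr_ge0 c_mono.
  by rewrite /K'; have := ler_norm K; lra.
pose g t := f (c t) + K' * c t.
have g_mono : nondecreasing g.
  move=> x y xy; have := fK' _ _ xy; rewrite /g ler_norml => /andP[]; lra.
have g_lip x y : x <= y -> g y - g x <= (K' + K') * (y - x).
  move=> xy; have := fK' _ _ xy; rewrite /g ler_norml => /andP[_ h].
  have := ler_wpM2l (ltW K'0) (c_lip _ _ xy); lra.
have g_rc : right_continuous g.
  apply: right_continuousW => x; apply/cvgrPdist_le => e e0; near=> y.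
  have h : `|g x - g y| <= (K' + K') * `|x - y|.
    have [xy|/ltW xy] := leP x y.
      rewrite ler0_norm ?subr_le0 ?g_mono// ler0_norm ?subr_le0// !opprB.
      exact: g_lip.
    rewrite ger0_norm ?subr_ge0 ?g_mono// ger0_norm ?subr_ge0//; exact: g_lip.
  apply: (le_trans h); rewrite -ler_pdivlMl; last lra.
  near: y; apply: cvgr_dist_le; first exact: cvg_id.
  by rewrite mulr_gt0// invr_gt0; lra.
pose G : cumulative R R := HB.pack g (@isCumulative.Build R _ R g g_mono g_rc).
pose D : set (measurableTypeR R) := `]a, b]%classic.
have mD : measurable D by exact: measurable_itv.
pose ls : {measure set _ -> \bar R} := lebesgue_stieltjes_measure G.
have lsE x : a <= x -> ls `]a, x]%classic = (g x - g a)%:E.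
  by move=> ax; exact: (@stieltjes_itvoc G).
have lsD : (ls D < +oo)%E by rewrite /D lsE ?ltry// ltW.
pose nu : {finite_measure set _ -> \bar R} := mfrestr mD lsD.
have nu_mu : nu `<< mu.
  apply/null_content_dominatesP => A mA A0.
  have h := @stieltjes_lipschitz_dominated G (K' + K') _ g_lip A A0.
  apply/eqP; rewrite eq_le measure_ge0 andbT -[leRHS](h _); last lra.
  by apply: le_measure; rewrite ?inE//; exact: measurableI.
pose h := Radon_Nikodym_SigmaFinite.f nu mu.
have h_int : mu.-integrable setT h by exact: Radon_Nikodym_SigmaFinite.f_integrable.
have h_fin x : h x \is a fin_num by exact: Radon_Nikodym_SigmaFinite.f_fin_num.
pose hr := fine \o h.
have hrE : EFin \o hr = h by apply/funext => x /=; rewrite fineK.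
have hr_int : mu.-integrable setT (EFin \o hr) by rewrite hrE.
have gE x : a < x <= b -> g x = g a + \int[mu]_(t in `]a, x]) hr t.
  move=> /andP[ax xb]; suff : (nu `]a, x]%classic = (\int[mu]_(t in `]a, x]) hr t)%:E)%E.
    rewrite /nu/= /mfrestr /mrestr/= setIidl; last first.
      by move=> t /=; rewrite /D/= !in_itv/=; lra.
    by rewrite lsE ?ltW// => -[]; lra.
  rewrite (Radon_Nikodym_SigmaFinite.f_integral nu_mu); last exact: measurable_itv.
  rewrite /Rintegral fineK; first by apply: eq_integral => t _ /=; rewrite fineK// h_fin.
  by apply: integrable_fin_num => //; apply: (integrableS measurableT _ _ hr_int).
have hl : locally_integrable [set: R] hr.
  have := @integrable_locally _ hr setT measurableT; rewrite patch_setT; exact.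
have hr_int_itv y : mu.-integrable [set` Interval (BRight a) (BRight y)] (EFin \o hr).
  by apply: (integrableS measurableT _ _ hr_int).
have mab : measurable (`]a, b]%classic : set (measurableTypeR R)).
  exact: measurable_itv.
have cst_int : mu.-integrable `]a, b] (EFin \o cst K').
  apply: measurable_bounded_integrable => //.
  - exact: lebesgue_measure_itvoc_fin.
  - by exists K'; split; [exact: num_real|move=> x Kx y _ /=; rewrite gtr0_norm// ltW].
exists (fun t => hr t - K'); split.
- exact: (integrableB mab (hr_int_itv b) cst_int).
- rewrite RintegralB//= Rintegral_cst// lebesgue_measure_itvocE ?(ltW ab)//.
  have := gE b; rewrite ab lexx => /(_ isT); rewrite /g !cE ?lexx ?(ltW ab)//; clear => /=; lra.
have := @FTC1 _ hr (BRight a) hr_int_itv hl.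
apply: filterS => [|t ht /andP[at_ tb]]; first exact: (ae_filter_ringOfSetsType mu).
have [|dF FE] := ht; first by rewrite lte_fin.
pose F x := \int[mu]_(s in `]a, x]) hr s.
have near_t : \forall x \near t, g a + F x - K' * x = f x.
  near=> x.
  have /andP[ax xb] : a < x < b.
    by near: x; apply: near_in_itvoo; rewrite in_itv/= at_ tb.
  have <- : g x = g a + F x by apply: gE; lra.
  by rewrite /g cE ?addrK//; lra.
exact: derive1_near_affine dF FE near_t.
Unshelve. all: by end_near. Qed.
End Rademacher.

(** * Monotonicity and primitives of Lipschitz functions of one variable *)

Section Lipschitz.
Context {R : realType}.
Let mu := @lebesgue_measure R.

Lemma ae_nondecreasing (f : R -> R) (a b K : R) : a <= b ->
  (forall x y, a <= x -> x <= y -> y <= b -> `|f y - f x| <= K * (y - x)) ->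
  {ae mu, forall t, a < t < b -> derivable f t 1 -> 0 <= derive1 f t} ->
  f a <= f b.
Proof.
rewrite le_eqVlt => /predU1P[->//|ab] fK f'0.
have [h [hi fE hE]] := lipschitz_ae_derive ab fK.
have mab : measurable (`]a, b]%classic : set (measurableTypeR R)).
  exact: measurable_itv.
have mh := measurable_int _ hi.
rewrite -subr_ge0 fE /Rintegral fine_ge0//.
(* The sign of [h] is known only almost everywhere, so the integrand is replaced by its absolute
   value before positivity of the integral is used. The endpoint b is one more null set. *)
have -> : (\int[mu]_(x in `]a, b]) (h x)%:E = \int[mu]_(x in `]a, b]) `|(h x)%:E|)%E.
  apply: ae_eq_integral => //; first exact: measurable_int (integrable_abse hi).
  have nb : {ae mu, forall t, t != b}.
    exists [set b]; split => //; first exact: lebesgue_measure_set1.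
    by move=> x /= /negP; rewrite negbK => /eqP.
  apply: ae_impl (ae_and nb (ae_and hE f'0)) => t [tb [ht f't]].
  rewrite /= in_itv/= => /andP[at_ tb']; rewrite ger0_norm//.
  have atb : a < t < b by rewrite at_/= lt_neqAle tb.
  by have [d <-] := ht atb; exact: f't.
exact: integral_ge0.
Qed.

Lemma bounded_antiderivative (f : R -> R) (a b M : R) :
  measurable_fun setT f -> (forall x, `|f x| <= M) ->
  exists F : R -> R,
   (forall x y, a <= x -> x <= y -> y <= b -> `|F y - F x| <= M * (y - x)) /\
   {ae mu, forall t, a < t < b -> derivable F t 1 /\ derive1 F t = f t}.
Proof.
move=> mf fM.
have MA (A : set (measurableTypeR R)) : measurable A -> (mu A < +oo)%E -> mu.-integrable A (EFin \o cst M).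
  move=> mA Aoo; apply: measurable_bounded_integrable => //.
  exists `|M|; split; [exact: num_real|move=> x Mx y _ /=; exact: ltW].
have fi (A : set (measurableTypeR R)) : measurable A -> (mu A < +oo)%E -> mu.-integrable A (EFin \o f).
  move=> mA Aoo; apply: measurable_bounded_integrable => //.
    exact: measurable_funS mf.
  by exists M; split; [exact: num_real|move=> x Mx y _; apply: le_trans (ltW Mx)].
exists (fun x => \int[mu]_(s in `]a, x]) f s); split.
  move=> x y ax xy yb.
  have itvE : `]a, y]%classic = `]a, x]%classic `|` `]x, y]%classic :> set R.
    by apply/seteqP; split=> z /=; rewrite !in_itv/=; [case: (leP z x)|case]; lra.
  have mitv u v : measurable (`]u, v]%classic : set (measurableTypeR R)) by exact: measurable_itv.
  have fitv u v : (mu `]u, v]%classic < +oo)%E by exact: lebesgue_measure_itvoc_fin.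
  rewrite itvE Rintegral_setU//; last 2 first.
  - by rewrite -itvE; exact: fi.
  - by apply/disj_setPS => z /= []; rewrite !in_itv/=; lra.
  rewrite addrC addKr; apply: le_trans (le_normr_Rintegral _ (fi _ _ _)) _ => //.
  apply: (@le_trans _ _ (\int[mu]_(s in `]x, y]) cst M s)).
    apply: le_Rintegral => //; first exact: (integrable_norm (fi _ _ _)).
    exact: MA.
  by rewrite Rintegral_cst// lebesgue_measure_itvocE.
have fl : locally_integrable setT f.
  split => //; first exact: openT.
  move=> K _ cK.
  have /integrableP[_] := fi K (compact_measurable cK) (compact_finite_measure cK).
  by under eq_integral do rewrite /= .
have fab y : mu.-integrable [set` Interval (BRight a) (BRight y)] (EFin \o f).
  by apply: fi; [exact: measurable_itv|exact: lebesgue_measure_itvoc_fin].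
apply: ae_impl (FTC1 fab fl) => t ft /andP[at_ _].
by apply: ft; rewrite lte_fin.
Qed.
End Lipschitz.

(** * Quadratic forms *)

Section VectorAlgebra.
Context {R : realType} {n : nat}.
Implicit Types (p q v w x y : 'rV[R]_n) (M N : 'M[R]_n).

Lemma dotpC p q : dotp p q = dotp q p.
Proof. by apply: eq_bigr => i _; rewrite mulrC. Qed.
Lemma dotpDl p q v : dotp (p + q) v = dotp p v + dotp q v.
Proof. by rewrite /dotp -big_split/=; apply: eq_bigr => i _; rewrite mxE mulrDl. Qed.
Lemma dotpZl a p v : dotp (a *: p) v = a * dotp p v.
Proof. by rewrite /dotp mulr_sumr; apply: eq_bigr => i _; rewrite mxE mulrA. Qed.
Lemma dotpDr v p q : dotp v (p + q) = dotp v p + dotp v q.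
Proof. by rewrite dotpC dotpDl !(dotpC v). Qed.
Lemma dotpZr a v p : dotp v (a *: p) = a * dotp v p.
Proof. by rewrite dotpC dotpZl (dotpC v). Qed.
Lemma dotpNl p v : dotp (- p) v = - dotp p v.
Proof. by rewrite -scaleN1r dotpZl mulN1r. Qed.
Lemma dotpNr v p : dotp v (- p) = - dotp v p.
Proof. by rewrite dotpC dotpNl (dotpC v). Qed.
Lemma dotpBl p q v : dotp (p - q) v = dotp p v - dotp q v.
Proof. by rewrite dotpDl dotpNl. Qed.
Lemma dotpBr v p q : dotp v (p - q) = dotp v p - dotp v q.
Proof. by rewrite dotpDr dotpNr. Qed.
Lemma dotp0l v : dotp 0 v = 0.
Proof. by rewrite -(scale0r 0) dotpZl mul0r. Qed.
Lemma dotp0r v : dotp v 0 = 0.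
Proof. by rewrite dotpC dotp0l. Qed.

Lemma mxactD M p q : mxact M (p + q) = mxact M p + mxact M q.
Proof. by rewrite /mxact linearD/= mulmxDr linearD. Qed.
Lemma mxactZ M a p : mxact M (a *: p) = a *: mxact M p.
Proof. by rewrite /mxact linearZ/= -scalemxAr linearZ. Qed.
Lemma mxactN M p : mxact M (- p) = - mxact M p.
Proof. by rewrite -scaleN1r mxactZ scaleN1r. Qed.
Lemma mxactB M p q : mxact M (p - q) = mxact M p - mxact M q.
Proof. by rewrite mxactD mxactN. Qed.
Lemma mxact0 M : mxact M 0 = 0.
Proof. by rewrite -(scale0r (0 : 'rV[R]_n)) mxactZ !scale0r. Qed.
Lemma mxactDm M N p : mxact (M + N) p = mxact M p + mxact N p.
Proof. by rewrite /mxact mulmxDl linearD. Qed.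
Lemma mxactNm M p : mxact (- M) p = - mxact M p.
Proof. by rewrite /mxact mulNmx linearN. Qed.
Lemma mxactBm M N p : mxact (M - N) p = mxact M p - mxact N p.
Proof. by rewrite mxactDm mxactNm. Qed.
Lemma mxactM M N p : mxact (M *m N) p = mxact M (mxact N p).
Proof. by rewrite /mxact trmxK mulmxA. Qed.
Lemma mxact1 p : mxact 1%:M p = p.
Proof. by rewrite /mxact mul1mx trmxK. Qed.

Lemma mxact_sym M p q : M^T = M -> dotp (mxact M p) q = dotp p (mxact M q).
Proof.
move=> MT.
have dE (v w : 'rV[R]_n) : dotp v w = (v *m w^T) 0 0.
  by rewrite mxE; apply: eq_bigr => i _; rewrite mxE.
by rewrite !dE /mxact trmx_mul !trmxK MT mulmxA.
Qed.

Lemma coord_le_norm (m1 m2 : nat) (A : 'M[R]_(m1, m2)) i j : `|A i j| <= `|A|.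
Proof.
by rewrite [leRHS]/Num.norm/= mx_normrE; apply/bigmax_geP; right; exists (i, j).
Qed.

Lemma norm_le_coord (m1 m2 : nat) (A : 'M[R]_(m1, m2)) (c : R) : 0 <= c ->
  (forall i j, `|A i j| <= c) -> `|A| <= c.
Proof.
move=> c0 Ac; rewrite [leLHS]/Num.norm/= mx_normrE.
by apply: bigmax_le => // -[i j] _; exact: Ac.
Qed.

Lemma dotp_le p q : `|dotp p q| <= n%:R * (`|p| * `|q|).
Proof.
rewrite /dotp; apply: le_trans (ler_norm_sum _ _ _) _.
have -> : n%:R * (`|p| * `|q|) = \sum_(i < n) (`|p| * `|q|).
  by rewrite sumr_const card_ord mulr_natl.
by apply: ler_sum => i _; rewrite normrM ler_pM// coord_le_norm.
Qed.

Lemma dotp_ge0 p : 0 <= dotp p p.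
Proof. by apply: sumr_ge0 => i _; rewrite -expr2 sqr_ge0. Qed.

Lemma norm_sq_le p : `|p| ^+ 2 <= dotp p p.
Proof.
rewrite -[leRHS]sqr_sqrtr ?dotp_ge0// ler_sqr ?nnegrE ?sqrtr_ge0//.
apply: norm_le_coord; first exact: sqrtr_ge0.
move=> i j; rewrite -ler_sqr ?nnegrE ?sqrtr_ge0// sqr_sqrtr ?dotp_ge0//.
rewrite /dotp (bigD1 j)//= -normrX ger0_norm ?sqr_ge0// ord1 expr2 lerDl.
by apply: sumr_ge0 => k _; rewrite -expr2 sqr_ge0.
Qed.

Lemma dotp_eq0 p : dotp p p <= 0 -> p = 0.
Proof.
move=> p0; apply/eqP; rewrite -normr_eq0 -sqrf_eq0 eq_le sqr_ge0 andbT.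
exact: le_trans (norm_sq_le p) p0.
Qed.

Lemma mxact_le M p : `|mxact M p| <= n%:R * (`|M| * `|p|).
Proof.
apply: norm_le_coord => [|i j]; first by rewrite !mulr_ge0.
rewrite /mxact !mxE; apply: le_trans (ler_norm_sum _ _ _) _.
have -> : n%:R * (`|M| * `|p|) = \sum_(i < n) (`|M| * `|p|).
  by rewrite sumr_const card_ord mulr_natl.
by apply: ler_sum => k _; rewrite normrM ler_pM// ?mxE coord_le_norm.
Qed.

Definition bil M v w : R := dotp (mxact M v) w.

Lemma bilDl M v w x : bil M (v + w) x = bil M v x + bil M w x.
Proof. by rewrite /bil mxactD dotpDl. Qed.
Lemma bilDr M x v w : bil M x (v + w) = bil M x v + bil M x w.
Proof. by rewrite /bil dotpDr. Qed.
Lemma bilZl M a v x : bil M (a *: v) x = a * bil M v x.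
Proof. by rewrite /bil mxactZ dotpZl. Qed.
Lemma bilZr M a x v : bil M x (a *: v) = a * bil M x v.
Proof. by rewrite /bil dotpZr. Qed.
Lemma bilNl M v x : bil M (- v) x = - bil M v x.
Proof. by rewrite /bil mxactN dotpNl. Qed.
Lemma bilNr M x v : bil M x (- v) = - bil M x v.
Proof. by rewrite /bil dotpNr. Qed.
Lemma bilBl M v w x : bil M (v - w) x = bil M v x - bil M w x.
Proof. by rewrite bilDl bilNl. Qed.
Lemma bilBr M x v w : bil M x (v - w) = bil M x v - bil M x w.
Proof. by rewrite bilDr bilNr. Qed.
Lemma bilDm M N v w : bil (M + N) v w = bil M v w + bil N v w.
Proof. by rewrite /bil mxactDm dotpDl. Qed.
Lemma bilNm M v w : bil (- M) v w = - bil M v w.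
Proof. by rewrite /bil mxactNm dotpNl. Qed.
Lemma bilBm M N v w : bil (M - N) v w = bil M v w - bil N v w.
Proof. by rewrite bilDm bilNm. Qed.
Lemma bil_le M v w : `|bil M v w| <= n%:R ^+ 2 * (`|M| * `|v| * `|w|).
Proof.
rewrite /bil; apply: le_trans (dotp_le _ _) _.
rewrite expr2 -mulrA ler_wpM2l// mulrA ler_wpM2r//.
exact: mxact_le.
Qed.
Lemma bilC M v w : M^T = M -> bil M v w = bil M w v.
Proof. by move=> MT; rewrite /bil mxact_sym// dotpC. Qed.

Lemma elliptic_unitmx M (c : R) : 0 < c ->
  (forall p, c * dotp p p <= dotp (mxact M p) p) -> M \in unitmx.
Proof.
move=> c0 Mc; rewrite -unitmx_tr -row_free_unit; apply: inj_row_free => v vM.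
apply: dotp_eq0; rewrite -(pmulr_rle0 _ c0); apply: le_trans (Mc v) _.
by rewrite /mxact trmx_mul trmxK vM dotp0l.
Qed.

Lemma invmx_sym M : M^T = M -> (invmx M)^T = invmx M.
Proof. by move=> MT; rewrite trmx_inv MT. Qed.

Section Elliptic.
Variables (M : 'M[R]_n) (c : R).
Hypothesis c_gt0 : 0 < c.
Hypothesis M_sym : M^T = M.
Hypothesis M_ell : forall p, c * dotp p p <= bil M p p.

Let B := invmx M.

Lemma mxact_invK v : mxact M (mxact B v) = v.
Proof. by rewrite -mxactM mulmxV ?mxact1// (elliptic_unitmx c_gt0). Qed.

Lemma mxact_invKV v : mxact B (mxact M v) = v.
Proof. by rewrite -mxactM mulVmx ?mxact1// (elliptic_unitmx c_gt0). Qed.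

Lemma bil_inv_ge0 v : 0 <= bil B v v.
Proof.
rewrite /bil mxact_sym ?invmx_sym// -{1}(mxact_invK v); apply: le_trans (M_ell _).
by rewrite mulr_ge0 ?dotp_ge0// ltW.
Qed.

(** Young's inequality for [M]: expand <M (q - M^-1 v), q - M^-1 v> >= 0. It expresses the duality
    between Hamiltonian and Lagrangian. *)
Lemma fenchel v q : dotp q v - 2^-1 * bil M q q <= 2^-1 * bil B v v.
Proof.
have h : 0 <= bil M (q - mxact B v) (q - mxact B v).
  by apply: le_trans (M_ell _); rewrite mulr_ge0 ?dotp_ge0// ltW.
move: h; rewrite !(bilBl, bilBr).
rewrite (bilC (mxact B v) q)//.
have -> : bil M q (mxact B v) = dotp q v by rewrite /bil mxact_sym// mxact_invK.
have -> : bil M (mxact B v) (mxact B v) = bil B v v.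
  by rewrite /bil mxact_invK dotpC.
by lra.
Qed.

Lemma fenchel_eq q : dotp q (mxact M q) - 2^-1 * bil M q q = 2^-1 * bil B (mxact M q) (mxact M q).
Proof. by rewrite /bil mxact_invKV (dotpC q (mxact M q)); lra. Qed.

(** With w = M^-1 v, ellipticity gives c |w| ^ 2 <= <M w, w> = <v, w>; the factor n pays for the sup
    norm in |<v, w>| <= n |v| |w|. *)
Lemma norm_mxact_inv v : `|mxact B v| <= n%:R / c * `|v|.
Proof.
have [->|w0] := eqVneq (mxact B v) 0; first by rewrite normr0 mulr_ge0 ?divr_ge0// ltW.
have w_gt0 : 0 < `|mxact B v| by rewrite normr_gt0.
rewrite mulrAC ler_pdivlMr// -(ler_pM2r w_gt0).
apply: (@le_trans _ _ (c * dotp (mxact B v) (mxact B v))).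
  rewrite mulrAC -expr2 mulrC ler_wpM2l ?norm_sq_le//; exact: ltW.
apply: le_trans (M_ell _) _; rewrite /bil mxact_invK -mulrA.
exact: le_trans (ler_norm _) (dotp_le _ _).
Qed.

Lemma bil_inv_le v : bil B v v <= n%:R ^+ 2 / c * `|v| ^+ 2.
Proof.
apply: le_trans (ler_norm _) _; apply: le_trans (dotp_le _ _) _.
have := ler_wpM2r (normr_ge0 v) (norm_mxact_inv v).
move=> /(ler_wpM2l (ler0n R n)); congr (_ <= _); ring.
Qed.

Lemma bil_inv_coercive (m : R) v : `|M| <= m ->
  c * `|v| ^+ 2 <= (n%:R * m) ^+ 2 * bil B v v.
Proof.
move=> Mm; set w := mxact B v.
have vw : `|v| <= n%:R * m * `|w|.
  rewrite -{1}(mxact_invK v); apply: le_trans (mxact_le _ _) _.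
  by rewrite -mulrA ler_wpM2l// ler_wpM2r.
have h : c * `|w| ^+ 2 <= bil B v v.
  have -> : bil B v v = bil M w w by rewrite /bil mxact_invK dotpC.
  apply: le_trans (M_ell _); rewrite ler_wpM2l ?norm_sq_le//; exact: ltW.
have nm0 : 0 <= n%:R * m by rewrite mulr_ge0// (le_trans _ Mm).
apply: (@le_trans _ _ (c * (n%:R * m * `|w|) ^+ 2)).
  rewrite ler_wpM2l ?(ltW c_gt0)// ler_sqr ?nnegrE// mulr_ge0//.
by rewrite exprMn mulrCA ler_wpM2l// sqr_ge0.
Qed.
End Elliptic.

Section TwoElliptic.
Variables (M0 M1 : 'M[R]_n) (c : R).
Hypothesis c_gt0 : 0 < c.
Hypothesis M0_sym : M0^T = M0.
Hypothesis M1_sym : M1^T = M1.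
Hypothesis M0_ell : forall p, c * dotp p p <= bil M0 p p.
Hypothesis M1_ell : forall p, c * dotp p p <= bil M1 p p.

(** The resolvent identity M1^-1 - M0^-1 = - M1^-1 (M1 - M0) M0^-1, tested on v and w. *)
Lemma inv_diff v w :
  bil (invmx M1) v w - bil (invmx M0) v w =
  - bil (M1 - M0) (mxact (invmx M0) v) (mxact (invmx M1) w).
Proof.
rewrite bilBm /bil (mxact_invK c_gt0 M0_ell) (mxact_sym _ _ M1_sym).
rewrite (mxact_invK c_gt0 M1_ell) opprB; congr (_ - _).
by rewrite mxact_sym// invmx_sym.
Qed.

(** The resolvent identity applied twice: the first-order term in M1 - M0 is exact and the remainder
    is quadratic. For two opposite displacements the first-order terms then add up to a second
    difference of the matrices. *)
Lemma inv_expand v : let w := mxact (invmx M0) v in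
  bil (invmx M1) v v = bil (invmx M0) v v - bil (M1 - M0) w w +
    bil (invmx M1) (mxact (M1 - M0) w) (mxact (M1 - M0) w).
Proof.
move=> w.
have h := inv_diff v v.
have h2 := inv_diff v (mxact (M1 - M0) w).
have e1 : bil (M1 - M0) w (mxact (invmx M1) v) = bil (invmx M1) v (mxact (M1 - M0) w).
  by rewrite {1}/bil dotpC.
have e2 : bil (invmx M0) v (mxact (M1 - M0) w) = bil (M1 - M0) w w.
  by rewrite /bil dotpC.
have e3 : bil (M1 - M0) w (mxact (invmx M1) (mxact (M1 - M0) w)) =
    bil (invmx M1) (mxact (M1 - M0) w) (mxact (M1 - M0) w).
  by rewrite {1}/bil dotpC.
move: h h2; rewrite -/w e1 e2 e3; lra.
Qed.
End TwoElliptic.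

End VectorAlgebra.

(** * Penalized minimization *)

Section Penalization.
Context {R : realType}.

Definition cont_on {X : normedModType R} (K : set X) (f : X -> R) :=
  forall z, K z -> forall e : R, 0 < e -> exists2 d : R, 0 < d &
    forall z', K z' -> `|z' - z| < d -> `|f z' - f z| < e.

Lemma cont_onW {X : normedModType R} (K K' : set X) (f : X -> R) :
  K' `<=` K -> cont_on K f -> cont_on K' f.
Proof.
move=> KK fK z Kz e e0; have [d d0 h] := fK z (KK _ Kz) e e0.
by exists d => // z' Kz'; apply: h; exact: KK.
Qed.

Lemma within_cont_on {X : normedModType R} (K : set X) (f : X -> R) :
  {within K, continuous f} -> cont_on K f.
Proof.
move=> /subspace_continuousP fK z Kz e e0.
have := fK z Kz; move=> /cvgrPdist_lt /(_ _ e0); rewrite near_withinE.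
move=> /nbhs_normP[d /= d0 h]; exists d => // w Kw wd; rewrite distrC; apply: h => //.
by rewrite /= distrC.
Qed.

Lemma cont_on_within {X : normedModType R} (K : set X) (f : X -> R) :
  cont_on K f -> {within K, continuous f}.
Proof.
move=> fK; apply/subspace_continuousP => z Kz; apply/cvgrPdist_lt => e e0.
have [d d0 h] := fK z Kz e e0.
rewrite near_withinE; apply/nbhs_normP; exists d => //= w wd Kw.
by rewrite distrC; apply: h => //; rewrite distrC.
Qed.

Lemma compact_seq {X : normedModType R} (K : set X) (z : nat -> X) : compact K ->
  (forall k, K (z k)) ->
  exists2 w, K w & forall d : R, 0 < d -> forall k0, exists2 k, (k0 <= k)%N & `|z k - w| < d.
Proof.
move=> cK zK.
have [|w [Kw cw]] := cK (z @ \oo) _.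
  by exists 0%N => // k _; exact: zK.
exists w => // d d0 k0.
have /(cw _ _) : (z @ \oo) (z @` [set k | (k0 <= k)%N]).
  by exists k0 => // k kk0; exists k.
move=> /(_ (ball w d)) []; first exact: nbhsx_ballx.
move=> _ [[k kk0 <-]]; rewrite -ball_normE/= distrC => h.
by exists k.
Qed.

Lemma cont_on_min {X : normedModType R} (K : set X) (f : X -> R) : compact K ->
  K !=set0 -> cont_on K f -> exists2 z, K z & forall w, K w -> f z <= f w.
Proof.
move=> cK K0 /cont_on_within fK.
have [z zK h] := compact_EVT_min K0 cK fK.
by exists z => [|w Kw]; [rewrite -inE|apply: h; rewrite inE].
Qed.

Lemma cont_onD {X : normedModType R} (K : set X) (f g : X -> R) :
  cont_on K f -> cont_on K g -> cont_on K (fun z => f z + g z).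
Proof.
move=> fK gK z Kz e e0.
have [|d1 d10 h1] := fK z Kz (e / 2); first lra.
have [|d2 d20 h2] := gK z Kz (e / 2); first lra.
exists (Num.min d1 d2); first by rewrite lt_min d10.
move=> w Kw; rewrite lt_min => /andP[w1 w2].
have := h1 w Kw w1; have := h2 w Kw w2.
rewrite !ltr_norml => /andP[? ?] /andP[? ?]; apply/andP; split; lra.
Qed.

Lemma cont_onN {X : normedModType R} (K : set X) (f : X -> R) :
  cont_on K f -> cont_on K (fun z => - f z).
Proof.
move=> fK z Kz e e0; have [d d0 h] := fK z Kz e e0; exists d => // w Kw wd.
by rewrite -opprD normrN; apply: h.
Qed.

Lemma cont_onZ {X : normedModType R} (K : set X) (k : R) (f : X -> R) :
  cont_on K f -> cont_on K (fun z => k * f z).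
Proof.
move=> fK z Kz e e0; have k0 : 0 < `|k| + 1 by rewrite ltr_wpDl.
have [|d d0 h] := fK z Kz (e / (`|k| + 1)); first by rewrite divr_gt0.
exists d => // w Kw wd; rewrite -mulrBr normrM.
have := h w Kw wd; rewrite ltr_pdivlMr// mulrC; apply: le_lt_trans.
by rewrite ler_wpM2r// lerDl.
Qed.

Lemma cont_on_comp {X Y : normedModType R} (K : set X) (K' : set Y) (g : X -> Y) (f : Y -> R) :
  (forall z, K z -> K' (g z)) -> (forall z w, `|g z - g w| <= `|z - w|) ->
  cont_on K' f -> cont_on K (f \o g).
Proof.
move=> gK g1 fK z Kz e e0; have [d d0 h] := fK _ (gK _ Kz) e e0; exists d => // w Kw wd.
by apply: h; [exact: gK|exact: le_lt_trans wd].
Qed.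

Lemma continuous_cont_on {X : normedModType R} (K : set X) (f : X -> R) :
  (forall z, K z -> {for z, continuous f}) -> cont_on K f.
Proof.
move=> fK z Kz e e0; have /cvgrPdist_lt /(_ _ e0) := fK z Kz.
move=> /nbhs_normP[d /= d0 h]; exists d => // w _ wd; rewrite distrC; apply: h.
by rewrite /= distrC.
Qed.

(** Let k grow: the minimizers of Phi + k P accumulate at a point w with P w = 0 and Phi w <= Phi
    z1. If all those with P < e were bad, w would be bad too, against the strict gap. Thus the gap
    has to be checked only where the penalty vanishes. *)
Lemma penalized_min {X : normedModType R} (K bad : set X) (Phi P : X -> R) (z1 : X) (e : R) :
  compact K -> cont_on K Phi -> cont_on K P -> (forall z, K z -> 0 <= P z) ->
  closed bad -> K z1 -> P z1 = 0 ->
  (forall z, K z -> bad z -> P z = 0 -> Phi z1 < Phi z) -> 0 < e ->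
  exists (k : R) (z : X), [/\ 0 < k, K z, ~ bad z, P z < e &
    forall w, K w -> Phi z + k * P z <= Phi w + k * P w].
Proof.
move=> cK cPhi cP P0 cbad Kz1 Pz1 hbad e0; apply: contrapT => H.
have mins k : exists2 z, K z & forall w, K w -> Phi z + k.+1%:R * P z <= Phi w + k.+1%:R * P w.
  apply: cont_on_min => //; first by exists z1.
  by apply: cont_onD => //; exact: cont_onZ.
have /choice[z hz] : forall k, exists z, K z /\ forall w, K w -> Phi z + k.+1%:R * P z <= Phi w + k.+1%:R * P w.
  by move=> k; have [z ? ?] := mins k; exists z.
have zK k : K (z k) by have [] := hz k.
have zbad k : P (z k) < e -> bad (z k).
  move=> Pe; apply: contrapT => nb; apply: H; exists k.+1%:R, (z k); split => //.
  by have [] := hz k.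
have [m Km hm] := cont_on_min cK (ex_intro _ z1 Kz1) cPhi.
have zle k : Phi (z k) + k.+1%:R * P (z k) <= Phi z1.
  by have [_ /(_ z1 Kz1)] := hz k; rewrite Pz1 mulr0 addr0.
have [w Kw hw] := compact_seq cK zK.
have Pw : P w = 0.
  apply/eqP; rewrite eq_le P0// andbT leNgt; apply/negP => Pw0.
  have [|d d0 hd] := cP w Kw (P w / 2); first lra.
  (* Beyond [k0], the penalty at points where P exceeds P w / 2 outweighs the oscillation of Phi,
     which is bounded below by its value at [m]. *)
  have [k0 hk0] : exists k0 : nat, (Phi z1 - Phi m) / (P w / 2) < k0%:R.
    exists (Num.bound `|(Phi z1 - Phi m) / (P w / 2)|); apply: le_lt_trans (ler_norm _) _.
    by rewrite archi_boundP.
  have [k kk0 zkw] := hw d d0 k0.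
  have := hd _ (zK k) zkw; rewrite ltr_norml => /andP[Pk _].
  have := zle k; have := hm _ (zK k).
  move: hk0; rewrite ltr_pdivrMr; last lra.
  have : k0%:R <= k.+1%:R :> R by rewrite ler_nat (leq_trans kk0).
  have : 0 <= k.+1%:R * (P (z k) - P w / 2) by rewrite mulr_ge0//; lra.
  have : 0 <= (k.+1%:R - k0%:R) * (P w / 2) by rewrite mulr_ge0 ?subr_ge0 ?ler_nat ?(leq_trans kk0)//; lra.
  by move=> *; nra.
have badw : bad w.
  apply: cbad => B /nbhs_normP[d /= d0 dB].
  have [d' d'0 hd] := cP w Kw e e0.
  have [|k _ zkw] := hw (Num.min d d') _ 0%N; first by rewrite lt_min d0.
  move: zkw; rewrite lt_min => /andP[zd zd'].
  exists (z k); split; last by apply: dB; rewrite /= distrC.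
  apply: zbad; have := hd _ (zK k) zd'; rewrite Pw subr0.
  exact: le_lt_trans (ler_norm _).
have gap := hbad w Kw badw Pw.
have [|d d0 hd] := cPhi w Kw (Phi w - Phi z1); first lra.
have [k _ zkw] := hw d d0 0%N.
have := hd _ (zK k) zkw; rewrite ltr_norml => /andP[h _].
have := zle k; have : 0 <= k.+1%:R * P (z k) by rewrite mulr_ge0// P0.
by lra.
Qed.

Section MovingPenalty.
Context {n : nat}.
Implicit Types (f F : R * 'rV[R]_n -> R).

Definition box (a b : R) (x0 : 'rV[R]_n) (r : R) : set (R * 'rV[R]_n) :=
  [set z | a <= z.1 <= b /\ `|z.2 - x0| <= r].

Lemma closed_normle {X : normedModType R} (x0 : X) (r : R) : closed [set y | `|y - x0| <= r].
Proof.
have -> : [set y | `|y - x0| <= r] = (fun y => `|y - x0|) @^-1` [set t | t <= r] by [].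
apply: closed_comp; last exact: closed_le.
move=> y _; apply: (@continuous_comp _ _ _ (fun y => y - x0) (@Num.norm _ X)); last exact: norm_continuous.
by apply: continuousB; [exact: cvg_id|exact: cvg_cst].
Qed.

Lemma compact_cball (x0 : 'rV[R]_n) (r : R) : compact [set y | `|y - x0| <= r].
Proof.
apply: bounded_closed_compact; last exact: closed_normle.
exists (`|x0| + r); split => [|M Mx y /= yx]; first exact: num_real.
have -> : y = (y - x0) + x0 by rewrite subrK.
by apply: (le_trans (ler_normD _ _)); lra.
Qed.

Lemma compact_box a b x0 r : compact (box a b x0 r).
Proof.
have := compact_setX (@segment_compact R a b) (@compact_cball x0 r).
congr compact; apply/seteqP; split => -[s y] /=; rewrite in_itv/=; exact.
Qed.

(* Replacing f (s, y) + F (lam, y) by f (s, y) + k (s - lam) ^ 2 + F (lam, y)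
   decouples the two time variables: F need not be differentiable in time, and
   f is tested only against functions quadratic in time. The minimum may lie on
   the final face lam = b, whence the one-sided last conclusion. *)
Lemma moving_penalty f F (a0 b0 a b : R) (x0 : 'rV[R]_n) (r lam1 : R) (y1 : 'rV[R]_n) (e : R) :
  cont_on (box a0 b0 x0 r) f -> cont_on (box a b x0 r) F ->
  a0 <= a -> b <= b0 -> box a b x0 r (lam1, y1) ->
  (forall y : 'rV[R]_n, `|y - x0| <= r -> f (lam1, y1) + F (lam1, y1) < f (a, y) + F (a, y)) ->
  (forall (lam : R) (y : 'rV[R]_n), a <= lam <= b -> `|y - x0| = r ->
     f (lam1, y1) + F (lam1, y1) < f (lam, y) + F (lam, y)) ->
  0 < e ->
  exists (lam s tau k : R) (y : 'rV[R]_n), [/\ 0 < k,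
   [/\ a < lam <= b, a < s <= b0, `|y - x0| < r & `|s - lam| < e],
   f (s, y) + F (lam, y) <= f (lam1, y1) + F (lam1, y1),
   forall (s' : R) (y' : 'rV[R]_n), a0 <= s' <= b0 -> `|y' - x0| <= r ->
    f (s, y) + tau * (s' - s) - k * (s' - s) ^+ 2 - (F (lam, y') - F (lam, y)) <= f (s', y') &
   forall lam' : R, a <= lam' <= b ->
    F (lam, y) - tau * (lam' - lam) - k * (lam' - lam) ^+ 2 <= F (lam', y)].
Proof.
move=> cf cF a0a bb0 K1 Ha Hr e0.
pose K : set (R * (R * 'rV[R]_n)) := [set z | a <= z.1 <= b /\ box a0 b0 x0 r z.2].
pose Phi (z : R * (R * 'rV[R]_n)) := f z.2 + F (z.1, z.2.2).
pose P (z : R * (R * 'rV[R]_n)) := (z.2.1 - z.1) ^+ 2.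
pose bad : set (R * (R * 'rV[R]_n)) := [set z | (z.1 <= a \/ z.2.1 <= a) \/ r <= `|z.2.2 - x0|].
have cK : compact K.
  have := compact_setX (@segment_compact R a b) (@compact_box a0 b0 x0 r).
  congr compact; apply/seteqP; split => -[s y] /=; rewrite in_itv/=; exact.
have cPhi : cont_on K Phi.
  apply: cont_onD.
    apply: (cont_on_comp _ _ cf) => [[l [s y]] [] //|[l [s y]] [l' [s' y']]] /=.
    by rewrite [leRHS]prod_normE/= le_max lexx orbT.
  apply: (cont_on_comp (g := fun z : R * (R * 'rV[R]_n) => (z.1, z.2.2)) _ _ cF) => [[l [s y]] [] //= ? []//|[l [s y]] [l' [s' y']]] /=.
  rewrite !prod_normE/= ge_max !le_max lexx/= orbC.
  by rewrite lexx !orbT.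
have cP : cont_on K P.
  apply: continuous_cont_on => z _.
  have c1 : {for z, continuous (fun z : R * (R * 'rV[R]_n) => z.2.1 - z.1)}.
    apply: continuousB; last exact: cvg_fst.
    by apply: (@continuous_comp _ _ _ snd fst); [exact: cvg_snd|exact: cvg_fst].
  have -> : P = (fun z => (z.2.1 - z.1) * (z.2.1 - z.1)) by apply/funext => w; rewrite /P expr2.
  exact: continuousM.
have P0 z : K z -> 0 <= P z by rewrite sqr_ge0.
have cbad : closed bad.
  have -> : bad = ([set z | z.1 <= a] `|` [set z | z.2.1 <= a]) `|` [set z | r <= `|z.2.2 - x0|] by [].
  apply: closedU; first apply: closedU.
    apply: (@closed_comp _ _ (fun z : R * (R * 'rV[R]_n) => z.1) [set t | t <= a]); last exact: closed_le.
    by move=> z _; exact: cvg_fst.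
    apply: (@closed_comp _ _ (fun z : R * (R * 'rV[R]_n) => z.2.1) [set t | t <= a]); last exact: closed_le.
    by move=> z _; apply: (@continuous_comp _ _ _ snd fst); [exact: cvg_snd|exact: cvg_fst].
  apply: (@closed_comp _ _ (fun z : R * (R * 'rV[R]_n) => `|z.2.2 - x0|) [set t | r <= t]); last exact: closed_ge.
  move=> z _; apply: continuous_comp; last exact: norm_continuous.
  apply: continuousB; last exact: cvg_cst.
  by apply: (@continuous_comp _ _ _ snd snd); exact: cvg_snd.
have K1' : K (lam1, (lam1, y1)).
  move: K1 => [/= lab yr]; split; first by [].
  by split; [move: lab => /= /andP[? ?]; apply/andP; split; lra|].
have P1 : P (lam1, (lam1, y1)) = 0 by rewrite /P subrr expr0n.
have e20 : 0 < e ^+ 2 by rewrite exprn_gt0.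
have [] := penalized_min cK cPhi cP P0 cbad K1' P1 _ e20.
  move=> [l [s y]] [/= lab [/= sab yr]] bd.
  rewrite /P/= => /eqP; rewrite sqrf_eq0 subr_eq0 => /eqP sl; rewrite /Phi/= sl.
  case: bd => /= h; last by apply: Hr => //; apply/eqP; rewrite eq_le yr.
  have {}h : l <= a by case: h => //; rewrite sl.
  have -> : l = a by apply/eqP; rewrite eq_le h/=; case/andP: lab.
  exact: Ha.
move=> k [[l [s y]] [k0 [/= lab [/= sab yr]] nb Pe hmin]].
(* [tau] is minus the derivative in s of the penalty k (s - lam) ^ 2, the slope at which the two
   halves of the minimized sum balance. *)
exists l, s, (- (2 * k * (s - l))), k, y; split => //.
- have /andP[al lb] := lab; split => //.
  + by rewrite lb andbT ltNge; apply/negP => ?; apply: nb; left; left.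
  + by have /andP[_ ->] := sab; rewrite andbT ltNge; apply/negP => ?; apply: nb; left; right.
  + by rewrite ltNge; apply/negP => ?; apply: nb; right.
  + by rewrite -(ltr_sqr) ?nnegrE ?(ltW e0)// real_normK ?num_real.
- have := hmin _ K1'; rewrite P1 /Phi/P/= mulr0 addr0.
  have : 0 <= k * (s - l) ^+ 2 by rewrite mulr_ge0 ?sqr_ge0// ltW.
  lra.
- move=> s' y' s'ab y'r.
  have /hmin : K (l, (s', y')) by split.
  rewrite /Phi/P/=; lra.
- move=> l' l'ab.
  have /hmin : K (l', (s, y)) by split.
  rewrite /Phi/P/=; lra.
Qed.

End MovingPenalty.

End Penalization.

(** * The Lagrangian *)

Ltac ge0 := repeat first [done | exact: normr_ge0 | exact: sqr_ge0 | exact: ler0n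
  | apply: mulr_ge0 | apply: addr_ge0 | apply: exprn_ge0 | rewrite invr_ge0 | by apply: ltW | lra].

Lemma le_of_eq (R : realType) (a b : R) : a = b -> a <= b.
Proof. by move=> ->. Qed.

Section LocalData.
Context {R : realType} {n : nat}.
Implicit Types (u V : R * 'rV[R]_n -> R) (A : R * 'rV[R]_n -> 'M[R]_n).
Implicit Types (x y v w b p q : 'rV[R]_n) (s t : R).

Definition ham A V s y p : R := 2^-1 * bil (A (s, y)) p p + V (s, y).
Definition lag A V s y v : R := 2^-1 * bil (invmx (A (s, y))) v v - V (s, y).

(** Quantitative C^2 regularity on a box. Second differences in space replace second derivatives:
    they pass directly to the inverse matrices and to semiconcavity. *)
Record coef_data A V (ta tb : R) (x0 : 'rV[R]_n) (r c m : R) : Prop := CoefData {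
  cd_c : 0 < c;
  cd_m : 0 <= m;
  cd_sym : forall z, box ta tb x0 r z -> (A z)^T = A z;
  cd_ell : forall z, box ta tb x0 r z -> forall p, c * dotp p p <= bil (A z) p p;
  cd_Abnd : forall z, box ta tb x0 r z -> `|A z| <= m;
  cd_Vbnd : forall z, box ta tb x0 r z -> `|V z| <= m;
  cd_Alip : forall z z', box ta tb x0 r z -> box ta tb x0 r z' ->
    `|A z - A z'| <= m * (`|z.1 - z'.1| + `|z.2 - z'.2|);
  cd_Vlip : forall z z', box ta tb x0 r z -> box ta tb x0 r z' ->
    `|V z - V z'| <= m * (`|z.1 - z'.1| + `|z.2 - z'.2|);
  cd_A2 : forall s y w, box ta tb x0 r (s, y) -> box ta tb x0 r (s, y + w) ->
    box ta tb x0 r (s, y - w) ->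
    `|A (s, y + w) + A (s, y - w) - (A (s, y) + A (s, y))| <= m * `|w| ^+ 2;
  cd_V2 : forall s y w, box ta tb x0 r (s, y) -> box ta tb x0 r (s, y + w) ->
    box ta tb x0 r (s, y - w) ->
    `|V (s, y + w) + V (s, y - w) - (V (s, y) + V (s, y))| <= m * `|w| ^+ 2 }.

(** One constant [C] for all bounds, so that later thresholds depend on few parameters. In [lb_2]
    the position moves by +-w and the velocity by +-b; the term <A^-1 b, b> carries the exact
    coefficient 1, on which the calibration rests, and all other terms contain a factor |w|. *)
Record lag_bounds A V (ta tb : R) (x0 : 'rV[R]_n) (r C : R) : Prop := LagBounds {
  lb_C : 1 <= C;
  lb_bnd : forall s y v, box ta tb x0 r (s, y) -> `|lag A V s y v| <= C * (1 + `|v| ^+ 2);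
  lb_lip : forall s y s' y' v, box ta tb x0 r (s, y) -> box ta tb x0 r (s', y') ->
    lag A V s y v <= lag A V s' y' v + C * (`|s - s'| + `|y - y'|) * (1 + `|v| ^+ 2);
  lb_2 : forall s y w v b, box ta tb x0 r (s, y) -> box ta tb x0 r (s, y + w) ->
    box ta tb x0 r (s, y - w) ->
    lag A V s (y + w) (v + b) + lag A V s (y - w) (v - b) - 2 * lag A V s y v <=
    bil (invmx (A (s, y))) b b +
    C * (`|w| * `|b| * (1 + `|v|) + `|w| ^+ 2 * (1 + `|v| ^+ 2) + `|w| * `|b| ^+ 2);
  lb_coer : forall s y v, box ta tb x0 r (s, y) -> `|v| ^+ 2 <= C * bil (invmx (A (s, y))) v v;
  lb_Bbnd : forall s y v, box ta tb x0 r (s, y) -> bil (invmx (A (s, y))) v v <= C * `|v| ^+ 2;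
  lb_Blip : forall s y s' y' v w, box ta tb x0 r (s, y) -> box ta tb x0 r (s', y') ->
    `|bil (invmx (A (s, y))) v w - bil (invmx (A (s', y'))) v w| <=
    C * (`|s - s'| + `|y - y'|) * (`|v| * `|w|);
  lb_Alip : forall z z' v, box ta tb x0 r z -> box ta tb x0 r z' ->
    `|mxact (A z - A z') v| <= C * (`|z.1 - z'.1| + `|z.2 - z'.2|) * `|v|;
  lb_Abnd : forall z v, box ta tb x0 r z -> `|mxact (A z) v| <= C * `|v|;
  lb_Bnorm : forall z v, box ta tb x0 r z -> `|mxact (invmx (A z)) v| <= C * `|v| }.

Lemma bil_invmx_diff (M0 M1 : 'M[R]_n) (c : R) v w : 0 < c ->
  M0^T = M0 -> M1^T = M1 -> (forall p, c * dotp p p <= bil M0 p p) ->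
  (forall p, c * dotp p p <= bil M1 p p) ->
  `|bil (invmx M1) v w - bil (invmx M0) v w| <=
  n%:R ^+ 2 * (n%:R / c) ^+ 2 * `|M1 - M0| * (`|v| * `|w|).
Proof.
move=> c0 s0 s1 e0 e1; rewrite (inv_diff c0 s1 e0 e1) normrN.
apply: le_trans (bil_le _ _ _) _.
have h0 := norm_mxact_inv c0 e0 v; have h1 := norm_mxact_inv c0 e1 w.
have := ler_pM (normr_ge0 _) (normr_ge0 _) h0 h1.
move=> /(ler_wpM2l (normr_ge0 (M1 - M0))) /(ler_wpM2l (sqr_ge0 (n%:R : R))).
move=> h; apply: le_trans (le_trans h _); first by rewrite !mulrA.
by apply: le_of_eq; ring.
Qed.

(** Sum of [inv_expand] at M1 and at M2: the first-order terms combine into M1 + M2 - 2 M0, which is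
    of second order for a C^2 family, and the remainders are squares of first differences. *)
Lemma bil_invmx_2diff (M0 M1 M2 : 'M[R]_n) (c : R) v : 0 < c ->
  M0^T = M0 -> M1^T = M1 -> M2^T = M2 -> (forall p, c * dotp p p <= bil M0 p p) ->
  (forall p, c * dotp p p <= bil M1 p p) -> (forall p, c * dotp p p <= bil M2 p p) ->
  bil (invmx M1) v v + bil (invmx M2) v v - 2 * bil (invmx M0) v v <=
  n%:R ^+ 2 * (n%:R / c) ^+ 2 * `|M1 + M2 - (M0 + M0)| * `|v| ^+ 2 +
  n%:R ^+ 2 / c * (n%:R * (n%:R / c)) ^+ 2 * (`|M1 - M0| ^+ 2 + `|M2 - M0| ^+ 2) * `|v| ^+ 2.
Proof.
move=> c0 s0 s1 s2 e0 e1 e2.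
have := inv_expand c0 s1 e0 e1 v; have := inv_expand c0 s2 e0 e2 v.
move=> /=; set w := mxact (invmx M0) v => -> ->.
have wv : `|w| <= n%:R / c * `|v| by exact: norm_mxact_inv.
have sq (N : 'M[R]_n) : `|mxact N w| ^+ 2 <= (n%:R * (n%:R / c)) ^+ 2 * `|N| ^+ 2 * `|v| ^+ 2.
  rewrite -!exprMn ler_sqr ?nnegrE ?mulr_ge0 ?invr_ge0 ?(ltW c0)//.
  apply: le_trans (mxact_le _ _) _; rewrite -!mulrA ler_wpM2l//.
  have := ler_wpM2l (normr_ge0 N) wv; move/le_trans; apply.
  by apply: le_of_eq; ring.
have t1 := bil_inv_le c0 e1 (mxact (M1 - M0) w).
have t2 := bil_inv_le c0 e2 (mxact (M2 - M0) w).
have nc : 0 <= n%:R ^+ 2 / c by rewrite divr_ge0 ?sqr_ge0// ltW.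
have t1' := ler_wpM2l nc (sq (M1 - M0)).
have t2' := ler_wpM2l nc (sq (M2 - M0)).
have t3 : - (bil (M1 - M0) w w + bil (M2 - M0) w w) <=
    n%:R ^+ 2 * (n%:R / c) ^+ 2 * `|M1 + M2 - (M0 + M0)| * `|v| ^+ 2.
  rewrite -bilDm addrACA -opprD.
  apply: le_trans (ler_norm _) _; rewrite normrN; apply: le_trans (bil_le _ _ _) _.
  have := ler_pM (normr_ge0 _) (normr_ge0 _) wv wv.
  move=> /(ler_wpM2l (normr_ge0 (M1 + M2 - (M0 + M0)))) /(ler_wpM2l (sqr_ge0 (n%:R : R))).
  move=> h; apply: le_trans (le_trans h _); rewrite ?mulrA//.
  by apply: le_of_eq; ring.
move: t1 t2 t1' t2' t3; lra.
Qed.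

Ltac sl := clear -R n; lra.

Lemma coef_data_bounds A V ta tb x0 r c m : coef_data A V ta tb x0 r c m ->
  exists C, lag_bounds A V ta tb x0 r C.
Proof.
move=> cd; have c0 := cd_c cd; have m0 := cd_m cd.
pose N : R := n%:R; have N0 : 0 <= N by exact: ler0n.
pose ka := N / c; have ka0 : 0 <= ka by rewrite /ka; ge0.
pose k0 := N ^+ 2 / c; have k00 : 0 <= k0 by rewrite /k0; ge0.
pose k1 := N ^+ 2 * ka ^+ 2 * m; have k10 : 0 <= k1 by rewrite /k1; ge0.
pose k2 := k0 * (N * ka) ^+ 2 * (2 * m ^+ 2).
have k20 : 0 <= k2 by rewrite /k2; ge0.
pose k3 := (N * m) ^+ 2 / c; have k30 : 0 <= k3 by rewrite /k3; ge0.
pose Nm := N * m; have Nm0 : 0 <= Nm by rewrite /Nm; ge0.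
pose C := 1 + k0 + 2 * k1 + k2 + k3 + m + Nm + ka.
have [C1 [Cm Ck0 Ck1]] : 1 <= C /\ [/\ m <= C, k0 <= C & 2 * k1 <= C].
  by split; [|split]; rewrite /C; clear C; move: k00 k10 k20 k30 Nm0 ka0 m0; move: ka k0 k1 k2 k3 Nm => ? ? ? ? ? ?; sl.
have [Ck1' Ck12 Ck1h] : [/\ k1 <= C, (k1 + k2) / 2 <= C & k1 / 2 <= C].
  by split; rewrite /C; clear C1 Cm Ck0 Ck1 C; move: k00 k10 k20 k30 Nm0 ka0 m0; move: ka k0 k1 k2 k3 Nm => ? ? ? ? ? ?; sl.
have [Ck3 CNm Cka] : [/\ k3 <= C, Nm <= C & ka <= C].
  by split; rewrite /C; clear C1 Cm Ck0 Ck1 Ck1' Ck12 Ck1h C; move: k00 k10 k20 k30 Nm0 ka0 m0; move: ka k0 k1 k2 k3 Nm => ? ? ? ? ? ?; sl.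
have C0 : 0 <= C by move: C1; sl.
clearbody C.
have Blip s y s' y' v w : box ta tb x0 r (s, y) -> box ta tb x0 r (s', y') ->
    `|bil (invmx (A (s, y))) v w - bil (invmx (A (s', y'))) v w| <=
    k1 * (`|s - s'| + `|y - y'|) * (`|v| * `|w|).
  move=> K1 K2; have := bil_invmx_diff v w c0 (cd_sym cd K2) (cd_sym cd K1) (cd_ell cd K2) (cd_ell cd K1).
  move/le_trans; apply; rewrite ler_wpM2r ?mulr_ge0// -/N -/ka /k1 -[leRHS]mulrA.
  have q : 0 <= N ^+ 2 * ka ^+ 2 by ge0.
  exact: (ler_wpM2l q (cd_Alip cd K1 K2)).
have BD z (v w : 'rV[R]_n) : bil (invmx (A z)) (v + w) (v + w) =
   bil (invmx (A z)) v v + bil (invmx (A z)) v w + bil (invmx (A z)) w v + bil (invmx (A z)) w w.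
  by rewrite !(bilDl, bilDr); ring.
have Bs z (v w : 'rV[R]_n) : box ta tb x0 r z -> bil (invmx (A z)) v w = bil (invmx (A z)) w v.
  by move=> Kz; rewrite bilC// invmx_sym// (cd_sym cd).
have Bge0 z v : box ta tb x0 r z -> 0 <= bil (invmx (A z)) v v.
  by move=> Kz; apply: (bil_inv_ge0 c0 (cd_sym cd Kz) (cd_ell cd Kz)).
have Bbnd z v : box ta tb x0 r z -> bil (invmx (A z)) v v <= k0 * `|v| ^+ 2.
  by move=> Kz; exact: (bil_inv_le c0 (cd_ell cd Kz)).
have D0 (s s' : R) (y y' : 'rV[R]_n) : 0 <= `|s - s'| + `|y - y'| by rewrite addr_ge0.
exists C; split.
- exact: C1.
- move=> s y v K1; have h1 := Bge0 _ v K1; have h2 := Bbnd _ v K1.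
  have := cd_Vbnd cd K1; rewrite /lag !ler_norml => /andP[h3 h4].
  have v0 : 0 <= `|v| ^+ 2 by exact: sqr_ge0.
  have h5 : 0 <= (C - k0) * `|v| ^+ 2 by apply: mulr_ge0 => //; rewrite subr_ge0.
  by apply/andP; split; move: h1 h2 h3 h4 h5 Cm; sl.
- move=> s y s' y' v K1 K2; have := Blip _ _ _ _ v v K1 K2; have := cd_Vlip cd K1 K2.
  rewrite /lag /= !ler_norml => /andP[h1 _] /andP[_ h2].
  set d := `|s - s'| + _ in h1 h2 *; have d0 : 0 <= d by exact: D0.
  have dv0 : 0 <= d * `|v| ^+ 2 by rewrite mulr_ge0 ?sqr_ge0.
  have h5 : 0 <= (C - k1 / 2) * (d * `|v| ^+ 2) by apply: mulr_ge0 => //; rewrite subr_ge0.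
  have h6 : 0 <= (C - m) * d by apply: mulr_ge0 => //; rewrite subr_ge0.
  by move: h2; rewrite -expr2; move: h1 h5 h6 dv0; sl.
- move=> s y w v b K0 Kp Km.
  have Ap : `|A (s, y + w) - A (s, y)| <= m * `|w|.
    by have := cd_Alip cd Kp K0; rewrite /= subrr normr0 add0r addrAC subrr add0r.
  have Am : `|A (s, y - w) - A (s, y)| <= m * `|w|.
    by have := cd_Alip cd Km K0; rewrite /= subrr normr0 add0r addrAC subrr add0r normrN.
  have S2 := bil_invmx_2diff v c0 (cd_sym cd K0) (cd_sym cd Kp) (cd_sym cd Km)
     (cd_ell cd K0) (cd_ell cd Kp) (cd_ell cd Km).
  rewrite -/N -/ka -/k0 in S2.
  have A2 := cd_A2 cd K0 Kp Km.
  have Ap2 : `|A (s, y + w) - A (s, y)| ^+ 2 <= m ^+ 2 * `|w| ^+ 2.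
    by rewrite -exprMn ler_sqr ?nnegrE ?mulr_ge0.
  have Am2 : `|A (s, y - w) - A (s, y)| ^+ 2 <= m ^+ 2 * `|w| ^+ 2.
    by rewrite -exprMn ler_sqr ?nnegrE ?mulr_ge0.
  have T1 : bil (invmx (A (s, y + w))) v v + bil (invmx (A (s, y - w))) v v -
      2 * bil (invmx (A (s, y))) v v <= (k1 + k2) * (`|w| ^+ 2 * `|v| ^+ 2).
    apply: le_trans S2 _.
    have q1 : 0 <= N ^+ 2 * ka ^+ 2 by ge0.
    have q2 : 0 <= k0 * (N * ka) ^+ 2 by ge0.
    have h1 := ler_wpM2r (sqr_ge0 `|v|) (ler_wpM2l q1 A2).
    have h2 := ler_wpM2r (sqr_ge0 `|v|) (ler_wpM2l q2 (lerD Ap2 Am2)).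
    apply: le_trans (lerD h1 h2) _; apply: le_of_eq; rewrite /k1 /k2; ring.
  have T2 : bil (invmx (A (s, y + w))) v b - bil (invmx (A (s, y - w))) v b <=
      2 * k1 * (`|w| * `|b| * `|v|).
    apply: le_trans (ler_norm _) _; apply: le_trans (Blip _ _ _ _ _ _ Kp Km) _.
    rewrite subrr normr0 add0r opprD opprK addrACA subrr add0r.
    have : `|w + w| <= 2 * `|w| by apply: le_trans (ler_normD _ _) _; move: `|w| => ?; sl.
    have q : 0 <= k1 * (`|v| * `|b|) by ge0.
    by move=> /(ler_wpM2l q); move: (`|w + w|) `|w| `|b| `|v| => ? ? ? ?; sl.
  have T3 : bil (invmx (A (s, y + w))) b b <= bil (invmx (A (s, y))) b b + k1 * (`|w| * `|b| ^+ 2).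
    have := Blip _ _ _ _ b b Kp K0; rewrite ler_norml => /andP[_].
    by rewrite subrr normr0 add0r addrAC subrr add0r -expr2; sl.
  have T4 : bil (invmx (A (s, y - w))) b b <= bil (invmx (A (s, y))) b b + k1 * (`|w| * `|b| ^+ 2).
    have := Blip _ _ _ _ b b Km K0; rewrite ler_norml => /andP[_].
    by rewrite subrr normr0 add0r addrAC subrr add0r normrN -expr2; sl.
  have T5 := cd_V2 cd K0 Kp Km; rewrite ler_norml in T5.
  have /andP[T5a _] := T5.
  (* Both forms are expanded at v +- b: the pure v terms are bounded by [T1], the mixed terms cancel
     up to the variation of A^-1 ([T2]), the pure b terms give [T3] and [T4], and the potential
     gives [T5]. *)
  rewrite /lag BD (BD _ v (- b)) !(bilNl, bilNr) (Bs _ b v Kp) (Bs _ b v Km).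
  have p1 : 0 <= `|w| ^+ 2 * `|v| ^+ 2 by ge0.
  have p2 : 0 <= `|w| * `|b| * `|v| by ge0.
  have p3 : 0 <= `|w| * `|b| ^+ 2 by ge0.
  have p4 : 0 <= `|w| * `|b| by ge0.
  have p5 : 0 <= `|w| ^+ 2 by ge0.
  have g1 : 0 <= (C - (k1 + k2) / 2) * (`|w| ^+ 2 * `|v| ^+ 2) by apply: mulr_ge0 => //; rewrite subr_ge0.
  have g2 : 0 <= (C - 2 * k1) * (`|w| * `|b| * `|v|) by apply: mulr_ge0 => //; rewrite subr_ge0.
  have g3 : 0 <= (C - k1) * (`|w| * `|b| ^+ 2) by apply: mulr_ge0 => //; rewrite subr_ge0.
  have g4 : 0 <= C * (`|w| * `|b|) by exact: mulr_ge0.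
  have g5 : 0 <= (C - m) * `|w| ^+ 2 by apply: mulr_ge0 => //; rewrite subr_ge0.
  move: T1 T2 T3 T4 T5a g1 g2 g3 g4 g5; sl.
- move=> s y v K1; have := bil_inv_coercive c0 (cd_ell cd K1) v (cd_Abnd cd K1).
  rewrite -/N => h; have := Bge0 _ v K1 => b0.
  have : `|v| ^+ 2 <= k3 * bil (invmx (A (s, y))) v v.
    by rewrite /k3 mulrAC ler_pdivlMr// mulrC.
  have : 0 <= (C - k3) * bil (invmx (A (s, y))) v v by apply: mulr_ge0 => //; rewrite subr_ge0.
  by move=> + h1; move: h1; sl.
- move=> s y v K1; have := Bbnd _ v K1.
  have : 0 <= (C - k0) * `|v| ^+ 2 by apply: mulr_ge0; [rewrite subr_ge0|exact: sqr_ge0].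
  by sl.
- move=> s y s' y' v w K1 K2; apply: le_trans (Blip _ _ _ _ v w K1 K2) _.
  apply: ler_wpM2r; first exact: mulr_ge0.
  by apply: ler_wpM2r; [exact: D0|exact: Ck1'].
- move=> z z' v K1 K2; apply: le_trans (mxact_le _ _) _; rewrite mulrA ler_wpM2r//.
  by apply: le_trans (ler_wpM2l N0 (cd_Alip cd K1 K2)) _; rewrite mulrA ler_wpM2r//.
- move=> z v K1; apply: le_trans (mxact_le _ _) _; rewrite mulrA ler_wpM2r//.
  exact: le_trans (ler_wpM2l N0 (cd_Abnd cd K1)) CNm.
- move=> z v K1; apply: le_trans (norm_mxact_inv c0 (cd_ell cd K1) v) _.
  by rewrite ler_wpM2r// -/N -/ka.
Qed.
End LocalData.

(** * Viscosity inequalities along curves *)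

Ltac vec := apply/rowP => ?; rewrite !mxE; ring.

Section BilContinuous.
Context {R : realType} {n : nat}.

Lemma continuous_csub (X : normedModType R) (x y : X) : {for y, continuous (fun y : X => x - y)}.
Proof. by apply: continuousB; [exact: cvg_cst|exact: cvg_id]. Qed.

Lemma continuous_sumr (X : topologicalType) (k : nat) (f : 'I_k -> X -> R) (z : X) :
  (forall i, {for z, continuous (f i)}) -> {for z, continuous (fun x => \sum_i f i x)}.
Proof.
move=> cf; elim: k f cf => [|k IH] f cf.
  have -> : (fun x => \sum_i f i x) = fun=> 0 by apply/funext => x; rewrite big_ord0.
  exact: cvg_cst.
have -> : (fun x => \sum_i f i x) = (fun x => f ord0 x + \sum_i f (lift ord0 i) x).
  by apply/funext => x; rewrite big_ord_recl.
apply: cvgD; first exact: cf.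
by apply: IH => i; exact: cf.
Qed.

Lemma coord_for (X : topologicalType) (g : X -> 'rV[R]_n) (z : X) i :
  {for z, continuous g} -> {for z, continuous (fun x => g x 0 i)}.
Proof.
by move=> cg; apply: (@continuous_comp _ _ _ g (fun y : 'rV[R]_n => y 0 i)); [exact: cg|exact: coord_continuous].
Qed.

Lemma dotp_continuous (X : topologicalType) (g h : X -> 'rV[R]_n) (z : X) :
  {for z, continuous g} -> {for z, continuous h} -> {for z, continuous (fun x => dotp (g x) (h x))}.
Proof.
by move=> cg ch; apply: continuous_sumr => i; apply: cvgM; apply: coord_for.
Qed.

Lemma bil_continuous (X : topologicalType) (M : 'M[R]_n) (g h : X -> 'rV[R]_n) (z : X) :
  {for z, continuous g} -> {for z, continuous h} -> {for z, continuous (fun x => bil M (g x) (h x))}.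
Proof.
move=> cg ch; apply: continuous_sumr => i; apply: cvgM; last exact: coord_for.
change {for z, continuous (fun x => mxact M (g x) 0 i)}.
have -> : (fun x => mxact M (g x) 0 i) = (fun x => \sum_j (M i j * g x 0 j)).
  by apply/funext => x; rewrite /mxact !mxE; apply: eq_bigr => j _; rewrite mxE.
by apply: continuous_sumr => j; apply: cvgM; [exact: cvg_cst|exact: coord_for].
Qed.
End BilContinuous.

Section LocalSolution.
Context {R : realType} {n : nat}.
Implicit Types (u V : R * 'rV[R]_n -> R) (A : R * 'rV[R]_n -> 'M[R]_n).
Implicit Types (x y v w b p q z : 'rV[R]_n) (s t h k : R).

(* Viscosity inequalities tested with proximal sub- and superjets only. *)
Record sol_data u A V (ta tb : R) (x0 : 'rV[R]_n) (r M : R) : Prop := SolData {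
  sd_lt : ta < tb;
  sd_r : 0 < r;
  sd_cont : cont_on (box ta tb x0 r) u;
  sd_bnd : forall z : R * 'rV[R]_n, box ta tb x0 r z -> `|u z| <= M;
  sd_sub : forall s y tau p k d, ta < s < tb -> `|y - x0| < r -> 0 < d ->
    (forall s' y', `|s' - s| < d -> `|y' - y| < d ->
      u (s', y') <= u (s, y) + tau * (s' - s) + dotp p (y' - y) +
        k * ((s' - s) ^+ 2 + dotp (y' - y) (y' - y))) ->
    tau + ham A V s y p <= 0;
  sd_sup : forall s y tau p k d, ta < s < tb -> `|y - x0| < r -> 0 < d ->
    (forall s' y', `|s' - s| < d -> `|y' - y| < d ->
      u (s, y) + tau * (s' - s) + dotp p (y' - y) -
        k * ((s' - s) ^+ 2 + dotp (y' - y) (y' - y)) <= u (s', y')) ->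
    0 <= tau + ham A V s y p }.

Lemma deriv_le_of_quadratic (a c d : R) : 0 < d ->
  (forall h, 0 < h -> h <= d -> a * h <= c * h ^+ 2) -> a <= 0.
Proof.
move=> d0 H; rewrite leNgt; apply/negP => a0.
pose h := Num.min d (a / (`|c| + 1) / 2).
have c1 : 0 < `|c| + 1 by rewrite ltr_wpDl.
have h0 : 0 < h by rewrite lt_min d0/= !divr_gt0.
have := H h h0; rewrite ge_min lexx => /(_ isT).
rewrite expr2 mulrA ler_pM2r// => ach.
have : c * h <= `|c| * h by rewrite ler_wpM2r ?ler_norm// ltW.
have : h <= a / (`|c| + 1) / 2 by rewrite ge_min lexx orbT.
have -> : a / (`|c| + 1) / 2 = (a / 2) / (`|c| + 1) by field; lra.
rewrite ler_pdivlMr//; lra.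
Qed.

Variables (u V : R * 'rV[R]_n -> R) (A : R * 'rV[R]_n -> 'M[R]_n).
Variables (ta tb : R) (x0 : 'rV[R]_n) (r M c m C : R).
Hypothesis cd : coef_data A V ta tb x0 r c m.
Hypothesis lb : lag_bounds A V ta tb x0 r C.
Hypothesis sd : sol_data u A V ta tb x0 r M.

Let M0 : 0 <= M.
Proof.
have K0 : box ta tb x0 r (ta, x0).
  split; first by rewrite /= lexx (ltW (sd_lt sd)).
  by rewrite /= subrr normr0 ltW// (sd_r sd).
exact: le_trans (normr_ge0 _) (sd_bnd sd K0).
Qed.

Ltac sl := clear -R n u V A ta tb x0 r M c m C cd lb sd M0; lra.

Lemma lag_fenchel s y v q : box ta tb x0 r (s, y) ->
  dotp q v - ham A V s y q <= lag A V s y v.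
Proof.
move=> K; have := fenchel (cd_c cd) (cd_sym cd K) (cd_ell cd K) v q.
rewrite /ham /lag; lra.
Qed.

(** If the inequality failed, follow the moving point [xi] with the penalty K |z - xi| ^ 2 and the
    slope g = l0 + ka. At a minimum the subsolution inequality gives H (qv) <= tau, minimality in
    [lam] gives g + tau <= <qv, v>, and Fenchel's inequality gives <qv, v> - H (qv) <= L (v) <= l0 +
    ka / 2: a contradiction. *)
Lemma line_ineq t t' y v r' l0 : ta <= t -> t <= t' -> t' < tb -> r' < r ->
  `|y - x0| <= r' -> `|y + (t' - t) *: v - x0| <= r' ->
  (forall s, t <= s <= t' -> lag A V s (y + (s - t) *: v) v <= l0) ->
  u (t', y + (t' - t) *: v) <= u (t, y) + (t' - t) * l0.
Proof.
move=> tat; rewrite le_eqVlt => /predU1P[->|tt'] t'tb r'r yr y'r hL.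
  by rewrite subrr scale0r addr0 mul0r addr0.
set xi := fun s : R => y + (s - t) *: v.
have xir s : t <= s <= t' -> `|xi s - x0| <= r'.
  move=> /andP[ts st'].
  pose th := (s - t) / (t' - t).
  have th0 : 0 <= th by rewrite /th divr_ge0; lra.
  have th1 : th <= 1 by rewrite /th ler_pdivrMr; lra.
  have -> : xi s - x0 = (1 - th) *: (y - x0) + th *: (y + (t' - t) *: v - x0).
    rewrite /xi !scalerBr !scalerDr !scalerA.
    have -> : th * (t' - t) = s - t by rewrite /th divfK// subr_eq0 gt_eqF.
    by rewrite !scalerBl !scale1r; apply/rowP => i; rewrite !mxE; ring.
  have h1 : 0 <= 1 - th by lra.
  apply: le_trans (ler_normD _ _) _.
  have -> : `|(1 - th) *: (y - x0)| = (1 - th) * `|y - x0| by rewrite normrZ ger0_norm.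
  have -> : `|th *: (y + (t' - t) *: v - x0)| = th * `|y + (t' - t) *: v - x0|.
    by rewrite normrZ ger0_norm.
  by have := ler_wpM2l th0 y'r; have := ler_wpM2l h1 yr; sl.
have xiK s : t <= s <= t' -> box ta tb x0 r (s, xi s).
  by move=> sI; split => /=; [move: sI tat t'tb; sl|apply: le_trans (xir s sI) (ltW r'r)].
rewrite leNgt; apply/negP => H.
pose gap := u (t', xi t') - (u (t, y) + (t' - t) * l0).
have gap0 : 0 < gap by rewrite /gap subr_gt0; exact: H.
(* Half of the excess slope; the other half leaves a strict gap at the initial face. *)
pose ka := gap / (t' - t) / 2.
have ka0 : 0 < ka by rewrite /ka !divr_gt0// subr_gt0.
have gapE : gap = 2 * ka * (t' - t) by rewrite /ka; field; move: tt'; sl.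
pose g := l0 + ka.
have gE : u (t', xi t') = u (t, y) + (t' - t) * (g + ka) by move: gapE; rewrite /gap /g; sl.
have Kty : box ta tb x0 r (t, y) by have := xiK t; rewrite /xi subrr scale0r addr0; apply; move: tt'; sl.
have kat : 0 < ka * (t' - t) by apply: mulr_gt0 => //; rewrite subr_gt0.
have [d d0 hd] := sd_cont sd Kty kat.
(* [W] exceeds the oscillation of u plus that of the drift. With K de ^ 2 = W the penalty alone
   confines minimizers to distance [de] from [xi], and de <= r - r' keeps them off the lateral
   face. *)
pose W := 2 * M + 2 * `|g| * (t' - t) + 1.
have W0 : 0 < W.
  have : 0 <= `|g| * (t' - t) by apply: mulr_ge0 => //; rewrite subr_ge0 ltW.
  by rewrite /W; have := M0; move: `|g| => ?; sl.
have v1 : 1 <= 1 + `|v| ^+ 2 by rewrite lerDl sqr_ge0.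
have C1 := lb_C lb.
pose e1 := ka / (4 * C * (1 + `|v| ^+ 2)).
have e10 : 0 < e1 by rewrite /e1; apply: divr_gt0 => //; apply: mulr_gt0; [apply: mulr_gt0; move: C1; sl|move: v1; sl].
pose de := Num.min d (Num.min (r - r') e1).
have de0 : 0 < de by rewrite !lt_min d0 e10 andbT/= subr_gt0.
pose K := W / de ^+ 2.
have K0 : 0 < K by rewrite divr_gt0// exprn_gt0.
have KE : K * de ^+ 2 = W by rewrite /K divfK// sqrf_eq0 gt_eqF.
pose f (z : R * 'rV[R]_n) := - u z.
pose F (z : R * 'rV[R]_n) := K * dotp (z.2 - xi z.1) (z.2 - xi z.1) + g * (z.1 - t).
have cf : cont_on (box ta tb x0 r) f by apply: cont_onN; exact: sd_cont sd.
have cxi (z : R * 'rV[R]_n) : {for z, continuous (fun z : R * 'rV[R]_n => z.2 - xi z.1)}.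
  apply: continuousB; first exact: cvg_snd.
  apply: continuousD; first exact: cvg_cst.
  apply: cvgZ; last exact: cvg_cst.
  by apply: continuousB; [exact: cvg_fst|exact: cvg_cst].
have cF : cont_on (box t t' x0 r) F.
  apply: continuous_cont_on => z _.
  apply: continuousD.
    by apply: continuousM; [exact: cvg_cst|exact: dotp_continuous].
  apply: continuousM; first exact: cvg_cst.
  by apply: continuousB; [exact: cvg_fst|exact: cvg_cst].
have Kl1 : box t t' x0 r (t', xi t').
  split => /=; first by rewrite lexx ltW.
  by have [|//] := xiK t'; rewrite lexx ltW.
have big (z : 'rV[R]_n) (s : R) : de <= `|z - xi s| -> W <= K * dotp (z - xi s) (z - xi s).
  move=> h; rewrite -KE ler_pM2l//; apply: le_trans (norm_sq_le _).
  by rewrite ler_sqr ?nnegrE// ltW.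
have ub (z : R * 'rV[R]_n) : box ta tb x0 r z -> u z <= M /\ - M <= u z.
  by move=> /(sd_bnd sd); rewrite ler_norml => /andP[].
have gt s : t <= s <= t' -> `|g * (s - t)| <= `|g| * (t' - t).
  move=> /andP[ts st]; rewrite normrM; apply: ler_wpM2l => //.
  by rewrite ger0_norm; move: ts st; sl.
have fF1 : f (t', xi t') + F (t', xi t') = - u (t, y) - ka * (t' - t).
  by rewrite /f /F/= subrr dotp0l mulr0 gE; ring.
(* The free time [s] exceeds t' by less than tb - t', so it stays in the open time interval where
   the viscosity inequality holds. *)
have e2 : 0 < Num.min e1 (tb - t') by rewrite lt_min e10 subr_gt0.
have [||l [s [tau [k [z [k0 [lI sI zr sl] val prox lamd]]]]]] :=
  moving_penalty cf cF tat (ltW t'tb) Kl1 _ _ e2.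
- move=> z zr; rewrite fF1 /f /F/= subrr mulr0 addr0.
  have -> : xi t = y by rewrite /xi subrr scale0r addr0.
  have dd := dotp_ge0 (z - y).
  have [zd|zd] := ltP `|z - y| de.
    have Ktz : box ta tb x0 r (t, z) by split => //=; move: tat tt' t'tb; sl.
    have := hd _ Ktz; rewrite prod_normE/= subrr normr0.
    have zd' : `|z - y| < d by apply: lt_le_trans zd _; rewrite /de ge_min lexx.
    have -> : Num.max 0 `|z - y| = `|z - y| by apply/max_idPr.
    move=> /(_ zd'); rewrite ltr_norml => /andP[_ ukat].
    have : 0 <= K * dotp (z - y) (z - y) by rewrite mulr_ge0// ltW.
    by move: ukat; sl.
  have := big z t; have -> : xi t = y by rewrite /xi subrr scale0r addr0.
  move=> /(_ zd); have Ktz : box ta tb x0 r (t, z) by split => //=; move: tat tt' t'tb; sl.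
  have [p1 _] := ub _ Ktz; have [_ p2] := ub _ Kty.
  have : 0 <= `|g| * (t' - t) by apply: mulr_ge0 => //; rewrite subr_ge0 ltW.
  by rewrite /W; move: p1 p2 kat; sl.
- move=> l z lI zr; rewrite fF1 /f /F/=.
  have h : de <= `|z - xi l|.
    have := xir l lI; have : `|z - x0| <= `|z - xi l| + `|xi l - x0|.
      by have := ler_normD (z - xi l) (xi l - x0); rewrite addrA subrK.
    have : de <= r - r' by rewrite /de !ge_min lexx !orbT.
    by rewrite zr; sl.
  have := big _ _ h; have Klz : box ta tb x0 r (l, z) by split => /=; [move: lI tat t'tb; sl|rewrite zr].
  have [p1 _] := ub _ Klz; have [_ p2] := ub _ Kty.
  by have := gt l lI; rewrite /W ler_norml => /andP[]; move: p1 p2 kat; sl.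
have lI' : t <= l <= t' by move: lI; sl.
have [sle sltb] : `|s - l| < e1 /\ `|s - l| < tb - t' by move: sl; rewrite lt_min => /andP[].
have Ksz : box ta tb x0 r (s, z) by split => /=; [move: sltb lI sI tat t'tb; rewrite ltr_norml; sl|exact: ltW].
pose qv := (2 * K) *: (z - xi l).
have FE z' : F (l, z') - F (l, z) = dotp qv (z' - z) + K * dotp (z' - z) (z' - z).
  rewrite /F/= /qv dotpZl.
  have -> : z' - xi l = (z - xi l) + (z' - z) by vec.
  by move: (z - xi l) (z' - z) => X Y; rewrite !(dotpDl, dotpDr) (dotpC Y X); ring.
have hsub : - tau + ham A V s z qv <= 0.
  pose dd := Num.min (r - `|z - x0|) (Num.min (s - ta) (tb - s)).
  have dd0 : 0 < dd by rewrite !lt_min; move: sltb lI sI tat t'tb zr; rewrite ltr_norml; sl.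
  apply: (sd_sub sd (k := k + K) (d := dd)) => //.
    by move: sltb lI sI tat t'tb; rewrite ltr_norml; sl.
  move=> s' z'; rewrite !lt_min => /andP[_ s's] /andP[z'z _].
  have s'I : ta <= s' <= tb by move: s's; rewrite !ltr_norml; sl.
  have z'r : `|z' - x0| <= r.
    have := ler_normD (z' - z) (z - x0); rewrite addrA subrK; move: z'z; sl.
  have := prox s' z' s'I z'r; rewrite FE /f.
  have : 0 <= k * dotp (z' - z) (z' - z) by rewrite mulr_ge0 ?dotp_ge0// ltW.
  have : 0 <= K * (s' - s) ^+ 2 by rewrite mulr_ge0 ?sqr_ge0// ltW.
  by sl.
have hlam : g + tau - dotp qv v <= 0.
  apply: (@deriv_le_of_quadratic _ (k + K * dotp v v) (l - t)); first by move: lI; sl.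
  move=> h h0 hlt; have := lamd (l - h); rewrite /F/=.
  have -> : z - xi (l - h) = (z - xi l) + h *: v.
    by rewrite /xi; apply/rowP => i; rewrite !mxE; ring.
  rewrite /qv dotpZl; move: (z - xi l) => X.
  rewrite !(dotpDl, dotpDr, dotpZl, dotpZr) (dotpC v X).
  have -> : t <= l - h <= t' by move: lI h0 hlt; sl.
  by move=> /(_ isT); sl.
have hf := lag_fenchel v qv Ksz.
have hzl : `|z - xi l| < e1.
  have K1 := xiK l lI'.
  apply: (@lt_le_trans _ _ de); last by rewrite /de !ge_min lexx !orbT.
  rewrite ltNge; apply/negP => /big; move: val; rewrite fF1 /f /F/=.
  have [p1 _] := ub _ Ksz; have [_ p2] := ub _ Kty.
  by have := gt l lI'; rewrite /W ler_norml => /andP[]; move: p1 p2 kat; sl.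
have hlip := lb_lip lb v Ksz (xiK l lI').
have := hL l lI'; rewrite -/(xi l) => hl.
have : C * (`|s - l| + `|z - xi l|) * (1 + `|v| ^+ 2) <= ka / 2.
  have -> : ka / 2 = C * (e1 + e1) * (1 + `|v| ^+ 2) by rewrite /e1; field; move: C1 v1; sl.
  apply: ler_wpM2r; first by move: v1; sl.
  by apply: ler_wpM2l; move: C1 sle hzl; sl.
by move: hsub hlam hf hlip hl ka0; rewrite /g; sl.
Qed.

End LocalSolution.

(** * Almost optimal backward steps for supersolutions *)

Section SuperStep.
Context {R : realType} {n : nat}.
Implicit Types (x y v w b p q z : 'rV[R]_n) (s t h k : R).

Variables (u V : R * 'rV[R]_n -> R) (A : R * 'rV[R]_n -> 'M[R]_n).
Variables (ta tb : R) (x0 : 'rV[R]_n) (r M c m C : R).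
Hypothesis cd : coef_data A V ta tb x0 r c m.
Hypothesis lb : lag_bounds A V ta tb x0 r C.
Hypothesis sd : sol_data u A V ta tb x0 r M.

Let M0 : 0 <= M.
Proof.
have K0 : box ta tb x0 r (ta, x0).
  split; first by rewrite /= lexx (ltW (sd_lt sd)).
  by rewrite /= subrr normr0 ltW// (sd_r sd).
exact: le_trans (normr_ge0 _) (sd_bnd sd K0).
Qed.

Ltac sl := clear -R n u V A ta tb x0 r M c m C cd lb sd M0; lra.

(* One-step dynamic programming for supersolutions: otherwise
   e (lam - t) + (1 - eta) <B (x - y), x - y> / (2 (t - lam)) would touch u from
   below strictly inside the box. *)
Lemma super_step t h x rho : ta <= t - h -> 0 < h -> t < tb -> 0 < rho ->
  `|x - x0| + rho <= r ->
  let eta := n%:R * C ^+ 4 * (2 * h + rho) in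
  let e := V (t, x) + C * (3 * h + rho) in
  eta <= 2^-1 -> 2 * M + 2 * `|e| * h < rho ^+ 2 / (4 * h * C) ->
  exists2 y, `|y - x| <= rho &
    u (t - h, y) + (1 - eta) / (2 * h) * bil (invmx (A (t, x))) (x - y) (x - y) - e * h <= u (t, x).
Proof.
move=> tath h0 ttb rho0 xr eta e eta2 lat; apply: contrapT => H.
have {}H y : `|y - x| <= rho -> u (t, x) <
    u (t - h, y) + (1 - eta) / (2 * h) * bil (invmx (A (t, x))) (x - y) (x - y) - e * h.
  by move=> yx; rewrite ltNge; apply/negP => ?; apply: H; exists y.
have C1 := lb_C lb; have C0 : 0 <= C by move: C1; sl.
have G0 : 0 <= n%:R * C ^+ 4 by apply: mulr_ge0 => //; exact: exprn_ge0.
have eta0 : 0 <= eta by rewrite /eta; apply: mulr_ge0 => //; move: h0 rho0; sl.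
have Kx s : t - h <= s <= tb -> forall y, `|y - x| <= rho -> box ta tb x0 r (s, y).
  move=> sI y yx; split => /=; first by move: sI tath; sl.
  by have := ler_normD (y - x) (x - x0); rewrite addrA subrK; move: yx xr; sl.
have Ktx : box ta tb x0 r (t, x) by apply: Kx; [move: h0 ttb; sl|rewrite subrr normr0 ltW].
set B := invmx (A (t, x)) in H *.
have Bs v w : bil B v w = bil B w v by rewrite bilC// invmx_sym// (cd_sym cd Ktx).
have Bge v : 0 <= bil B v v by exact: (bil_inv_ge0 (cd_c cd) (cd_sym cd Ktx) (cd_ell cd Ktx)).
have cbox : cont_on (box (t - h) tb x rho) u.
  by apply: cont_onW (sd_cont sd) => -[s y] [/= sI yx]; exact: Kx.
have cQ (y : 'rV[R]_n) : {for y, continuous (fun y : 'rV[R]_n => bil B (x - y) (x - y))}.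
  have cx : {for y, continuous (fun y : 'rV[R]_n => x - y)}.
    exact: continuous_csub.
  by apply: bil_continuous.
have [ym ymx hym] : exists2 y, `|y - x| <= rho & forall z, `|z - x| <= rho ->
    u (t - h, y) + (1 - eta) / (2 * h) * bil B (x - y) (x - y) <=
    u (t - h, z) + (1 - eta) / (2 * h) * bil B (x - z) (x - z).
  apply: (@cont_on_min _ _ [set y | `|y - x| <= rho]); first exact: compact_cball.
    by exists x; rewrite /= subrr normr0 ltW.
  apply: cont_onD.
    apply: (cont_on_comp (g := fun y : 'rV[R]_n => (t - h, y)) _ _ cbox).
      by move=> y /= yx; split => //=; move: h0 ttb; sl.
    by move=> y y'; rewrite prod_normE/= subrr normr0 ge_max normr_ge0/=.
  by apply: cont_onZ; apply: continuous_cont_on => y _; exact: cQ.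
pose gam := u (t - h, ym) + (1 - eta) / (2 * h) * bil B (x - ym) (x - ym) - e * h - u (t, x).
have gam0 : 0 < gam by rewrite /gam subr_gt0; exact: H.
have g20 : 0 < gam / 2 by exact: divr_gt0.
have [d d0 hd] := sd_cont sd Ktx g20.
have ne1 : 0 < `|e| + 1 by rewrite ltr_wpDl.
(* The model function has a pole at time t, so it is used only up to t - ka, where u and the drift
   together have changed by less than [gam]. *)
pose ka := Num.min (d / 2) (Num.min (h / 2) (gam / 4 / (`|e| + 1))).
have ka0 : 0 < ka by rewrite !lt_min !divr_gt0.
have kad : ka <= d / 2 by rewrite /ka ge_min lexx.
have kah : ka <= h / 2 by rewrite /ka !ge_min lexx orbT.
have kae : `|e| * ka <= gam / 4.
  have : ka <= gam / 4 / (`|e| + 1) by rewrite /ka !ge_min lexx !orbT.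
  by rewrite ler_pdivlMr// mulrDr mulr1 mulrC; move: ka0; sl.
pose F (z : R * 'rV[R]_n) := (1 - eta) / 2 * (t - z.1)^-1 * bil B (x - z.2) (x - z.2) + e * (z.1 - t).
have cF : cont_on (box (t - h) (t - ka) x rho) F.
  apply: continuous_cont_on => z [/= zI _].
  have cz : {for z, continuous (fun z : R * 'rV[R]_n => x - z.2)}.
    by apply: continuousB; [exact: cvg_cst|exact: cvg_snd].
  apply: continuousD; apply: continuousM.
  - apply: continuousM; first exact: cvg_cst.
    apply: continuousV; first by rewrite subr_eq0 gt_eqF//; move: zI ka0; sl.
    by apply: continuousB; [exact: cvg_cst|exact: cvg_fst].
  - exact: bil_continuous.
  - exact: cvg_cst.
  - by apply: continuousB; [exact: cvg_fst|exact: cvg_cst].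
have K1 : box (t - h) (t - ka) x rho (t - ka, x).
  by split => /=; [move: kah h0; sl|rewrite subrr normr0 ltW].
have hu1 : u (t - ka, x) < u (t, x) + gam / 2.
  have Kk : box ta tb x0 r (t - ka, x) by apply: Kx; [move: kah h0 ka0 ttb; sl|rewrite subrr normr0 ltW].
  have := hd _ Kk; rewrite prod_normE/= subrr normr0 addrAC subrr add0r normrN.
  have -> : Num.max `|ka| 0 = `|ka| by apply/max_idPl.
  by rewrite gtr0_norm// ltr_norml => hh; have := hh ltac:(by move: kad d0; sl); move=> /andP[_]; sl.
have val1 : u (t - ka, x) + F (t - ka, x) < u (t, x) + gam.
  rewrite /F/= subrr /bil dotp0r mulr0 add0r.
  have : `|e * (t - ka - t)| <= gam / 4.
    by rewrite addrAC subrr add0r normrM normrN (gtr0_norm ka0).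
  by rewrite ler_norml; move: hu1 gam0; sl.
have tbt : 0 < Num.min h (tb - t) by rewrite lt_min h0 subr_gt0.
have tkb : t - ka <= tb by move: ka0 ttb; sl.
have [||l [s [tau [k [z [k0 [lI sI zr sl] _ prox lamd]]]]]] :=
  moving_penalty cbox cF (lexx _) tkb K1 _ _ tbt.
- move=> y yx; apply: lt_le_trans val1 _; have := hym y yx.
  rewrite /F/= /gam.
  rewrite subKr.
  have -> : (1 - eta) / 2 * h^-1 = (1 - eta) / (2 * h) by field; exact: lt0r_neq0.
  have -> : e * (t - h - t) = - (e * h) by ring.
  by sl.
- move=> l y lI yx.
  have Kl : box ta tb x0 r (l, y) by apply: Kx; [move: lI ka0 ttb; sl|rewrite yx].
  have Kk : box ta tb x0 r (t - ka, x) by apply: Kx; [move: kah h0 ka0 ttb; sl|rewrite subrr normr0 ltW].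
  have := sd_bnd sd Kl; have := sd_bnd sd Kk; rewrite !ler_norml => /andP[_ u1] /andP[u2 _].
  rewrite /F/= subrr /bil dotp0r mulr0 add0r -/(bil B (x - y) (x - y)).
  (* On the lateral face the kinetic term is at least rho ^ 2 / (4 h C), since 1 - eta >= 1 / 2 and
     t - l <= h; by the smallness condition on h this exceeds the oscillation of u and of the
     drift. *)
  have Qr : rho ^+ 2 / C <= bil B (x - y) (x - y).
    by rewrite ler_pdivrMr; [rewrite mulrC -yx distrC; exact: (lb_coer lb)|move: C1; sl].
  have q1 : 4^-1 * h^-1 * (rho ^+ 2 / C) <= (1 - eta) / 2 * (t - l)^-1 * bil B (x - y) (x - y).
    have tl0 : 0 < t - l by move: lI ka0; sl.
    have hinv : h^-1 <= (t - l)^-1 by rewrite lef_pV2 ?posrE//; move: lI; sl.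
    have h1 : 4^-1 * h^-1 <= (1 - eta) / 2 * (t - l)^-1.
      by apply: ler_pM => //; rewrite ?invr_ge0; move: h0 eta2; sl.
    apply: ler_pM => //; first by apply: mulr_ge0 => //; rewrite invr_ge0 ltW.
    by apply: divr_ge0 => //; exact: sqr_ge0.
  have q2 : 4^-1 * h^-1 * (rho ^+ 2 / C) = rho ^+ 2 / (4 * h * C).
    by field; rewrite !gt_eqF//; move: C1; sl.
  have e1 : `|e * (l - t)| <= `|e| * h by rewrite normrM; apply: ler_wpM2l => //; rewrite ler_norml; move: lI ka0 h0; sl.
  have e2 : `|e * (t - ka - t)| <= `|e| * h by rewrite normrM; apply: ler_wpM2l => //; rewrite ler_norml; move: kah ka0 h0; sl.
  move: e1 e2; rewrite !ler_norml => /andP[e1a _] /andP[_ e2b].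
  by move: q1; rewrite q2; move: e1a e2b lat u1 u2; sl.
clearbody ka; clear H ym ymx hym gam gam0 g20 d d0 hd ne1 kad kae hu1 val1 K1 tbt cF cQ cbox lat tkb.
have [slh sltb] : `|s - l| < h /\ `|s - l| < tb - t by move: sl; rewrite lt_min => /andP[].
pose T := t - l; have T0 : 0 < T by rewrite /T; move: lI ka0; sl.
have sI' : s < tb by move: sltb lI ka0; rewrite ltr_norml; sl.
pose w := T^-1 *: (x - z).
pose p1 := mxact B w.
have Ksz : box ta tb x0 r (s, z) by apply: Kx; [move: sI sI'; sl|exact: ltW].
pose k' := (1 - eta) / 2 * T^-1 * C.
have k'0 : 0 <= k' by rewrite /k' !mulr_ge0 ?invr_ge0//; move: C1 T0 eta2; sl.
have FE z' : F (l, z') - F (l, z) <= - dotp ((1 - eta) *: p1) (z' - z) + k' * dotp (z' - z) (z' - z).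
  rewrite /F/= -/T /p1 dotpZl.
  have -> : dotp (mxact B w) (z' - z) = T^-1 * bil B (x - z) (z' - z).
    by rewrite /w -/(bil B _ _) bilZl.
  have -> : x - z' = (x - z) - (z' - z) by vec.
  have BB X Y : bil B (X - Y) (X - Y) = bil B X X - 2 * bil B X Y + bil B Y Y.
    by rewrite !(bilBl, bilBr) (Bs Y X); ring.
  rewrite BB.
  have c1 := lb_Bbnd lb (z' - z) Ktx; have c2 := norm_sq_le (z' - z).
  have c3 : bil B (z' - z) (z' - z) <= C * dotp (z' - z) (z' - z).
    by apply: le_trans c1 _; exact: ler_wpM2l.
  have q : 0 <= (1 - eta) / 2 * T^-1.
    by apply: mulr_ge0; [move: eta2; sl|rewrite invr_ge0 ltW].
  have := ler_wpM2l q c3; rewrite /k'; sl.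
have hsup : 0 <= tau + ham A V s z ((1 - eta) *: p1).
  pose dd := Num.min (rho - `|z - x|) (Num.min (s - (t - h)) (tb - s)).
  have dd0 : 0 < dd by rewrite !lt_min; move: zr sI sI'; sl.
  apply: (sd_sup sd (k := k + k') (d := dd)) => //.
  - by move: sI sI' tath; sl.
  - by have := ler_normD (z - x) (x - x0); rewrite addrA subrK; move: zr xr; sl.
  move=> s' z'; rewrite !lt_min => /andP[_ s's] /andP[z'z _].
  have s'I : t - h <= s' <= tb by move: s's sI sI'; rewrite !ltr_norml; sl.
  have z'r : `|z' - x| <= rho.
    by have := ler_normD (z' - z) (z - x); rewrite addrA subrK; move: z'z; sl.
  have := prox s' z' s'I z'r; have := FE z'.
  have : 0 <= k * dotp (z' - z) (z' - z) by rewrite mulr_ge0 ?dotp_ge0// ltW.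
  have : 0 <= k' * (s' - s) ^+ 2 by rewrite mulr_ge0 ?sqr_ge0.
  by sl.
have Qw : bil B (x - z) (x - z) = T ^+ 2 * bil B w w.
  rewrite /w bilZl bilZr; field; exact: lt0r_neq0.
have hlam : tau + (1 - eta) / 2 * bil B w w + e <= 0.
  apply: (@deriv_le_of_quadratic R _ (k + (1 - eta) / 2 * bil B w w / T) (l - (t - h))); first by move: lI; sl.
  move=> j j0 jlt; have := lamd (l - j); rewrite /F/= Qw.
  have -> : t - (l - j) = T + j by rewrite /T; sl.
  rewrite -/T.
  have -> : t - h <= l - j <= t - ka by move: lI j0 jlt; sl.
  move=> /(_ isT).
  (* Taylor expansion of the pole with an explicit remainder; only the part linear in j survives in
     [hlam]. *)
  have i1 : (T + j)^-1 <= T^-1 - j / T ^+ 2 + j ^+ 2 / T ^+ 3.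
    rewrite -subr_ge0.
    have -> : T^-1 - j / T ^+ 2 + j ^+ 2 / T ^+ 3 - (T + j)^-1 = j ^+ 3 / (T ^+ 3 * (T + j)).
      by field; rewrite !gt_eqF//; move: T0 j0; sl.
    by apply: divr_ge0; [|apply: mulr_ge0]; try apply: exprn_ge0; move: T0 j0; sl.
  have q1 : 0 <= (1 - eta) / 2 by move: eta2; sl.
  have q := mulr_ge0 q1 (mulr_ge0 (sqr_ge0 T) (Bge w)).
  have i2 := ler_wpM2l q i1.
  have i3 : (1 - eta) / 2 * (T ^+ 2 * bil B w w) * (T^-1 - j / T ^+ 2 + j ^+ 2 / T ^+ 3) =
    (1 - eta) / 2 * T^-1 * (T ^+ 2 * bil B w w) - (1 - eta) / 2 * bil B w w * j
     + (1 - eta) / 2 * bil B w w / T * j ^+ 2 by field; exact: lt0r_neq0.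
  by move: i2; rewrite i3; sl.
have Ap : bil (A (s, z)) p1 p1 <= (1 + eta) * bil B w w.
  have -> : bil (A (s, z)) p1 p1 = bil (A (t, x)) p1 p1 + bil (A (s, z) - A (t, x)) p1 p1.
    by rewrite bilBm; ring.
  have -> : bil (A (t, x)) p1 p1 = bil B w w.
    by rewrite /p1 /bil (mxact_invK (cd_c cd) (cd_ell cd Ktx)) dotpC.
  have b1 := lb_Alip lb p1 Ksz Ktx; have b2 := lb_Bnorm lb w Ktx; have b3 := lb_coer lb w Ktx.
  rewrite /= in b1.
  set dd := `|s - t| + `|z - x| in b1.
  have dd0 : 0 <= dd by rewrite addr_ge0.
  have ddle : dd <= 2 * h + rho.
    rewrite /dd; apply: lerD; last exact: ltW.
    by move: slh lI ka0 h0; rewrite ltr_norml ler_norml; sl.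
  have b4 : `|bil (A (s, z) - A (t, x)) p1 p1| <= n%:R * (C * dd * `|p1| * `|p1|).
    by apply: le_trans (dotp_le _ _) _; rewrite ler_wpM2l// ler_wpM2r.
  (* The powers of C in [eta]: |p1| <= C |w| and coercivity give C ^ 3, and the Lipschitz constant
     of A gives one more. *)
  have b5 : `|p1| ^+ 2 <= C ^+ 3 * bil B w w.
    have : `|p1| ^+ 2 <= (C * `|w|) ^+ 2 by rewrite ler_sqr ?nnegrE//; exact: mulr_ge0.
    have : C ^+ 2 * `|w| ^+ 2 <= C ^+ 2 * (C * bil B w w) by rewrite ler_wpM2l ?sqr_ge0.
    by rewrite exprMn; sl.
  have b6 : n%:R * (C * dd * `|p1| * `|p1|) <= eta * bil B w w.
    have -> : n%:R * (C * dd * `|p1| * `|p1|) = n%:R * C * dd * `|p1| ^+ 2 by ring.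
    have -> : eta * bil B w w = n%:R * C * (2 * h + rho) * (C ^+ 3 * bil B w w) by rewrite /eta; ring.
    have nC0 : 0 <= n%:R * C :> R by exact: mulr_ge0.
    exact: (ler_pM (mulr_ge0 nC0 dd0) (sqr_ge0 _) (ler_wpM2l nC0 ddle) b5).
  by move: b4 b6; rewrite ler_norml => /andP[_]; sl.
have Vle : V (s, z) < e.
  have := lb_lip lb 0 Ktx Ksz; rewrite /lag /bil !dotp0r normr0 expr0n/= addr0 mulr1.
  have : `|t - s| + `|x - z| <= 2 * h + rho.
    apply: lerD; last by rewrite distrC ltW.
    by move: slh lI ka0 h0; rewrite ltr_norml ler_norml; sl.
  move=> /(ler_wpM2l C0); rewrite /e.
  have : 0 < C * h by rewrite mulr_gt0//; move: C1; sl.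
  by sl.
(* The slack eta pays for A being taken at (s, z) instead of (t, x): (1 - eta) ^ 2 (1 + eta) <= 1 -
   eta. With V (s, z) < e this contradicts [hlam]. *)
move: hsup; rewrite /ham bilZl bilZr.
have q : 0 <= (1 - eta) ^+ 2 by exact: sqr_ge0.
have := ler_wpM2l q Ap.
have q1 : 0 <= 1 - eta by move: eta2; sl.
have := mulr_ge0 q1 (mulr_ge0 (sqr_ge0 eta) (Bge w)).
move: hlam Vle.
have -> : (1 - eta) ^+ 2 * ((1 + eta) * bil B w w) = (1 - eta) * bil B w w - (1 - eta) * (eta ^+ 2 * bil B w w).
  ring.
by sl.
Qed.

End SuperStep.

(** * Semiconcavity of the solution *)

Ltac cl := clear; lra.

Lemma box_ball (R : realType) (n : nat) (ta tb r s : R) (x0 y : 'rV[R]_n) :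
  ta <= s <= tb -> `|y - x0| <= r -> box ta tb x0 r (s, y).
Proof. by []. Qed.

Lemma lag_lower (R : realType) (n : nat) (A : R * 'rV[R]_n -> 'M[R]_n) V ta tb (x0 : 'rV[R]_n) r C s y v :
  lag_bounds A V ta tb x0 r C -> box ta tb x0 r (s, y) ->
  `|v| ^+ 2 / (2 * C) - C <= lag A V s y v.
Proof.
move=> lb K; have C1 := lb_C lb; have h1 := lb_coer lb v K; have := lb_bnd lb 0 K.
rewrite /lag /bil dotp0r mulr0 add0r normr0 expr0n/= addr0 mulr1 ler_norml => /andP[h2 h3].
have : `|v| ^+ 2 / (2 * C) <= 2^-1 * bil (invmx (A (s, y))) v v.
  by rewrite ler_pdivrMr; [move: h1; cl|move: C1; cl].
by rewrite /bil; move: h2 h3; cl.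
Qed.

(** [super_step] in terms of the mean velocity v = (y - y') / h. The loss [eta] of kinetic energy
    and the oscillation of V are of order rho; they are collected in one error proportional to rho
    (1 + |v| ^ 2), which disappears as the chain is refined. *)
Lemma chain_step (R : realType) (n : nat) (u V : R * 'rV[R]_n -> R) (A : R * 'rV[R]_n -> 'M[R]_n)
    (ta tb : R) (x0 : 'rV[R]_n) (r M c m C : R) (t h rho : R) (y : 'rV[R]_n) :
  coef_data A V ta tb x0 r c m -> lag_bounds A V ta tb x0 r C ->
  sol_data u A V ta tb x0 r M ->
  ta <= t - h -> t < tb -> 0 < h -> h <= rho -> rho <= 1 -> `|y - x0| + rho <= r ->
  n%:R * C ^+ 4 * (3 * rho) <= 2^-1 -> h * (4 * C * (2 * M + 10 * C)) < rho ^+ 2 ->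
  exists y' v : 'rV[R]_n, [/\ y = y' + h *: v, h * `|v| <= rho &
    u (t - h, y') + h * (lag A V t y v - (n%:R * C ^+ 5 + C) * (4 * rho) * (1 + `|v| ^+ 2)) <= u (t, y)].
Proof.
move=> cd lb sd tath ttb h0 hrho rho1 yr Grho hlat.
have C1 := lb_C lb.
have rho0 : 0 < rho by move: h0 hrho; cl.
have M0 : 0 <= M.
  have K0 : box ta tb x0 r (t, y) by split => /=; [move: tath h0 ttb; cl|move: yr rho0; cl].
  exact: le_trans (normr_ge0 _) (sd_bnd sd K0).
have K : box ta tb x0 r (t, y) by split => /=; [move: tath h0 ttb; cl|move: yr rho0; cl].
have G0 : 0 <= n%:R * C ^+ 4 by rewrite mulr_ge0// exprn_ge0//; move: C1; cl.
have := super_step cd lb sd tath h0 ttb rho0 yr.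
set eta := n%:R * C ^+ 4 * (2 * h + rho); set e := V (t, y) + _ => /= hs.
have eta0 : 0 <= eta by rewrite mulr_ge0//; move: h0 rho0; cl.
have etale : eta <= n%:R * C ^+ 4 * (3 * rho).
  by apply: ler_wpM2l => //; move: hrho; cl.
have e2 : eta <= 2^-1 by move: etale Grho; cl.
have Vb : `|V (t, y)| <= C.
  have := lb_bnd lb 0 K; rewrite /lag /bil dotp0r mulr0 add0r normrN normr0 expr0n/=.
  by rewrite addr0 mulr1.
(* |V| <= C and the correction is at most 4 C, whence the 10 C in the condition on h. *)
have eb : `|e| <= 5 * C.
  apply: le_trans (ler_normD _ _) _.
  have -> : `|C * (3 * h + rho)| = C * (3 * h + rho).
    by rewrite ger0_norm// mulr_ge0//; move: C1 h0 rho0; cl.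
  have : C * (3 * h + rho) <= C * 4 by apply: ler_wpM2l; move: C1 hrho rho1; cl.
  by move: Vb; cl.
have hC : 0 < 4 * h * C by rewrite !mulr_gt0//; move: C1; cl.
have lat : 2 * M + 2 * `|e| * h < rho ^+ 2 / (4 * h * C).
  rewrite ltr_pdivlMr//; apply: le_lt_trans hlat.
  have -> : h * (4 * C * (2 * M + 10 * C)) = (2 * M + 2 * (5 * C)) * (4 * h * C) by ring.
  apply: ler_wpM2r; first exact: ltW.
  have : `|e| * h <= 5 * C * 1 by apply: ler_pM => //; [exact: ltW|move: hrho rho1; cl].
  by cl.
have [y' y'r hy'] := hs e2 lat.
exists y', (h^-1 *: (y - y')).
set v := h^-1 *: (y - y').
have yE : y - y' = h *: v by rewrite /v scalerA divff ?scale1r ?gt_eqF.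
split; first by rewrite -yE; apply/rowP => i; rewrite !mxE; ring.
  by rewrite -[X in X * _](gtr0_norm h0) -normrZ -yE distrC.
move: hy'; rewrite yE bilZl bilZr.
have -> : (1 - eta) / (2 * h) * (h * (h * bil (invmx (A (t, y))) v v)) =
   h * (2^-1 * bil (invmx (A (t, y))) v v) - h * (eta * (2^-1 * bil (invmx (A (t, y))) v v)).
  by field; move: h0; cl.
have b1 := lb_Bbnd lb v K.
have q : eta * (2^-1 * bil (invmx (A (t, y))) v v) + C * (3 * h + rho) <=
    (n%:R * C ^+ 5 + C) * (4 * rho) * (1 + `|v| ^+ 2).
  have v0 : 0 <= `|v| ^+ 2 by exact: sqr_ge0.
  have q1 : eta * (2^-1 * bil (invmx (A (t, y))) v v) <= n%:R * C ^+ 4 * (3 * rho) * (C * `|v| ^+ 2).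
    apply: le_trans (ler_wpM2l eta0 _) (ler_wpM2r _ etale).
      by move: b1 (bil_inv_ge0 (cd_c cd) (cd_sym cd K) (cd_ell cd K) v); cl.
    by rewrite mulr_ge0//; move: C1; cl.
  have q2 : C * (3 * h + rho) <= C * (4 * rho) by apply: ler_wpM2l; move: C1 hrho; cl.
  have q3 : 0 <= C * (4 * rho) * `|v| ^+ 2 by rewrite !mulr_ge0//; move: C1 rho0; cl.
  have q4 : 0 <= n%:R * C ^+ 4 * (C * rho) * `|v| ^+ 2 by rewrite !mulr_ge0 ?exprn_ge0//; move: C1 rho0; cl.
  have q5 : 0 <= n%:R * C ^+ 4 * (C * rho) by rewrite !mulr_ge0 ?exprn_ge0//; move: C1 rho0; cl.
  have -> : (n%:R * C ^+ 5 + C) * (4 * rho) * (1 + `|v| ^+ 2) =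
    n%:R * C ^+ 4 * (3 * rho) * (C * `|v| ^+ 2) + C * (4 * rho) + C * (4 * rho) * `|v| ^+ 2 +
    n%:R * C ^+ 4 * (C * rho) * `|v| ^+ 2 + 4 * (n%:R * C ^+ 4 * (C * rho)) by ring.
  by move: q1 q2 q3 q4 q5; cl.
have := ler_wpM2l (ltW h0) q.
have -> : e * h = h * V (t, y) + h * (C * (3 * h + rho)) by rewrite /e; ring.
rewrite /lag; cl.
Qed.

(** The endpoints are moved by +-w with weight [zeta] at time t and zeta - beta h at time t - h, so
    the two segments have velocities v +- beta w. In the sum of the two subsolution inequalities the
    Lagrangian enters through its second difference, where first-order terms cancel. *)
Lemma shift_step (R : realType) (n : nat) (u V : R * 'rV[R]_n -> R) (A : R * 'rV[R]_n -> 'M[R]_n)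
    (ta tb : R) (x0 : 'rV[R]_n) (r M c m C : R) (t h rho beta zeta : R) (y' v w : 'rV[R]_n) :
  coef_data A V ta tb x0 r c m -> lag_bounds A V ta tb x0 r C ->
  sol_data u A V ta tb x0 r M ->
  ta <= t - h -> t < tb -> 0 < h -> h <= rho -> h * `|v| <= rho ->
  0 <= beta -> 0 <= zeta <= 1 -> 0 <= zeta - beta * h -> `|w| <= r / 4 ->
  `|y' - x0| <= r / 2 -> `|y' + h *: v - x0| <= r / 2 ->
  u (t, y' + h *: v + zeta *: w) + u (t, y' + h *: v - zeta *: w) <=
  u (t - h, y' + (zeta - beta * h) *: w) + u (t - h, y' - (zeta - beta * h) *: w) +
  h * (2 * lag A V t (y' + h *: v) v +
    (C * (2 * beta ^+ 2 + 2 * beta + 1 + beta ^+ 2 * r) * `|w| ^+ 2 +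
     8 * C * (1 + beta * r) ^+ 3 * rho) * (1 + `|v| ^+ 2)).
Proof.
move=> cd lb sd tath ttb h0 hrho hv beta0 /andP[z0 z1] z'0 wr y'r.
set y := y' + h *: v => yr.
have C1 := lb_C lb; have r0 := sd_r sd.
have rho0 : 0 < rho by move: h0 hrho; cl.
pose b := beta *: w; pose zeta' := zeta - beta * h.
have z'1 : zeta' <= 1 by rewrite /zeta'; have := mulr_ge0 beta0 (ltW h0); move: z1; cl.
have nb : `|b| = beta * `|w| by rewrite normrZ ger0_norm.
have w0 := normr_ge0 w.
have br : `|b| <= beta * r by rewrite nb; apply: ler_wpM2l => //; move: wr r0; cl.
have nzw : `|zeta *: w| <= `|w| by rewrite normrZ ger0_norm// ler_piMl.
have nzw' : `|zeta' *: w| <= `|w| by rewrite normrZ ger0_norm// ler_piMl.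
have Kin (s : R) (p q : 'rV[R]_n) : ta <= s <= tb -> `|p - x0| <= r / 2 -> `|q| <= `|w| ->
    `|p + q - x0| <= 3 / 4 * r /\ box ta tb x0 r (s, p + q).
  move=> sI pr qw; have : `|p + q - x0| <= `|p - x0| + `|q|.
    by rewrite addrAC; exact: ler_normD.
  move=> h1; have h2 : `|p + q - x0| <= 3 / 4 * r by move: h1 pr qw wr; cl.
  by split => //; apply: box_ball => //; move: h2 r0; cl.
have tI : ta <= t <= tb by move: tath ttb h0; cl.
have t'I : ta <= t - h <= tb by move: tath ttb h0; cl.
have K : box ta tb x0 r (t, y) by apply: box_ball => //; move: yr r0; cl.
have L v' : 0 <= 1 + `|v'| ^+ 2 :> R by rewrite addr_ge0// sqr_ge0.
(* Variation of the Lagrangian along one short segment. It is of order rho, not of order |w| ^ 2, so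
   rho must tend to 0 while w stays fixed. *)
pose err : R := 4 * C * (1 + beta * r) ^+ 3 * rho * (1 + `|v| ^+ 2).
have side (sg : R) : `|sg| = 1 -> u (t, y + sg *: (zeta *: w)) <=
    u (t - h, y' + sg *: (zeta' *: w)) + h * (lag A V t (y + sg *: (zeta *: w)) (v + sg *: b) + err).
  move=> sg1.
  have nsg (q : 'rV[R]_n) : `|sg *: q| = `|q| by rewrite normrZ sg1 mul1r.
  have nvb : `|v + sg *: b| <= `|v| + `|b|.
    by apply: le_trans (ler_normD _ _) _; rewrite nsg.
  have [e1 K1] : _ := Kin t y (sg *: (zeta *: w)) tI yr (le_trans (le_of_eq (nsg _)) nzw).
  have [e2 K2] : _ := Kin (t - h) y' (sg *: (zeta' *: w)) t'I y'r (le_trans (le_of_eq (nsg _)) nzw').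
  have yE : y + sg *: (zeta *: w) = (y' + sg *: (zeta' *: w)) + (t - (t - h)) *: (v + sg *: b).
    by rewrite /y /b /zeta'; apply/rowP => i; rewrite !mxE; ring.
  have := @line_ineq _ _ u V A ta tb x0 r M c m C cd lb sd (t - h) t (y' + sg *: (zeta' *: w)) (v + sg *: b)
    (3 / 4 * r) (lag A V t (y + sg *: (zeta *: w)) (v + sg *: b) + err) tath.
  rewrite -yE; have -> : t - (t - h) = h by ring.
  apply => //; [by move: h0; cl|by move: r0; cl|].
  move=> s /andP[s1 s2].
  set xi := _ + (s - _) *: _.
  have xiE : xi - (y + sg *: (zeta *: w)) = - ((t - s) *: (v + sg *: b)).
    by rewrite /xi yE; apply/rowP => i; rewrite !mxE; ring.
  have nxi : `|xi - (y + sg *: (zeta *: w))| <= h * `|v + sg *: b|.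
    rewrite xiE normrN normrZ ger0_norm; last by move: s2; cl.
    by apply: ler_wpM2r => //; move: s1; cl.
  have th : 0 <= (t - s) / h <= 1.
    by rewrite divr_ge0 ?(ltW h0) ?ler_pdivrMr//=; [rewrite mul1r; move: s1; cl|move: s2; cl].
  have Kxi : box ta tb x0 r (s, xi).
    apply: box_ball; first by move: tath s1 s2 ttb; cl.
    have -> : xi - x0 = ((t - s) / h) *: ((y' + sg *: (zeta' *: w)) - x0)
       + (1 - (t - s) / h) *: (y + sg *: (zeta *: w) - x0).
      by rewrite /xi yE; apply/rowP => i; rewrite !mxE; field; move: h0; cl.
    apply: le_trans (ler_normD _ _) _.
    case/andP: th => th0 th1.
    have -> : `|((t - s) / h) *: ((y' + sg *: (zeta' *: w)) - x0)| =
      ((t - s) / h) * `|(y' + sg *: (zeta' *: w)) - x0| by rewrite normrZ ger0_norm.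
    have th1' : 0 <= 1 - (t - s) / h by rewrite subr_ge0.
    have -> : `|(1 - (t - s) / h) *: (y + sg *: (zeta *: w) - x0)| =
       (1 - (t - s) / h) * `|y + sg *: (zeta *: w) - x0| by rewrite normrZ ger0_norm.
    by have := ler_wpM2l th0 e2; have := ler_wpM2l th1' e1; move: r0; cl.
  apply: le_trans (lb_lip lb _ Kxi K1) _; rewrite lerD2l.
  have a1 : `|s - t| <= rho by rewrite ler_norml; move: s1 s2 hrho; cl.
  have a2 : `|xi - (y + sg *: (zeta *: w))| <= rho + rho * (beta * r).
    apply: le_trans nxi _; apply: le_trans (ler_wpM2l (ltW h0) nvb) _.
    rewrite mulrDr; apply: lerD => //; apply: ler_pM => //; exact: ltW.
  have br0 : 0 <= beta * r by rewrite mulr_ge0// ltW.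
  have a3 : 1 + `|v + sg *: b| ^+ 2 <= 2 * (1 + beta * r) ^+ 2 * (1 + `|v| ^+ 2).
    have : `|v + sg *: b| ^+ 2 <= (`|v| + beta * r) ^+ 2.
      rewrite ler_sqr ?nnegrE ?addr_ge0//; apply: le_trans nvb _; exact: lerD.
    have : 0 <= (`|v| - beta * r) ^+ 2 by exact: sqr_ge0.
    have : 0 <= beta * r * `|v| ^+ 2 by rewrite mulr_ge0 ?sqr_ge0.
    have : 0 <= (beta * r) ^+ 2 * `|v| ^+ 2 by rewrite mulr_ge0 ?sqr_ge0.
    have : 0 <= `|v| ^+ 2 by exact: sqr_ge0.
    by move: br0; move: (beta * r) => k; nra.
  have a12 : `|s - t| + `|xi - (y + sg *: (zeta *: w))| <= 2 * rho * (1 + beta * r).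
    by have := mulr_ge0 (ltW rho0) br0; move: a1 a2; cl.
  have -> : err = C * (2 * rho * (1 + beta * r)) * (2 * (1 + beta * r) ^+ 2 * (1 + `|v| ^+ 2)).
    by rewrite /err; ring.
  apply: ler_pM => //; first by rewrite mulr_ge0 ?addr_ge0//; move: C1; cl.
  by apply: ler_wpM2l => //; move: C1; cl.
have s1 := side 1 (normr1 _); have s2 := side (-1) (normrN1 _).
move: s1 s2; rewrite !scale1r !scaleN1r => s1 s2.
have Kp : box ta tb x0 r (t, y + zeta *: w) by have [] := Kin t y (zeta *: w) tI yr nzw.
have nzwN : `|- (zeta *: w)| <= `|w| by rewrite normrN.
have Km : box ta tb x0 r (t, y - zeta *: w) by have [] := Kin t y _ tI yr nzwN.
have l2 := lb_2 lb v b K Kp Km.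
have bB := lb_Bbnd lb b K.
have v0 := normr_ge0 v.
have zw2 : `|zeta *: w| ^+ 2 <= `|w| ^+ 2 by rewrite ler_sqr ?nnegrE.
have f1 : `|zeta *: w| * `|b| * (1 + `|v|) <= 2 * beta * `|w| ^+ 2 * (1 + `|v| ^+ 2).
  have -> : 2 * beta * `|w| ^+ 2 * (1 + `|v| ^+ 2) = `|w| * (beta * `|w|) * (2 * (1 + `|v| ^+ 2)) by ring.
  apply: ler_pM => //; rewrite ?mulr_ge0 ?addr_ge0//.
    by rewrite nb ler_wpM2r// mulr_ge0.
  by have := sqr_ge0 (`|v| - 1); nra.
have f2 : `|zeta *: w| ^+ 2 * (1 + `|v| ^+ 2) <= `|w| ^+ 2 * (1 + `|v| ^+ 2) by rewrite ler_wpM2r.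
have f3 : `|zeta *: w| * `|b| ^+ 2 <= beta ^+ 2 * r * `|w| ^+ 2 * (1 + `|v| ^+ 2).
  have -> : beta ^+ 2 * r * `|w| ^+ 2 * (1 + `|v| ^+ 2) = r * (beta * `|w|) ^+ 2 * (1 + `|v| ^+ 2) by ring.
  rewrite nb -[leLHS]mulr1; apply: ler_pM => //; rewrite ?mulr_ge0 ?sqr_ge0//.
    by apply: ler_wpM2r; [exact: sqr_ge0|move: nzw wr r0; cl].
  by rewrite lerDl sqr_ge0.
have f4 : bil (invmx (A (t, y))) b b <= C * (2 * beta ^+ 2) * `|w| ^+ 2 * (1 + `|v| ^+ 2).
  apply: le_trans bB _; rewrite nb.
  have -> : C * (2 * beta ^+ 2) * `|w| ^+ 2 * (1 + `|v| ^+ 2) = C * (beta * `|w|) ^+ 2 * (2 * (1 + `|v| ^+ 2)) by ring.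
  rewrite -[leLHS]mulr1; apply: ler_pM => //.
    by rewrite mulr_ge0 ?sqr_ge0//; move: C1; cl.
  by have := sqr_ge0 `|v|; cl.
have C0 : 0 <= C by move: C1; cl.
have f5 := ler_wpM2l C0 (lerD (lerD f1 f2) f3).
have := ler_wpM2l (ltW h0) (le_trans l2 (lerD f4 f5)).
have -> : (C * (2 * beta ^+ 2 + 2 * beta + 1 + beta ^+ 2 * r) * `|w| ^+ 2 + 8 * C * (1 + beta * r) ^+ 3 * rho) * (1 + `|v| ^+ 2) =
  C * (2 * beta ^+ 2) * `|w| ^+ 2 * (1 + `|v| ^+ 2) + C * (2 * beta * `|w| ^+ 2 * (1 + `|v| ^+ 2) + `|w| ^+ 2 * (1 + `|v| ^+ 2) + beta ^+ 2 * r * `|w| ^+ 2 * (1 + `|v| ^+ 2)) + 2 * err.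
  by rewrite /err; ring.
move: s1 s2; rewrite -/zeta'; cl.
Qed.

(* Iterating chain_step yields an almost minimizing chain (y_k) ending at x.
   Moving the vertices of the chain by +-zeta_k w, where zeta_k decreases
   linearly backwards in time at rate beta, and comparing through the
   subsolution inequality bounds second differences of u at time t. Here E is
   the accumulated kinetic energy. *)
Lemma chain_bound (R : realType) (n : nat) (u V : R * 'rV[R]_n -> R) (A : R * 'rV[R]_n -> 'M[R]_n)
    (ta tb : R) (x0 : 'rV[R]_n) (r M c m C : R) (N : nat) (t h rho beta e : R) (x w : 'rV[R]_n) :
  coef_data A V ta tb x0 r c m -> lag_bounds A V ta tb x0 r C ->
  sol_data u A V ta tb x0 r M ->
  t - N%:R * h = ta -> t < tb -> 0 < h -> h <= rho -> rho <= 1 -> rho <= r / 4 ->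
  n%:R * C ^+ 4 * (3 * rho) <= 2^-1 -> h * (4 * C * (2 * M + 10 * C)) < rho ^+ 2 ->
  let K1 := n%:R * C ^+ 5 + C in
  K1 * (4 * rho) <= (4 * C)^-1 -> 0 < e -> N%:R * h <= 1 ->
  let Eb := 4 * C * (2 * M + C + 1) in
  e / 2 * Eb + N%:R * h / (2 * e) <= r / 4 ->
  `|x - x0| <= r / 4 -> `|w| <= r / 4 -> 0 <= beta -> beta * (N%:R * h) <= 1 ->
  forall k, (k <= N)%N -> exists (y : 'rV[R]_n) (E : R),
   [/\ 0 <= E <= Eb, `|x - y| <= e / 2 * E + k%:R * h / (2 * e),
    u (t - k%:R * h, y) + E / (4 * C) - (C + 1) * (k%:R * h) <= u (t, x),
    `|y - x0| <= r / 2 &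
    u (t, x + w) + u (t, x - w) - 2 * u (t, x) <=
    u (t - k%:R * h, y + (1 - beta * (k%:R * h)) *: w) + u (t - k%:R * h, y - (1 - beta * (k%:R * h)) *: w)
    - 2 * u (t - k%:R * h, y) +
    (C * (2 * beta ^+ 2 + 2 * beta + 1 + beta ^+ 2 * r) * `|w| ^+ 2 +
      (8 * C * (1 + beta * r) ^+ 3 + 8 * K1) * rho) * E].
Proof.
move=> cd lb sd tN ttb h0 hrho rho1 rhor Grho hlat K1 K1r e0 Nh1 Eb er xr wr b0 bN.
have C1 := lb_C lb; have r0 := sd_r sd.
have N0 : 0 <= N%:R * h by rewrite mulr_ge0// ltW.
have KI : ta <= t <= tb by move: tN N0 ttb; cl.
have Kx : box ta tb x0 r (t, x) by apply: box_ball => //; move: xr r0; cl.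
have M0 : 0 <= M by exact: le_trans (normr_ge0 _) (sd_bnd sd Kx).
have Eb0 : 0 <= Eb by rewrite /Eb mulr_ge0//; move: C1 M0; cl.
elim=> [_|k IH kN].
  exists x, 0; rewrite !mul0r !mulr0 !subr0 !addr0 subrr normr0 scale1r; split => //.
  - by rewrite lexx.
  - by move: xr r0; cl.
have [y [E [/andP[E0 EEb] xy en yr sd2]]] := IH (ltnW kN).
set tk := t - k%:R * h in en sd2.
have kN1 : k.+1%:R * h <= N%:R * h by apply: ler_wpM2r; [exact: ltW|rewrite ler_nat].
have kS : k.+1%:R * h = k%:R * h + h by rewrite -natr1; ring.
have kh0 : 0 <= k%:R * h by rewrite mulr_ge0// ltW.
have tkE : t - k.+1%:R * h = tk - h by rewrite kS /tk; ring.
have tk1 : ta <= tk - h by rewrite -tkE; move: kN1 tN; cl.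
have tk2 : tk < tb by rewrite /tk; move: kh0 ttb; cl.
have yrr : `|y - x0| + rho <= r by move: yr rhor r0; cl.
have [y' [v [yE hv stp]]] := chain_step cd lb sd tk1 tk2 h0 hrho rho1 yrr Grho hlat.
have v0 : 0 <= `|v| ^+ 2 by exact: sqr_ge0.
(* Half of the coercive lower bound of the Lagrangian absorbs the error of [chain_step]; the other
   half yields the term E / (4 C), and the bound on u turns it into E <= Eb. *)
pose dE := h * (1 + `|v| ^+ 2).
have dE0 : 0 <= dE by rewrite mulr_ge0 ?addr_ge0// ltW.
have Ky : box ta tb x0 r (tk, y) by apply: box_ball; [move: tk1 h0 tk2; cl|move: yr r0; cl].
have ll := lag_lower v lb Ky.
rewrite -/K1 in stp.
have en' : u (tk - h, y') + (E + dE) / (4 * C) - (C + 1) * (k.+1%:R * h) <= u (t, x).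
  have q1 : K1 * (4 * rho) * (1 + `|v| ^+ 2) <= (4 * C)^-1 * (1 + `|v| ^+ 2).
    by apply: ler_wpM2r K1r; rewrite addr_ge0.
  have q2 : (1 + `|v| ^+ 2) / (2 * C) - (C + 1) <= lag A V tk y v.
    apply: le_trans ll.
    have : (2 * C)^-1 <= 1 by rewrite invf_le1; move: C1; cl.
    by rewrite mulrDl; cl.
  have q3 : (1 + `|v| ^+ 2) / (4 * C) - (C + 1) <= lag A V tk y v - K1 * (4 * rho) * (1 + `|v| ^+ 2).
    have : (1 + `|v| ^+ 2) / (2 * C) = 2 * ((1 + `|v| ^+ 2) / (4 * C)) by field; move: C1; cl.
    by move: q1 q2; rewrite [(4 * C)^-1 * _]mulrC; cl.
  have := ler_wpM2l (ltW h0) q3.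
  have -> : (E + dE) / (4 * C) = E / (4 * C) + h * ((1 + `|v| ^+ 2) / (4 * C)).
    by rewrite /dE; ring.
  by move: stp en; rewrite kS; cl.
have K'0 : ta <= tk - h <= tb by move: tk1 tk2 h0; cl.
(* Young's inequality: the displacement is bounded by energy and elapsed time, so the chain stays in
   the ball of radius r / 2 whatever its number of vertices. *)
have nv : h * `|v| <= e / 2 * dE + h / (2 * e).
  have q : `|v| <= e / 2 * (1 + `|v| ^+ 2) + (2 * e)^-1.
    have := sqr_ge0 (e * `|v| - 1) => s0.
    have ei : 0 < (2 * e)^-1 by rewrite invr_gt0 mulr_gt0.
    have : 0 <= (2 * e)^-1 * (e * `|v| - 1) ^+ 2 by rewrite mulr_ge0// ltW.
    have -> : (2 * e)^-1 * (e * `|v| - 1) ^+ 2 = e / 2 * `|v| ^+ 2 - `|v| + (2 * e)^-1.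
      by field; move: e0; cl.
    by move: e0; cl.
  have := ler_wpM2l (ltW h0) q; rewrite /dE; cl.
have yy' : `|y - y'| = h * `|v|.
  have -> : y - y' = h *: v by rewrite yE; apply/rowP => i; rewrite !mxE; ring.
  by rewrite normrZ gtr0_norm.
have xy' : `|x - y'| <= e / 2 * (E + dE) + k.+1%:R * h / (2 * e).
  have := ler_distD y x y'; rewrite yy' kS; move: xy nv.
  have -> : (k%:R * h + h) / (2 * e) = k%:R * h / (2 * e) + h / (2 * e) by rewrite mulrDl.
  by cl.
have y'r1 : `|y' - x0| <= r.
  have := ler_distD y y' x0; rewrite (distrC y' y) yy'; move: hv yr rhor r0; cl.
have EE : E + dE <= Eb.
  have Ky' : box ta tb x0 r (tk - h, y') by apply: box_ball.
  have := sd_bnd sd Ky'; have := sd_bnd sd Kx; rewrite !ler_norml => /andP[_ u1] /andP[u2 _].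
  have : (E + dE) / (4 * C) <= 2 * M + C + 1.
    have : (C + 1) * (k.+1%:R * h) <= C + 1.
      by rewrite -[leRHS]mulr1; apply: ler_wpM2l; [move: C1; cl|apply: le_trans kN1 Nh1].
    by move: en' u1 u2; cl.
  by rewrite ler_pdivrMr; [rewrite /Eb mulrC|move: C1; cl].
have y'r : `|y' - x0| <= r / 2.
  have : e / 2 * (E + dE) <= e / 2 * Eb by apply: ler_wpM2l => //; move: e0; cl.
  have : k.+1%:R * h / (2 * e) <= N%:R * h / (2 * e).
    by apply: ler_wpM2r => //; rewrite invr_ge0; move: e0; cl.
  have := ler_distD x y' x0; rewrite (distrC y' x); move: xy' er xr; cl.
exists y', (E + dE); rewrite tkE; split => //; first by rewrite addr_ge0.
have bk : beta * (k.+1%:R * h) <= 1 by apply: le_trans bN; apply: ler_wpM2l.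
have bh0 : 0 <= beta * h by rewrite mulr_ge0// ltW.
have bkh0 : 0 <= beta * (k%:R * h) by rewrite mulr_ge0.
have zI : 0 <= 1 - beta * (k%:R * h) <= 1.
  by move: bk bh0 bkh0; rewrite kS mulrDr; cl.
have z'I : 0 <= 1 - beta * (k%:R * h) - beta * h by move: bk; rewrite kS mulrDr; cl.
have yr' : `|y' + h *: v - x0| <= r / 2 by rewrite -yE.
have := shift_step cd lb sd tk1 tk2 h0 hrho hv b0 zI z'I wr y'r yr'.
rewrite -yE.
have -> : 1 - beta * (k%:R * h) - beta * h = 1 - beta * (k.+1%:R * h) by rewrite kS; ring.
move: stp sd2; rewrite /dE; cl.
Qed.

(** The order of the quantifiers matters: the time span [tau0] depends on r, M and C, and [K] on
    these, [bb] and [C0]. The remaining error terms of [chain_bound] contain rho, which tends to 0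
    with the mesh, so they leave no trace in [K]. *)
Lemma semiconcave_estimate (R : realType) (n : nat) (r M C : R) : 0 < r -> 0 <= M -> 1 <= C ->
  exists2 tau0 : R, 0 < tau0 & forall bb C0 : R, 0 <= bb -> 0 <= C0 ->
  exists2 K : R, 0 <= K & forall (u V : R * 'rV[R]_n -> R) (A : R * 'rV[R]_n -> 'M[R]_n)
    (ta tb : R) (x0 : 'rV[R]_n) (c m : R),
   coef_data A V ta tb x0 r c m -> lag_bounds A V ta tb x0 r C ->
   sol_data u A V ta tb x0 r M ->
   forall beta t (x w : 'rV[R]_n), 0 <= beta <= bb ->
   ta < t -> t < tb -> t - ta <= tau0 -> beta * (t - ta) <= 1 ->
   `|x - x0| <= r / 4 -> `|w| <= r / 4 ->
   (forall z, `|z - x0| <= r / 2 ->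
    u (ta, z + (1 - beta * (t - ta)) *: w) + u (ta, z - (1 - beta * (t - ta)) *: w) - 2 * u (ta, z)
      <= C0 * `|w| ^+ 2) ->
   u (t, x + w) + u (t, x - w) - 2 * u (t, x) <= K * `|w| ^+ 2.
Proof.
move=> r0 M0 C1.
pose Eb := 4 * C * (2 * M + C + 1).
have Eb0 : 0 < Eb by rewrite /Eb mulr_gt0//; move: C1 M0; cl.
(* With this weight the energy part of the displacement, e / 2 times [Eb], equals r / 8, and t - ta
   <= e r / 4 bounds the other part by r / 8. *)
pose e := r / (4 * Eb).
have e0 : 0 < e by rewrite divr_gt0// mulr_gt0.
have tau00 : 0 < Num.min 1 (e * r / 4) by rewrite lt_min ltr01 !divr_gt0// mulr_gt0.
exists (Num.min 1 (e * r / 4)) => // bb C0 bb0 C00.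
pose K6 := C * (2 * bb ^+ 2 + 2 * bb + 1 + bb ^+ 2 * r).
have K60 : 0 <= K6.
  rewrite mulr_ge0//; first by move: C1; cl.
  have := sqr_ge0 bb; have : 0 <= bb ^+ 2 * r by rewrite mulr_ge0 ?sqr_ge0// ltW.
  by move: bb0; cl.
exists (C0 + K6 * Eb) => [|u V A ta tb x0 c m cd lb sd beta t x w /andP[b0 bbb] tat ttb]; first by rewrite addr_ge0// mulr_ge0// ltW.
rewrite le_min => /andP[t1 te] bt xr wr init.
pose K1 := n%:R * C ^+ 5 + C.
have K10 : 0 < K1 by rewrite /K1 ltr_wpDl ?mulr_ge0 ?exprn_ge0//; move: C1; cl.
pose K7 := 8 * C * (1 + beta * r) ^+ 3 + 8 * K1.
have br0 : 0 <= beta * r by rewrite mulr_ge0// ltW.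
have K70 : 0 < K7.
  rewrite /K7 ltr_wpDl//; last by move: K10; cl.
  by rewrite mulr_ge0 ?exprn_ge0//; [move: C1; cl|move: br0; cl].
apply/ler_addgt0Pr => d d0.
pose G := n%:R * C ^+ 4 * 6 + 1.
have G0 : 0 < G by rewrite /G ltr_wpDl ?mulr_ge0 ?exprn_ge0//; move: C1; cl.
pose rho := Num.min 1 (Num.min (r / 4) (Num.min G^-1 (Num.min (16 * C * K1)^-1 (d / (K7 * Eb))))).
have rho0 : 0 < rho.
  have q1 : 0 < 16 * C * K1 by rewrite mulr_gt0//; move: C1; cl.
  have q2 : 0 < K7 * Eb by rewrite mulr_gt0.
  by rewrite !lt_min ltr01/= divr_gt0//= !invr_gt0 G0 q1/= divr_gt0.
have rho1 : rho <= 1 by rewrite /rho !ge_min lexx.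
have rhor : rho <= r / 4 by rewrite /rho !ge_min lexx !orbT.
have rhoG : rho <= G^-1 by rewrite /rho !ge_min lexx !orbT.
have rhoK : rho <= (16 * C * K1)^-1 by rewrite /rho !ge_min lexx !orbT.
have rhod : rho <= d / (K7 * Eb) by rewrite /rho !ge_min lexx !orbT.
have Grho : n%:R * C ^+ 4 * (3 * rho) <= 2^-1.
  have : G * rho <= 1 by rewrite mulrC -ler_pdivlMr// mul1r.
  by rewrite /G; move: rho0; cl.
have K1r : K1 * (4 * rho) <= (4 * C)^-1.
  have -> : (4 * C)^-1 = K1 * (4 * (16 * C * K1)^-1).
    by move: K10 C1; rewrite -/K1; move: (K1); clear => k k0 C1; field; move: k0 C1; cl.
  by apply: ler_wpM2l; [exact: ltW|move: rhoK; cl].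
have dr : K7 * rho * Eb <= d.
  have : rho * (K7 * Eb) <= d by rewrite -ler_pdivlMr// mulr_gt0.
  by cl.
(* A step is admissible when h is of order rho ^ 2. The summand 1 makes [Q] positive, and the factor
   1 / 2 in [hm] makes the inequality strict. *)
pose Q := 4 * C * (2 * M + 10 * C) + 1.
have Q0 : 0 < Q by rewrite /Q ltr_wpDl// !mulr_ge0//; move: C1 M0; cl.
pose hm := Num.min rho (rho ^+ 2 / Q / 2).
have hm0 : 0 < hm by rewrite lt_min rho0 !divr_gt0 ?exprn_gt0.
have [N hN] : exists N : nat, (t - ta) / hm < N%:R.
  by exists (Num.bound `|(t - ta) / hm|); apply: le_lt_trans (ler_norm _) _; rewrite archi_boundP.
have tta : 0 < t - ta by move: tat; cl.
have N0 : 0 < N%:R :> R by apply: le_lt_trans hN; rewrite divr_ge0 ?ltW.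
pose h := (t - ta) / N%:R.
have h0 : 0 < h by rewrite divr_gt0.
have Nh : N%:R * h = t - ta by rewrite /h mulrC divfK// gt_eqF.
have hhm : h <= hm.
  by rewrite /h ler_pdivrMr// mulrC -ler_pdivrMr// ltW.
have hrho : h <= rho by apply: le_trans hhm _; rewrite /hm ge_min lexx.
have hlat : h * (4 * C * (2 * M + 10 * C)) < rho ^+ 2.
  have : h <= rho ^+ 2 / Q / 2 by apply: le_trans hhm _; rewrite /hm ge_min lexx orbT.
  have -> : rho ^+ 2 / Q / 2 = (rho ^+ 2 / 2) / Q by field; move: Q0; cl.
  rewrite ler_pdivlMr// /Q.
  have : 0 < rho ^+ 2 by rewrite exprn_gt0.
  by move: h0; cl.
have er : e / 2 * Eb + N%:R * h / (2 * e) <= r / 4.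
  have -> : e / 2 * Eb = r / 8 by rewrite /e; field; move: Eb0; cl.
  have : N%:R * h / (2 * e) <= r / 8.
    rewrite Nh ler_pdivrMr; last by move: e0; cl.
    by move: te; cl.
  by cl.
have tN : t - N%:R * h = ta by rewrite Nh; ring.
have bN : beta * (N%:R * h) <= 1 by rewrite Nh.
have Nh1 : N%:R * h <= 1 by rewrite Nh.
have [y [E [/andP[E0 EEb] _ _ yr hfin]]] := chain_bound cd lb sd tN ttb h0 hrho rho1 rhor
  Grho hlat K1r e0 Nh1 er xr wr b0 bN (leqnn N).
apply: (le_trans hfin); rewrite tN Nh -/K1 -/K7.
have hi := init y yr.
have w0 : 0 <= `|w| ^+ 2 by exact: sqr_ge0.
have q1 : C * (2 * beta ^+ 2 + 2 * beta + 1 + beta ^+ 2 * r) <= K6.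
  have bb2 : beta ^+ 2 <= bb ^+ 2 by rewrite ler_sqr ?nnegrE.
  apply: ler_wpM2l; first by move: C1; cl.
  by have := ler_wpM2r (ltW r0) bb2; move: bb2 bbb; cl.
have q2 : (C * (2 * beta ^+ 2 + 2 * beta + 1 + beta ^+ 2 * r) * `|w| ^+ 2 + K7 * rho) * E <=
    (K6 * `|w| ^+ 2 + K7 * rho) * Eb.
  apply: ler_pM => //.
    apply: addr_ge0; last by rewrite mulr_ge0// ltW.
    rewrite mulr_ge0// mulr_ge0//; first by move: C1; cl.
    have : 0 <= beta ^+ 2 * r by rewrite mulr_ge0 ?sqr_ge0// ltW.
    by have := sqr_ge0 beta; move: b0; cl.
  by rewrite lerD2r ler_wpM2r.
by move: hi q2 dr; cl.
Qed.

(** * Local regularity of the solution *)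

Section Smooth.
Context {R : realType} {E : normedModType R}.
Implicit Types (g : E -> R) (z v : E).

Lemma is_derive_quadratic_line g z v (a b : R) :
  (forall h : R, g (h *: v + z) = g z + a * h + b * h ^+ 2) -> is_derive z v g a.
Proof.
move=> H.
have lim : h^-1 *: (g (h *: v + z) - g z) @[h --> 0^'] --> a.
  have h1 : (a + b * h) @[h --> 0^'] --> a.
    rewrite -[X in _ --> X]addr0; apply: cvgD; first exact: cvg_cst.
    rewrite -[X in _ --> X](mulr0 b); apply: cvgM; first exact: cvg_cst.
    exact: nbhs_dnbhs.
  apply: cvg_trans h1; apply: near_eq_cvg; near=> h.
  have h0 : h != 0 by near: h; exact: nbhs_dnbhs_neq.
  by rewrite H /GRing.scale/=; field.
apply: DeriveDef; last by rewrite /derive; apply/cvg_lim.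
by apply/cvg_ex; exists a.
Unshelve. all: by end_near. Qed.

Lemma derivable_line g z v (s : R) : differentiable g (z + s *: v) ->
  is_derive s 1 (fun t : R => g (z + t *: v)) ('D_v g (z + s *: v)).
Proof.
move=> dg; have dv := @diff_derivable _ _ _ _ _ v dg.
have E1 : (fun h : R => h^-1 *: ((fun t : R => g (z + t *: v)) (h *: 1 + s) - g (z + s *: v))) =
    (fun h : R => h^-1 *: (g (h *: v + (z + s *: v)) - g (z + s *: v))).
  apply/funext => h /=; congr (_ *: (g _ - _)).
  by rewrite scalerDl [in LHS]/GRing.scale/= mulr1 [LHS]addrC -addrA; congr (_ + _); rewrite addrC.
apply: DeriveDef; first by rewrite /derivable E1.
by rewrite /derive E1.
Qed.

Lemma mvt_line g z v : (forall s : R, 0 <= s <= 1 -> differentiable g (z + s *: v)) ->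
  exists2 s : R, 0 <= s <= 1 & g (z + v) - g z = 'D_v g (z + s *: v).
Proof.
move=> dg.
have D (s : R) : s \in `]0, 1[ -> is_derive s 1 (fun t : R => g (z + t *: v)) ('D_v g (z + s *: v)).
  by rewrite in_itv/= => /andP[s0 s1]; apply: derivable_line; apply: dg; rewrite !ltW.
have C : {within `[0, 1], continuous (fun t : R => g (z + t *: v))}.
  apply: derivable_within_continuous => s; rewrite in_itv/= => sI.
  by have [] := derivable_line (dg s sI).
have [s] := MVT_segment ler01 D C; rewrite in_itv/= => sI.
rewrite scale1r scale0r addr0 subr0 mulr1 => H; by exists s.
Qed.

Lemma ball_segment z0 (r : R) z v (s : R) : 0 <= s <= 1 -> `|z - z0| < r -> `|z + v - z0| < r ->
  `|z + s *: v - z0| < r.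
Proof.
move=> /andP[s0 s1] h0 h1.
have -> : z + s *: v - z0 = (1 - s) *: (z - z0) + s *: (z + v - z0).
  rewrite [z + v - z0]addrAC [LHS]addrAC; move: (z - z0) => a.
  by rewrite scalerBl scale1r scalerDr addrA subrK.
apply: le_lt_trans (ler_normD _ _) _; rewrite !normrZ (ger0_norm s0) ger0_norm ?subr_ge0//.
have [s10|s10] := eqVneq s 1; first by rewrite s10 subrr mul0r add0r mul1r.
have : (1 - s) * `|z - z0| < (1 - s) * r by rewrite ltr_pM2l// subr_gt0 lt_neqAle s10.
have : s * `|z + v - z0| <= s * r by apply: ler_wpM2l => //; exact: ltW.
by cl.
Qed.

Variables (k : nat) (e : 'I_k -> E) (c : 'I_k -> E -> R).
Hypothesis c_dec : forall v, v = \sum_i c i v *: e i.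
Hypothesis c_le : forall i v, `|c i v| <= `|v|.

(** The family [e] with the coordinate functions [c] stands for a basis whose coordinates are
    bounded by the norm; with it the local estimates serve both functions of x and functions of (t,
    x). *)
Lemma derive_coord g z v : differentiable g z -> 'D_v g z = \sum_i c i v * 'D_(e i) g z.
Proof.
move=> dg; rewrite !deriveE// {1}(c_dec v) linear_sum.
by apply: eq_bigr => i _; rewrite deriveE// linearZ.
Qed.

Lemma loc_bnd_fam (f : 'I_k -> E -> R) z0 : (forall i, {for z0, continuous (f i)}) ->
  exists r M : R, [/\ 0 < r, 0 <= M & forall i z, `|z - z0| < r -> `|f i z| <= M].
Proof.
move=> cf.
have [r r0 H] : exists2 r : R, 0 < r & forall i z, `|z - z0| < r -> `|f i z - f i z0| < 1.
  have : \forall z \near z0, forall i, `|f i z - f i z0| < 1.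
    apply: filter_forall => i.
    have /cvgrPdist_lt /(_ 1 ltr01) := cf i.
    by apply: filterS => z; rewrite distrC.
  move=> /nbhs_ballP[r /= r0 H]; exists r => // i z zr; apply: H.
  by rewrite -ball_normE/= distrC.
exists r, (1 + \sum_i `|f i z0|); split => //; first by rewrite addr_ge0// sumr_ge0.
move=> i z /(H i) h.
have : `|f i z0| <= \sum_i `|f i z0| by rewrite (bigD1 i)//= lerDl sumr_ge0.
have := ler_normD (f i z - f i z0) (f i z0); rewrite subrK; move: h; cl.
Qed.

Lemma C1_local U g z0 : open U -> C1_on U g -> U z0 -> exists r M : R,
  [/\ 0 < r, 0 <= M, (forall z, `|z - z0| < r -> U z),
   (forall z, `|z - z0| < r -> `|g z| <= M) &
   forall z z', `|z - z0| < r -> `|z' - z0| < r -> `|g z - g z'| <= M * `|z - z'| ].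
Proof.
move=> oU [dg cg] Uz.
have [r1 r10 H1] : exists2 r : R, 0 < r & forall z, `|z - z0| < r -> U z.
  have /nbhs_ballP[r /= r0 H] := open_nbhs_nbhs (conj oU Uz).
  by exists r => // z zr; apply: H; rewrite -ball_normE/= distrC.
have [r2 [M2 [r20 M20 H2]]] := @loc_bnd_fam (fun i => 'D_(e i) g) z0 (fun i => cg (e i) z0 Uz).
have [r3 r30 H3] : exists2 r : R, 0 < r & forall z, `|z - z0| < r -> `|g z - g z0| < 1.
  have /differentiable_continuous/cvgrPdist_lt /(_ 1 ltr01) := dg z0 Uz.
  move=> /nbhs_ballP[r /= r0 H]; exists r => // z zr; rewrite distrC; apply: H.
  by rewrite -ball_normE/= distrC.
have kM : 0 <= k%:R * M2 by rewrite mulr_ge0.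
exists (Num.min r1 (Num.min r2 r3)), (`|g z0| + 1 + k%:R * M2); split.
- by rewrite !lt_min r10 r20.
- by have := normr_ge0 (g z0); move: kM; cl.
- by move=> z; rewrite !lt_min => /andP[/H1].
- move=> z; rewrite !lt_min => /and3P[_ _ /H3 h].
  have := ler_normD (g z - g z0) (g z0); rewrite subrK; move: h kM; cl.
move=> z z' zr z'r; have zz : z' + (z - z') = z by rewrite addrC subrK.
have [s sI] : exists2 s : R, 0 <= s <= 1 & g (z' + (z - z')) - g z' = 'D_(z - z') g (z' + s *: (z - z')).
  apply: mvt_line => s sI; apply: dg; apply: H1.
  apply: (@lt_le_trans _ _ (Num.min r1 (Num.min r2 r3))); last by rewrite ge_min lexx.
  by apply: ball_segment => //; rewrite zz.
rewrite zz => ->.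
have sr : `|z' + s *: (z - z') - z0| < Num.min r1 (Num.min r2 r3).
  by apply: ball_segment => //; rewrite zz.
move: (sr); rewrite !lt_min => /and3P[/H1 Us s2 _].
rewrite derive_coord; last exact: dg.
apply: le_trans (ler_norm_sum _ _ _) _.
have : \sum_i `|c i (z - z') * 'D_(e i) g (z' + s *: (z - z'))| <= \sum_(i < k) (`|z - z'| * M2).
  by apply: ler_sum => i _; rewrite normrM ler_pM// H2.
rewrite sumr_const card_ord => h; apply: (le_trans h).
rewrite -mulr_natr.
have := normr_ge0 (g z0); have := normr_ge0 (z - z').
have : 0 <= `|g z0| * `|z - z'| by rewrite mulr_ge0.
by move: kM; cl.
Qed.

(** Mean value theorem for t |-> g (z + t v) + g (z - t v): its derivative is the difference of D_v
    g at two points 2 t v apart, and each partial derivative, being C^1, is Lipschitz near z0. *)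
Lemma C2_local U g z0 : open U -> C2_on U g -> U z0 -> exists r M : R,
  [/\ 0 < r, 0 <= M, (forall z, `|z - z0| < r -> U z /\ `|g z| <= M),
   (forall z z', `|z - z0| < r -> `|z' - z0| < r -> `|g z - g z'| <= M * `|z - z'|) &
   forall z v, `|z - z0| < r -> `|z + v - z0| < r -> `|z - v - z0| < r ->
     `|g (z + v) + g (z - v) - (g z + g z)| <= M * `|v| ^+ 2 ].
Proof.
move=> oU [C1g C2g] Uz.
have [r1 [M1 [r10 M10 H1U H1b H1l]]] := C1_local oU C1g Uz.
have [r2 [M2 [r20 M20 H2]]] : exists r M : R, [/\ 0 < r, 0 <= M & forall i z z',
    `|z - z0| < r -> `|z' - z0| < r -> `|'D_(e i) g z - 'D_(e i) g z'| <= M * `|z - z'|].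
  have H i : exists p : R * R, [/\ 0 < p.1, 0 <= p.2 & forall z z',
    `|z - z0| < p.1 -> `|z' - z0| < p.1 -> `|'D_(e i) g z - 'D_(e i) g z'| <= p.2 * `|z - z'|].
    by have [r [M [r0 M0 _ _ hl]]] := C1_local oU (C2g (e i)) Uz; exists (r, M).
  have [p hp] := choice H.
  exists (\big[Num.min/1]_i (p i).1), (\sum_i (p i).2); split.
  - by apply: (big_ind (fun x => 0 < x)) => // [x y x0 y0|i _]; [rewrite lt_min x0|have [] := hp i].
  - by apply: sumr_ge0 => i _; have [] := hp i.
  move=> i z z' zr z'r; have [_ _ hi] := hp i.
  have mi : \big[Num.min/1]_i (p i).1 <= (p i).1 by apply: bigmin_le_cond.
  apply: le_trans (hi z z' (lt_le_trans zr mi) (lt_le_trans z'r mi)) _.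
  apply: ler_wpM2r => //; rewrite (bigD1 i)//= lerDl sumr_ge0// => j _.
  by have [] := hp j.
exists (Num.min r1 r2), (M1 + k%:R * M2 * 2); split.
- by rewrite lt_min r10.
- by rewrite addr_ge0// !mulr_ge0.
- move=> z; rewrite lt_min => /andP[h1 _]; split; first exact: H1U.
  by apply: le_trans (H1b _ h1) _; rewrite lerDl !mulr_ge0.
- move=> z z'; rewrite !lt_min => /andP[h1 _] /andP[h1' _].
  apply: le_trans (H1l _ _ h1 h1') _; apply: ler_wpM2r => //.
  by rewrite lerDl !mulr_ge0.
move=> z v zr zpr zmr.
have zmr' : `|z + - v - z0| < Num.min r1 r2 by [].
have sp (s : R) : 0 <= s <= 1 -> `|z + s *: v - z0| < Num.min r1 r2.
  by move=> sI; apply: ball_segment.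
have sm (s : R) : 0 <= s <= 1 -> `|z - s *: v - z0| < Num.min r1 r2.
  by move=> sI; rewrite -scalerN; apply: ball_segment.
have dU y : `|y - z0| < Num.min r1 r2 -> differentiable g y.
  by rewrite lt_min => /andP[/H1U h _]; apply: (proj1 C1g).
have dm (s : R) : 0 <= s <= 1 -> is_derive s 1 (fun t : R => g (z - t *: v)) (- 'D_v g (z - s *: v)).
  move=> sI.
  have -> : (fun t : R => g (z - t *: v)) = (fun t : R => g (z + t *: (- v))).
    by apply/funext => t; rewrite scalerN.
  have -> : - 'D_v g (z - s *: v) = 'D_(- v) g (z + s *: - v).
    rewrite scalerN !deriveE; [|exact: dU (sm _ sI)..].
    by rewrite linearN.
  by apply: derivable_line; rewrite scalerN; exact: dU (sm _ sI).
pose F (t : R) := g (z + t *: v) + g (z - t *: v).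
have dF (s : R) : 0 <= s <= 1 -> is_derive s 1 F ('D_v g (z + s *: v) - 'D_v g (z - s *: v)).
  move=> sI; have h1 := derivable_line (dU _ (sp _ sI)); have h2 := dm s sI.
  exact: is_deriveD.
have [s] := @MVT_segment R F _ _ _ ler01
    (fun s (h : s \in `]0, 1[) => dF s ltac:(by move: h; rewrite in_itv/= => /andP[? ?]; rewrite !ltW))
    ltac:(by apply: derivable_within_continuous => s; rewrite in_itv/= => /dF[]).
rewrite in_itv/= => sI.
rewrite /F !scale1r !scale0r addr0 subr0 subr0 mulr1 => ->.
rewrite !derive_coord; [|exact: dU (sm _ sI)|exact: dU (sp _ sI)].
rewrite -sumrB; apply: le_trans (ler_norm_sum _ _ _) _.
have : \sum_i `|c i v * 'D_(e i) g (z + s *: v) - c i v * 'D_(e i) g (z - s *: v)|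
   <= \sum_(i < k) (`|v| * (M2 * (2 * `|v|))).
  apply: ler_sum => i _; rewrite -mulrBr normrM ler_pM//.
  have h1 := sp s sI; have h2 := sm s sI.
  move: h1 h2; rewrite !lt_min => /andP[_ h1] /andP[_ h2].
  apply: le_trans (H2 i _ _ h1 h2) _; apply: ler_wpM2l => //.
  have -> : z + s *: v - (z - s *: v) = (2 * s) *: v.
    by rewrite opprB addrC addrA subrK -scalerDl; congr (_ *: _); ring.
  move: sI => /andP[s0 s1]; rewrite normrZ (ger0_norm (mulr_ge0 (ler0n _ 2) s0)).
  by apply: ler_wpM2r => //; rewrite -[leRHS]mulr1; apply: ler_wpM2l.
rewrite sumr_const card_ord -mulr_natr => h; apply: (le_trans h).
have : 0 <= M1 * `|v| ^+ 2 by rewrite mulr_ge0 ?sqr_ge0.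
by cl.
Qed.

End Smooth.

Lemma fin_unif (R : realType) (I : finType) (P : I -> R -> R -> Prop) :
  (forall i (r r' M M' : R), 0 < r' -> r' <= r -> M <= M' -> P i r M -> P i r' M') ->
  (forall i, exists r M : R, [/\ 0 < r, 0 <= M & P i r M]) ->
  exists r M : R, [/\ 0 < r, 0 <= M & forall i, P i r M].
Proof.
move=> mono H.
have /choice[p hp] : forall i, exists p : R * R, [/\ 0 < p.1, 0 <= p.2 & P i p.1 p.2].
  by move=> i; have [r [M h]] := H i; exists (r, M).
have r0 : 0 < \big[Num.min/1]_i (p i).1.
  by apply: (big_ind (fun x => 0 < x)) => // [x y x0 y0|i _]; [rewrite lt_min x0|have [] := hp i].
exists (\big[Num.min/1]_i (p i).1), (\sum_i (p i).2); split => //.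
  by apply: sumr_ge0 => i _; have [] := hp i.
move=> i; have [_ _ hi] := hp i.
apply: mono hi => //; first by apply: bigmin_le_cond.
by rewrite (bigD1 i)//= lerDl sumr_ge0// => j _; have [] := hp j.
Qed.

(** * Coordinates on the product of time and space, and quadratic test functions *)

Section ProductBasis.
Context {R : realType} {n : nat}.
Notation E := (R * 'rV[R]_n)%type.

Definition pbasis (i : 'I_n.+1) : E :=
  if unlift ord0 i is Some j then (0, delta_mx 0 j) else (1, 0).

Definition pcoord (i : 'I_n.+1) (v : E) : R :=
  if unlift ord0 i is Some j then v.2 0 j else v.1.

Lemma fst_sum (I : finType) (f : I -> E) : (\sum_i f i).1 = \sum_i (f i).1.
Proof. by elim/big_rec2: _ => //= i a b _ <-. Qed.

Lemma snd_sum (I : finType) (f : I -> E) : (\sum_i f i).2 = \sum_i (f i).2.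
Proof. by elim/big_rec2: _ => //= i a b _ <-. Qed.

Lemma pcoord_dec (v : E) : v = \sum_i pcoord i v *: pbasis i.
Proof.
rewrite big_ord_recl /pcoord /pbasis unlift_none.
under eq_bigr => i _ do rewrite liftK.
have pe (a b : E) : a.1 = b.1 -> a.2 = b.2 -> a = b by case: a b => [? ?] [? ?] /= -> ->.
apply: pe.
  by rewrite /= fst_sum/= big1 ?addr0 => [|i _]; rewrite /GRing.scale/= ?mulr1 ?mulr0.
rewrite /= snd_sum/= scaler0 add0r [LHS]row_sum_delta.
by [].
Qed.

Lemma norm_fst (v : E) : `|v.1| <= `|v|.
Proof. by rewrite [leRHS]prod_normE le_max lexx. Qed.

Lemma norm_snd (v : E) : `|v.2| <= `|v|.
Proof. by rewrite [leRHS]prod_normE le_max lexx orbT. Qed.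

Lemma prod_norm_le (v : E) : `|v| <= `|v.1| + `|v.2|.
Proof. by rewrite [leLHS]prod_normE ge_max lerDl lerDr !normr_ge0. Qed.

Lemma prod_norm_lt (v : E) (r : R) : `|v.1| < r -> `|v.2| < r -> `|v| < r.
Proof. by move=> h1 h2; rewrite [ltLHS]prod_normE gt_max h1. Qed.

Lemma pcoord_le i (v : E) : `|pcoord i v| <= `|v|.
Proof.
rewrite /pcoord; case: (unlift _ _) => [j|]; last exact: norm_fst.
by apply: le_trans (norm_snd v); exact: coord_le_norm.
Qed.

Definition C2_bounds (D : set E) (g : E -> R) z0 r M :=
  [/\ forall z, D z -> `|z - z0| < r -> `|g z| <= M,
    forall z z', D z -> D z' -> `|z - z0| < r -> `|z' - z0| < r -> `|g z - g z'| <= M * `|z - z'| &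
    forall z v, D z -> D (z + v) -> D (z - v) -> `|z - z0| < r -> `|z + v - z0| < r ->
     `|z - v - z0| < r -> `|g (z + v) + g (z - v) - (g z + g z)| <= M * `|v| ^+ 2].

Lemma C2_bounds_mono D g z0 (r r' M M' : R) : 0 < r' -> r' <= r -> M <= M' ->
  C2_bounds D g z0 r M -> C2_bounds D g z0 r' M'.
Proof.
move=> r'0 rr MM [h1 h2 h3].
have w a : a < r' -> a < r by move=> h; exact: lt_le_trans h rr.
split.
- by move=> z Dz /w zr; apply: le_trans MM; exact: h1.
- move=> z z' Dz Dz' /w zr /w z'r; apply: le_trans (h2 _ _ _ _ _ _) _ => //.
  by apply: ler_wpM2r.
move=> z v Dz Dp Dm /w zr /w zp /w zm; apply: le_trans (h3 _ _ _ _ _ _ _ _) _ => //.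
by apply: ler_wpM2r => //; exact: sqr_ge0.
Qed.

Lemma C2_near_bounds (D : set E) g z0 : C2_near D g -> D z0 ->
  exists r M : R, [/\ 0 < r, 0 <= M & C2_bounds D g z0 r M].
Proof.
move=> [U [g' [oU DU C2 gg]]] Dz.
have [r [M [r0 M0 h1 h2 h3]]] := C2_local pcoord_dec pcoord_le oU C2 (DU _ Dz).
have e z : D z -> g z = g' z by move=> Dz'; apply: gg; rewrite inE.
exists r, M; split => //; split.
- by move=> z Dz' zr; rewrite e//; have [] := h1 z zr.
- by move=> z z' Dz1 Dz2 zr zr'; rewrite !e//; exact: h2.
- by move=> z v D1 D2 D3 z1 z2 z3; rewrite !e//; exact: h3.
Qed.

(** The jet (tau, p) at (s, y) with curvature k, as a C^1 test function: it links the viscosity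
    inequalities to the proximal ones of [sol_data]. *)
Definition qtest (s : R) (y : 'rV[R]_n) (tau : R) (p : 'rV[R]_n) (k : R) (z : E) : R :=
  tau * (z.1 - s) + dotp p (z.2 - y) + k * ((z.1 - s) ^+ 2 + dotp (z.2 - y) (z.2 - y)).

Lemma qtest_derive s y tau p k z v : is_derive z v (qtest s y tau p k)
  (tau * v.1 + dotp p v.2 + 2 * k * ((z.1 - s) * v.1 + dotp (z.2 - y) v.2)).
Proof.
apply: (@is_derive_quadratic_line _ _ _ _ _ _ (k * (v.1 ^+ 2 + dotp v.2 v.2))) => h.
rewrite /qtest/=.
have -> : h *: v.2 + z.2 - y = h *: v.2 + (z.2 - y) by rewrite addrA.
move: (z.2 - y) => q.
rewrite !dotpDl !dotpDr !dotpZl !dotpZr (dotpC v.2 q) /GRing.scale/=.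
by ring.
Qed.

Lemma differentiable_fst (z : E) : differentiable (fun z : E => z.1) z.
Proof. by apply: (@linear_differentiable _ _ _ (fst : {linear E -> R})); move=> w; exact: cvg_fst. Qed.

Lemma differentiable_snd_coord (z : E) i : differentiable (fun z : E => z.2 0 i) z.
Proof.
apply: (@differentiable_comp _ _ _ _ snd (fun y : 'rV[R]_n => y 0 i)); last exact: differentiable_coord.
by apply: (@linear_differentiable _ _ _ (snd : {linear E -> _})) => w; exact: cvg_snd.
Qed.

Lemma qtest_C1 (Q : set E) s y tau p k : C1_on Q (qtest s y tau p k).
Proof.
split => [z _|v z _].
  have d1 : differentiable (fun z : E => z.1 - s) z.
    by apply: differentiableB; [exact: differentiable_fst|exact: differentiable_cst].
  have d2 i : differentiable (fun z : E => (z.2 - y) 0 i) z.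
    have -> : (fun z : E => (z.2 - y) 0 i) = (fun z : E => z.2 0 i - y 0 i).
      by apply/funext => w; rewrite !mxE.
    by apply: differentiableB; [exact: differentiable_snd_coord|exact: differentiable_cst].
  have d3 : differentiable (fun z : E => dotp p (z.2 - y)) z.
    rewrite /dotp; have -> : (fun z : E => \sum_(i < n) p 0 i * (z.2 - y) 0 i) =
      \sum_(i < n) (fun z : E => p 0 i * (z.2 - y) 0 i) by apply/funext => w; rewrite fct_sumE.
    by apply: differentiable_sum => i; apply: differentiableM => //; exact: differentiable_cst.
  have d4 : differentiable (fun z : E => dotp (z.2 - y) (z.2 - y)) z.
    rewrite /dotp; have -> : (fun z : E => \sum_(i < n) (z.2 - y) 0 i * (z.2 - y) 0 i) =
      \sum_(i < n) (fun z : E => (z.2 - y) 0 i * (z.2 - y) 0 i) by apply/funext => w; rewrite fct_sumE.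
    by apply: differentiable_sum => i; exact: differentiableM.
  apply: differentiableD; first apply: differentiableD => //.
    by apply: differentiableM => //; exact: differentiable_cst.
  apply: differentiableM; first exact: differentiable_cst.
  apply: differentiableD => //; exact: (differentiableM d1 d1).
have -> : 'D_v (qtest s y tau p k) = fun z : E =>
    tau * v.1 + dotp p v.2 + 2 * k * ((z.1 - s) * v.1 + dotp (z.2 - y) v.2).
  by apply/funext => w; have d := qtest_derive s y tau p k w v; exact: derive_val.
apply: cvgD; first exact: cvg_cst.
apply: cvgM; first exact: cvg_cst.
apply: cvgD.
  apply: cvgM; last exact: cvg_cst.
  by apply: cvgB; [exact: cvg_fst|exact: cvg_cst].
apply: (dotp_continuous (z := z)); last exact: cvg_cst.
by apply: cvgB; [exact: cvg_snd|exact: cvg_cst].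
Qed.

Lemma qtest_HJ (A : E -> 'M[R]_n) (V : E -> R) s y tau p k :
  HJ_operator (quadratic_ham A V) (qtest s y tau p k) (s, y) = tau + ham A V s y p.
Proof.
rewrite /HJ_operator /quadratic_ham /ham /bil /=; congr (_ + _).
  rewrite derive1E.
  have d : is_derive s 1 (fun s0 => qtest s y tau p k (s0, y)) tau.
    apply: (@is_derive_quadratic_line _ _ _ _ _ _ k) => h.
    rewrite /qtest/= subrr dotp0r dotp0l subrr /GRing.scale/=; ring.
  exact: derive_val.
suff -> : grad (fun y0 => qtest s y tau p k (s, y0)) y = p by [].
apply/rowP => i; rewrite mxE.
have d : is_derive y (delta_mx 0 i) (fun y0 => qtest s y tau p k (s, y0)) (dotp p (delta_mx 0 i)).
  apply: (@is_derive_quadratic_line _ _ _ _ _ _ (k * dotp (delta_mx 0 i) (delta_mx 0 i))) => h.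
  rewrite /qtest/= addrK !subrr dotpZl !dotpZr !dotp0r; ring.
rewrite derive_val /dotp (bigD1 i)//= big1 ?addr0 => [|j ji]; rewrite !mxE/=.
  by rewrite eqxx mulr1.
by rewrite (negbTE ji) mulr0.
Qed.

End ProductBasis.

Lemma coef_local (R : realType) (n : nat) (Om : set 'rV[R]_n) (T c1 c2 : R)
    (A : R * 'rV[R]_n -> 'M[R]_n) (V : R * 'rV[R]_n -> R) (z0 : R * 'rV[R]_n) :
  C2_near (closed_cylinder T Om) V ->
  (forall i j, C2_near (closed_cylinder T Om) (fun z => A z i j)) ->
  (forall z, closed_cylinder T Om z -> (A z)^T = A z) -> 0 < c1 ->
  (forall z, closed_cylinder T Om z -> forall p, p != 0 ->
       c1 * dotp p p < dotp (mxact (A z) p) p < c2 * dotp p p) ->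
  closed_cylinder T Om z0 ->
  exists rho m : R, [/\ 0 < rho, 0 <= m & forall ta tb r : R,
    (forall z, box ta tb z0.2 r z -> closed_cylinder T Om z) ->
    z0.1 - rho < ta -> tb < z0.1 + rho -> r < rho -> coef_data A V ta tb z0.2 r c1 m].
Proof.
move=> VC AC As c10 Ab Dz0.
have [rv [mv [rv0 mv0 hV]]] := C2_near_bounds VC Dz0.
have [ra [ma [ra0 ma0 hA]]] := @fin_unif R ('I_n * 'I_n)%type
  (fun ij r M => C2_bounds (closed_cylinder T Om) (fun z => A z ij.1 ij.2) z0 r M)
  (fun ij => @C2_bounds_mono R n _ _ _) (fun ij => C2_near_bounds (AC ij.1 ij.2) Dz0).
pose rho := Num.min ra rv; pose m := ma + mv.
have rho0 : 0 < rho by rewrite lt_min ra0.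
have m0 : 0 <= m by rewrite addr_ge0.
have {}hV : C2_bounds (closed_cylinder T Om) V z0 rho m.
  by apply: C2_bounds_mono hV => //; [rewrite ge_min lexx orbT|rewrite lerDr].
have {}hA i j : C2_bounds (closed_cylinder T Om) (fun z => A z i j) z0 rho m.
  by apply: C2_bounds_mono (hA (i, j)) => //; [rewrite ge_min lexx|rewrite lerDl].
exists rho, m; split => // ta tb r bD ra' rb' rr.
have bn z : box ta tb z0.2 r z -> `|z - z0| < rho.
  move=> [/andP[h1 h2] h3]; apply: prod_norm_lt; last exact: le_lt_trans h3 rr.
  by rewrite ltr_norml /=; move: h1 h2 ra' rb'; cl.
have pd (z z' : R * 'rV[R]_n) : m * `|z - z'| <= m * (`|z.1 - z'.1| + `|z.2 - z'.2|).
  by apply: ler_wpM2l => //; exact: prod_norm_le.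
have pw (w : 'rV[R]_n) : `|((0, w) : R * 'rV[R]_n)| <= `|w|.
  by apply: le_trans (prod_norm_le _) _; rewrite /= normr0 add0r.
have pD (s : R) (y w : 'rV[R]_n) : ((s, y) : R * 'rV[R]_n) + (0, w) = (s, y + w).
  by apply/pair_equal_spec; rewrite /= addr0.
have pB (s : R) (y w : 'rV[R]_n) : ((s, y) : R * 'rV[R]_n) - (0, w) = (s, y - w).
  by apply/pair_equal_spec; rewrite /= subr0.
have pw2 (w : 'rV[R]_n) : m * `|((0, w) : R * 'rV[R]_n)| ^+ 2 <= m * `|w| ^+ 2.
  by apply: ler_wpM2l => //; rewrite ler_sqr ?nnegrE.
split => //.
- by move=> z /bD; exact: As.
- move=> z /bD /Ab h p; have [->|/h /andP[/ltW]//] := eqVneq p 0.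
  by rewrite /bil dotp0l dotp0r mulr0.
- move=> z bz; apply: norm_le_coord => // i j; have [h _ _] := hA i j.
  by apply: h; [exact: bD|exact: bn].
- by move=> z bz; have [h _ _] := hV; apply: h; [exact: bD|exact: bn].
- move=> z z' bz bz'; apply: norm_le_coord => [|i j]; first by rewrite mulr_ge0// addr_ge0.
  have [_ h _] := hA i j; rewrite !mxE; apply: le_trans (pd z z').
  by apply: h; [exact: bD|exact: bD|exact: bn|exact: bn].
- move=> z z' bz bz'; have [_ h _] := hV; apply: le_trans (pd z z').
  by apply: h; [exact: bD|exact: bD|exact: bn|exact: bn].
- move=> s y w b1 b2 b3; apply: norm_le_coord => [|i j]; first by rewrite mulr_ge0// sqr_ge0.
  have [_ _ h] := hA i j; rewrite !mxE; apply: le_trans (pw2 w).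
  by have := h (s, y) (0, w); rewrite pD pB; apply; [exact: bD|exact: bD|exact: bD|exact: bn|exact: bn|exact: bn].
- move=> s y w b1 b2 b3; have [_ _ h] := hV; apply: le_trans (pw2 w).
  by have := h (s, y) (0, w); rewrite pD pB; apply; [exact: bD|exact: bD|exact: bD|exact: bn|exact: bn|exact: bn].
Qed.

Lemma sol_local (R : realType) (n : nat) (Om : set 'rV[R]_n) (T : R)
    (A : R * 'rV[R]_n -> 'M[R]_n) (V : R * 'rV[R]_n -> R) (u : R * 'rV[R]_n -> R)
    (ta tb r : R) (x0 : 'rV[R]_n) :
  {within ropen_cylinder T Om, continuous u} ->
  viscosity_solution (quadratic_ham A V) (open_cylinder T Om) u ->
  ta < tb -> 0 < r -> (forall z, box ta tb x0 r z -> ropen_cylinder T Om z) ->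
  exists M, sol_data u A V ta tb x0 r M.
Proof.
move=> /within_cont_on uc [vsub vsup] tab r0 bD.
have cu := cont_onW bD uc.
have b0 : box ta tb x0 r !=set0.
  by exists (ta, x0); split => /=; [rewrite lexx ltW|rewrite subrr normr0 ltW].
have [z1 _ h1] := cont_on_min (@compact_box _ _ ta tb x0 r) b0 cu.
have [z2 _ h2] := cont_on_min (@compact_box _ _ ta tb x0 r) b0 (cont_onN cu).
have inn s y : ta < s < tb -> `|y - x0| < r -> open_cylinder T Om (s, y).
  move=> /andP[s1 s2] yr.
  have bs : box ta tb x0 r (s, y) by split => /=; [rewrite !ltW|exact: ltW].
  have bt : box ta tb x0 r (ta, y) by split => /=; [rewrite lexx ltW|exact: ltW].
  have [/andP[_ h3] h4] := bD _ bs; have [/andP[h5 _] _] := bD _ bt.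
  by split => //=; rewrite h3 andbT; exact: le_lt_trans h5 s1.
have nb s y d (P : R * 'rV[R]_n -> Prop) : 0 < d ->
  (forall s' y', `|s' - s| < d -> `|y' - y| < d -> P (s', y')) -> \forall w \near (s, y), P w.
  move=> d0 H; apply/nbhs_normP; exists d => //= -[s' y'] /= h.
  have h' : `|(s, y) - (s', y')| < d by [].
  apply: H; rewrite distrC.
    by apply: le_lt_trans h'; exact: (norm_fst ((s, y) - (s', y'))).
  by apply: le_lt_trans h'; exact: (norm_snd ((s, y) - (s', y'))).
have q0 (s : R) (y : 'rV[R]_n) (tau : R) p (k : R) : qtest s y tau p k (s, y) = 0.
  by rewrite /qtest/= !subrr !dotp0r; ring.
exists (`|u z1| + `|u z2|); split => //.
- move=> z bz; rewrite ler_norml; have := h1 z bz; have := h2 z bz.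
  have := ler_norm (u z2); have := ler_norm (- u z1); rewrite normrN.
  have := normr_ge0 (u z2); have := normr_ge0 (u z1); cl.
- move=> s y tau p k d sI yr d0 H.
  rewrite -(qtest_HJ A V s y tau p k); apply: vsub; [exact: qtest_C1|exact: inn|].
  apply: (nb _ _ d) => // s' y' hs hy; rewrite q0 subr0.
  by have := H s' y' hs hy; rewrite /qtest/=; cl.
move=> s y tau p k d sI yr d0 H.
rewrite -(qtest_HJ A V s y tau p (- k)); apply: vsup; [exact: qtest_C1|exact: inn|].
apply: (nb _ _ d) => // s' y' hs hy; rewrite q0 subr0.
by have := H s' y' hs hy; rewrite /qtest/=; cl.
Qed.

(** Midpoint concavity removes v1 from the second difference; the C^2 part v2 contributes the
    quadratic bound. *)
Lemma semiconcave_second (R : realType) (n : nat) (Om : set 'rV[R]_n) (v : 'rV[R]_n -> R) x0 :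
  locally_semiconcave Om v -> Om x0 -> exists r C : R, [/\ 0 < r, 0 <= C &
    forall z w : 'rV[R]_n, `|z - x0| <= r -> `|w| <= r ->
      v (z + w) + v (z - w) - 2 * v z <= C * `|w| ^+ 2].
Proof.
move=> sc Ox; have [r [v1 [v2 [r0 _ cv1 C2v2 vE]]]] := sc x0 Ox.
pose e i : 'rV[R]_n := delta_mx 0 i; pose cf i (y : 'rV[R]_n) := y 0 i.
have ec y : y = \sum_i cf i y *: e i by rewrite {1}[y]row_sum_delta.
have cl1 i y : `|cf i y| <= `|y| by exact: coord_le_norm.
have [r2 [M [r20 M0 _ _ h2]]] := C2_local ec cl1 (ball_open x0 r) C2v2 (ballxx _ r0).
pose rr := Num.min r r2.
have rr0 : 0 < rr by rewrite lt_min r0.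
exists (rr / 3), M; split => //; first by rewrite divr_gt0.
move=> z w zr wr.
have n1 y : `|y| <= rr / 3 -> `|z + y - x0| < rr.
  move=> yr; rewrite addrAC; apply: le_lt_trans (ler_normD _ _) _.
  by move: zr yr rr0; cl.
have wm : `|- w| <= rr / 3 by rewrite normrN.
have n0 : `|z - x0| < rr by move: zr rr0; cl.
have bb y : `|y - x0| < rr -> ball x0 r y.
  by rewrite lt_min -ball_normE/= => /andP[h _]; rewrite distrC.
have b2 y : `|y - x0| < rr -> `|y - x0| < r2 by rewrite lt_min => /andP[].
have := h2 z w (b2 _ n0) (b2 _ (n1 _ wr)) (b2 _ (n1 _ wm)).
rewrite ler_norml => /andP[_ hv2].
have h01 : (0 : R) <= 2^-1 by rewrite invr_ge0.
have h11 : (2^-1 : R) <= 1 by rewrite invf_le1// ler1n.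
have /(_ (z + w) (z - w)) := cv1 (Itv01 h01 h11).
rewrite !inE => /(_ (bb _ (n1 _ wr)) (bb _ (n1 _ wm))).
rewrite convRE/=.
have -> : conv (Itv01 h01 h11) (z + w : convex_lmodType 'rV[R]_n) (z - w) = z.
  by apply/rowP => i; rewrite /conv/= !mxE /unstable.onem; field.
rewrite (vE _ (bb _ (n1 _ wr))) (vE _ (bb _ (n1 _ wm))) (vE _ (bb _ n0)).
by rewrite /unstable.onem; move: hv2; cl.
Qed.

Lemma cball_segment (R : realType) (E : normedModType R) (z0 : E) (r : R) (z v : E) (s : R) :
  0 <= s <= 1 -> `|z - z0| <= r -> `|z + v - z0| <= r -> `|z + s *: v - z0| <= r.
Proof.
move=> /andP[s0 s1] h0 h1.
have -> : z + s *: v - z0 = (1 - s) *: (z - z0) + s *: (z + v - z0).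
  rewrite [z + v - z0]addrAC [LHS]addrAC; move: (z - z0) => a.
  by rewrite scalerBl scale1r scalerDr addrA subrK.
apply: le_trans (ler_normD _ _) _; rewrite !normrZ (ger0_norm s0) ger0_norm ?subr_ge0//.
have := ler_wpM2l s0 h1; have s1' : 0 <= 1 - s by rewrite subr_ge0.
have := ler_wpM2l s1' h0; move: (`|z - z0|) (`|z + v - z0|) => a b; cl.
Qed.

(** * Semiconcave functions on a ball *)

Section Semiconcave.
Context {R : realType} {E : normedModType R}.
Implicit Types (f : E -> R) (x w : E).

Definition semiconcave_ball f (x0 : E) (r K : R) := forall x w, `|x - x0| <= r ->
  `|x + w - x0| <= r -> `|x - w - x0| <= r -> f (x + w) + f (x - w) - 2 * f x <= K * `|w| ^+ 2.

(** Second differences control midpoints only, so the step is halved j times. The errors K / 4 * 2 ^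
    -i * |w| ^ 2 form a geometric series with sum K / 2 * (1 - 2 ^ -j) * |w| ^ 2. *)
Lemma semiconcave_dyadic f x0 (r K : R) (j : nat) x w : semiconcave_ball f x0 r K ->
  `|x - x0| <= r -> `|x + w - x0| <= r ->
  f (x + w) - f x <= 2 ^+ j * (f (x + (2 ^+ j)^-1 *: w) - f x) + K / 2 * (1 - (2 ^+ j)^-1) * `|w| ^+ 2.
Proof.
move=> sc xr; elim: j w => [|j IH] w wr.
  by rewrite expr0 invr1 scale1r mul1r subrr mulr0 mul0r addr0.
pose h := 2^-1 *: w.
have hr : `|x + h - x0| <= r by apply: cball_segment => //; lra.
have e1 : x + h + h = x + w by rewrite -addrA /h -scalerDl; congr (_ + _); rewrite -[RHS]scale1r; congr (_ *: _); field.
have e2 : x + h - h = x by rewrite addrK.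
have := sc (x + h) h hr; rewrite e1 e2 => /(_ wr xr) h1.
have nh : `|h| ^+ 2 = `|w| ^+ 2 / 4.
  by rewrite normrZ ger0_norm ?invr_ge0// exprMn; field.
have := IH h hr; rewrite nh in h1 *.
have -> : (2 ^+ j)^-1 *: h = (2 ^+ j.+1)^-1 *: w.
  by rewrite /h scalerA exprSr invfM.
have -> : (2 ^+ j.+1)^-1 = (2 ^+ j)^-1 / 2 :> R by rewrite exprSr invfM.
rewrite [2 ^+ j.+1]exprS.
move: h1; move: (f (x + (_ / 2) *: w)) => a.
  move: (f (x + h)) (f (x + w)) (f x) ((2 ^+ j : R)^-1) (2 ^+ j : R) (`|w| ^+ 2) => b d e i g k.
clear; lra.
Qed.

Lemma pow2_bracket (a rho : R) : 0 < a -> a <= rho -> exists j : nat, rho / 2 < 2 ^+ j * a <= rho.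
Proof.
move=> a0 ar.
have [N hN] : exists N, rho < 2 ^+ N * a.
  exists (Num.bound `|rho / a|).
  rewrite -ltr_pdivrMr//; apply: le_lt_trans (ler_norm _) _.
  apply: lt_le_trans (_ : (Num.bound `|rho / a|)%:R <= _); first by rewrite archi_boundP.
  by rewrite -natrX ler_nat ltnW// ltn_expl.
have [j hj mj] := ex_minnP (ex_intro (fun N => rho < 2 ^+ N * a) N hN).
case: j hj mj => [|j] hj mj; first by move: hj; rewrite expr0 mul1r ltNge ar.
exists j; apply/andP; split; last by rewrite leNgt; apply/negP => /mj; rewrite ltnn.
by move: hj; rewrite exprS; lra.
Qed.

(** A descent from x to y persists, up to the quadratic error, when the segment is prolonged by a
    factor 2 ^ j to a length between r / 4 and r / 2; there the descent cannot exceed 2 M. *)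
Lemma semiconcave_lipschitz f x0 (r M K : R) : 0 < r -> 0 <= M -> 0 <= K ->
  (forall x, `|x - x0| <= r -> `|f x| <= M) -> semiconcave_ball f x0 r K ->
  forall x y, `|x - x0| <= r / 4 -> `|y - x0| <= r / 4 ->
    `|f x - f y| <= (8 * M / r + K * r) * `|x - y|.
Proof.
move=> r0 M0 K0 fM sc.
have L0 : 0 <= 8 * M / r + K * r by rewrite addr_ge0 ?divr_ge0 ?mulr_ge0// ltW.
have one x y : `|x - x0| <= r / 4 -> `|y - x0| <= r / 4 ->
    f x - f y <= (8 * M / r + K * r) * `|x - y|.
  move=> xr yr; have [->|xy] := eqVneq x y; first by rewrite !subrr normr0 mulr0.
  have a0 : 0 < `|y - x| by rewrite normr_gt0 subr_eq0 eq_sym.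
  have ar : `|y - x| <= r / 2.
    have := ler_distD x0 y x; rewrite (distrC x0 x); lra.
  have [j /andP[j1 j2]] := pow2_bracket a0 ar.
  pose w := 2 ^+ j *: (y - x).
  have p0 : 0 < 2 ^+ j :> R by rewrite exprn_gt0.
  have nw : `|w| = 2 ^+ j * `|y - x| by rewrite normrZ gtr0_norm.
  have wr : `|x + w - x0| <= r.
    rewrite addrAC; apply: le_trans (ler_normD _ _) _; rewrite nw; lra.
  have xr' : `|x - x0| <= r by lra.
  have := semiconcave_dyadic j sc xr' wr.
  rewrite /w scalerA mulVf ?gt_eqF// scale1r -/w [x + (y - x)]addrC subrK => H.
  have f1 := fM _ wr; have f2 := fM _ xr'.
  move: f1 f2; rewrite !ler_norml => /andP[f1 _] /andP[_ f2].
  have i0 : 0 <= (2 ^+ j)^-1 :> R by rewrite invr_ge0 ltW.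
  have w2 : 0 <= `|w| ^+ 2 by exact: sqr_ge0.
  have w3 : `|w| ^+ 2 <= (r / 2) * `|w|.
    by rewrite expr2; apply: ler_wpM2r => //; rewrite nw.
  have H2 : 2 ^+ j * (f x - f y) <= 2 * M + K / 2 * `|w| ^+ 2.
    have : 0 <= K / 2 * (2 ^+ j)^-1 * `|w| ^+ 2 by rewrite !mulr_ge0// invr_ge0.
    move: H f1 f2; move: (f (x + w)) (f x) (f y) ((2 ^+ j : R)^-1) (2 ^+ j : R) (`|w| ^+ 2) => a b d i g k.
    by clear; lra.
  have H3 : 2 * M + K / 2 * `|w| ^+ 2 <= (8 * M / r + K * r) * `|w|.
    have q1 : 2 * M <= 8 * M / r * `|w|.
      have -> : 2 * M = 8 * M / r * (r / 4) by field; rewrite gt_eqF.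
      apply: ler_wpM2l; last by rewrite nw; move: j1; lra.
      by rewrite divr_ge0 ?mulr_ge0// ltW.
    have q2 : K * `|w| ^+ 2 <= K * (r / 2 * `|w|) by apply: ler_wpM2l.
    have q3 : 0 <= K * r * `|w| by rewrite !mulr_ge0// ltW.
    by move: q1 q2 q3; lra.
  have := le_trans H2 H3; rewrite nw (distrC x y).
  by rewrite mulrCA ler_pM2l.
move=> x y xr yr; rewrite ler_norml one// andbT lerNl opprB distrC.
exact: one.
Qed.

End Semiconcave.

(** * Restriction to smaller boxes, and regularity near a point *)

Lemma box_sub (R : realType) (n : nat) (ta tb ta' tb' r r' : R) (x0 : 'rV[R]_n) :
  ta <= ta' -> tb' <= tb -> r' <= r -> box ta' tb' x0 r' `<=` box ta tb x0 r.
Proof. by move=> h1 h2 h3 [s y] [/= h4 h5]; split => /=; [move: h1 h2 h4; cl|move: h3 h5; cl]. Qed.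

Lemma coef_data_sub (R : realType) (n : nat) (A : R * 'rV[R]_n -> 'M[R]_n) V
    (ta tb ta' tb' r r' c m : R) (x0 : 'rV[R]_n) :
  ta <= ta' -> tb' <= tb -> r' <= r -> coef_data A V ta tb x0 r c m ->
  coef_data A V ta' tb' x0 r' c m.
Proof.
move=> h1 h2 h3 cd; have B := box_sub (x0 := x0) h1 h2 h3.
split; [exact: cd_c cd|exact: cd_m cd|..].
- by move=> z /B; exact: (cd_sym cd).
- by move=> z /B; exact: (cd_ell cd).
- by move=> z /B; exact: (cd_Abnd cd).
- by move=> z /B; exact: (cd_Vbnd cd).
- by move=> z z' /B + /B; exact: (cd_Alip cd).
- by move=> z z' /B + /B; exact: (cd_Vlip cd).
- by move=> s y w /B + /B + /B; exact: (cd_A2 cd).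
- by move=> s y w /B + /B + /B; exact: (cd_V2 cd).
Qed.

Lemma lag_bounds_sub (R : realType) (n : nat) (A : R * 'rV[R]_n -> 'M[R]_n) V
    (ta tb ta' tb' r r' C : R) (x0 : 'rV[R]_n) :
  ta <= ta' -> tb' <= tb -> r' <= r -> lag_bounds A V ta tb x0 r C ->
  lag_bounds A V ta' tb' x0 r' C.
Proof.
move=> h1 h2 h3 lb; have B := box_sub (x0 := x0) h1 h2 h3.
split; first exact: (lb_C lb).
- by move=> s y v /B; exact: (lb_bnd lb).
- by move=> s y s' y' v /B + /B; exact: (lb_lip lb).
- by move=> s y w v b /B + /B + /B; exact: (lb_2 lb).
- by move=> s y v /B; exact: (lb_coer lb).
- by move=> s y v /B; exact: (lb_Bbnd lb).
- by move=> s y s' y' v w /B + /B; exact: (lb_Blip lb).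
- by move=> z z' v /B + /B; exact: (lb_Alip lb).
- by move=> z v /B; exact: (lb_Abnd lb).
- by move=> z v /B; exact: (lb_Bnorm lb).
Qed.

Lemma sol_data_sub (R : realType) (n : nat) u (A : R * 'rV[R]_n -> 'M[R]_n) V
    (ta tb ta' tb' r r' M : R) (x0 : 'rV[R]_n) :
  ta <= ta' -> tb' <= tb -> r' <= r -> ta' < tb' -> 0 < r' -> sol_data u A V ta tb x0 r M ->
  sol_data u A V ta' tb' x0 r' M.
Proof.
move=> h1 h2 h3 h4 h5 sd; have B := box_sub (x0 := x0) h1 h2 h3.
have I s : ta' < s < tb' -> ta < s < tb by move: h1 h2; cl.
split => //; first exact: cont_onW (sd_cont sd).
- by move=> z /B; exact: (sd_bnd sd).
- by move=> s y tau p k d /I sI yr; apply: (sd_sub sd) sI _; exact: lt_le_trans yr h3.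
- by move=> s y tau p k d /I sI yr; apply: (sd_sup sd) sI _; exact: lt_le_trans yr h3.
Qed.

(** What later arguments use of the equation, on one closed box. The inequality along segments
    reaches both time faces, in particular ta = 0, whereas [sol_data] tests at interior points only;
    [K] is both a semiconcavity and a Lipschitz constant. *)
Record local_reg (R : realType) (n : nat) (u : R * 'rV[R]_n -> R) (A : R * 'rV[R]_n -> 'M[R]_n)
    (V : R * 'rV[R]_n -> R) (ta tb : R) (x0 : 'rV[R]_n) (r c m C M K : R) : Prop := LocalReg {
  lr_cd : coef_data A V ta tb x0 r c m;
  lr_lb : lag_bounds A V ta tb x0 r C;
  lr_sd : sol_data u A V ta tb x0 r M;
  lr_K : 0 <= K;
  lr_sc : forall t : R, ta <= t <= tb -> semiconcave_ball (fun x => u (t, x)) x0 r K;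
  lr_lip : forall (t t' : R) (x x' : 'rV[R]_n), box ta tb x0 r (t, x) -> box ta tb x0 r (t', x') ->
    `|u (t, x) - u (t', x')| <= K * (`|t - t'| + `|x - x'|);
  lr_line : forall (t t' : R) (y v : 'rV[R]_n) (l0 : R), ta <= t -> t <= t' -> t' <= tb ->
    `|y - x0| <= r -> `|y + (t' - t) *: v - x0| <= r ->
    (forall s : R, t <= s <= t' -> lag A V s (y + (s - t) *: v) v <= l0) ->
    u (t', y + (t' - t) *: v) <= u (t, y) + (t' - t) * l0 }.

(** In one direction, the constant curve; in the other, a single [chain_step] of length t' - t,
    where the cost K |v| of moving its foot point back to x is absorbed by the kinetic energy. One
    step suffices because the time span is at most [h0]. *)
Lemma time_lipschitz (R : realType) (n : nat) (u V : R * 'rV[R]_n -> R) (A : R * 'rV[R]_n -> 'M[R]_n)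
    (ta tb : R) (x0 : 'rV[R]_n) (r M c m C K : R) :
  coef_data A V ta tb x0 r c m -> lag_bounds A V ta tb x0 r C ->
  sol_data u A V ta tb x0 r M -> 0 <= K ->
  exists h0 K3 : R, [/\ 0 < h0, 0 <= K3 & forall ta' tb' : R, ta <= ta' -> tb' < tb ->
    (forall (t : R) (x x' : 'rV[R]_n), ta' <= t <= tb' -> `|x - x0| <= r / 2 -> `|x' - x0| <= r / 2 ->
       `|u (t, x) - u (t, x')| <= K * `|x - x'|) ->
    tb' - ta' <= h0 ->
    forall (t t' : R) (x : 'rV[R]_n), ta' <= t <= tb' -> ta' <= t' <= tb' ->
      `|x - x0| <= r / 4 -> `|u (t, x) - u (t', x)| <= K3 * `|t - t'| ].
Proof.
move=> cd lb sd K0; have C1 := lb_C lb; have r0 := sd_r sd.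
have K00 : box ta tb x0 r (ta, x0).
  by split => /=; [rewrite lexx ltW// (sd_lt sd)|rewrite subrr normr0 ltW].
have M0 : 0 <= M by exact: le_trans (normr_ge0 _) (sd_bnd sd K00).
pose G := n%:R * C ^+ 4 * 6 + 1.
have G0 : 0 < G by rewrite /G ltr_wpDl ?mulr_ge0 ?exprn_ge0//; move: C1; cl.
pose K1 := n%:R * C ^+ 5 + C.
have K10 : 0 < K1 by rewrite /K1 ltr_wpDl ?mulr_ge0 ?exprn_ge0//; move: C1; cl.
have CK : 0 < 16 * C * K1 by rewrite mulr_gt0//; move: C1; cl.
pose rho := Num.min 1 (Num.min (r / 4) (Num.min G^-1 (16 * C * K1)^-1)).
have rho0 : 0 < rho by rewrite !lt_min ltr01/= divr_gt0//= !invr_gt0 G0.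
have rho1 : rho <= 1 by rewrite /rho !ge_min lexx.
have rhor : rho <= r / 4 by rewrite /rho !ge_min lexx !orbT.
have rhoG : rho <= G^-1 by rewrite /rho !ge_min lexx !orbT.
have rhoK : rho <= (16 * C * K1)^-1 by rewrite /rho !ge_min lexx !orbT.
have Grho : n%:R * C ^+ 4 * (3 * rho) <= 2^-1.
  have : G * rho <= 1 by rewrite mulrC -ler_pdivlMr// mul1r.
  by rewrite /G; move: rho0; cl.
have K1r : K1 * (4 * rho) <= (4 * C)^-1.
  have -> : (4 * C)^-1 = K1 * (4 * (16 * C * K1)^-1).
    by move: K10 C1; rewrite -/K1; move: (K1); clear => k k0 C1; field; move: k0 C1; cl.
  by apply: ler_wpM2l; [exact: ltW|move: rhoK; cl].
pose Q := 4 * C * (2 * M + 10 * C) + 1.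
have Q0 : 0 < Q by rewrite /Q ltr_wpDl// !mulr_ge0//; move: C1 M0; cl.
pose h0 := Num.min rho (rho ^+ 2 / Q / 2).
have h00 : 0 < h0 by rewrite lt_min rho0 !divr_gt0 ?exprn_gt0.
exists h0, (K ^+ 2 * C + C + 1); split => //.
  by have : 0 <= K ^+ 2 * C; [rewrite mulr_ge0 ?sqr_ge0//; move: C1; cl|move: C1; cl].
move=> ta' tb' tata' tbtb' lip th0.
have main (t t' : R) (x : 'rV[R]_n) : ta' <= t -> t < t' -> t' <= tb' -> `|x - x0| <= r / 4 ->
    `|u (t, x) - u (t', x)| <= (K ^+ 2 * C + C + 1) * (t' - t).
  move=> tt1 tt tt2 xr.
  have KC : 0 <= K ^+ 2 * C by rewrite mulr_ge0 ?sqr_ge0//; move: C1; cl.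
  pose h := t' - t.
  have hp : 0 < h by rewrite subr_gt0.
  have hh0 : h <= h0 by apply: le_trans th0; rewrite /h; move: tt1 tt2; cl.
  have hrho : h <= rho by apply: le_trans hh0 _; rewrite /h0 ge_min lexx.
  have hlat : h * (4 * C * (2 * M + 10 * C)) < rho ^+ 2.
    have : h <= rho ^+ 2 / Q / 2 by apply: le_trans hh0 _; rewrite /h0 ge_min lexx orbT.
    have -> : rho ^+ 2 / Q / 2 = (rho ^+ 2 / 2) / Q by field; move: Q0; cl.
    rewrite ler_pdivlMr// /Q.
    have : 0 < rho ^+ 2 by rewrite exprn_gt0.
    by move: hp; cl.
  have th : t' - h = t by rewrite /h; ring.
  have tta : ta <= t' - h by rewrite th; exact: le_trans tt1.
  have ttb : t' < tb by exact: le_lt_trans tt2 tbtb'.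
  rewrite ler_norml; apply/andP; split.
    have up : u (t', x + (t' - t) *: 0) <= u (t, x) + (t' - t) * C.
      have xr2 : `|x + (t' - t) *: 0 - x0| <= r / 2 by rewrite scaler0 addr0; move: xr r0; cl.
      apply: (line_ineq cd lb sd (r' := r / 2)) xr2 _ => //.
      - exact: le_trans tt1.
      - exact: ltW.
      - by move: r0; cl.
      - by move: xr r0; cl.
      move=> s /andP[s1 s2]; rewrite scaler0 addr0.
      have Ks : box ta tb x0 r (s, x).
        by split => /=; [move: tata' tt1 s1 s2 ttb; cl|move: xr r0; cl].
      have := lb_bnd lb 0 Ks; rewrite normr0 expr0n addr0 mulr1; exact: le_trans (ler_norm _).
    rewrite scaler0 addr0 in up.
    have : (t' - t) * C <= (K ^+ 2 * C + C + 1) * (t' - t).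
      by rewrite mulrC; apply: ler_wpM2r; [exact: ltW|move: KC; cl].
    by move: up; cl.
  have xrr : `|x - x0| + rho <= r by move: xr rhor r0; cl.
  have [y' [v [xE hv stp]]] := chain_step cd lb sd tta ttb hp hrho rho1 xrr Grho hlat.
  rewrite th in stp.
  have Kx : box ta tb x0 r (t', x).
    by split => /=; [move: tata' tt1 tt ttb; cl|move: xr r0; cl].
  have ll := lag_lower v lb Kx.
  have v0 : 0 <= `|v| ^+ 2 by exact: sqr_ge0.
  have q1 : K1 * (4 * rho) * (1 + `|v| ^+ 2) <= (4 * C)^-1 * (1 + `|v| ^+ 2).
    by apply: ler_wpM2r K1r; rewrite addr_ge0.
  have i1 : (4 * C)^-1 <= 1 by rewrite invf_le1; move: C1; cl.
  have yE : x - y' = h *: v by rewrite xE; vec.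
  have ny : `|x - y'| = h * `|v| by rewrite yE normrZ gtr0_norm.
  have y'r : `|y' - x0| <= r / 2.
    by have := ler_distD x y' x0; rewrite (distrC y' x) ny; move: hv xr rhor r0; cl.
  have xr2 : `|x - x0| <= r / 2 by move: xr r0; cl.
  have := lip t x y' _ xr2 y'r; rewrite ny ler_norml => /(_ _)/andP[|_ l1].
    by move: tt1 tt tt2; cl.
  have sq : K * `|v| <= `|v| ^+ 2 / (4 * C) + K ^+ 2 * C.
    have : 0 <= (4 * C)^-1 * (`|v| - 2 * C * K) ^+ 2.
      by rewrite mulr_ge0 ?sqr_ge0// invr_ge0; move: C1; cl.
    have -> : (4 * C)^-1 * (`|v| - 2 * C * K) ^+ 2 = `|v| ^+ 2 / (4 * C) + K ^+ 2 * C - K * `|v|.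
      by field; move: C1; cl.
    by cl.
  have q2 : - (K ^+ 2 * C + C + 1) <= lag A V t' x v - K1 * (4 * rho) * (1 + `|v| ^+ 2) - K * `|v|.
    have : `|v| ^+ 2 / (2 * C) = 2 * (`|v| ^+ 2 / (4 * C)) by field; move: C1; cl.
    by move: ll q1 i1 sq; rewrite mulrDr mulr1 [(4 * C)^-1 * _]mulrC; cl.
  have := ler_wpM2l (ltW hp) q2; move: stp l1; rewrite -/h /K1.
  by cl.
move=> t t' x t1 t2 xr; have [tt|tt|->] := ltgtP t t'.
- rewrite (ler0_norm (x := t - t')) ?opprB; last by move: tt; cl.
  by apply: main => //; [move: t1; cl|move: t2; cl].
- rewrite distrC (gtr0_norm (x := t - t')) ?subr_gt0//.
  by apply: main => //; [move: t2; cl|move: t1; cl].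
- by rewrite !subrr normr0 mulr0.
Qed.

(** The box is a neighbourhood of (th, xh) relative to [0, T[ x Omega: the last clause puts th
    strictly after ta unless th = 0, in which case ta = 0. *)
Definition regular_at (R : realType) (n : nat) (u : R * 'rV[R]_n -> R) (A : R * 'rV[R]_n -> 'M[R]_n)
    (V : R * 'rV[R]_n -> R) (T : R) (Om : set 'rV[R]_n) (th : R) (xh : 'rV[R]_n) :=
  exists ta tb r c m C M K : R,
   [/\ [/\ 0 <= ta, tb < T, ta <= th < tb & 0 < th -> ta < th],
     forall z, box ta tb xh r z -> ropen_cylinder T Om z &
     local_reg u A V ta tb xh r c m C M K].

Lemma local_regularity (R : realType) (n : nat) (Om : set 'rV[R]_n) (T c1 c2 : R)
    (A : R * 'rV[R]_n -> 'M[R]_n) (V : R * 'rV[R]_n -> R)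
    (u0 : 'rV[R]_n -> R) (u : R * 'rV[R]_n -> R)
    (Om_open : open Om)
    (V_C2 : C2_near (closed_cylinder T Om) V)
    (A_C2 : forall i j, C2_near (closed_cylinder T Om) (fun z => A z i j))
    (A_sym : forall z, closed_cylinder T Om z -> (A z)^T = A z)
    (c1_gt0 : 0 < c1)
    (A_bounds : forall z, closed_cylinder T Om z -> forall p, p != 0 ->
       c1 * dotp p p < dotp (mxact (A z) p) p < c2 * dotp p p)
    (u0_semiconcave : locally_semiconcave Om u0)
    (u_cont : {within ropen_cylinder T Om, continuous u})
    (u_visc : viscosity_solution (quadratic_ham A V) (open_cylinder T Om) u)
    (u_init : forall x, Om x -> u (0, x) = u0 x) (th : R) (xh : 'rV[R]_n) :
  0 <= th < T -> Om xh -> regular_at u A V T Om th xh.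
Proof.
move=> /andP[th0 thT] Oxh.
have [r1 r10 hr1] : exists2 r1 : R, 0 < r1 & forall y, `|y - xh| < r1 -> Om y.
  have /nbhs_normP[r /= r0 H] := open_nbhs_nbhs (conj Om_open Oxh).
  by exists r => // y yr; apply: H; rewrite /= distrC.
have Dz0 : closed_cylinder T Om (th, xh) by split => //=; rewrite th0 ltW.
have [rho [m [rho0 m0 hcd]]] := coef_local V_C2 A_C2 A_sym c1_gt0 A_bounds Dz0.
have [ru [C0 [ru0 C00 hu0]]] := semiconcave_second u0_semiconcave Oxh.
pose r := Num.min (r1 / 2) (Num.min (rho / 2) ru).
have r0 : 0 < r by rewrite !lt_min ru0 !divr_gt0.
have rr1 : r <= r1 / 2 by rewrite /r ge_min lexx.
have rrho : r <= rho / 2 by rewrite /r !ge_min lexx !orbT.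
have rru : r <= ru by rewrite /r !ge_min lexx !orbT.
pose ta0 := Num.max 0 (th - rho / 2); pose tb0 := Num.min ((th + T) / 2) (th + rho / 2).
have ta00 : 0 <= ta0 by rewrite /ta0 le_max lexx.
have ta0h : ta0 <= th by rewrite /ta0 ge_max th0/=; move: rho0; cl.
have ta0r : th - rho < ta0 by rewrite /ta0 lt_max; apply/orP; right; move: rho0; cl.
have ta0s : 0 < th -> ta0 < th by move=> h; rewrite /ta0 gt_max h/=; move: rho0; cl.
have tb0h : th < tb0 by rewrite /tb0 lt_min; apply/andP; split; [move: thT; cl|move: rho0; cl].
have tb0T : tb0 < T by rewrite /tb0 gt_min; apply/orP; left; move: thT; cl.
have tb0r : tb0 < th + rho by rewrite /tb0 gt_min; apply/orP; right; move: rho0; cl.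
have tab0 : ta0 < tb0 by exact: le_lt_trans tb0h.
have bR z : box ta0 tb0 xh r z -> ropen_cylinder T Om z.
  move=> [/andP[h1 h2] h3]; split; first by apply/andP; split; [exact: le_trans h1|exact: le_lt_trans tb0T].
  by apply: hr1; move: h3 rr1 r10; cl.
have bC z : box ta0 tb0 xh r z -> closed_cylinder T Om z.
  by move=> /bR[/andP[h1 h2] h3]; split => //; rewrite h1 ltW.
have cd : coef_data A V ta0 tb0 xh r c1 m by apply: hcd => //; move: rrho rho0; cl.
have [C lb] := coef_data_bounds cd.
have [M sd] := sol_local u_cont u_visc tab0 r0 bR.
have C1 := lb_C lb.
have K00 : box ta0 tb0 xh r (ta0, xh).
  by split => /=; [rewrite lexx ltW|rewrite subrr normr0 ltW].
have M0 : 0 <= M by exact: le_trans (normr_ge0 _) (sd_bnd sd K00).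
have [tau0 tau00 est] := semiconcave_estimate n r0 M0 C1.
have [ta1 [tb1 [K1 [[t1 t2 t3 t4 t5] K10 sc1]]]] : exists ta1 tb1 K1 : R,
  [/\ [/\ ta0 <= ta1, ta1 <= th, th < tb1, tb1 < tb0 & 0 < th -> ta1 < th], 0 <= K1 &
   forall (t : R) (x w : 'rV[R]_n), ta1 <= t <= tb1 -> `|x - xh| <= r / 4 -> `|w| <= r / 4 ->
     u (t, x + w) + u (t, x - w) - 2 * u (t, x) <= K1 * `|w| ^+ 2].
  (* At th = 0 the chain is translated rigidly (beta = 0), so the second difference of u is bounded
     by that of u0 plus the accumulated error. *)
  have [thE|th0'] := eqVneq th 0.
    have ta0E : ta0 = 0 by apply/eqP; rewrite eq_le ta00 andbT -thE.
    have [K1 K10 H] := est 0 C0 (lexx _) C00.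
    pose tb1 := Num.min (tb0 / 2) tau0.
    have tb00 : 0 < tb0 by rewrite -thE.
    have tb1l : tb1 <= tb0 / 2 by rewrite /tb1 ge_min lexx.
    have tb1t : tb1 <= tau0 by rewrite /tb1 ge_min lexx orbT.
    exists 0, tb1, (C0 + K1); split.
    - split; [by rewrite ta0E|by rewrite thE| |by move: tb1l tb00; cl|by rewrite thE ltxx].
      by rewrite thE /tb1 lt_min tau00 andbT; move: tb00; cl.
    - exact: addr_ge0.
    move=> t x w /andP[s0 s1] xr wr.
    have w2 : 0 <= `|w| ^+ 2 by exact: sqr_ge0.
    have K1w : 0 <= K1 * `|w| ^+ 2 by exact: mulr_ge0.
    have C0w : 0 <= C0 * `|w| ^+ 2 by exact: mulr_ge0.
    have ini z (w' : 'rV[R]_n) : `|z - xh| <= r / 2 -> `|w'| <= r / 4 ->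
        u (0, z + w') + u (0, z - w') - 2 * u (0, z) <= C0 * `|w'| ^+ 2.
      move=> zr w'r.
      have Oz y : `|y - xh| <= r -> Om y by move=> h; apply: hr1; move: h rr1 r10; cl.
      have n1 y : `|y| <= r / 4 -> `|z + y - xh| <= r.
        move=> yr; rewrite addrAC; apply: le_trans (ler_normD _ _) _; move: zr yr r0; cl.
      rewrite !u_init; first apply: hu0.
      + by move: zr rru r0; cl.
      + by move: w'r rru r0; cl.
      + by apply: Oz; move: zr r0; cl.
      + by apply: Oz; apply: n1; rewrite normrN.
      + by apply: Oz; exact: n1.
    move: s0; rewrite le_eqVlt => /predU1P[<-|s0].
      by apply: le_trans (ini x w _ wr) _; [move: xr r0; cl|move: K1w; cl].
    have := H u V A ta0 tb0 xh c1 m cd lb sd 0 t x w; rewrite lexx ta0E subr0 !mul0r subr0 scale1r.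
    move=> /(_ isT s0 _ _ ler01 xr wr) h; apply: le_trans (h _ _ _) _.
    + by move: s1 tb1l tb00; cl.
    + exact: le_trans s1 tb1t.
    + by move=> z zr; apply: ini.
    by move: C0w; cl.
  have thp : 0 < th by rewrite lt_neqAle eq_sym th0'.
  pose d := Num.min tau0 (th - ta0) / 2.
  have d0 : 0 < d by rewrite divr_gt0// lt_min tau00/= subr_gt0 ta0s.
  have dt : 2 * d <= tau0 by rewrite /d mulrC divfK// ge_min lexx.
  have dta : 2 * d <= th - ta0 by rewrite /d mulrC divfK// ge_min lexx orbT.
  pose ta' := th - d.
  have h1 : ta0 <= ta' by rewrite /ta'; move: dta d0; cl.
  have cd' := coef_data_sub h1 (lexx tb0) (lexx r) cd.
  have lb' := lag_bounds_sub h1 (lexx tb0) (lexx r) lb.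
  have h2 : ta' < tb0 by rewrite /ta'; move: d0 tb0h; cl.
  have sd' := sol_data_sub h1 (lexx tb0) (lexx r) h2 r0 sd.
  (* At th > 0 the auxiliary initial time ta' = th - d is used with beta = 1 / (t - ta'): the shift
     vanishes at ta', where the initial bound then holds with constant 0. On the final box t - ta'
     >= d / 2, whence beta <= 2 / d. *)
  have bb0 : 0 <= 2 / d by rewrite divr_ge0// ltW.
  have [K1 K10 H] := est (2 / d) 0 bb0 (lexx _).
  pose tb1 := Num.min (th + d / 2) ((th + tb0) / 2).
  have tb1l : tb1 <= th + d / 2 by rewrite /tb1 ge_min lexx.
  have tb1t : tb1 <= (th + tb0) / 2 by rewrite /tb1 ge_min lexx orbT.
  exists (th - d / 2), tb1, K1; split => //.
    split; [by move: dta d0; cl|by move: d0; cl| |by move: tb1t tb0h; cl|by move: d0; cl].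
    by rewrite /tb1 lt_min; apply/andP; split; [move: d0; cl|move: tb0h; cl].
  move=> t x w /andP[s0 s1] xr wr.
  have td : d / 2 <= t - ta' by rewrite /ta'; move: s0; cl.
  have td0 : 0 < t - ta' by move: td d0; cl.
  have bE : (t - ta')^-1 * (t - ta') = 1 by rewrite mulVf// gt_eqF.
  have := H u V A ta' tb0 xh c1 m cd' lb' sd' (t - ta')^-1 t x w; rewrite bE subrr.
  apply => //.
  - rewrite invr_ge0 ltW//= -(invf_div d 2) lef_pV2 ?posrE// divr_gt0//.
  - by move: td0; cl.
  - by move: s1 tb1t tb0h; cl.
  - by rewrite /ta'; move: s1 tb1l dt d0; cl.
  - by move=> z _; rewrite !scale0r addr0 subr0 mul0r; cl.
have sc t : ta1 <= t <= tb1 -> semiconcave_ball (fun x => u (t, x)) xh (r / 8) K1.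
  move=> tI x w xr xp xm; apply: sc1 => //; first by move: xr r0; cl.
  have -> : w = (x + w - xh) - (x - xh) by vec.
  by apply: le_trans (ler_normB _ _) _; move: xr xp; cl.
have bbnd t x : ta1 <= t <= tb1 -> `|x - xh| <= r / 8 -> `|u (t, x)| <= M.
  move=> tI xr; apply: (sd_bnd sd); split => /=; first by move: tI t1 t4; cl.
  by move: xr r0; cl.
have r80 : 0 < r / 8 by rewrite divr_gt0.
(* Each estimate costs a part of the ball: r / 8 remains for semiconcavity, a quarter of it for the
   Lipschitz bound in space, and r / 64 for the one in time. *)
pose L := 8 * M / (r / 8) + K1 * (r / 8).
have L0 : 0 <= L by rewrite addr_ge0// ?divr_ge0 ?mulr_ge0// ltW.
have lipx t x y : ta1 <= t <= tb1 -> `|x - xh| <= r / 16 / 2 -> `|y - xh| <= r / 16 / 2 ->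
    `|u (t, x) - u (t, y)| <= L * `|x - y|.
  move=> tI xr yr; apply: (semiconcave_lipschitz r80 M0 K10 _ (sc t tI)).
  - by move=> z zr; exact: bbnd.
  - by move: xr; cl.
  - by move: yr; cl.
have r16 : r / 16 <= r by move: r0; cl.
have r160 : 0 < r / 16 by rewrite divr_gt0.
have [h0 [K3 [h00 K30 tlip]]] := time_lipschitz (coef_data_sub (lexx ta0) (lexx tb0) r16 cd)
  (lag_bounds_sub (lexx ta0) (lexx tb0) r16 lb)
  (sol_data_sub (lexx ta0) (lexx tb0) r16 tab0 r160 sd) L0.
pose ta := Num.max ta1 (th - h0 / 2); pose tb := Num.min tb1 (th + h0 / 2).
have e1 : ta1 <= ta by rewrite /ta le_max lexx.
have e2 : ta <= th by rewrite /ta ge_max t2/=; move: h00; cl.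
have e3 : th < tb by rewrite /tb lt_min t3/=; move: h00; cl.
have e4 : tb <= tb1 by rewrite /tb ge_min lexx.
have e5 : 0 < th -> ta < th by move=> /t5 h; rewrite /ta gt_max h/=; move: h00; cl.
have e6 : tb - ta <= h0.
  have : th - h0 / 2 <= ta by rewrite /ta le_max lexx orbT.
  have : tb <= th + h0 / 2 by rewrite /tb ge_min lexx orbT.
  by cl.
have i1 (t : R) : ta <= t <= tb -> ta1 <= t <= tb1 by move: e1 e4; cl.
have a1 : ta0 <= ta by exact: le_trans e1.
have a2 : tb <= tb0 by apply: le_trans e4 (ltW t4).
have a3 : r / 64 <= r by move: r0; cl.
have a4 : ta < tb by exact: le_lt_trans e3.
have a5 : 0 < r / 64 by rewrite divr_gt0.
exists ta, tb, (r / 64), c1, m, C, M, (K1 + L + K3); split.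
- split => //; [exact: le_trans a1|exact: le_lt_trans tb0T|by rewrite e2].
- by move=> z zb; apply: bR; apply: box_sub zb.
split.
- exact: coef_data_sub cd.
- exact: lag_bounds_sub lb.
- exact: sol_data_sub sd.
- by move: K10 L0 K30; cl.
- move=> t /i1 tI x w xr xp xm.
  have h y : `|y - xh| <= r / 64 -> `|y - xh| <= r / 8 by move: r0; cl.
  apply: le_trans (sc t tI x w (h _ xr) (h _ xp) (h _ xm)) _.
  apply: ler_wpM2r; first exact: sqr_ge0.
  by move: L0 K30; cl.
- move=> t t' x x' [/= tI xr] [/= t'I x'r].
  have := lipx t x x' (i1 _ tI) _ _.
  have h y : `|y - xh| <= r / 64 -> `|y - xh| <= r / 16 / 2 by move: r0; cl.
  move=> /(_ (h _ xr) (h _ x'r)) l1.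
  have l2 : `|u (t, x') - u (t', x')| <= K3 * `|t - t'|.
    apply: (tlip ta tb) => //; last by move: x'r; cl.
    + exact: le_lt_trans e4 t4.
    + by move=> t'' y y' /i1 h' yr y'r; exact: lipx.
  have := ler_distD (u (t, x')) (u (t, x)) (u (t', x')).
  have q1 := normr_ge0 (t - t'); have q2 := normr_ge0 (x - x').
  have : 0 <= (K1 + L) * `|t - t'| by rewrite mulr_ge0// addr_ge0.
  have : 0 <= (K1 + K3) * `|x - x'| by rewrite mulr_ge0// addr_ge0.
  by move: l1 l2; cl.
move=> t t' y v l0 q1 q2 q3 yr y'r hl.
apply: (line_ineq cd lb sd (r' := r / 64)) => //.
- exact: le_trans q1.
- by apply: le_lt_trans q3 _; exact: le_lt_trans e4 t4.
- by move: r0; cl.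
Qed.

(** * Superdifferentials *)

Generalizable All Variables.

Lemma norm_le_enorm (R : realType) (n : nat) (v : 'rV[R]_n) : `|v| <= enorm v.
Proof.
rewrite /enorm -[leLHS](ger0_norm (normr_ge0 v)) -sqrtr_sqr ler_sqrt ?norm_sq_le//.
exact: dotp_ge0.
Qed.

Lemma dotp_self_le (R : realType) (n : nat) (v : 'rV[R]_n) : dotp v v <= n%:R * `|v| ^+ 2.
Proof. by rewrite expr2; apply: le_trans (dotp_le v v); exact: ler_norm. Qed.

Lemma enorm_le (R : realType) (n : nat) (v : 'rV[R]_n) : enorm v <= n%:R * `|v|.
Proof.
have h : dotp v v <= (n%:R * `|v|) ^+ 2.
  apply: le_trans (dotp_self_le v) _; rewrite exprMn; apply: ler_wpM2r; first exact: sqr_ge0.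
  by rewrite -natrX ler_nat; case: (n) => // k; rewrite expnS expn1 leq_pmulr.
by rewrite /enorm -[leRHS](@ger0_norm _ (n%:R * `|v|)) ?mulr_ge0// -sqrtr_sqr ler_wsqrtr.
Qed.

(* For semiconcave f these are the elements of the superdifferential of f at x,
   by superdiff_sgrad; the bound is uniform in x. *)
Definition sgrad (R : realType) (n : nat) (f : 'rV[R]_n -> R) (x0 : 'rV[R]_n) (r K : R)
    (x p : 'rV[R]_n) :=
  forall w, `|x + w - x0| <= r -> f (x + w) <= f x + dotp p w + K * `|w| ^+ 2.

Lemma limf_esup_le0P (R : realType) (X : normedModType R) (f : X -> R) (x : X) :
  ((limf_esup (fun y => (f y)%:E) (x^')) <= 0)%E <->
  forall e : R, 0 < e -> exists2 d : R, 0 < d & forall y, y != x -> `|y - x| < d -> f y <= e.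
Proof.
split.
  move=> h e e0.
  have : (limf_esup (fun y => (f y)%:E) (x^') < e%:E)%E by apply: le_lt_trans h _; rewrite lte_fin.
  move=> /ereal_inf_lt[_ [V xV <-]] hV.
  move: xV; rewrite /= /dnbhs => /nbhs_normP[d /= d0 H].
  exists d => // y yx yd.
  have Vy : V y by apply: H => //=; rewrite distrC.
  rewrite -lee_fin; apply: le_trans (ltW hV); apply: ereal_sup_ubound.
  by exists y.
move=> H; apply/lee_addgt0Pr => e e0; rewrite add0e.
have [d d0 hd] := H e e0.
apply: ge_ereal_inf; exists (ereal_sup ((fun y => (f y)%:E) @` [set y | y != x /\ `|y - x| < d])).
  exists [set y | y != x /\ `|y - x| < d] => //; apply/nbhs_normP; exists d => //= y yd yx.
  by split => //; rewrite distrC.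
by apply: ge_ereal_sup => _ [y [yx yd] <-]; rewrite lee_fin; exact: hd.
Qed.

(** The Euclidean norm of the definition lies between the sup norm and n times it, so the slack e is
    rescaled by n + 1. *)
Lemma superdiff_xP (R : realType) (n : nat) (u : R * 'rV[R]_n -> R) (t : R) (x p : 'rV[R]_n) :
  superdiff_x u t x p <->
  forall e : R, 0 < e -> exists2 d : R, 0 < d & forall w, `|w| < d ->
    u (t, x + w) <= u (t, x) + dotp p w + e * `|w|.
Proof.
rewrite /superdiff_x /= limf_esup_le0P; split => H e e0.
  have e1 : 0 < e / (n%:R + 1) by rewrite divr_gt0// ltr_wpDl.
  have [d d0 hd] := H _ e1; exists d => // w wd.
  have [->|w0] := eqVneq w 0; first by rewrite addr0 dotp0r normr0 mulr0 !addr0.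
  have /hd : x + w != x by rewrite -subr_eq0 addrC addKr.
  rewrite addrC addKr addrC => /(_ wd).
  have ew : 0 < enorm w by apply: lt_le_trans (norm_le_enorm w); rewrite normr_gt0.
  rewrite ler_pdivrMr// => h.
  have : e / (n%:R + 1) * enorm w <= e * `|w|.
    rewrite mulrAC ler_pdivrMr ?ltr_wpDl// -mulrA ler_pM2l//.
    by apply: le_trans (enorm_le w) _; rewrite mulrC ler_wpM2l// lerDl.
  by move: h; cl.
have [d d0 hd] := H e e0; exists d => // y yx yd.
have yx0 : 0 < `|y - x| by rewrite normr_gt0 subr_eq0.
have ew : 0 < enorm (y - x) by exact: lt_le_trans (norm_le_enorm _).
have := hd (y - x) yd; rewrite addrC subrK ler_pdivrMr// => h.
have : e * `|y - x| <= e * enorm (y - x) by rewrite ler_pM2l// norm_le_enorm.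
by move: h; cl.
Qed.

(** Shrink w by 2 ^ -j into the range where the first-order inequality holds and return with
    [semiconcave_dyadic]: an infinitesimal property becomes one on the whole ball. *)
Lemma sgrad_of_small (R : realType) (n : nat) (f : 'rV[R]_n -> R) x0 (r K : R) x p :
  semiconcave_ball f x0 r K -> 0 <= K -> `|x - x0| <= r ->
  (forall e : R, 0 < e -> exists2 d : R, 0 < d & forall w, `|w| < d -> `|x + w - x0| <= r ->
    f (x + w) <= f x + dotp p w + e * `|w|) ->
  sgrad f x0 r K x p.
Proof.
move=> sc K0 xr H w wr; apply/ler_addgt0Pr => e e0.
have w1 : 0 < `|w| + 1 by rewrite ltr_wpDl.
have [d d0 hd] := H (e / (`|w| + 1)) (divr_gt0 e0 w1).
have [j hj] : exists j : nat, `|w| < 2 ^+ j * d.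
  pose a := `|w| / d; exists (Num.bound `|a|).
  rewrite -ltr_pdivrMr//; apply: le_lt_trans (ler_norm _) _.
  apply: lt_le_trans (_ : (Num.bound `|a|)%:R <= _); first by rewrite archi_boundP.
  by rewrite -natrX ler_nat ltnW// ltn_expl.
have p0 : 0 < 2 ^+ j :> R by rewrite exprn_gt0.
have i0 : 0 < (2 ^+ j)^-1 :> R by rewrite invr_gt0.
have i1 : (2 ^+ j)^-1 <= 1 :> R by rewrite invf_le1// exprn_ege1// ler1n.
have nw : `|(2 ^+ j)^-1 *: w| = (2 ^+ j)^-1 * `|w| by rewrite normrZ gtr0_norm.
have nd : `|(2 ^+ j)^-1 *: w| < d by rewrite nw mulrC ltr_pdivrMr// mulrC.
have nr : `|x + (2 ^+ j)^-1 *: w - x0| <= r by apply: cball_segment => //; rewrite (ltW i0).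
have := hd _ nd nr; rewrite nw dotpZr => h1.
have := semiconcave_dyadic j sc xr wr => h2.
have h3 : 2 ^+ j * (f (x + (2 ^+ j)^-1 *: w) - f x) <= dotp p w + e / (`|w| + 1) * `|w|.
  have -> : dotp p w + e / (`|w| + 1) * `|w| = 2 ^+ j * ((2 ^+ j)^-1 * dotp p w + e / (`|w| + 1) * ((2 ^+ j)^-1 * `|w|)).
    by field; rewrite ?gt_eqF.
  by rewrite ler_pM2l//; move: h1; cl.
have h4 : e / (`|w| + 1) * `|w| <= e.
  by rewrite mulrAC ler_pdivrMr// ler_pM2l// lerDl.
have w2 : 0 <= `|w| ^+ 2 by exact: sqr_ge0.
have h5 : K / 2 * (1 - (2 ^+ j)^-1) * `|w| ^+ 2 <= K * `|w| ^+ 2.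
  apply: ler_wpM2r => //.
  have : 0 <= K * (2 ^+ j)^-1 by rewrite mulr_ge0// ltW.
  by move: K0; cl.
by move: h2 h3 h4 h5; cl.
Qed.

(** The lower bound at x - w and the second difference together bound f (x + w) from above; so
    proximal subgradients are supergradients. *)
Lemma sgrad_of_sub (R : realType) (n : nat) (f : 'rV[R]_n -> R) x0 (r K k d : R) x p :
  semiconcave_ball f x0 r K -> 0 <= K -> `|x - x0| < r -> 0 < d ->
  (forall y, `|y - x| < d -> f x + dotp p (y - x) - k * `|y - x| ^+ 2 <= f y) ->
  sgrad f x0 r K x p.
Proof.
move=> sc K0 xr d0 H; apply: sgrad_of_small => // [|e e0]; first exact: ltW.
have k1 : 0 < K + `|k| + 1 by rewrite ltr_wpDl// addr_ge0.
exists (Num.min d (Num.min (r - `|x - x0|) (e / (K + `|k| + 1)))).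
  by rewrite !lt_min d0 subr_gt0 xr divr_gt0.
move=> w; rewrite !lt_min => /and3P[wd wr we] _.
have nb v : `|v| = `|w| -> `|x + v - x0| <= r.
  by move=> e1; rewrite addrAC; apply: le_trans (ler_normD _ _) _; rewrite e1; move: wr; cl.
have := sc x w (ltW xr) (nb _ erefl) (nb _ (normrN w)).
have /H : `|x - w - x| < d by rewrite addrC addKr normrN.
rewrite [x - w - x]addrC addKr dotpNr normrN => h1 h2.
have w0 : 0 <= `|w| by [].
have h3 : (K + `|k| + 1) * `|w| ^+ 2 <= e * `|w|.
  rewrite expr2 mulrA; apply: ler_wpM2r => //.
  by rewrite mulrC -ler_pdivlMr// ltW.
have h4 : k * `|w| ^+ 2 <= `|k| * `|w| ^+ 2 by rewrite ler_wpM2r ?sqr_ge0// ler_norm.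
have : 0 <= `|w| ^+ 2 by exact: sqr_ge0.
by move: h1 h2 h3 h4; cl.
Qed.

Lemma sgrad_bound (R : realType) (n : nat) (f : 'rV[R]_n -> R) x0 (r K L : R) x p :
  (forall x y, `|x - x0| <= r -> `|y - x0| <= r -> `|f x - f y| <= L * `|x - y|) ->
  0 <= L -> 0 <= K -> `|x - x0| < r -> sgrad f x0 r K x p -> `|p| <= L.
Proof.
move=> lip L0 K0 xr sg; rewrite leNgt; apply/negP => Lp.
have p0 : 0 < `|p| by exact: le_lt_trans Lp.
(* Test in the direction - p, with a step so short that the point stays in the ball and K s |p|
   stays below |p| - L. *)
pose s := Num.min ((r - `|x - x0|) / `|p|) ((`|p| - L) / ((K + 1) * `|p|)).
have K1 : 0 < K + 1 by rewrite ltr_wpDl.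
have s0 : 0 < s by rewrite lt_min !divr_gt0 ?subr_gt0// mulr_gt0.
have s1 : s * `|p| <= r - `|x - x0| by rewrite -ler_pdivlMr// /s ge_min lexx.
have s2 : s * ((K + 1) * `|p|) <= `|p| - L by rewrite -ler_pdivlMr ?mulr_gt0// /s ge_min lexx orbT.
have nn : `|s *: p| = s * `|p| by rewrite normrZ gtr0_norm.
have xw : `|x + - (s *: p) - x0| <= r.
  by rewrite addrAC; apply: le_trans (ler_normD _ _) _; rewrite normrN nn; move: s1; cl.
have := sg _ xw; rewrite dotpNr dotpZr normrN nn.
have := lip _ _ xw (ltW xr); rewrite [x - _ - x]addrC addKr normrN nn ler_norml => /andP[h1 _] h2.
have h3 : s * `|p| ^+ 2 <= s * dotp p p by rewrite ler_pM2l// norm_sq_le.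
have h4 : (s * `|p|) * `|p| <= (s * `|p|) * (L + K * (s * `|p|)) by move: h1 h2 h3; cl.
move: h4; rewrite ler_pM2l ?mulr_gt0//.
have : 0 < s * `|p| by rewrite mulr_gt0.
by move: s2; cl.
Qed.

Lemma sgrad_mono (R : realType) (n : nat) (f : 'rV[R]_n -> R) x0 (r K : R) x1 x2 p1 p2 :
  `|x1 - x0| <= r -> `|x2 - x0| <= r -> sgrad f x0 r K x1 p1 -> sgrad f x0 r K x2 p2 ->
  dotp (p1 - p2) (x1 - x2) <= 2 * K * `|x1 - x2| ^+ 2.
Proof.
move=> r1 r2 s1 s2.
have := s1 (x2 - x1); rewrite (addrC x1) subrK => /(_ r2) h1.
have := s2 (x1 - x2); rewrite (addrC x2) subrK => /(_ r1) h2.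
move: h1 h2; rewrite (distrC x2 x1) -(opprB x1 x2) dotpNr dotpBl; cl.
Qed.

Lemma sgrad_convex (R : realType) (n : nat) (f : 'rV[R]_n -> R) x0 (r K a : R) x p q :
  0 <= a <= 1 -> sgrad f x0 r K x p -> sgrad f x0 r K x q -> sgrad f x0 r K x (a *: p + (1 - a) *: q).
Proof.
move=> /andP[a0 a1] sp sq w wr; rewrite dotpDl !dotpZl.
have a1' : 0 <= 1 - a by rewrite subr_ge0.
have := ler_wpM2l a0 (sp w wr); have := ler_wpM2l a1' (sq w wr); cl.
Qed.

Lemma lr_r `(lr : @local_reg R n u A V ta tb x0 r c m C M K) : 0 < r.
Proof. exact: sd_r (lr_sd lr). Qed.

Lemma lr_lt `(lr : @local_reg R n u A V ta tb x0 r c m C M K) : ta < tb.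
Proof. exact: sd_lt (lr_sd lr). Qed.

Lemma lr_lipx `(lr : @local_reg R n u A V ta tb x0 r c m C M K) (t : R) x y :
  ta <= t <= tb -> `|x - x0| <= r -> `|y - x0| <= r -> `|u (t, x) - u (t, y)| <= K * `|x - y|.
Proof.
move=> tI xr yr; have := @lr_lip _ _ _ _ _ _ _ _ _ _ _ _ _ _ lr t t x y.
by rewrite subrr normr0 add0r; apply.
Qed.

Lemma superdiff_sgrad `(lr : @local_reg R n u A V ta tb x0 r c m C M K) (t : R) x p :
  ta <= t <= tb -> `|x - x0| < r ->
  superdiff_x u t x p <-> sgrad (fun y => u (t, y)) x0 r K x p.
Proof.
move=> tI xr; have K0 := lr_K lr; rewrite superdiff_xP; split.
  move=> H; apply: sgrad_of_small => //; first exact: (lr_sc lr).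
    exact: ltW.
  by move=> e /H[d d0 hd]; exists d => // w wd _; exact: hd.
move=> H e e0; have K1 : 0 < K + 1 by rewrite ltr_wpDl.
exists (Num.min (r - `|x - x0|) (e / (K + 1))); first by rewrite lt_min subr_gt0 xr divr_gt0.
move=> w; rewrite lt_min => /andP[wr we].
have xw : `|x + w - x0| <= r.
  by rewrite addrAC; apply: le_trans (ler_normD _ _) _; move: wr; cl.
apply: le_trans (H w xw) _; rewrite lerD2l expr2 mulrA; apply: ler_wpM2r => //.
have : `|w| * (K + 1) <= e by rewrite -ler_pdivlMr// ltW.
by have := normr_ge0 w; cl.
Qed.

Lemma sgrad_bnd `(lr : @local_reg R n u A V ta tb x0 r c m C M K) (t : R) x p :
  ta <= t <= tb -> `|x - x0| < r -> sgrad (fun y => u (t, y)) x0 r K x p -> `|p| <= K.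
Proof.
move=> tI xr; have K0 := lr_K lr; apply: sgrad_bound => // y z yr zr.
exact: (lr_lipx lr).
Qed.

(** The radius and the constant in [sgrad] do not depend on the point, so the inequality passes to
    the limit by the Lipschitz bound on u. *)
Lemma sgrad_closed `(lr : @local_reg R n u A V ta tb x0 r c m C M K) (t : R) x p :
  ta <= t <= tb -> `|x - x0| < r ->
  (forall d : R, 0 < d -> exists (t' : R) x' p', [/\ ta <= t' <= tb, `|x' - x0| < r,
     `|t' - t| < d, `|x' - x| < d & `|p' - p| < d /\ sgrad (fun y => u (t', y)) x0 r K x' p']) ->
  sgrad (fun y => u (t, y)) x0 r K x p.
Proof.
move=> tI xr H w wr; have K0 := lr_K lr; apply/ler_addgt0Pr => e e0.
pose Q := 3 * K + n%:R * (`|w| + 1) + n%:R * `|p| + K * (2 * `|w| + 1) + 1.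
have Q0 : 0 < Q by rewrite /Q ltr_wpDl// !addr_ge0 ?mulr_ge0 ?addr_ge0 ?mulr_ge0.
pose d := Num.min 1 (e / Q).
have d0 : 0 < d by rewrite lt_min ltr01 divr_gt0.
have d1 : d <= 1 by rewrite /d ge_min lexx.
have dQ : Q * d <= e by rewrite mulrC -ler_pdivlMr// /d ge_min lexx orbT.
have [t' [x' [p' [t'I x'r t't x'x [p'p sg]]]]] := H d d0.
have := sg (x + w - x'); rewrite [x' + _]addrC subrK => /(_ wr).
set w' := x + w - x'.
have -> : dotp p' w' = dotp p w + dotp (p' - p) w' + dotp p (x - x').
  by rewrite /w' !dotpBl !dotpBr !dotpDr; ring.
have nw' : `|w'| <= `|w| + d.
  have -> : w' = w - (x' - x) by rewrite /w'; vec.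
  by apply: le_trans (ler_normB _ _) _; move: x'x; cl.
have b1 : dotp (p' - p) w' <= n%:R * (`|w| + 1) * d.
  apply: le_trans (ler_norm _) _; apply: le_trans (dotp_le _ _) _.
  rewrite -mulrA; apply: ler_wpM2l => //; rewrite mulrC; apply: ler_pM => //.
    by move: nw' d1; cl.
  exact: ltW.
have b2 : dotp p (x - x') <= n%:R * `|p| * d.
  apply: le_trans (ler_norm _) _; apply: le_trans (dotp_le _ _) _.
  by rewrite -mulrA; apply: ler_wpM2l => //; apply: ler_wpM2l => //; rewrite distrC ltW.
have b3 : K * `|w'| ^+ 2 <= K * `|w| ^+ 2 + K * (2 * `|w| + 1) * d.
  rewrite -mulrA -mulrDr; apply: ler_wpM2l => //.
  apply: le_trans (_ : (`|w| + d) ^+ 2 <= _).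
    by rewrite ler_sqr ?nnegrE// addr_ge0// ltW.
  have := ler_wpM2l (ltW d0) d1; have := normr_ge0 w; cl.
have tr : box ta tb x0 r (t, x + w) by [].
have tr' : box ta tb x0 r (t', x + w) by [].
have := lr_lip lr tr tr'; rewrite subrr normr0 addr0 ler_norml => /andP[_ l1].
have sr : box ta tb x0 r (t, x) by split => //=; exact: ltW.
have sr' : box ta tb x0 r (t', x') by split => //=; exact: ltW.
have := lr_lip lr sr' sr; rewrite ler_norml => /andP[_ l2].
have l3 : K * `|t - t'| <= K * d by apply: ler_wpM2l => //; rewrite distrC ltW.
have l4 : K * (`|t' - t| + `|x' - x|) <= K * (d + d) by apply: ler_wpM2l => //; rewrite lerD// ltW.
by move: b1 b2 b3 l1 l2 l3 l4 dQ d0; rewrite /Q; cl.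
Qed.

Lemma continuous_subc (R : realType) (X : normedModType R) (x y : X) :
  {for y, continuous (fun z : X => z - x)}.
Proof. by apply: continuousB; [exact: cvg_id|exact: cvg_cst]. Qed.

(** Minimizing f + k |y - x| ^ 2 near x yields proximal subgradients at points tending to x; they
    are bounded by [L], and a cluster point is a supergradient at x. *)
Lemma sgrad_exists (R : realType) (n : nat) (f : 'rV[R]_n -> R) x0 (r K L : R) x :
  (forall x y, `|x - x0| <= r -> `|y - x0| <= r -> `|f x - f y| <= L * `|x - y|) ->
  semiconcave_ball f x0 r K -> 0 <= L -> 0 <= K -> `|x - x0| < r ->
  exists p, sgrad f x0 r K x p.
Proof.
move=> lip sc L0 K0 xr.
pose rho := (r - `|x - x0|) / 2.
have rho0 : 0 < rho by rewrite divr_gt0// subr_gt0.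
have rhor y : `|y - x| <= rho -> `|y - x0| < r.
  by move=> h; have := ler_distD x y x0; move: h xr; rewrite /rho; cl.
have L1 : 0 < L + 1 by rewrite ltr_wpDl.
have step (d : R) : 0 < d -> exists x' p', [/\ `|x' - x| < d, `|x' - x0| < r & sgrad f x0 r K x' p'].
  move=> d0; pose d' := Num.min d rho.
  have d'0 : 0 < d' by rewrite lt_min d0.
  (* A slope k d' above the Lipschitz constant forces the minimizer to lie within [d'] of x. *)
  pose k := (L + 1) / d'.
  have k0 : 0 < k by rewrite divr_gt0.
  pose g y := f y + k * dotp (y - x) (y - x).
  have cg : cont_on [set y | `|y - x| <= rho] g.
    apply: cont_onD.
      move=> z /= zr e e0; exists (e / (L + 1)); first by rewrite divr_gt0.
      move=> z' z'r zz'; apply: le_lt_trans (lip _ _ (ltW (rhor _ z'r)) (ltW (rhor _ zr))) _.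
      have : `|z' - z| * (L + 1) < e by rewrite -ltr_pdivlMr.
      by have := normr_ge0 (z' - z); cl.
    apply: cont_onZ; apply: continuous_cont_on => y _.
    have cs := @continuous_subc R _ x y.
    exact: dotp_continuous.
  have [|z zr zmin] := cont_on_min (@compact_cball R n x rho) _ cg.
    by exists x => /=; rewrite subrr normr0 ltW.
  have zd : `|z - x| < d'.
    have := zmin x; rewrite /= subrr normr0 => /(_ (ltW rho0)).
    rewrite /g subrr dotp0r mulr0 addr0 => h1.
    have [-> |zx] := eqVneq z x; first by rewrite subrr normr0.
    have zx0 : 0 < `|z - x| by rewrite normr_gt0 subr_eq0.
    have := lip x z (ltW xr) (ltW (rhor _ zr)); rewrite ler_norml => /andP[_ h2].
    have h3 := ler_wpM2l (ltW k0) (norm_sq_le (z - x)).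
    have h4 : k * `|z - x| * `|z - x| <= L * `|z - x|.
      by move: h1 h2 h3; rewrite (distrC x z); cl.
    rewrite ler_pM2r// in h4.
    have h5 : (L + 1) * `|z - x| <= L * d'.
      by move: h4; rewrite /k mulrAC ler_pdivrMr.
    rewrite ltNge; apply/negP => h6; have := ler_wpM2l L0 h6.
    by move: h5 h6 d'0; cl.
  have zdd : `|z - x| < d by apply: lt_le_trans zd _; rewrite ge_min lexx.
  have zdr : `|z - x| < rho by apply: lt_le_trans zd _; rewrite ge_min lexx orbT.
  exists z, ((- 2 * k) *: (z - x)); split => //; first exact: rhor.
  have q0 : 0 < rho - `|z - x| by rewrite subr_gt0.
  apply: (@sgrad_of_sub _ _ _ _ _ _ (k * n%:R) (rho - `|z - x|)) => //; first exact: rhor.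
  move=> y yz.
  have yr : `|y - x| <= rho by have := ler_distD z y x; move: yz; cl.
  have := zmin y yr; rewrite /g.
  have -> : y - x = (y - z) + (z - x) by rewrite addrA subrK.
  have := ler_wpM2l (ltW k0) (dotp_self_le (y - z)).
  move: (y - z) (z - x) => a b; rewrite !dotpDl !dotpDr dotpZl (dotpC a b); cl.
have H k : exists xp : 'rV[R]_n * 'rV[R]_n, [/\ `|xp.1 - x| < (k.+1%:R)^-1, `|xp.1 - x0| < r & sgrad f x0 r K xp.1 xp.2].
  have [|x' [p' h]] := step (k.+1%:R)^-1; first by rewrite invr_gt0.
  by exists (x', p').
have [g hg] := choice H.
have [|p _ hp] := compact_seq (z := fun k => (g k).2) (@compact_cball R n 0 L).
  move=> k /=; rewrite subr0; have [_ h1 h2] := hg k.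
  exact: sgrad_bound h2.
exists p; move=> w wr; apply/ler_addgt0Pr => e e0.
pose Q := L + n%:R * (`|w| + 1) + n%:R * `|p| + K * (2 * `|w| + 1) + 1.
have Q0 : 0 < Q by rewrite /Q ltr_wpDl// !addr_ge0 ?mulr_ge0 ?addr_ge0 ?mulr_ge0.
pose d := Num.min 1 (e / Q).
have d0 : 0 < d by rewrite lt_min ltr01 divr_gt0.
have d1 : d <= 1 by rewrite /d ge_min lexx.
have dQ : Q * d <= e by rewrite mulrC -ler_pdivlMr// /d ge_min lexx orbT.
have [k kb p'p] := hp d d0 (Num.bound `|d^-1|).
have [x'x x'r sg] := hg k.
set x' := (g k).1 in x'x x'r sg; set p' := (g k).2 in p'p sg.
have {}x'x : `|x' - x| < d.
  apply: lt_trans x'x _; rewrite -[ltRHS]invrK ltf_pV2 ?posrE ?invr_gt0//.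
  apply: le_lt_trans (ler_norm _) _; apply: lt_le_trans (archi_boundP _) _ => //.
  by rewrite ler_nat leqW.
have := sg (x + w - x'); rewrite [x' + _]addrC subrK => /(_ wr).
set w' := x + w - x'.
have -> : dotp p' w' = dotp p w + dotp (p' - p) w' + dotp p (x - x').
  by rewrite /w' !dotpBl !dotpBr !dotpDr; ring.
have nw' : `|w'| <= `|w| + d.
  have -> : w' = w - (x' - x) by rewrite /w'; vec.
  by apply: le_trans (ler_normB _ _) _; move: x'x; cl.
have b1 : dotp (p' - p) w' <= n%:R * (`|w| + 1) * d.
  apply: le_trans (ler_norm _) _; apply: le_trans (dotp_le _ _) _.
  rewrite -mulrA; apply: ler_wpM2l => //; rewrite mulrC; apply: ler_pM => //.
    by move: nw' d1; cl.
  exact: ltW.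
have b2 : dotp p (x - x') <= n%:R * `|p| * d.
  apply: le_trans (ler_norm _) _; apply: le_trans (dotp_le _ _) _.
  by rewrite -mulrA; apply: ler_wpM2l => //; apply: ler_wpM2l => //; rewrite distrC ltW.
have b3 : K * `|w'| ^+ 2 <= K * `|w| ^+ 2 + K * (2 * `|w| + 1) * d.
  rewrite -mulrA -mulrDr; apply: ler_wpM2l => //.
  apply: le_trans (_ : (`|w| + d) ^+ 2 <= _).
    by rewrite ler_sqr ?nnegrE// addr_ge0// ltW.
  have := ler_wpM2l (ltW d0) d1; have := normr_ge0 w; cl.
have := lip x' x (ltW x'r) (ltW xr); rewrite ler_norml => /andP[_ l2].
have l4 : L * `|x' - x| <= L * d by apply: ler_wpM2l => //; rewrite ltW.
by move: b1 b2 b3 l2 l4 dQ d0; rewrite /Q; cl.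
Qed.

Lemma grad_quadratic_ham (R : realType) (n : nat) (A : R * 'rV[R]_n -> 'M[R]_n) V (t : R) x p :
  (A (t, x))^T = A (t, x) -> grad (quadratic_ham A V t x) p = mxact (A (t, x)) p.
Proof.
move=> sym; apply/rowP => i; rewrite mxE.
pose e : 'rV[R]_n := delta_mx 0 i.
have d : is_derive p e (quadratic_ham A V t x) (dotp (mxact (A (t, x)) p) e).
  apply: (@is_derive_quadratic_line _ _ _ _ _ _ (2^-1 * bil (A (t, x)) e e)) => h.
  rewrite /quadratic_ham -!/(bil (A (t, x)) _ _) !bilDl !bilDr !bilZl !bilZr.
  by rewrite (bilC e p sym); field.
rewrite derive_val /dotp (bigD1 i)//= big1 ?addr0 => [|j ji]; rewrite !mxE/=.
  by rewrite eqxx mulr1.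
by rewrite (negbTE ji) mulr0.
Qed.

Lemma char_velocity `(lr : @local_reg R n u A V ta tb x0 r c m C M K) (t : R) x v :
  ta <= t <= tb -> `|x - x0| < r ->
  convex_hull (grad (quadratic_ham A V t x) @` superdiff_x u t x) v <->
  exists2 p, sgrad (fun y => u (t, y)) x0 r K x p & v = mxact (A (t, x)) p.
Proof.
move=> tI xr.
have sym : (A (t, x))^T = A (t, x) by apply: (cd_sym (lr_cd lr)); split => //=; exact: ltW.
split.
  pose S : set 'rV[R]_n := [set v | exists2 p, sgrad (fun y => u (t, y)) x0 r K x p & v = mxact (A (t, x)) p].
  suff H : convex_hull (grad (quadratic_ham A V t x) @` superdiff_x u t x) `<=` S by move=> /H.
  apply: smallest_sub; last first.
    by move=> _ [p /(superdiff_sgrad lr _ tI xr) sp <-]; exists p => //; exact: grad_quadratic_ham.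
  move=> v1 v2 a; rewrite !inE => -[p1 s1 ->] [p2 s2 ->].
  exists (a%:inum *: p1 + (1 - a%:inum) *: p2).
    by apply: sgrad_convex => //; rewrite ge0 le1.
  by rewrite mxactD !mxactZ.
move=> [p sp ->] S [cS hS]; apply: hS => /=.
by exists p; [apply/(superdiff_sgrad lr _ tI xr)|exact: grad_quadratic_ham].
Qed.

(** * Derivative of the solution along a curve *)

Ltac pos := repeat first [done | apply: divr_gt0 | apply: mulr_gt0 | apply: exprn_gt0 | apply/andP; split].

Lemma exists_small (R : realType) (s : seq R) : all (fun z => 0 < z) s ->
  exists2 h : R, 0 < h & all (fun z => h <= z) s.
Proof.
elim: s => [_|a s IH /= /andP[a0 /IH[h h0 hs]]]; first by exists 1.
exists (Num.min a h); rewrite ?lt_min ?a0//= ge_min lexx/=.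
by apply: sub_all hs => z hz; rewrite ge_min hz orbT.
Qed.

(** The quotient-free form of the derivative, valid for h = 0 as well, so that expansions are added
    without case distinctions. *)
Definition has_deriv (R : realType) (W : normedModType R) (f : R -> W) (t : R) (v : W) :=
  forall e : R, 0 < e -> exists2 d : R, 0 < d & forall h : R, `|h| < d ->
    `|f (t + h) - f t - h *: v| <= e * `|h|.

Lemma derivable_has_deriv (R : realType) (W : normedModType R) (f : R -> W) (t : R) :
  derivable f t 1 -> has_deriv f t (derive1 f t).
Proof.
move=> df e e0; have : h^-1 *: (f (h *: 1 + t) - f t) @[h --> 0^'] --> derive1 f t.
  by rewrite derive1E; exact: df.
move=> /cvgrPdist_le /(_ e e0); rewrite /dnbhs => /nbhs_normP[d /= d0 H].
exists d => // h hd; have [->|h0] := eqVneq h 0.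
  by rewrite addr0 subrr scale0r subrr !normr0 mulr0.
have := H h; rewrite /= sub0r normrN => /(_ hd h0).
rewrite [_ *: 1]mulr1 (addrC h t) => H1.
have -> : f (t + h) - f t - h *: derive1 f t = - (h *: (derive1 f t - h^-1 *: (f (t + h) - f t))).
  by rewrite scalerBr scalerA mulfV// scale1r opprB.
rewrite normrN normrZ mulrC; exact: ler_wpM2r.
Qed.

Lemma has_deriv_is_derive (R : realType) (W : normedModType R) (f : R -> W) (t : R) v :
  has_deriv f t v -> is_derive t 1 f v.
Proof.
move=> H; have lim : h^-1 *: (f (h *: 1 + t) - f t) @[h --> 0^'] --> v.
  apply/cvgrPdist_le => e e0; have [d d0 hd] := H e e0.
  rewrite /dnbhs; apply/nbhs_normP; exists d => //= h; rewrite /= sub0r normrN => h1 h0.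
  rewrite [_ *: 1]mulr1 (addrC h t).
  have -> : v - h^-1 *: (f (t + h) - f t) = - (h^-1 *: (f (t + h) - f t - h *: v)).
    by rewrite [in RHS]scalerBr scalerA mulVf// scale1r opprB.
  by rewrite normrN normrZ normfV mulrC ler_pdivrMr ?normr_gt0//; exact: hd.
apply: DeriveDef; last by rewrite /derive; apply/cvg_lim.
by apply/cvg_ex; exists v.
Qed.

Lemma lag_conj `(cd : @coef_data R n A V ta tb x0 r c m) (t : R) x q :
  box ta tb x0 r (t, x) -> lag A V t x (mxact (A (t, x)) q) =
  dotp q (mxact (A (t, x)) q) - ham A V t x q.
Proof.
move=> K; rewrite /lag /ham -(fenchel_eq (cd_c cd) (cd_ell cd K)); ring.
Qed.

(** Start at time t from y = gam (t + h) - h q, where q = A sig is the velocity dual to sig, and go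
    straight to gam (t + h). The cost is h L (q) + o (h), while u (t, y) is bounded through sig with
    y - x = h (v - q) + o (h); since L (q) = <sig, q> - H (sig), what remains is h (<sig, v> - H
    (sig)). *)
Lemma forward_ineq `(lr : @local_reg R n u A V ta tb x0 r c m C M K) (t : R) (gam : R -> 'rV[R]_n)
    v phi' sig :
  ta <= t < tb -> `|gam t - x0| < r -> has_deriv gam t v ->
  has_deriv (fun s => u (s, gam s)) t (phi' : R) -> sgrad (fun y => u (t, y)) x0 r K (gam t) sig ->
  phi' <= dotp sig v - ham A V t (gam t) sig.
Proof.
move=> /andP[tat ttb] xr dg dphi sg; have K0 := lr_K lr; have C1 := lb_C (lr_lb lr).
set x := gam t in xr sg *.
have Kx : box ta tb x0 r (t, x) by split => /=; [rewrite tat ltW|exact: ltW].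
pose q := mxact (A (t, x)) sig.
apply/ler_addgt0Pr => e e0.
have n1 : 0 < 2 * (1 + n%:R * `|sig|) by rewrite mulr_gt0// ltr_pwDl// mulr_ge0.
pose e1 := Num.min 1 (e / (2 * (1 + n%:R * `|sig|))).
have e10 : 0 < e1 by rewrite lt_min ltr01 divr_gt0.
have e11 : e1 <= 1 by rewrite /e1 ge_min lexx.
have e1n : e1 * (1 + n%:R * `|sig|) <= e / 2.
  have : e1 * (2 * (1 + n%:R * `|sig|)) <= e by rewrite -ler_pdivlMr// /e1 ge_min lexx orbT.
  by cl.
have [d1 d10 h1] := dg e1 e10; have [d2 d20 h2] := dphi e1 e10.
pose Q := `|v| + 1 + `|q|.
have Q0 : 0 < Q by rewrite /Q ltr_pwDl// ltr_wpDl.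
pose Z := C * (1 + Q) * (1 + `|q| ^+ 2) + K * Q ^+ 2 + 1.
have q20 : 0 <= `|q| ^+ 2 by exact: sqr_ge0.
have Z0 : 0 < Z.
  rewrite ltr_wpDl// addr_ge0//; last by rewrite mulr_ge0 ?sqr_ge0.
  apply: mulr_ge0; last by move: q20; cl.
  by apply: mulr_ge0; [move: C1; cl|move: Q0; cl].
have [|h h0 /= /and5P[hd1 hd2 ht hr /andP[hz _]]] := @exists_small R [:: d1 / 2; d2 / 2; (tb - t) / 2; (r - `|x - x0|) / Q; e / 2 / Z].
  by rewrite /= !divr_gt0 ?subr_gt0.
have hh : `|h| = h by rewrite gtr0_norm.
have hQ : h * Q <= r - `|x - x0| by rewrite -ler_pdivlMr.
have hZ : h * Z <= e / 2 by rewrite -ler_pdivlMr.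
pose y := gam (t + h) - h *: q.
have := h1 h; rewrite hh -/x => /(_ _) g1.
have {}g1 : `|gam (t + h) - x - h *: v| <= e1 * h by apply: g1; move: hd1 d10; cl.
have := h2 h; rewrite hh -/x => /(_ _) g2.
have {}g2 : `|u (t + h, gam (t + h)) - u (t, x) - h * phi'| <= e1 * h by apply: g2; move: hd2 d20; cl.
have e1h : e1 * h <= h by rewrite -[leRHS]mul1r; apply: ler_wpM2r => //; exact: ltW.
have nz (a : R) (z : 'rV[R]_n) : 0 <= a -> `|a *: z| = a * `|z| by move=> a0; rewrite normrZ ger0_norm.
have gx : `|gam (t + h) - x| <= h * (`|v| + 1).
  have -> : gam (t + h) - x = (gam (t + h) - x - h *: v) + h *: v by rewrite subrK.
  apply: le_trans (ler_normD _ _) _; rewrite (nz _ _ (ltW h0)); move: g1 e1h; cl.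
have yy s : t <= s <= t + h -> `|y + (s - t) *: q - x| <= h * Q.
  move=> /andP[s1 s2].
  have -> : y + (s - t) *: q - x = (gam (t + h) - x) - (t + h - s) *: q by rewrite /y; vec.
  apply: le_trans (ler_normB _ _) _; rewrite nz; last by move: s2; cl.
  have : (t + h - s) * `|q| <= h * `|q| by apply: ler_wpM2r => //; move: s1; cl.
  by move: gx; rewrite /Q; cl.
have yr s : t <= s <= t + h -> `|y + (s - t) *: q - x0| <= r.
  by move=> sI; have := ler_distD x (y + (s - t) *: q) x0; have := yy s sI; move: hQ; cl.
have I0 : t <= t <= t + h by move: h0; cl.
have Ih : t <= t + h <= t + h by move: h0; cl.
have yx : `|y - x| <= h * Q by have := yy t I0; rewrite subrr scale0r addr0.
have yx0 : `|y - x0| <= r by have := yr t I0; rewrite subrr scale0r addr0.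
have line : u (t + h, y + (t + h - t) *: q) <= u (t, y) + (t + h - t) * (lag A V t x q + C * (h + h * Q) * (1 + `|q| ^+ 2)).
  apply: (lr_line lr) => //; [by move: h0; cl|by move: ht h0; cl|exact: yr|].
  move=> s sI; have Ks : box ta tb x0 r (s, y + (s - t) *: q).
    by split => /=; [move: sI tat ht h0; cl|exact: yr].
  apply: le_trans (lb_lip (lr_lb lr) q Ks Kx) _; rewrite lerD2l.
  apply: ler_wpM2r; first by move: q20; cl.
  apply: ler_wpM2l; first by move: C1; cl.
  apply: lerD; last exact: yy.
  by rewrite ger0_norm; move: sI; cl.
have := sg (y - x); rewrite [x + _]addrC subrK => /(_ yx0) up.
have E1 : y + (t + h - t) *: q = gam (t + h) by rewrite /y; vec.
rewrite E1 in line.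
have E2 : dotp sig (y - x) = h * dotp sig (v - q) + dotp sig (gam (t + h) - x - h *: v).
  rewrite /y !dotpBr !dotpZr; ring.
have b1 : dotp sig (gam (t + h) - x - h *: v) <= n%:R * `|sig| * (e1 * h).
  apply: le_trans (ler_norm _) _; apply: le_trans (dotp_le _ _) _.
  by rewrite -mulrA; apply: ler_wpM2l => //; apply: ler_wpM2l.
have b2 : K * `|y - x| ^+ 2 <= K * (h * Q) ^+ 2.
  by apply: ler_wpM2l => //; rewrite ler_sqr ?nnegrE// mulr_ge0// ltW.
have b3 : h * (h * Z) <= h * (e / 2) by rewrite ler_pM2l.
have b4 : h * (e1 * (1 + n%:R * `|sig|)) <= h * (e / 2) by rewrite ler_pM2l.
have b5 : 0 <= h * h by rewrite mulr_ge0// ltW.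
have b6 : 0 <= h * h * (`|q| ^+ 2) by rewrite mulr_ge0.
have lc : lag A V t x q = dotp sig q - ham A V t x sig by exact: (lag_conj (lr_cd lr)).
rewrite -(ler_pM2l h0).
move: g2; rewrite ler_norml => /andP[g2 _].
move: line up g2 b1 b2 b3 b4 b5; rewrite E2 lc dotpBr /Z; cl.
Qed.

(** A mean value inequality from the supersolution property. The point [xi] moves with velocity v +
    th / ka from near gam (t - h) to x + (h / ka) th. As p is a supergradient, u grows along it at a
    mean rate at most phi' + <p, th> / ka, up to a small error; a penalized minimum gives a
    supergradient sig at a nearby point with <sig, v + th / ka> - H (sig) bounded by this rate plus
    e. *)
Lemma mean_value_approx `(lr : @local_reg R n u A V ta tb x0 r c m C M K) (t : R) (gam : R -> 'rV[R]_n)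
    v phi' p th (ka e : R) :
  ta < t < tb -> `|gam t - x0| < r -> has_deriv gam t v ->
  has_deriv (fun s => u (s, gam s)) t (phi' : R) -> sgrad (fun y => u (t, y)) x0 r K (gam t) p ->
  0 < ka -> 0 < e ->
  exists (s : R) y sig, [/\ `|s - t| < e, ta < s < tb, `|y - gam t| < e, `|y - x0| < r &
    sgrad (fun y => u (s, y)) x0 r K y sig /\
    dotp sig v - ham A V s y sig - phi' + dotp (sig - p) th / ka <= e].
Proof.
move=> /andP[tat ttb] xr dg dphi sg ka0 e0; have K0 := lr_K lr.
set x := gam t in xr sg *.
have Kx : box ta tb x0 r (t, x) by split => /=; [rewrite !ltW|exact: ltW].
have M0 : 0 <= M by exact: le_trans (normr_ge0 _) (sd_bnd (lr_sd lr) Kx).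
pose rho := (r - `|x - x0|) / 2.
have rho0 : 0 < rho by rewrite divr_gt0 ?subr_gt0.
have brho y : `|y - x| <= rho -> `|y - x0| < r.
  by move=> yx; have := ler_distD x y x0; move: yx rho0; rewrite /rho; cl.
pose w := v + ka^-1 *: th.
pose e1 := e / (4 * (1 + K)).
have e10 : 0 < e1 by rewrite divr_gt0// mulr_gt0// ltr_pwDl.
have [d1 d10 h1] := dg e1 e10; have [d2 d20 h2] := dphi e1 e10.
pose g := - phi' - dotp p th / ka - e.
pose Q := `|v| + `|w| + ka^-1 * `|th| + 1.
have Q0 : 0 < Q by rewrite /Q ltr_wpDl// !addr_ge0// mulr_ge0// invr_ge0 ltW.
pose Z := 4 * (2 * M + 2 * `|g| + 1).
have Z0 : 0 < Z by rewrite /Z mulr_gt0// ltr_wpDl// addr_ge0 ?mulr_ge0.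
pose Y := 4 * (K * `|th| ^+ 2 + 1).
have Y0 : 0 < Y by rewrite /Y mulr_gt0// ltr_wpDl// mulr_ge0 ?sqr_ge0.
have [|h h0 /= hs] := @exists_small R [:: 1; d1 / 2; d2 / 2; t - ta; rho / 2 / Q; e / 4 / Q; e / 4;
    rho ^+ 2 / 2 / Z / e; e / 4 / Z; ka ^+ 2 * e / Y; rho / 2 / e1].
  by rewrite /= ltr01 subr_gt0 tat /=; pos.
case/and5P: hs => k1 k2 k3 k4 /and5P[k5 k6 k7 k8 /and4P[k9 k10 k11 _]].
have hQ : h * Q <= rho / 2 by rewrite -ler_pdivlMr.
have hQe : h * Q <= e / 4 by rewrite -ler_pdivlMr.
have hZ : h * e * Z <= rho ^+ 2 / 2 by rewrite -ler_pdivlMr// -ler_pdivlMr.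
have hZe : h * Z <= e / 4 by rewrite -ler_pdivlMr.
have hY : h * Y <= ka ^+ 2 * e by rewrite -ler_pdivlMr.
pose a := t - h.
have ata : ta <= a by rewrite /a; move: k4; cl.
(* With kk h e = K ^ 2 + 1 the penalty absorbs the Lipschitz loss K |d| up to h e / 4, a quarter of
   the gap h e, and it is still large enough on the lateral face. *)
pose kk := (K ^+ 2 + 1) / (h * e).
have he0 : 0 < h * e by rewrite mulr_gt0.
have K20 : 0 <= K ^+ 2 by exact: sqr_ge0.
have kk0 : 0 < kk by rewrite divr_gt0// ltr_wpDl.
have kk1 : 1 <= kk * (h * e) by rewrite /kk divfK ?gt_eqF//; move: K20; cl.
pose xi (lam : R) : 'rV[R]_n := x - h *: v + (lam - a) *: w.
pose F (z : R * 'rV[R]_n) := kk * dotp (z.2 - xi z.1) (z.2 - xi z.1) + g * (z.1 - a).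
have nz (s : R) (z : 'rV[R]_n) : 0 <= s -> `|s *: z| = s * `|z| by move=> s0; rewrite normrZ ger0_norm.
have xir lam : a <= lam <= t -> `|xi lam - x| <= h * Q.
  move=> /andP[l1 l2]; have -> : xi lam - x = (lam - a) *: w - h *: v by rewrite /xi; vec.
  apply: le_trans (ler_normB _ _) _; rewrite !nz ?subr_ge0 ?(ltW h0)//.
  have : (lam - a) * `|w| <= h * `|w| by apply: ler_wpM2r => //; rewrite /a; move: l2; cl.
  have : 0 <= h * (ka^-1 * `|th| + 1).
    by rewrite mulr_ge0 ?(ltW h0)// addr_ge0// mulr_ge0// invr_ge0 ltW.
  by rewrite /Q; cl.
pose y1 := x + (h / ka) *: th.
have xit : xi t = y1.
  by apply/rowP => i; rewrite /xi /y1 /w /a !mxE; field; rewrite gt_eqF.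
have at_ : a <= t by rewrite /a; move: h0; cl.
have y1x : `|y1 - x| <= h * Q by rewrite -xit; apply: xir; rewrite at_ lexx.
have cF : cont_on (box a t x rho) F.
  apply: continuous_cont_on => z _.
  have cx : {for z, continuous (fun z : R * 'rV[R]_n => z.2 - xi z.1)}.
    have -> : (fun z : R * 'rV[R]_n => z.2 - xi z.1) =
      (fun z : R * 'rV[R]_n => (z.2 - (x - h *: v)) - (z.1 - a) *: w).
      by apply/funext => -[z1 z2]; rewrite /xi /=; vec.
    apply: continuousB.
      by apply: continuousB; [exact: cvg_snd|exact: cvg_cst].
    by apply: cvgZl; apply: cvgB; [exact: cvg_fst|exact: cvg_cst].
  apply: cvgD.
    by apply: cvgM; [exact: cvg_cst|exact: (dotp_continuous cx cx)].
  apply: cvgM; first exact: cvg_cst.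
  by apply: cvgB; [exact: cvg_fst|exact: cvg_cst].
have cu : cont_on (box ta tb x rho) (fun z => u z).
  apply: cont_onW (sd_cont (lr_sd lr)) => -[s y] [/= sI yx]; split => //=.
  by apply: ltW; exact: brho.
have F1 : F (t, y1) = g * h.
  by rewrite /F /= xit subrr dotp0r mulr0 add0r /a; congr (_ * _); ring.
have gn := ler_norm g; have gn' := ler_norm (- g); rewrite normrN in gn'.
have ybnd s y : ta <= s <= tb -> `|y - x| <= rho -> `|u (s, y)| <= M.
  by move=> sI yx; apply: (sd_bnd (lr_sd lr)); split => //=; exact/ltW/brho.
have y1rho : `|y1 - x| <= rho by move: y1x hQ rho0; cl.
have tI : ta <= t <= tb by rewrite !ltW.
have ub1 : u (t, y1) <= M by have := ybnd t y1 tI y1rho; rewrite ler_norml => /andP[].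
have Hlat (lam : R) (y : 'rV[R]_n) : a <= lam <= t -> `|y - x| = rho ->
     u (t, y1) + F (t, y1) < u (lam, y) + F (lam, y).
  move=> lI yr; rewrite F1 /F /=.
  have sI : ta <= lam <= tb by move: lI ata ttb; cl.
  have := ybnd lam y sI; rewrite yr lexx => /(_ isT); rewrite ler_norml => /andP[ub2 _].
  have d : rho / 2 <= `|y - xi lam|.
    by have := ler_distD (xi lam) y x; rewrite yr; have := xir lam lI; move: hQ; cl.
  have dd2 : (rho / 2) ^+ 2 <= dotp (y - xi lam) (y - xi lam).
    by apply: le_trans (norm_sq_le _); rewrite ler_sqr ?nnegrE// divr_ge0// ltW.
  have q1 := ler_wpM2l (ltW kk0) dd2.
  have q2 : h * e * Z * kk <= rho ^+ 2 / 2 * kk by apply: ler_wpM2r => //; exact: ltW.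
  have q3 : Z <= h * e * Z * kk.
    by have := ler_wpM2r (ltW Z0) kk1; cl.
  have lg : - `|g| <= g * (lam - a).
    rewrite -(mulr1 `|g|) -mulNr; apply: le_trans (_ : - `|g| * (lam - a) <= _).
      rewrite !mulNr lerN2; apply: ler_wpM2l => //.
      by rewrite /a; move: lI k1; cl.
    by apply: ler_wpM2r; [move: lI; cl|move: gn'; cl].
  have lg2 : g * h <= `|g|.
    rewrite -[leRHS]mulr1; apply: le_trans (_ : `|g| * h <= _); first by apply: ler_wpM2r => //; exact: ltW.
    by apply: ler_wpM2l.
  have := normr_ge0 g; move: q1 q2 q3 ub1 ub2 lg lg2 M0; rewrite /Z; cl.
have Ha (y : 'rV[R]_n) : `|y - x| <= rho -> u (t, y1) + F (t, y1) < u (a, y) + F (a, y).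
  move=> yx; rewrite F1 /F /= subrr mulr0 addr0.
  have xia : xi a = x - h *: v by rewrite /xi subrr scale0r addr0.
  set d := y - xi a.
  have aI : ta <= a <= tb by rewrite ata /a; move: h0 ttb; cl.
  have xiar : `|xi a - x| <= rho by have := xir a; rewrite lexx at_ => /(_ isT); move: hQ rho0; cl.
  have u1 : u (a, xi a) - K * `|d| <= u (a, y).
    have := lr_lipx lr aI (ltW (brho _ xiar)) (ltW (brho _ yx)).
    by rewrite (distrC (xi a)) -/d ler_norml => /andP[_]; cl.
  have gx : `|gam a - xi a| <= e1 * h.
    have := h1 (- h); rewrite normrN gtr0_norm// => /(_ _); rewrite -/a -/x xia.
    have -> : gam a - x - (- h) *: v = gam a - (x - h *: v) by vec.
    by apply; move: k2 d10; cl.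
  have gar : `|gam a - x0| <= r.
    have e1h : e1 * h <= rho / 2 by rewrite mulrC -ler_pdivlMr.
    have := ler_distD (xi a) (gam a) x; have := ler_distD x (gam a) x0.
    have := xir a; rewrite lexx at_ => /(_ isT).
    by move: hQ gx e1h rho0; rewrite /rho; cl.
  have u2 : u (a, gam a) - K * (e1 * h) <= u (a, xi a).
    have := lr_lipx lr aI gar (ltW (brho _ xiar)); rewrite ler_norml => /andP[_].
    by have := ler_wpM2l K0 gx; cl.
  have u3 : u (t, x) - h * phi' - e1 * h <= u (a, gam a).
    have := h2 (- h); rewrite normrN gtr0_norm// => /(_ _); rewrite -/a -/x ler_norml.
    move=> /(_ _)/andP[|+ _]; first by move: k3 d20; cl.
    by rewrite scaleNr /GRing.scale/=; cl.
  have u4 : u (t, y1) <= u (t, x) + h / ka * dotp p th + K * (h / ka * `|th|) ^+ 2.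
    have := sg ((h / ka) *: th); rewrite dotpZr nz; last by rewrite divr_ge0// ltW.
    by apply; exact: (ltW (brho _ y1rho)).
  have dd2 := norm_sq_le d.
  have q1 : K * `|d| <= kk * `|d| ^+ 2 + h * e / 4.
    have : 0 <= kk * (`|d| - K / (2 * kk)) ^+ 2 by rewrite mulr_ge0 ?sqr_ge0// ltW.
    have -> : kk * (`|d| - K / (2 * kk)) ^+ 2 = kk * `|d| ^+ 2 - K * `|d| + K ^+ 2 / (4 * kk).
      by field; rewrite gt_eqF.
    have : K ^+ 2 / (4 * kk) <= h * e / 4.
      rewrite ler_pdivrMr; last by rewrite mulr_gt0.
      have -> : h * e / 4 * (4 * kk) = kk * (h * e) by field.
      by rewrite /kk divfK ?gt_eqF//; cl.
    by cl.
  have q2 := ler_wpM2l (ltW kk0) dd2.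
  have q3 : e1 * h * (1 + K) = h * e / 4.
    by rewrite /e1; field; rewrite gt_eqF// ltr_pwDl.
  have q4 : K * (h / ka * `|th|) ^+ 2 <= h * e / 4.
    have -> : K * (h / ka * `|th|) ^+ 2 = h * (h * (K * `|th| ^+ 2)) / ka ^+ 2 by field; rewrite gt_eqF.
    rewrite ler_pdivrMr ?exprn_gt0// -!mulrA ler_pM2l//.
    by move: hY h0; rewrite /Y; cl.
  have q5 : g * h = - (h * phi') - h / ka * dotp p th - h * e by rewrite /g; ring.
  by move: u1 u2 u3 u4 q1 q2 q3 q4 q5 he0; cl.
have e20 : 0 < Num.min (e / 2) (tb - t) by rewrite lt_min divr_gt0//= subr_gt0.
have b1 : box a t x rho (t, y1) by split => //=; rewrite at_ lexx.
have [lam [s [tau [k [y [kp [lI sI yr sl] val prox lamin]]]]]] :=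
  moving_penalty cu cF ata (ltW ttb) b1 Ha Hlat e20.
pose sig := (- 2 * kk) *: (y - xi lam).
move: sl; rewrite lt_min => /andP[sl1 sl2].
have sta : ta < s by move: sI ata; cl.
have stb : s < tb by move: sl2; rewrite ltr_norml; move: lI; cl.
have lt_ : a <= lam <= t by move: lI; cl.
have yrr : `|y - x0| < r by apply: brho; exact: ltW.
have stI : ta <= s <= tb by rewrite !ltW.
pose k' := Num.max k kk.
have Fy (y' : 'rV[R]_n) : F (lam, y') - F (lam, y) = kk * dotp (y' - y) (y' - y) - dotp sig (y' - y).
  rewrite /F/=; have -> : y' - xi lam = (y' - y) + (y - xi lam) by rewrite addrA subrK.
  rewrite /sig; move: (y' - y) (y - xi lam) => a' b'.
  by rewrite !dotpDl !dotpDr dotpZl (dotpC a' b'); ring.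
exists s, y, sig; split => //.
- by move: sl1 lI k7 h0; rewrite !ltr_norml /a; cl.
- by rewrite sta.
- have := ler_distD (xi lam) y x; have := xir lam lt_.
  have : `|y - xi lam| ^+ 2 <= (e / 2) ^+ 2.
    have q1 := ler_wpM2l (ltW kk0) (norm_sq_le (y - xi lam)).
    have ys := ybnd s y stI (ltW yr).
    move: ys; rewrite ler_norml => /andP[ys _].
    have lg : - `|g| <= g * (lam - a).
      rewrite -(mulr1 `|g|) -mulNr; apply: le_trans (_ : - `|g| * (lam - a) <= _).
        rewrite !mulNr lerN2; apply: ler_wpM2l => //.
        by rewrite /a; move: lt_ k1; cl.
      by apply: ler_wpM2r; [move: lt_; cl|move: gn'; cl].
    have lg2 : g * h <= `|g|.
      rewrite -[leRHS]mulr1; apply: le_trans (_ : `|g| * h <= _); first by apply: ler_wpM2r => //; exact: ltW.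
      by apply: ler_wpM2l.
    have q2 : kk * `|y - xi lam| ^+ 2 <= Z.
      move: val q1 ys lg lg2 ub1 (normr_ge0 g) M0; rewrite F1 /F/= /Z; cl.
    have q3 : kk * `|y - xi lam| ^+ 2 <= kk * (h * e * Z).
      by apply: le_trans q2 _; rewrite mulrA -[leLHS]mul1r ler_pM2r.
    rewrite ler_pM2l// in q3; apply: (le_trans q3).
    by have := ler_wpM2l (ltW e0) hZe; rewrite expr2; cl.
  rewrite ler_sqr ?nnegrE ?divr_ge0 ?(ltW e0)//.
  by move: hQe e0; cl.
have prox2 (s' : R) (y' : 'rV[R]_n) : a <= a -> ta <= s' <= tb -> `|y' - x| <= rho ->
    u (s, y) + tau * (s' - s) + dotp sig (y' - y) - k' * ((s' - s) ^+ 2 + dotp (y' - y) (y' - y)) <= u (s', y').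
  move=> _ s'I y'r; have := prox s' y' s'I y'r; rewrite Fy.
  have l1 : k <= k' by rewrite /k' le_max lexx.
  have l2 : kk <= k' by rewrite /k' le_max lexx orbT.
  have := ler_wpM2r (sqr_ge0 (s' - s)) l1; have := ler_wpM2r (dotp_ge0 (y' - y)) l2.
  by cl.
pose d := Num.min (Num.min (s - ta) (tb - s)) (rho - `|y - x|).
have dp : 0 < d by rewrite !lt_min !subr_gt0 sta stb yr.
have prox3 (s' : R) (y' : 'rV[R]_n) : `|s' - s| < d -> `|y' - y| < d ->
    u (s, y) + tau * (s' - s) + dotp sig (y' - y) - k' * ((s' - s) ^+ 2 + dotp (y' - y) (y' - y)) <= u (s', y').
  rewrite !lt_min => /andP[/andP[a1 a2] _] /andP[_ a3]; apply: prox2 => //.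
    by move: a1 a2; rewrite !ltr_norml; cl.
  by have := ler_distD y y' x; move: a3; cl.
have sup : 0 <= tau + ham A V s y sig.
  by apply: (sd_sup (lr_sd lr) _ yrr dp prox3); rewrite sta.
split.
  apply: (@sgrad_of_sub _ _ _ _ _ _ (k' * n%:R) d) => //; first exact: (lr_sc lr).
  move=> y' y'd; have := prox3 s y'; rewrite subrr normr0 => /(_ dp y'd).
  rewrite mulr0 expr0n/= add0r addr0.
  have k'0 : 0 <= k' by rewrite /k' le_max (ltW kp).
  by have := ler_wpM2l k'0 (dotp_self_le (y' - y)); cl.
(* Minimality in [lam] towards the past; together with the supersolution inequality [sup] it
   eliminates tau. *)
have tau_le : tau + dotp sig w + g <= 0.
  apply: (@deriv_le_of_quadratic _ _ (k + kk * dotp w w) (lam - a)); first by move: lI; cl.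
  move=> dl dl0 dla; have := lamin (lam - dl).
  have -> : F (lam - dl, y) = F (lam, y) + kk * (2 * dl * dotp (y - xi lam) w + dl ^+ 2 * dotp w w) - g * dl.
    rewrite /F/=; have -> : y - xi (lam - dl) = (y - xi lam) + dl *: w by rewrite /xi; vec.
    move: (y - xi lam) => b'; move: (w) => w'.
    by rewrite !dotpDl !dotpDr !dotpZl !dotpZr (dotpC w' b'); ring.
  move=> /(_ _) H; have {}H : F (lam, y) - tau * (lam - dl - lam) - k * (lam - dl - lam) ^+ 2 <= F (lam, y) + kk * (2 * dl * dotp (y - xi lam) w + dl ^+ 2 * dotp w w) - g * dl.
    by apply: H; move: lI dl0 dla; cl.
  by rewrite /sig dotpZl; move: H; cl.
move: tau_le sup; rewrite /w dotpDr dotpZr /g dotpBl.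
have -> : (dotp sig th - dotp p th) / ka = ka^-1 * dotp sig th - dotp p th / ka by rewrite mulrBl mulrC.
by cl.
Qed.

Lemma ham_lip `(lr : @local_reg R n u A V ta tb x0 r c m C M K) : exists2 Ch : R, 0 <= Ch &
  forall (s t : R) y x p q, box ta tb x0 r (s, y) -> box ta tb x0 r (t, x) -> `|p| <= K -> `|q| <= K ->
  `|ham A V s y p - ham A V t x q| <= Ch * (`|s - t| + `|y - x| + `|p - q|).
Proof.
have K0 := lr_K lr; have m0 := cd_m (lr_cd lr).
pose a := n%:R ^+ 2 * m * K ^+ 2; pose b := n%:R ^+ 2 * m * K.
have a0 : 0 <= a by rewrite !mulr_ge0 ?sqr_ge0.
have b0 : 0 <= b by rewrite !mulr_ge0 ?sqr_ge0.
exists (a + b + m); first by rewrite !addr_ge0.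
move=> s t y x p q K1 K2 pK qK.
have -> : ham A V s y p - ham A V t x q = 2^-1 * bil (A (s, y) - A (t, x)) p p +
   2^-1 * bil (A (t, x)) (p - q) p + 2^-1 * bil (A (t, x)) q (p - q) + (V (s, y) - V (t, x)).
  by rewrite /ham bilBm !bilBl !bilBr; ring.
set D := `|s - t| + `|y - x|.
have D0 : 0 <= D by rewrite addr_ge0.
have b1 : `|bil (A (s, y) - A (t, x)) p p| <= a * D.
  apply: le_trans (bil_le _ _ _) _.
  have -> : a * D = n%:R ^+ 2 * (m * D * K * K) by rewrite /a; ring.
  apply: ler_wpM2l; first exact: sqr_ge0.
  have h1 := cd_Alip (lr_cd lr) K1 K2; rewrite /= -/D in h1.
  by apply: ler_pM => //; exact: ler_pM.
have b2 : `|bil (A (t, x)) (p - q) p| <= b * `|p - q|.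
  apply: le_trans (bil_le _ _ _) _.
  have -> : b * `|p - q| = n%:R ^+ 2 * (m * `|p - q| * K) by rewrite /b; ring.
  apply: ler_wpM2l; first exact: sqr_ge0.
  apply: ler_pM => //.
  by apply: ler_wpM2r => //; exact: (cd_Abnd (lr_cd lr) K2).
have b3 : `|bil (A (t, x)) q (p - q)| <= b * `|p - q|.
  apply: le_trans (bil_le _ _ _) _.
  have -> : b * `|p - q| = n%:R ^+ 2 * (m * K * `|p - q|) by rewrite /b; ring.
  apply: ler_wpM2l; first exact: sqr_ge0.
  apply: ler_wpM2r => //; apply: ler_pM => //; exact: (cd_Abnd (lr_cd lr) K2).
have b4 := cd_Vlip (lr_cd lr) K1 K2; rewrite /= -/D in b4.
move: b1 b2 b3 b4; rewrite !ler_norml => /andP[b11 b12] /andP[b21 b22] /andP[b31 b32] /andP[b41 b42].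
have q1 : 0 <= a * D by rewrite mulr_ge0.
have q2 : 0 <= b * D by rewrite mulr_ge0.
have q3 : 0 <= (a + m) * `|p - q| by rewrite mulr_ge0// addr_ge0.
apply/andP; split.
  by move: b11 b21 b31 b41 q1 q2 q3; cl.
by move: b12 b22 b32 b42 q1 q2 q3; cl.
Qed.

(** Compactness of superdifferentials. [P] is not assumed closed: the conclusion keeps
    approximations satisfying [P] at every scale, and each application passes to the limit in its
    own inequality. *)
Lemma sgrad_limit `(lr : @local_reg R n u A V ta tb x0 r c m C M K) (t : R) x
    (P : R -> R -> 'rV[R]_n -> 'rV[R]_n -> Prop) :
  ta <= t <= tb -> `|x - x0| < r -> (forall d d' s y sg, d <= d' -> P d s y sg -> P d' s y sg) ->
  (forall d : R, 0 < d -> exists (s : R) y sg, [/\ `|s - t| < d, `|y - x| < d, ta <= s <= tb, `|y - x0| < r &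
     sgrad (fun z => u (s, z)) x0 r K y sg /\ P d s y sg]) ->
  exists2 sg, sgrad (fun z => u (t, z)) x0 r K x sg &
   forall d : R, 0 < d -> exists (s : R) y sg', [/\ `|s - t| < d, `|y - x| < d, `|sg' - sg| < d, ta <= s <= tb &
     [/\ `|y - x0| < r, `|sg'| <= K & P d s y sg']].
Proof.
move=> tI xr mono H; have K0 := lr_K lr.
have Hk k : exists q : R * 'rV[R]_n * 'rV[R]_n, [/\ `|q.1.1 - t| < (k.+1%:R)^-1, `|q.1.2 - x| < (k.+1%:R)^-1,
    ta <= q.1.1 <= tb, `|q.1.2 - x0| < r &
     sgrad (fun z => u (q.1.1, z)) x0 r K q.1.2 q.2 /\ P (k.+1%:R)^-1 q.1.1 q.1.2 q.2].
  have [|s [y [sg h]]] := H (k.+1%:R)^-1; first by rewrite invr_gt0.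
  by exists (s, y, sg).
have [g hg] := choice Hk.
have gK k : `|(g k).2| <= K.
  by have [_ _ h1 h2 [h3 _]] := hg k; exact: (sgrad_bnd lr h1 h2 h3).
have [|sg _ hsg] := compact_seq (z := fun k => (g k).2) (@compact_cball R n 0 K).
  by move=> k /=; rewrite subr0.
have near (d : R) : 0 < d -> exists k, (k.+1%:R)^-1 < d /\ `|(g k).2 - sg| < d.
  move=> d0; have [k kb h] := hsg d d0 (Num.bound `|d^-1|).
  exists k; split => //; rewrite -[ltRHS]invrK ltf_pV2 ?posrE ?invr_gt0//.
  apply: le_lt_trans (ler_norm _) _; apply: lt_le_trans (archi_boundP _) _ => //.
  by rewrite ler_nat leqW.
exists sg.
  apply: (sgrad_closed lr) => // d /near[k [kd h]].
  have [h1 h2 h3 h4 [h5 _]] := hg k.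
  exists (g k).1.1, (g k).1.2, (g k).2; split => //; [exact: lt_trans kd|exact: lt_trans kd].
move=> d /near[k [kd h]].
have [h1 h2 h3 h4 [h5 h6]] := hg k.
exists (g k).1.1, (g k).1.2, (g k).2; split => //; [exact: lt_trans kd|exact: lt_trans kd|].
by split => //; apply: mono h6; exact: ltW.
Qed.

(** Limit of [mean_value_approx] as its e tends to 0: sig now belongs to the superdifferential at
    gam t itself. *)
Lemma mean_value_kappa `(lr : @local_reg R n u A V ta tb x0 r c m C M K) (t : R) (gam : R -> 'rV[R]_n)
    v phi' p th (ka : R) :
  ta < t < tb -> `|gam t - x0| < r -> has_deriv gam t v ->
  has_deriv (fun s => u (s, gam s)) t (phi' : R) -> sgrad (fun y => u (t, y)) x0 r K (gam t) p ->
  0 < ka ->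
  exists2 sig, sgrad (fun y => u (t, y)) x0 r K (gam t) sig &
    dotp sig v - ham A V t (gam t) sig - phi' + dotp (sig - p) th / ka <= 0.
Proof.
move=> tI xr dg dphi sg ka0; have tI' : ta <= t <= tb by move: tI; cl.
have [|d d'|sig sgs hs] := sgrad_limit lr tI' xr
  (P := fun d s y sg => dotp sg v - ham A V s y sg - phi' + dotp (sg - p) th / ka <= d).
- by move=> d d' s y sg0 dd h; exact: le_trans dd.
- have [s1 [y1 [sg1 [h1 h2 h3 h4 [h5 h6]]]]] := @mean_value_approx _ _ _ _ _ _ _ _ _ _ _ _ _ _ lr _ _ _ _ _ th _ _ tI xr dg dphi sg ka0 d'.
  by exists s1, y1, sg1; split => //; move: h2; cl.
exists sig => //; apply/ler_addgt0Pr => e e0; rewrite add0r.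
have [Ch Ch0 hH] := ham_lip lr.
pose Q := n%:R * `|v| + 3 * Ch + n%:R * `|th| / ka + 1.
have Q0 : 0 < Q.
  rewrite /Q ltr_wpDl// !addr_ge0 ?mulr_ge0// ?invr_ge0; exact: ltW.
have [s [y [sg' [h1 h2 h3 h4 [h5 h6 h7]]]]] := hs (e / Q) (divr_gt0 e0 Q0).
set d := e / Q in h1 h2 h3 h7.
have K1 : box ta tb x0 r (s, y) by split => //=; exact: ltW.
have K2 : box ta tb x0 r (t, gam t) by split => //=; exact: ltW.
have sK := sgrad_bnd lr tI' xr sgs.
have := hH _ _ _ _ _ _ K1 K2 h6 sK; rewrite ler_norml => /andP[_ g1].
have g1' : Ch * (`|s - t| + `|y - gam t| + `|sg' - sig|) <= Ch * (3 * d).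
  by apply: ler_wpM2l => //; move: h1 h2 h3; cl.
have g2 : - (n%:R * `|v| * d) <= dotp (sg' - sig) v.
  have := dotp_le (sg' - sig) v; rewrite ler_norml => /andP[+ _].
  have : n%:R * (`|sg' - sig| * `|v|) <= n%:R * (d * `|v|).
    by apply: ler_wpM2l => //; apply: ler_wpM2r => //; exact: ltW.
  by cl.
have g3 : - (n%:R * `|th| / ka * d) <= dotp (sg' - sig) th / ka.
  have := dotp_le (sg' - sig) th; rewrite ler_norml => /andP[+ _].
  have : n%:R * (`|sg' - sig| * `|th|) <= n%:R * (d * `|th|).
    by apply: ler_wpM2l => //; apply: ler_wpM2r => //; exact: ltW.
  move=> a1 a2; have : - (n%:R * (d * `|th|)) <= dotp (sg' - sig) th by move: a1 a2; cl.
  have ki : 0 <= ka^-1 by rewrite invr_ge0 ltW.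
  by move=> /(ler_wpM2r ki); cl.
have Qd : Q * d = e by rewrite /d mulrC divfK// gt_eqF.
move: h7 g1 g1' g2 g3 Qd; rewrite !dotpBl /Q; cl.
Qed.

(* The inequality for large ka forces the minimum of the first term in the
   limit, while forward_ineq gives the sign of the second one for every ka. *)
Lemma mean_value_select `(lr : @local_reg R n u A V ta tb x0 r c m C M K) (t : R) (gam : R -> 'rV[R]_n)
    v phi' p th :
  ta < t < tb -> `|gam t - x0| < r -> has_deriv gam t v ->
  has_deriv (fun s => u (s, gam s)) t (phi' : R) -> sgrad (fun y => u (t, y)) x0 r K (gam t) p ->
  exists sig, [/\ sgrad (fun y => u (t, y)) x0 r K (gam t) sig,
    phi' = dotp sig v - ham A V t (gam t) sig & dotp (sig - p) th <= 0].
Proof.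
move=> tI xr dg dphi sg; have tI' : ta <= t <= tb by move: tI; cl.
have tI'' : ta <= t < tb by move: tI; cl.
have K0 := lr_K lr.
have fw q := @forward_ineq _ _ _ _ _ _ _ _ _ _ _ _ _ _ lr t gam v phi' q tI'' xr dg dphi.
have [|d d0|sig sgs hs] := sgrad_limit lr tI' xr
  (P := fun d s y sg => [/\ s = t, y = gam t, dotp sg v - ham A V t (gam t) sg - phi' <= d & dotp (sg - p) th <= 0]).
- by move=> d d' s y sg0 dd [h1 h2 h3 h4]; split => //; exact: le_trans dd.
(* |<sig - p, th>| <= Z for any two supergradients, so with ka = Z / d the second term of
   [mean_value_kappa] is at most d in absolute value. *)
- pose Z := n%:R * (2 * K * `|th|) + 1.
  have Z0 : 0 < Z by rewrite /Z ltr_wpDl// !mulr_ge0.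
  have ka0 : 0 < Z / d by rewrite divr_gt0.
  have [sig sgs h] := @mean_value_kappa _ _ _ _ _ _ _ _ _ _ _ _ _ _ lr _ _ _ _ _ th _ tI xr dg dphi sg ka0.
  have f1 := fw _ sgs.
  have kd : 0 < (Z / d)^-1 by rewrite invr_gt0.
  exists t, (gam t), sig; split => //; rewrite ?subrr ?normr0//; split => //; split => //.
    have pK := sgrad_bnd lr tI' xr sg; have sK := sgrad_bnd lr tI' xr sgs.
    have a1 : - Z <= dotp (sig - p) th.
      have := dotp_le (sig - p) th; rewrite ler_norml => /andP[+ _].
      have : n%:R * (`|sig - p| * `|th|) <= n%:R * (2 * K * `|th|).
        apply: ler_wpM2l => //; apply: ler_wpM2r => //.
        by apply: le_trans (ler_normB _ _) _; move: pK sK; cl.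
      by rewrite /Z; cl.
    have := ler_wpM2r (ltW kd) a1.
    have -> : - Z * (Z / d)^-1 = - d by field; rewrite !gt_eqF.
    by move: h; cl.
  have : dotp (sig - p) th / (Z / d) <= 0 by move: h f1; cl.
  by rewrite pmulr_lle0.
have [Ch Ch0 hH] := ham_lip lr.
have K2 : box ta tb x0 r (t, gam t) by split => //=; exact: ltW.
have sK := sgrad_bnd lr tI' xr sgs.
exists sig; split => //.
  apply/eqP; rewrite eq_le fw//=; apply/ler_addgt0Pr => e e0.
  pose Q := n%:R * `|v| + Ch + 1.
  have Q0 : 0 < Q by rewrite /Q ltr_wpDl// !addr_ge0 ?mulr_ge0.
  have [s [y [sg' [h1 h2 h3 h4 [h5 h6 [es ey h7 h8]]]]]] := hs (e / Q) (divr_gt0 e0 Q0).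
  set d := e / Q in h1 h2 h3 h7.
  have := hH _ _ _ _ _ _ K2 K2 h6 sK; rewrite !subrr !normr0 !add0r ler_norml => /andP[_ g1].
  have g1' : Ch * `|sg' - sig| <= Ch * d by apply: ler_wpM2l => //; exact: ltW.
  have g2 : - (n%:R * `|v| * d) <= dotp (sg' - sig) v.
    have := dotp_le (sg' - sig) v; rewrite ler_norml => /andP[+ _].
    have : n%:R * (`|sg' - sig| * `|v|) <= n%:R * (d * `|v|).
      by apply: ler_wpM2l => //; apply: ler_wpM2r => //; exact: ltW.
    by cl.
  have Qd : Q * d = e by rewrite /d mulrC divfK// gt_eqF.
  by move: h7 g1 g1' g2 Qd; rewrite !dotpBl /Q; cl.
apply/ler_addgt0Pr => e e0; rewrite add0r.
pose Q := n%:R * `|th| + 1.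
have Q0 : 0 < Q by rewrite /Q ltr_wpDl// mulr_ge0.
have [s [y [sg' [h1 h2 h3 h4 [h5 h6 [es ey h7 h8]]]]]] := hs (e / Q) (divr_gt0 e0 Q0).
set d := e / Q in h1 h2 h3 h7.
have g2 : - (n%:R * `|th| * d) <= dotp (sg' - sig) th.
  have := dotp_le (sg' - sig) th; rewrite ler_norml => /andP[+ _].
  have : n%:R * (`|sg' - sig| * `|th|) <= n%:R * (d * `|th|).
    by apply: ler_wpM2l => //; apply: ler_wpM2r => //; exact: ltW.
  by cl.
have Qd : Q * d = e by rewrite /d mulrC divfK// gt_eqF.
have d0 : 0 < d by rewrite divr_gt0.
by move: h8 g2 Qd d0; rewrite !dotpBl /Q; cl.
Qed.

(** * Action of Lipschitz curves *)

Definition lip_on (R : realType) (W : normedModType R) (f : R -> W) (a b L : R) :=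
  forall x y : R, a <= x -> x <= y -> y <= b -> `|f y - f x| <= L * (y - x).

Lemma has_deriv_vec (R : realType) (n : nat) (f : R -> 'rV[R]_n) (t : R) (v : 'rV[R]_n) :
  (forall i, has_deriv (fun s => f s 0 i) t (v 0 i : R)) -> has_deriv f t v.
Proof.
move=> H e e0.
have /choice[d hd] : forall i, exists d : R, 0 < d /\ forall h : R, `|h| < d ->
    `|f (t + h) 0 i - f t 0 i - h *: v 0 i| <= e * `|h|.
  by move=> i; have [d d0 hd] := H i e e0; exists d.
exists (\big[Num.min/1]_i d i).
  by apply: (big_ind (fun x => 0 < x)) => // [x y x0 y0|i _]; [rewrite lt_min x0|have [] := hd i].
move=> h hh; apply: norm_le_coord => [|j i]; first by rewrite mulr_ge0// ltW.
rewrite !mxE (ord1 j); have [_ h1] := hd i; apply: h1.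
by apply: lt_le_trans hh _; exact: bigmin_le_cond.
Qed.

Lemma lip_deriv_le (R : realType) (W : normedModType R) (f : R -> W) (a b L t : R) v : 0 <= L ->
  lip_on f a b L -> a < t < b -> has_deriv f t v -> `|v| <= L.
Proof.
move=> L0 fL /andP[at_ tb] dv; apply/ler_addgt0Pr => e e0.
have [d d0 hd] := dv e e0.
pose h := Num.min (d / 2) (b - t).
have h0 : 0 < h by rewrite lt_min divr_gt0//= subr_gt0.
have hd2 : h < d by apply: (@le_lt_trans _ _ (d / 2)); [rewrite ge_min lexx|move: d0; cl].
have hb : h <= b - t by rewrite ge_min lexx orbT.
have := hd h; rewrite gtr0_norm// => /(_ hd2) h1.
have := fL t (t + h); rewrite (addrC t) addrK => h2.
have {}h2 : `|f (t + h) - f t| <= L * h by rewrite (addrC t); apply: h2; [exact: ltW|move: h0; cl|move: hb; cl].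
have : `|h *: v| <= L * h + e * h.
  have -> : h *: v = (f (t + h) - f t) - (f (t + h) - f t - h *: v) by rewrite opprB addrCA subrr addr0.
  by apply: le_trans (ler_normB _ _) _; exact: lerD.
by rewrite normrZ gtr0_norm// -mulrDl mulrC ler_pM2r.
Qed.

Lemma has_deriv_unique (R : realType) (f : R -> R) (t v w : R) :
  has_deriv f t v -> has_deriv f t w -> v = w.
Proof.
by move=> /has_deriv_is_derive[_ <-] /has_deriv_is_derive[_ <-].
Qed.

Lemma ae_true (R : realType) (P : R -> Prop) : (forall t, P t) -> {ae @lebesgue_measure R, forall t, P t}.
Proof. exact: (@filterE _ _ (ae_filter_ringOfSetsType (@lebesgue_measure R))). Qed.

Lemma curve_velocity (R : realType) (n : nat) (gam : R -> 'rV[R]_n) (a b L : R) : a < b -> 0 <= L ->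
  lip_on gam a b L ->
  exists h : R -> 'rV[R]_n, [/\ forall i, measurable_fun setT (fun t => h t 0 i),
    forall t, `|h t| <= L &
    {ae @lebesgue_measure R, forall t, a < t < b -> has_deriv gam t (h t)}].
Proof.
move=> ab L0 gL.
have comp i : exists g : R -> R, [/\ measurable_fun setT g, forall t, `|g t| <= L &
    {ae @lebesgue_measure R, forall t, a < t < b -> has_deriv (fun s => gam s 0 i) t (g t)}].
  have gLi : lip_on (fun s => gam s 0 i) a b L.
    move=> x y ax xy yb; apply: le_trans (gL x y ax xy yb).
    by have := coord_le_norm (gam y - gam x) 0 i; rewrite !mxE.
  have [h [hi _ hE]] := lipschitz_ae_derive ab gLi.
  (* The density is cut off at +-L and set to 0 outside ]a, b], so that it is bounded and measurable
     on the whole line; almost everywhere on ]a, b[ this changes nothing, because derivatives are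
     bounded by L. *)
  pose g t := Num.max (- L) (Num.min L (h t * \1_(`]a, b]%classic) t)).
  exists g; split.
  - apply: measurable_maxr; first exact: measurable_cst.
    apply: measurable_minr; first exact: measurable_cst.
    have mh := measurable_int _ hi.
    have mab : measurable (`]a, b]%classic : set (measurableTypeR R)) by exact: measurable_itv.
    have mh' : measurable_fun (`]a, b]%classic : set (measurableTypeR R)) h.
      exact/measurable_EFinP.
    have -> : (fun t => h t * \1_(`]a, b]%classic) t) = h \_ `]a, b].
      apply/funext => t; rewrite /patch indicE.
      by case: ifP => _; rewrite ?mulr1 ?mulr0.
    exact/(measurable_restrictT _ mab).
  - move=> t; rewrite ler_norml /g; apply/andP; split; first by rewrite le_max lexx.
    rewrite ge_max ge_min lexx /= andbT; move: L0; cl.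
  apply: ae_impl hE => t ht /andP[at_ tb]; have [dg hg] := ht (introT andP (conj at_ tb)).
  have dv := derivable_has_deriv dg; rewrite hg in dv.
  have := lip_deriv_le L0 gLi (introT andP (conj at_ tb)) dv; rewrite ler_norml => /andP[h1 h2].
  suff -> : g t = h t by [].
  rewrite /g indicE mem_set ?mulr1; last by rewrite /= in_itv/= at_ ltW.
  by rewrite min_r// max_r.
have [h hh] := choice comp.
exists (fun t => \row_i h i t); split.
- by move=> i; have [h1 _ _] := hh i; apply: eq_measurable_fun h1 => t _; rewrite mxE.
- by move=> t; apply: norm_le_coord => // j i; rewrite mxE; have [_ h1 _] := hh i.
have all_i (k : nat) : {ae @lebesgue_measure R, forall t, forall i : 'I_n, (i < k)%N -> a < t < b -> has_deriv (fun s => gam s 0 i) t (h i t)}.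
  elim: k => [|k IH]; first exact: ae_true.
  have [kn|kn] := ltnP k n.
    have [_ _ hk] := hh (Ordinal kn).
    apply: ae_impl (ae_and IH hk) => t [h1 h2] i; rewrite ltnS leq_eqVlt => /predU1P[ik|ik] tI.
      have -> : i = Ordinal kn by apply: val_inj.
      exact: h2.
    exact: h1.
  apply: ae_impl IH => t h1 i ik; apply: h1.
  exact: leq_trans (ltn_ord i) kn.
apply: ae_impl (all_i n) => t ht tI; apply: has_deriv_vec => i.
by rewrite mxE; exact: ht.
Qed.

Lemma lip_on_continuous (R : realType) (f : R -> R) (L : R) :
  (forall x y, `|f x - f y| <= L * `|x - y|) -> continuous f.
Proof.
move=> fL x; apply/cvgrPdist_lt => e e0.
have L1 : 0 < `|L| + 1 by rewrite ltr_wpDl.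
apply/nbhs_normP; exists (e / (`|L| + 1)) => /= [|y xy]; first by rewrite divr_gt0.
apply: le_lt_trans (fL x y) _; apply: le_lt_trans (_ : (`|L| + 1) * `|x - y| < e).
  by apply: ler_wpM2r => //; have := ler_norm L; cl.
by rewrite mulrC -ltr_pdivlMr.
Qed.

Definition clamp (R : realType) (a b s : R) : R := Num.max a (Num.min b s).

Lemma clamp_itv (R : realType) (a b s : R) : a <= b -> a <= clamp a b s <= b.
Proof. by move=> ab; rewrite /clamp le_max lexx ge_max ab ge_min lexx. Qed.

Lemma clamp_id (R : realType) (a b s : R) : a <= s <= b -> clamp a b s = s.
Proof. by move=> /andP[h1 h2]; rewrite /clamp min_r// max_r. Qed.

Lemma clamp_lip (R : realType) (a b s t : R) : `|clamp a b s - clamp a b t| <= `|s - t|.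
Proof.
rewrite /clamp ler_norml; have := ler_norm (s - t); have := ler_norm (- (s - t)); rewrite normrN.
have := normr_ge0 (s - t).
by case: (leP b s) => h1; case: (leP b t) => h2; case: (leP a b) => h3; case: (leP a s) => h4;
  case: (leP a t) => h5; lra.
Qed.

Lemma bil_sum (R : realType) (n : nat) (M : 'M[R]_n) v w :
  bil M v w = \sum_(i < n) \sum_(j < n) v 0 i * w 0 j * bil M (delta_mx 0 i) (delta_mx 0 j).
Proof.
have vE (z : 'rV[R]_n) : z = \sum_i z 0 i *: delta_mx 0 i by rewrite {1}[z]row_sum_delta.
have lin1 (I : finType) (F : I -> 'rV[R]_n) z : bil M (\sum_i F i) z = \sum_i bil M (F i) z.
  elim/big_rec2: _ => [|i a b _ <-]; first by rewrite /bil mxact0 dotp0l.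
  by rewrite bilDl.
have lin2 (I : finType) (F : I -> 'rV[R]_n) z : bil M z (\sum_i F i) = \sum_i bil M z (F i).
  elim/big_rec2: _ => [|i a b _ <-]; first by rewrite /bil dotp0r.
  by rewrite bilDr.
rewrite {1}(vE v) lin1; apply: eq_bigr => i _; rewrite bilZl {1}(vE w) lin2 mulr_sumr.
by apply: eq_bigr => j _; rewrite bilZr mulrA.
Qed.

Lemma measurable_sum_fin (R : realType) (k : nat) (F : 'I_k -> R -> R) :
  (forall i, measurable_fun setT (F i)) -> measurable_fun setT (fun t => \sum_i F i t).
Proof.
elim: k F => [|k IH] F mF.
  have -> : (fun t => \sum_i F i t) = cst 0 by apply/funext => t; rewrite big_ord0.
  exact: measurable_cst.
have -> : (fun t => \sum_i F i t) = (fun t => F ord0 t + \sum_i F (lift ord0 i) t).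
  by apply/funext => t; rewrite big_ord_recl.
by apply: measurable_funD => //; exact: IH.
Qed.

(* The Lagrangian along the curve y with velocity h; y is clamped to [a, b] so
   that the integrand is bounded and measurable on the whole line. *)
Lemma action_primitive `(lb : @lag_bounds R n A V ta tb x0 r C) (a b L L1 : R) (y h : R -> 'rV[R]_n) :
  ta <= a -> a <= b -> b <= tb -> 0 <= L -> 0 <= L1 ->
  (forall s, a <= s <= b -> `|y s - x0| <= r) -> lip_on y a b L1 ->
  (forall i, measurable_fun setT (fun t => h t 0 i)) -> (forall t, `|h t| <= L) ->
  exists G : R -> R, lip_on G a b (C * (1 + L ^+ 2)) /\
   {ae @lebesgue_measure R, forall t, a < t < b -> has_deriv G t (lag A V t (y t) (h t))}.
Proof.
move=> taa ab btb L0 L10 yr yL mh hL; have C1 := lb_C lb.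
pose z s := (clamp a b s, y (clamp a b s)).
have zK s : box ta tb x0 r (z s).
  have cI := clamp_itv s ab; split => /=; last exact: yr.
  by move: cI taa btb; cl.
have zd s t : `|clamp a b s - clamp a b t| + `|y (clamp a b s) - y (clamp a b t)| <= (1 + L1) * `|s - t|.
  have cst := clamp_lip a b s t; have /andP[s1 s2] := clamp_itv s ab; have /andP[t1 t2] := clamp_itv t ab.
  have : `|y (clamp a b s) - y (clamp a b t)| <= L1 * `|clamp a b s - clamp a b t|.
    have [st|ts] := leP (clamp a b s) (clamp a b t).
      by rewrite distrC (distrC (clamp a b s)) (ger0_norm (x := _ - clamp a b s)) ?subr_ge0//; exact: yL.
    by rewrite (ger0_norm (x := clamp a b s - _)) ?subr_ge0 ?(ltW ts)//; apply: yL => //; exact: ltW.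
  have := ler_wpM2l L10 cst; move: cst; cl.
pose g s := lag A V (z s).1 (z s).2 (h s).
have mg : measurable_fun setT g.
  have gE : g = fun s => 2^-1 * (\sum_(i < n) \sum_(j < n) h s 0 i * h s 0 j *
      bil (invmx (A (z s))) (delta_mx 0 i) (delta_mx 0 j)) - V (z s).
    by apply/funext => s; rewrite /g /lag bil_sum /z.
  rewrite gE; apply: measurable_funB.
    apply: measurable_funM; first exact: measurable_cst.
    apply: measurable_sum_fin => i; apply: measurable_sum_fin => j.
    apply: measurable_funM; first exact: measurable_funM.
    apply: continuous_measurable_fun.
    apply: (@lip_on_continuous _ _ (C * (1 + L1) * (`|delta_mx 0 i : 'rV[R]_n| * `|delta_mx 0 j : 'rV[R]_n|))) => s t.
    apply: le_trans (lb_Blip lb _ _ (zK s) (zK t)) _.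
    have -> : C * (1 + L1) * (`|delta_mx 0 i : 'rV[R]_n| * `|delta_mx 0 j : 'rV[R]_n|) * `|s - t| =
      C * ((1 + L1) * `|s - t|) * (`|delta_mx 0 i : 'rV[R]_n| * `|delta_mx 0 j : 'rV[R]_n|) by ring.
    apply: ler_wpM2r; first by rewrite mulr_ge0.
    by apply: ler_wpM2l; [move: C1; cl|exact: zd].
  apply: continuous_measurable_fun.
  apply: (@lip_on_continuous _ _ (C * (1 + L1))) => s t.
  have l0 s' : lag A V (z s').1 (z s').2 0 = - V (z s').
    by rewrite /lag /bil dotp0r mulr0 add0r /z.
  have e1 := lb_lip lb 0 (zK s) (zK t); have e2 := lb_lip lb 0 (zK t) (zK s).
  have l1 := l0 s; have l2 := l0 t; rewrite /= in l1 l2.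
  move: e1 e2; rewrite l1 l2 normr0 expr0n addr0 !mulr1 => e1 e2.
  have zd' : C * (`|clamp a b s - clamp a b t| + `|y (clamp a b s) - y (clamp a b t)|) <= C * ((1 + L1) * `|s - t|).
    by apply: ler_wpM2l; [move: C1; cl|exact: zd].
  rewrite (distrC (clamp a b t)) (distrC (y (clamp a b t))) in e2.
  by rewrite ler_norml; apply/andP; split; [move: e1 zd'|move: e2 zd']; cl.
have bg s : `|g s| <= C * (1 + L ^+ 2).
  apply: le_trans (lb_bnd lb (h s) (zK s)) _; apply: ler_wpM2l; first by move: C1; cl.
  by rewrite lerD2l ler_sqr ?nnegrE.
have [G [GL GE]] := bounded_antiderivative a b mg bg.
exists G; split => //; apply: ae_impl GE => t ht tI.
have [dG GE] := ht tI; have := derivable_has_deriv dG; rewrite GE /g /z clamp_id//.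
by move: tI; cl.
Qed.

Lemma has_derivD (R : realType) (W : normedModType R) (f g : R -> W) (t : R) v w :
  has_deriv f t v -> has_deriv g t w -> has_deriv (fun s => f s + g s) t (v + w).
Proof.
move=> df dg e e0; have e2 : 0 < e / 2 by rewrite divr_gt0.
have [d1 d10 h1] := df _ e2; have [d2 d20 h2] := dg _ e2.
exists (Num.min d1 d2); first by rewrite lt_min d10.
move=> h; rewrite lt_min => /andP[/h1 k1 /h2 k2].
have -> : f (t + h) + g (t + h) - (f t + g t) - h *: (v + w) =
   (f (t + h) - f t - h *: v) + (g (t + h) - g t - h *: w).
  by rewrite scalerDr !opprD (addrACA (f (t + h))) (addrACA (f (t + h) - f t)).
apply: le_trans (ler_normD _ _) _; move: k1 k2; set x := Num.norm _; set y := Num.norm _; cl.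
Qed.

Lemma has_derivZ (R : realType) (W : normedModType R) (f : R -> W) (k : R) (t : R) v :
  has_deriv f t v -> has_deriv (fun s => k *: f s) t (k *: v).
Proof.
move=> df e e0; have k1 : 0 < `|k| + 1 by rewrite ltr_wpDl.
have [d d0 hd] := df (e / (`|k| + 1)) (divr_gt0 e0 k1).
exists d => // h /hd h1.
have -> : k *: f (t + h) - k *: f t - h *: (k *: v) = k *: (f (t + h) - f t - h *: v).
  by rewrite !scalerBr !scalerA (mulrC h).
rewrite normrZ; apply: le_trans (_ : (`|k| + 1) * (e / (`|k| + 1) * `|h|) <= _).
  by apply: ler_pM => //; rewrite lerDl.
by rewrite mulrA mulrCA divff ?mulr1// gt_eqF.
Qed.

Lemma has_derivB (R : realType) (W : normedModType R) (f g : R -> W) (t : R) v w :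
  has_deriv f t v -> has_deriv g t w -> has_deriv (fun s => f s - g s) t (v - w).
Proof.
move=> df /(has_derivZ (-1)); rewrite scaleN1r => /(has_derivD df) h e e0.
by have [d d0 hd] := h e e0; exists d => // x /hd; rewrite !scaleN1r.
Qed.

Lemma has_deriv_ext (R : realType) (W : normedModType R) (f g : R -> W) (t : R) v :
  (forall s, f s = g s) -> has_deriv f t v -> has_deriv g t v.
Proof. by move=> /funext ->. Qed.

Lemma has_deriv_affine (R : realType) (W : normedModType R) (b : W) (e t : R) :
  has_deriv (fun s : R => (s - e) *: b) t b.
Proof.
move=> d d0; exists 1 => // h _.
have -> : (t + h - e) *: b - (t - e) *: b - h *: b = 0.
  by rewrite -!scalerBl (_ : _ - _ - _ = 0) ?scale0r//; ring.
by rewrite normr0 mulr_ge0// ltW.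
Qed.

(** [forward_ineq] with any supergradient, followed by Fenchel's inequality. *)
Lemma deriv_le_lag `(lr : @local_reg R n u A V ta tb x0 r c m C M K) (t : R) (xi : R -> 'rV[R]_n)
    w (phi' : R) :
  ta <= t < tb -> `|xi t - x0| < r -> has_deriv xi t w ->
  has_deriv (fun s => u (s, xi s)) t phi' -> phi' <= lag A V t (xi t) w.
Proof.
move=> tI xr dx dphi; have K0 := lr_K lr.
have tI' : ta <= t <= tb by move: tI; cl.
have [sig sg] : exists p, sgrad (fun y => u (t, y)) x0 r K (xi t) p.
  apply: (sgrad_exists (L := K)) => //; last exact: (lr_sc lr).
  by move=> x y xr' yr'; exact: (lr_lipx lr).
apply: le_trans (forward_ineq lr tI xr dx dphi sg) _.
have Kt : box ta tb x0 r (t, xi t) by split => //=; exact: ltW.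
rewrite /ham /lag; have := fenchel (cd_c (lr_cd lr)) (cd_sym (lr_cd lr) Kt) (cd_ell (lr_cd lr) Kt) w sig.
by cl.
Qed.

Lemma lag_diff `(lb : @lag_bounds R n A V ta tb x0 r C) (s : R) y y' v v' (Lam : R) :
  box ta tb x0 r (s, y) -> box ta tb x0 r (s, y') -> `|v| <= Lam -> `|v'| <= Lam ->
  lag A V s y v - lag A V s y' v' <= C * (1 + Lam ^+ 2) * `|y - y'| + n%:R * C * Lam * `|v - v'|.
Proof.
move=> K1 K2 vL v'L; have C1 := lb_C lb.
have L0 : 0 <= Lam by exact: le_trans vL.
have h1 := lb_lip lb v K1 K2; rewrite subrr normr0 add0r in h1.
have h2 : C * `|y - y'| * (1 + `|v| ^+ 2) <= C * (1 + Lam ^+ 2) * `|y - y'|.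
  rewrite mulrAC; apply: ler_wpM2r => //; apply: ler_wpM2l; first by move: C1; cl.
  by rewrite lerD2l ler_sqr ?nnegrE.
have bb p q : `|bil (invmx (A (s, y'))) p q| <= n%:R * (C * `|p| * `|q|).
  apply: le_trans (dotp_le _ _) _; apply: ler_wpM2l => //; apply: ler_wpM2r => //.
  exact: (lb_Bnorm lb).
have E : lag A V s y' v - lag A V s y' v' = 2^-1 * (bil (invmx (A (s, y'))) (v - v') v + bil (invmx (A (s, y'))) v' (v - v')).
  by rewrite /lag bilBl bilBr; ring.
have b1 := le_trans (ler_norm _) (bb (v - v') v); have b2 := le_trans (ler_norm _) (bb v' (v - v')).
have g1 : n%:R * (C * `|v - v'| * `|v|) <= n%:R * (C * `|v - v'| * Lam).
  by apply: ler_wpM2l => //; apply: ler_wpM2l => //; rewrite mulr_ge0//; move: C1; cl.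
have g2 : n%:R * (C * `|v'| * `|v - v'|) <= n%:R * (C * Lam * `|v - v'|).
  apply: ler_wpM2l => //; apply: ler_wpM2r => //; apply: ler_wpM2l => //; move: C1; cl.
by move: h1 h2 E b1 b2 g1 g2; cl.
Qed.

Lemma ae_deriv_mono (R : realType) (f : R -> R) (a b K : R) : a <= b -> lip_on f a b K ->
  {ae @lebesgue_measure R, forall t, a < t < b -> forall f', has_deriv f t f' -> 0 <= f'} -> f a <= f b.
Proof.
move=> ab fL H; apply: (ae_nondecreasing ab fL); apply: ae_impl H => t ht tI df.
exact: ht (derivable_has_deriv df).
Qed.

Lemma lip_onW (R : realType) (W : normedModType R) (f : R -> W) (a b a' b' L L' : R) :
  a <= a' -> b' <= b -> L <= L' -> lip_on f a b L -> lip_on f a' b' L'.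
Proof.
move=> aa bb LL fL x y ax xy yb; apply: le_trans (fL x y _ _ _) _ => //.
- exact: le_trans ax.
- exact: le_trans bb.
- by apply: ler_wpM2r => //; rewrite subr_ge0.
Qed.

Lemma lip_onD (R : realType) (W : normedModType R) (f g : R -> W) (a b L L' : R) :
  lip_on f a b L -> lip_on g a b L' -> lip_on (fun s => f s + g s) a b (L + L').
Proof.
move=> fL gL x y ax xy yb; rewrite opprD addrACA; apply: le_trans (ler_normD _ _) _.
by rewrite mulrDl lerD// ?fL// gL.
Qed.

Lemma lip_onZ (R : realType) (W : normedModType R) (f : R -> W) (a b L k : R) :
  lip_on f a b L -> lip_on (fun s => k *: f s) a b (`|k| * L).
Proof.
move=> fL x y ax xy yb; rewrite -scalerBr normrZ -mulrA; apply: ler_wpM2l => //; exact: fL.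
Qed.

Lemma lip_on_affine (R : realType) (W : normedModType R) (a b e : R) (w : W) :
  lip_on (fun s : R => (s - e) *: w) a b `|w|.
Proof.
move=> x y ax xy yb; rewrite -scalerBl (_ : _ - _ = y - x); last by ring.
by rewrite normrZ ger0_norm ?subr_ge0// mulrC.
Qed.

Lemma lip_u_curve `(lr : @local_reg R n u A V ta tb x0 r c m C M K) (a b L : R) (y : R -> 'rV[R]_n) :
  ta <= a -> b <= tb -> lip_on y a b L -> (forall s, a <= s <= b -> `|y s - x0| <= r) ->
  lip_on (fun s => u (s, y s)) a b (K * (1 + L)).
Proof.
move=> taa btb yL yr s t as_ st tb'; have K0 := lr_K lr.
have K1 : box ta tb x0 r (s, y s).
  by split => /=; [move: taa as_ st tb' btb; cl|apply: yr; move: as_ st tb'; cl].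
have K2 : box ta tb x0 r (t, y t).
  by split => /=; [move: taa as_ st tb' btb; cl|apply: yr; move: as_ st tb'; cl].
apply: le_trans (lr_lip lr K2 K1) _; rewrite -mulrA; apply: ler_wpM2l => //.
rewrite ger0_norm ?subr_ge0//; have := yL s t as_ st tb'; cl.
Qed.

(** The curve is bent into gam s + (s - e) b, with its end at time e fixed; let f (b) be its action
    on [s, e]. The Lagrangian is not differentiated: second differences show that f (b) - (e - s) /
    2 * <A^-1 b, b> is semiconcave with constant O ((e - s) ^ 2), and [mm] is a supergradient of it
    at b = 0. *)
Lemma action_expansion `(lr : @local_reg R n u A V ta tb x0 r c m C M K) (L beta : R) :
  0 <= L -> 0 < beta -> exists h0 C3 : R, [/\ 0 < h0, 0 <= C3 &
  forall (gam : R -> 'rV[R]_n) (a e : R), ta <= a -> a < e -> e < tb -> e - a <= h0 ->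
    lip_on gam a e L -> (forall s, a <= s <= e -> `|gam s - x0| <= r / 2) ->
  exists (Phi : R -> R) (v : R -> 'rV[R]_n), [/\ lip_on Phi a e C3,
   {ae @lebesgue_measure R, forall t, a < t < e -> has_deriv gam t (v t) /\
      has_deriv Phi t (lag A V t (gam t) (v t))} &
   forall s, a <= s -> s < e -> exists mm, forall b, `|b| <= beta ->
     u (e, gam e) <= u (s, gam s - (e - s) *: b) + (Phi e - Phi s) + dotp mm b +
       (e - s) / 2 * bil (invmx (A (s, gam s))) b b + C3 * (e - s) ^+ 2 * `|b| ^+ 2]].
Proof.
move=> L0 b0; have C1 := lb_C (lr_lb lr); have r0 := lr_r lr; have K0 := lr_K lr.
have lb := lr_lb lr.
pose Lam := L + beta.
have Lam0 : 0 <= Lam by rewrite addr_ge0// ltW.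
pose h0 := Num.min 1 (r / 4 / (beta + 1)).
have b1 : 0 < beta + 1 by rewrite addr_gt0.
have h00 : 0 < h0 by rewrite lt_min ltr01 !divr_gt0.
pose C2 := C * (2 + Lam + Lam ^+ 2 + beta) + C * (1 + L + beta).
have Lam2 : 0 <= Lam ^+ 2 by exact: sqr_ge0.
have C20 : 0 <= C2.
  rewrite /C2 addr_ge0// mulr_ge0//; first by move: C1; cl.
  - by move: Lam0 Lam2 b0; cl.
  - by move: C1; cl.
  - by move: L0 b0; cl.
pose C3 := C2 + C * (1 + Lam ^+ 2).
have CL0 : 0 <= C * (1 + Lam ^+ 2) by apply: mulr_ge0; [move: C1|move: Lam2]; cl.
have C30 : 0 <= C3 by rewrite /C3 addr_ge0.
exists h0, C3; split => // gam a e taa ae_ etb eah0 gL gr.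
have ea1 : e - a <= 1 by apply: le_trans eah0 _; rewrite /h0 ge_min lexx.
have eab : (e - a) * beta <= r / 4.
  have : (e - a) * (beta + 1) <= r / 4 by rewrite -ler_pdivlMr//; apply: le_trans eah0 _; rewrite /h0 ge_min lexx orbT.
  by move: ae_; cl.
have [v [vm vL vae]] := curve_velocity ae_ L0 gL.
pose gb b (s : R) := gam s + (s - e) *: b.
have se_norm (s : R) (b : 'rV[R]_n) : s <= e -> `|(s - e) *: b| = (e - s) * `|b|.
  by move=> se; rewrite normrZ distrC ger0_norm// subr_ge0.
have gbr b s : `|b| <= beta -> a <= s <= e -> `|gb b s - x0| <= r / 4 * 3.
  move=> bb sI; rewrite /gb addrAC; apply: le_trans (ler_normD _ _) _.
  rewrite se_norm; last by move: sI; cl.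
  have : (e - s) * `|b| <= (e - a) * beta by apply: ler_pM => //; move: sI; cl.
  by have := gr s sI; move: eab; cl.
have gbr1 b s : `|b| <= beta -> a <= s <= e -> `|gb b s - x0| <= r.
  by move=> /gbr h /h; move: r0; cl.
have Kb b s : `|b| <= beta -> a <= s <= e -> box ta tb x0 r (s, gb b s).
  by move=> bb sI; split => /=; [move: sI taa etb; cl|exact: gbr1].
have gbL b : `|b| <= beta -> lip_on (gb b) a e Lam.
  move=> bb; apply: (@lip_onW _ _ _ a e _ _ (L + `|b|)) => //; first by rewrite lerD2l.
  by apply: lip_onD => //; exact: lip_on_affine.
have vbL b t : `|b| <= beta -> `|v t + b| <= Lam.
  by move=> bb; apply: le_trans (ler_normD _ _) _; rewrite lerD.
have HG (b : 'rV[R]_n) : exists G : R -> R, `|b| <= beta -> lip_on G a e (C * (1 + Lam ^+ 2)) /\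
   {ae @lebesgue_measure R, forall t, a < t < e -> has_deriv G t (lag A V t (gb b t) (v t + b))}.
  have [bb|bb] := leP `|b| beta; last by exists (fun=> 0).
  have mvb i : measurable_fun setT (fun t => (v t + b) 0 i).
    have -> : (fun t => (v t + b) 0 i) = (fun t => v t 0 i + cst (b 0 i) t).
      by apply/funext => t; rewrite !mxE.
    by apply: measurable_funD => //; exact: measurable_cst.
  have [G hG] := @action_primitive _ _ _ _ _ _ _ _ _ lb a e Lam Lam (gb b) (fun t => v t + b) taa (ltW ae_)
    (ltW etb) Lam0 Lam0 (gbr1 b ^~ bb) (gbL b bb) mvb (vbL b ^~ bb).
  by exists G.
have [G hG] := choice HG.
have z0 : `|0 : 'rV[R]_n| <= beta by rewrite normr0 ltW.
have gb0 : gb 0 = gam by apply/funext => s; rewrite /gb scaler0 addr0.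
exists (G 0), v; split.
- by apply: lip_onW (proj1 (hG 0 z0)) => //; rewrite /C3 lerDr.
- apply: ae_impl (ae_and vae (proj2 (hG 0 z0))) => t [h1 h2] tI; split; first exact: h1.
  by have := h2 tI; rewrite gb0 addr0.
move=> s as_ se.
pose h := e - s.
have hp : 0 < h by rewrite subr_gt0.
have hea : h <= e - a by rewrite /h; move: as_; cl.
have h1 : h <= 1 by exact: le_trans ea1.
have sI : a <= s <= e by rewrite as_ ltW.
have tin (t : R) : s < t < e -> a < t < e by move: as_; cl.
have tin' (t : R) : s < t < e -> a <= t <= e by move: as_; cl.
(* Comparison of derivatives: along the bent curve u grows, almost everywhere, at most at the rate
   given by the Lagrangian. *)
have up (b : 'rV[R]_n) : `|b| <= beta -> u (e, gam e) <= u (s, gam s - h *: b) + (G b e - G b s).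
  move=> bb; have [GL Gae] := hG b bb.
  have uL := lip_u_curve lr taa (ltW etb) (gbL b bb) (gbr1 b ^~ bb).
  have := @ae_deriv_mono R (fun t => G b t + (-1) *: u (t, gb b t)) s e _ (ltW se)
    (lip_onD (lip_onW as_ (lexx e) (lexx _) GL) (lip_onZ (-1) (lip_onW as_ (lexx e) (lexx _) uL))).
  have gbe : gb b e = gam e by rewrite /gb subrr scale0r addr0.
  have gbs : gb b s = gam s - h *: b by rewrite /gb /h -[e - s]opprB scaleNr opprK.
  rewrite gbe gbs !scaleN1r => H; suff : G b s - u (s, gam s - h *: b) <= G b e - u (e, gam e) by cl.
  apply: H; apply: ae_impl (ae_and vae Gae) => t [q1 q2] tI f' df.
  have {}q1 := q1 (tin t tI); have {}q2 := q2 (tin t tI).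
  have dx : has_deriv (gb b) t (v t + b) by apply: has_derivD => //; exact: has_deriv_affine.
  have du : has_deriv (fun t => u (t, gb b t)) t (lag A V t (gb b t) (v t + b) - f').
    by apply: has_deriv_ext (has_derivB q2 df) => s'; rewrite /GRing.scale/=; ring.
  suff : lag A V t (gb b t) (v t + b) - f' <= lag A V t (gb b t) (v t + b) by cl.
  apply: (deriv_le_lag lr _ _ dx du); first by move: tI as_ taa etb; cl.
  by apply: le_lt_trans (gbr b t bb (tin' t tI)) _; move: r0; cl.
pose Bs := invmx (A (s, gam s)).
pose f (b : 'rV[R]_n) := G b e - G b s.
have Ks : box ta tb x0 r (s, gam s) by have := Kb 0 s z0 sI; rewrite gb0.
have sd (b1' w : 'rV[R]_n) : `|b1'| <= beta -> `|b1' + w| <= beta -> `|b1' - w| <= beta ->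
    f (b1' + w) + f (b1' - w) - 2 * f b1' <= h * bil Bs w w + C2 * h ^+ 2 * `|w| ^+ 2.
  move=> bb bp bm.
  have wb : `|w| <= beta.
    have E : w = 2^-1 *: ((b1' + w) - (b1' - w)) by apply/rowP => i; rewrite !mxE; field.
    rewrite E normrZ ger0_norm ?invr_ge0//.
    have := ler_normB (b1' + w) (b1' - w); move: bp bm; cl.
  pose q := bil Bs w w + C2 * h * `|w| ^+ 2.
  have [GLp Gp] := hG _ bp; have [GLm Gm] := hG _ bm; have [GL0 G0] := hG _ bb.
  (* The pointwise bound on the second difference of the Lagrangian is integrated in the form of
     monotonicity of [F], whose linear part has slope [q]. *)
  pose F (t : R) : R := (t - e) *: q + ((-1) *: G (b1' + w) t + ((-1) *: G (b1' - w) t + 2 *: G b1' t)).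
  have cut (g : R -> R) : lip_on g a e (C * (1 + Lam ^+ 2)) -> lip_on g s e (C * (1 + Lam ^+ 2)).
    exact: lip_onW.
  have FL := lip_onD (@lip_on_affine R R s e e q) (lip_onD (lip_onZ (-1) (cut _ GLp))
     (lip_onD (lip_onZ (-1) (cut _ GLm)) (lip_onZ (2) (cut _ GL0)))).
  have := ae_deriv_mono (ltW se) FL.
  have -> : q = bil Bs w w + C2 * h * `|w| ^+ 2 by [].
  rewrite -/q => H.
  suff : F s <= F e.
    by rewrite /F /f /GRing.scale/= subrr -/h /q; rewrite (_ : s - e = - h); [cl|rewrite /h opprB].
  apply: H; apply: ae_impl (ae_and Gp (ae_and Gm G0)) => t [dp [dm d0]] tI f' df.
  have {}dp := dp (tin t tI); have {}dm := dm (tin t tI); have {}d0 := d0 (tin t tI).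
  have := has_derivD (has_deriv_affine q e t) (has_derivD (has_derivZ (-1) dp) (has_derivD (has_derivZ (-1) dm) (has_derivZ 2 d0))).
  move=> /(has_deriv_unique df) ->; rewrite /GRing.scale/=.
  have tI' := tin' t tI.
  have gE : gb (b1' + w) t = gb b1' t + (t - e) *: w by rewrite /gb scalerDr addrA.
  have gE' : gb (b1' - w) t = gb b1' t - (t - e) *: w by rewrite /gb scalerBr addrA.
  have K1 := Kb _ t bb tI'; have K2 := Kb _ t bp tI'; have K3 := Kb _ t bm tI'.
  rewrite gE in K2; rewrite gE' in K3.
  have := lb_2 lb (v t + b1') w K1 K2 K3.
  rewrite gE gE' (addrA (v t) b1' w) (addrA (v t) b1' (- w)).
  set W := (t - e) *: w; set vv := v t + b1'.
  have Wn : `|W| <= h * `|w|.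
    rewrite se_norm; last by move: tI; cl.
    by apply: ler_wpM2r => //; rewrite /h; move: tI; cl.
  have vvL : `|vv| <= Lam by exact: vbL.
  have w0 : 0 <= `|w| ^+ 2 by exact: sqr_ge0.
  have hw0 : 0 <= h * `|w| ^+ 2 by rewrite mulr_ge0// ltW.
  have e1 : `|W| * `|w| * (1 + `|vv|) <= h * `|w| ^+ 2 * (1 + Lam).
    rewrite expr2 mulrA; apply: ler_pM; [exact: mulr_ge0|exact: addr_ge0| |by rewrite lerD2l].
    by apply: ler_wpM2r.
  have e2 : `|W| ^+ 2 * (1 + `|vv| ^+ 2) <= h * `|w| ^+ 2 * (1 + Lam ^+ 2).
    apply: ler_pM; [exact: sqr_ge0|by rewrite addr_ge0 ?sqr_ge0| |by rewrite lerD2l ler_sqr ?nnegrE].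
    apply: le_trans (_ : (h * `|w|) ^+ 2 <= _); first by rewrite ler_sqr ?nnegrE// mulr_ge0// ltW.
    rewrite exprMn; apply: ler_wpM2r => //; rewrite expr2 -[leRHS]mulr1; apply: ler_wpM2l => //; exact: ltW.
  have e3 : `|W| * `|w| ^+ 2 <= h * `|w| ^+ 2 * beta.
    rewrite expr2 !mulrA; apply: ler_pM; [exact: mulr_ge0|by []| |by []].
    exact: ler_wpM2r.
  have Ce := ler_wpM2l (le_trans ler01 C1) (lerD (lerD e1 e2) e3).
  have Bl := lb_Blip lb w w K1 Ks; rewrite ler_norml in Bl; move/andP: Bl => [_ Bl].
  have gg : `|t - s| + `|gb b1' t - gam s| <= h * (1 + L + beta).
    have ts : s <= t by move: tI; cl.
    have te : t <= e by move: tI; cl.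
    rewrite ger0_norm ?subr_ge0//.
    have -> : gb b1' t - gam s = (gam t - gam s) + (t - e) *: b1' by rewrite /gb; vec.
    have := ler_normD (gam t - gam s) ((t - e) *: b1'); rewrite se_norm// => n1.
    have n2 := gL s t as_ ts te.
    have n3 : L * (t - s) <= L * h by apply: ler_wpM2l => //; rewrite /h; move: te; cl.
    have n4 : (e - t) * `|b1'| <= h * beta by apply: ler_pM => //; [rewrite subr_ge0|rewrite /h; move: ts; cl].
    have n5 : t - s <= h by rewrite /h; move: te; cl.
    by move: n1 n2 n3 n4 n5; cl.
  have Cg : C * (`|t - s| + `|gb b1' t - gam s|) * (`|w| * `|w|) <= C * (h * (1 + L + beta)) * (`|w| * `|w|).
    by apply: ler_wpM2r; [rewrite mulr_ge0|apply: ler_wpM2l => //; move: C1; cl].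
  by move: Ce Bl Cg; rewrite /q /C2 /Bs; cl.
(* The inequality of [sgrad] has the constant K where the second difference alone would suggest K /
   2, so the exact quadratic part is removed first; what remains has the constant C2 h ^ 2. *)
pose g b := f b - h / 2 * bil Bs b b.
have gsc : semiconcave_ball g 0 beta (C2 * h ^+ 2).
  move=> x w; rewrite !subr0 => n1 n2 n3; have := sd x w n1 n2 n3.
  by rewrite /g !bilDl !bilDr !bilNl !bilNr; cl.
pose L3 := C * (1 + Lam ^+ 2) + n%:R * C * Lam.
have L30 : 0 <= L3 by rewrite /L3 addr_ge0// !mulr_ge0//; move: C1; cl.
have flip (b b' : 'rV[R]_n) : `|b| <= beta -> `|b'| <= beta -> f b - f b' <= L3 * `|b - b'|.
  move=> bb bb'.
  have [GL1 G1] := hG _ bb; have [GL2 G2] := hG _ bb'.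
  pose q := L3 * `|b - b'|.
  have q0 : 0 <= q by rewrite mulr_ge0.
  have cut (g' : R -> R) : lip_on g' a e (C * (1 + Lam ^+ 2)) -> lip_on g' s e (C * (1 + Lam ^+ 2)).
    exact: lip_onW.
  have FL := lip_onD (@lip_on_affine R R s e e q) (lip_onD (lip_onZ (-1) (cut _ GL1)) (lip_onZ (1) (cut _ GL2))).
  have := ae_deriv_mono (ltW se) FL => H.
  suff : f b - f b' <= h * q.
    by move=> k; apply: le_trans k _; rewrite -[leRHS]mul1r; exact: ler_wpM2r.
  suff : (s - e) *: q + (-1 *: G b s + 1 *: G b' s) <= (e - e) *: q + (-1 *: G b e + 1 *: G b' e).
    by rewrite /f /GRing.scale/= /h; cl.
  apply: H; apply: ae_impl (ae_and G1 G2) => t [d1 d2] tI f' df.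
  have {}d1 := d1 (tin t tI); have {}d2 := d2 (tin t tI).
  have := has_derivD (has_deriv_affine q e t) (has_derivD (has_derivZ (-1) d1) (has_derivZ 1 d2)).
  move=> /(has_deriv_unique df) ->; rewrite /GRing.scale/=.
  have tI' := tin' t tI.
  have := lag_diff lb (Kb _ t bb tI') (Kb _ t bb' tI') (vbL _ t bb) (vbL _ t bb').
  have -> : gb b t - gb b' t = (t - e) *: (b - b') by rewrite /gb; vec.
  have -> : v t + b - (v t + b') = b - b' by vec.
  rewrite se_norm; last by move: tI; cl.
  have et : (e - t) * `|b - b'| <= `|b - b'|.
    by rewrite -[leRHS]mul1r; apply: ler_wpM2r => //; move: tI' ea1; cl.
  have := ler_wpM2l CL0 et; rewrite /q /L3; cl.
pose L4 := L3 + n%:R * C * beta.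
have L40 : 0 <= L4 by rewrite /L4 addr_ge0// !mulr_ge0// ?(ltW b0)//; move: C1; cl.
have glip x y : `|x - 0| <= beta -> `|y - 0| <= beta -> `|g x - g y| <= L4 * `|x - y|.
  have one x' y' : `|x'| <= beta -> `|y'| <= beta -> g x' - g y' <= L4 * `|x' - y'|.
    move=> xb yb; have h2 := flip x' y' xb yb.
    have bb p q : `|bil Bs p q| <= n%:R * (C * `|p| * `|q|).
      apply: le_trans (dotp_le _ _) _; apply: ler_wpM2l => //; apply: ler_wpM2r => //.
      exact: (lb_Bnorm lb).
    have E : bil Bs y' y' - bil Bs x' x' = bil Bs (y' - x') y' + bil Bs x' (y' - x').
      by rewrite bilBl bilBr; ring.
    have k1 := le_trans (ler_norm _) (bb (y' - x') y'); have k2 := le_trans (ler_norm _) (bb x' (y' - x')).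
    have g1 : n%:R * (C * `|y' - x'| * `|y'|) <= n%:R * (C * `|y' - x'| * beta).
      by apply: ler_wpM2l => //; apply: ler_wpM2l => //; rewrite mulr_ge0//; move: C1; cl.
    have g2 : n%:R * (C * `|x'| * `|y' - x'|) <= n%:R * (C * beta * `|y' - x'|).
      apply: ler_wpM2l => //; apply: ler_wpM2r => //; apply: ler_wpM2l => //; move: C1; cl.
    have k3 : h / 2 * (bil Bs y' y' - bil Bs x' x') <= h / 2 * (2 * (n%:R * C * beta * `|y' - x'|)).
      by apply: ler_wpM2l; [move: hp; cl|move: E k1 k2 g1 g2; cl].
    have k4 : h * (n%:R * C * beta * `|y' - x'|) <= n%:R * C * beta * `|y' - x'|.
      rewrite -[leRHS]mul1r; apply: ler_wpM2r => //; rewrite !mulr_ge0// ?(ltW b0)//; move: C1; cl.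
    by move: h2 k3 k4; rewrite /g /L4 (distrC y'); cl.
  rewrite !subr0 => xb yb; rewrite ler_norml one// andbT lerNl opprB distrC.
  exact: one.
have zz : `|(0 : 'rV[R]_n) - 0| < beta by rewrite subr0 normr0.
have C2h : 0 <= C2 * h ^+ 2 by rewrite mulr_ge0// sqr_ge0.
have [mm hm] := sgrad_exists glip gsc L40 C2h zz.
exists mm => b bb; apply: le_trans (up b bb) _.
have := hm b; rewrite add0r subr0 => /(_ bb).
have hb0 : 0 <= h ^+ 2 * `|b| ^+ 2 by rewrite mulr_ge0 ?sqr_ge0.
have := mulr_ge0 CL0 hb0.
rewrite /g /f -/h -/Bs /C3 {2}/bil mxact0 dotp0l mulr0 subr0.
by cl.
Qed.

(** * Calibration *)

Lemma lip_ae_has_deriv (R : realType) (f : R -> R) (a b L : R) : a < b -> lip_on f a b L ->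
  {ae @lebesgue_measure R, forall t, a < t < b -> exists f', has_deriv f t f'}.
Proof.
move=> ab fL; have [h [_ _ hE]] := lipschitz_ae_derive ab fL.
apply: ae_impl hE => t ht /ht[dg _]; exists (derive1 f t); exact: derivable_has_deriv.
Qed.

Lemma lip_onM (R : realType) (f g : R -> R) (a b L L' M M' : R) :
  lip_on f a b L -> lip_on g a b L' -> (forall s, a <= s <= b -> `|f s| <= M) ->
  (forall s, a <= s <= b -> `|g s| <= M') -> lip_on (fun s => f s * g s) a b (M * L' + M' * L).
Proof.
move=> fL gL fM gM x y ax xy yb.
have -> : f y * g y - f x * g x = f y * (g y - g x) + g x * (f y - f x) by ring.
apply: le_trans (ler_normD _ _) _; rewrite !normrM mulrDl -!mulrA; apply: lerD.
  apply: ler_pM => //; [apply: fM; move: ax xy yb; cl|exact: gL].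
apply: ler_pM => //; [apply: gM; move: ax xy yb; cl|exact: fL].
Qed.

Lemma lip_on_inv (R : realType) (a b e : R) : b < e ->
  lip_on (fun s : R => (e - s)^-1) a b ((e - b)^-1 ^+ 2).
Proof.
move=> be x y ax xy yb.
have y0 : 0 < e - y by move: be yb; cl.
have x0 : 0 < e - x by move: be yb xy; cl.
have b0 : 0 < e - b by move: be; cl.
have -> : (e - y)^-1 - (e - x)^-1 = (y - x) * ((e - y)^-1 * (e - x)^-1).
  by field; rewrite !gt_eqF.
rewrite ger0_norm; last by rewrite !mulr_ge0 ?subr_ge0// ?invr_ge0 ltW.
rewrite mulrC; apply: ler_wpM2r; first by rewrite subr_ge0.
by rewrite expr2; apply: ler_pM; rewrite ?invr_ge0 ?(ltW x0) ?(ltW y0)// lef_pV2 ?posrE//; move: yb xy; cl.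
Qed.

Lemma has_derivM (R : realType) (f g : R -> R) (t v w : R) :
  has_deriv f t v -> has_deriv g t w -> has_deriv (fun s => f s * g s) t (f t * w + g t * v).
Proof.
move=> /has_deriv_is_derive df /has_deriv_is_derive dg.
have := is_deriveM df dg => -[d1 d2].
by have := derivable_has_deriv d1; rewrite derive1E d2.
Qed.

Lemma has_deriv_inv (R : realType) (e t : R) : t < e ->
  has_deriv (fun s : R => (e - s)^-1) t ((e - t)^-1 ^+ 2).
Proof.
move=> te; have e0 : e - t != 0 by rewrite gt_eqF// subr_gt0.
have dl : is_derive t 1 (fun s : R => e - s) (- 1).
  by have := is_deriveB (is_derive_cst e t 1) (is_derive_id t 1); rewrite sub0r.
have [d1 d2] := is_deriveV (f := fun s : R => e - s) e0 dl.
have := derivable_has_deriv d1; rewrite derive1E d2 /GRing.scale/= mulrN1 opprK.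
by rewrite -exprVn.
Qed.

Lemma lip_on_cst (R : realType) (a b k : R) : lip_on (fun=> k : R) a b 0.
Proof. by move=> x y _ _ _; rewrite subrr normr0 mul0r. Qed.

Lemma has_deriv_cst (R : realType) (k t : R) : has_deriv (fun=> k : R) t 0.
Proof.
by move=> e e0; exists 1 => // h _; rewrite subrr scaler0 subr0 normr0 mulr_ge0// ltW.
Qed.

(* delta = lag - phi' measures the failure of gam to be calibrated. Testing the
   expansion of the action in the direction b = A (sig - p), where sig is
   chosen so that the linear part has a sign, gives
   D t >= (e - t) (1 - k (e - t)) delta t, i.e. D (1 / (e - t) - k) is
   nondecreasing. *)
Lemma calibration `(lr : @local_reg R n u A V ta tb x0 r c m C M K) (L : R) : 0 <= L ->
  exists h1 C3 beta : R, [/\ 0 < h1, 0 <= C3, 0 < beta &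
  forall (gam : R -> 'rV[R]_n) (a e : R), ta <= a -> a < e -> e < tb -> e - a <= h1 ->
    lip_on gam a e L -> (forall s, a <= s <= e -> `|gam s - x0| <= r / 2) ->
    {ae @lebesgue_measure R, forall t, a < t < e -> exists2 p,
       sgrad (fun y => u (t, y)) x0 r K (gam t) p & has_deriv gam t (mxact (A (t, gam t)) p)} ->
  exists (Phi : R -> R) (v : R -> 'rV[R]_n), [/\ lip_on Phi a e C3,
   {ae @lebesgue_measure R, forall t, a < t < e -> has_deriv gam t (v t) /\
      has_deriv Phi t (lag A V t (gam t) (v t))},
   forall s, a <= s -> s < e -> exists mm, forall b, `|b| <= beta ->
     u (e, gam e) <= u (s, gam s - (e - s) *: b) + (Phi e - Phi s) + dotp mm b +
       (e - s) / 2 * bil (invmx (A (s, gam s))) b b + C3 * (e - s) ^+ 2 * `|b| ^+ 2 &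
   (forall d : R, 0 < d -> exists s, [/\ a <= s, s < e, e - s < d &
      Phi e - Phi s - (u (e, gam e) - u (s, gam s)) <= d * (e - s)]) ->
   forall s, a <= s <= e -> u (e, gam e) - u (s, gam s) = Phi e - Phi s]].
Proof.
move=> L0; have C1 := lb_C (lr_lb lr); have r0 := lr_r lr; have K0 := lr_K lr.
have lb := lr_lb lr; have cd := lr_cd lr.
(* Bounds |A (sig - p)| for any two supergradients, so that b = A (sig - p) is an admissible
   variation. *)
pose beta := 2 * C * K + 1.
have beta0 : 0 < beta by rewrite /beta ltr_wpDl// !mulr_ge0//; move: C1; cl.
have [h0 [C3 [h00 C30 exp]]] := action_expansion lr L0 beta0.
(* The remainders C3 h ^ 2 |b| ^ 2 and K h ^ 2 |b| ^ 2 become C5 h ^ 2 delta, because |b| ^ 2 <= C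
   <sig - p, b> = 2 C delta. *)
pose C5 := 2 * C * (C3 + K).
have C50 : 0 <= C5 by rewrite /C5 !mulr_ge0// ?addr_ge0//; move: C1; cl.
pose h1 := Num.min h0 (Num.min (r / 4 / (beta + 1)) ((2 * (C5 + 1))^-1)).
have b10 : 0 < beta + 1 by rewrite addr_gt0.
have c50 : 0 < 2 * (C5 + 1) by rewrite mulr_gt0// ltr_wpDl.
have h10 : 0 < h1 by rewrite !lt_min h00 invr_gt0 c50 !divr_gt0.
exists h1, C3, beta; split => // gam a e taa ae_ etb eah gL gr char.
have eah0 : e - a <= h0 by apply: le_trans eah _; rewrite /h1 ge_min lexx.
have eab : (e - a) * (beta + 1) <= r / 4.
  by rewrite -ler_pdivlMr//; apply: le_trans eah _; rewrite /h1 !ge_min lexx orbT.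
have eaC : (e - a) * (2 * (C5 + 1)) <= 1.
  by rewrite -ler_pdivlMr// mul1r; apply: le_trans eah _; rewrite /h1 !ge_min lexx !orbT.
have [Phi [v [PL vP ex]]] := exp gam a e taa ae_ etb eah0 gL gr.
exists Phi, v; split => // small.
pose phi s := u (s, gam s).
have gr1 s : a <= s <= e -> `|gam s - x0| <= r by move=> /gr; move: r0; cl.
have phiL := lip_u_curve lr taa (ltW etb) gL gr1.
pose D s := Phi e - Phi s - (phi e - phi s).
have D0 s : a <= s -> s < e -> 0 <= D s.
  move=> as_ se; have [mm /(_ 0)] := ex s as_ se.
  rewrite normr0 ltW// scaler0 subr0 dotp0r /bil dotp0r expr0n/= !mulr0 !addr0 => /(_ isT).
  by rewrite /D /phi; cl.
pose LD := `|-1| * C3 + (K * (1 + L)).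
have DL : lip_on D a e LD.
  move=> x y ax xy ye; have := lip_onD (lip_onZ (-1) PL) phiL => /(_ x y ax xy ye).
  by rewrite /D !scaleN1r => h; rewrite (_ : _ - _ = - Phi y + phi y - (- Phi x + phi x)) //; ring.
have aephi := lip_ae_has_deriv ae_ phiL.
have ae1 : {ae @lebesgue_measure R, forall t, a < t < e -> exists dl : R,
    [/\ 0 <= dl, has_deriv D t (- dl) & (e - t) * (1 - C5 * (e - t)) * dl <= D t]}.
  apply: ae_impl (ae_and (ae_and char vP) aephi) => t [[q1 q2] q3] tI.
  have [p sp dgp] := q1 tI; have [dg dP] := q2 tI; have [phi' dphi] := q3 tI.
  have vE : v t = mxact (A (t, gam t)) p.
    by have [_ <-] := has_deriv_is_derive dg; have [_ <-] := has_deriv_is_derive dgp.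
  rewrite vE in dP.
  pose h := e - t; have hp : 0 < h by rewrite /h; move: tI; cl.
  have at_ : a <= t by move: tI; cl.
  have te : t < e by move: tI; cl.
  have tI1 : ta < t < tb by move: tI taa etb; cl.
  have tI2 : ta <= t <= tb by move: tI taa etb; cl.
  have xr : `|gam t - x0| < r by have := gr t; rewrite at_ (ltW te) => /(_ isT); move: r0; cl.
  have Kt : box ta tb x0 r (t, gam t) by split => //=; exact: ltW.
  have sym := cd_sym cd Kt; have ell := cd_ell cd Kt; have c0 := cd_c cd.
  have [mm hm] := ex t at_ te.
  (* The direction A (mm - h p) is chosen so that the half-space condition reads <b, mm> <= h <b,
     p>, which controls the unknown linear term of the expansion. *)
  have [sig [ss phiE sth]] := @mean_value_select _ _ _ _ _ _ _ _ _ _ _ _ _ _ lr t gam _ _ p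
    (mxact (A (t, gam t)) (mm - h *: p)) tI1 xr dgp dphi sp.
  pose b := mxact (A (t, gam t)) (sig - p).
  have pK := sgrad_bnd lr tI2 xr sp; have sK := sgrad_bnd lr tI2 xr ss.
  have bb : `|b| <= 2 * C * K.
    apply: le_trans (lb_Abnd lb (sig - p) Kt) _; rewrite (_ : 2 * C * K = C * (2 * K)); last by ring.
    apply: ler_wpM2l; first by move: C1; cl.
    by apply: le_trans (ler_normB _ _) _; move: pK sK; cl.
  have bbeta : `|b| <= beta by rewrite /beta; move: bb; cl.
  have hb : `|gam t + - (h *: b) - x0| <= r.
    rewrite addrAC; apply: le_trans (ler_normD _ _) _; rewrite normrN normrZ gtr0_norm//.
    have : h * `|b| <= (e - a) * (beta + 1).
      by apply: ler_pM => //; [exact: ltW|rewrite /h; move: at_; cl|move: bbeta; cl].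
    by have := gr t; rewrite at_ (ltW te) => /(_ isT); move: eab r0; cl.
  have up := hm b bbeta; have us := ss _ hb.
  have nhb : `|- (h *: b)| ^+ 2 = h ^+ 2 * `|b| ^+ 2 by rewrite normrN normrZ gtr0_norm// exprMn.
  rewrite nhb dotpNr dotpZr in us.
  have Bb : bil (invmx (A (t, gam t))) b b = dotp (sig - p) b.
    by rewrite /bil /b (mxact_invKV c0 ell).
  have sth' : dotp b mm - h * dotp b p <= 0.
    by move: sth; rewrite -mxact_sym// -/b dotpBr dotpZr.
  have coer := lb_coer lb b Kt; rewrite Bb in coer.
  (* The defect is half the squared length of sig - p in the metric A; in particular it is
     nonnegative. *)
  have dlE : lag A V t (gam t) (mxact (A (t, gam t)) p) - phi' = 2^-1 * dotp (sig - p) b.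
    have e1 : dotp p (mxact (A (t, gam t)) sig) = dotp sig (mxact (A (t, gam t)) p).
      by rewrite -mxact_sym// dotpC.
    rewrite phiE (lag_conj cd p Kt) /ham /b /bil !mxactB !dotpBl !dotpBr e1.
    rewrite (dotpC (mxact (A (t, gam t)) p) p) (dotpC (mxact (A (t, gam t)) sig) sig).
    by field.
  exists (lag A V t (gam t) (mxact (A (t, gam t)) p) - phi').
  have hh0 : 0 <= h ^+ 2 by exact: sqr_ge0.
  split.
  - rewrite dlE mulr_ge0 ?invr_ge0//; have := sqr_ge0 `|b|.
    by move=> b2; rewrite -(pmulr_rge0 _ (lt_le_trans ltr01 C1)); exact: le_trans coer.
  - have dd := has_derivD (has_deriv_cst (Phi e - phi e) t) (has_derivD (has_derivZ (-1) dP) dphi).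
    set lg := lag _ _ _ _ _ in dd *.
    have -> : - (lg - phi') = 0 + (-1 *: lg + phi') by rewrite /GRing.scale/=; ring.
    by apply: has_deriv_ext dd => s; rewrite /D /GRing.scale/= /phi; ring.
  (* Expansion [up], supergradient inequality [us] at gam t - h b and half-space condition [sth']:
     the terms of first order in h leave h <sig - p, b> - h / 2 * <sig - p, b>, that is h delta. *)
  rewrite dlE -/h.
  have cc := ler_wpM2l (mulr_ge0 hh0 (addr_ge0 C30 K0)) coer.
  move: up us sth' cc; rewrite Bb /D /phi -/h /C5 (dotpC mm b) (dotpC b p) (dotpBl sig p).
  cl.
move=> s /andP[as_]; rewrite le_eqVlt => /predU1P[->|se]; first by rewrite !subrr.
suff : D s <= 0 by move=> Ds; have := D0 s as_ se; rewrite -/(phi e) -/(phi s); move: Ds; rewrite /D; cl.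
have es0 : 0 < e - s by rewrite subr_gt0.

have es0C : (e - s) * C5 <= 2^-1.
  have : (e - s) * (2 * (C5 + 1)) <= 1.
    by apply: le_trans eaC; apply: ler_wpM2r; [exact: ltW|move: as_; cl].
  by move: es0; cl.
(* D times 1 / (e - t) - C5 is nondecreasing up to a time s' near e, where the small defect bounds
   it by d; at s the weight is at least half of 1 / (e - s). *)
have main d : 0 < d -> D s * (2 * (e - s))^-1 <= d.
  move=> d0; have dm : 0 < Num.min d (e - s) by rewrite lt_min d0.
  have [s' [as' s'e s'd Ds']] := small _ dm.
  have ss' : s < s' by move: s'd; rewrite lt_min => /andP[_]; cl.
  have es'0 : 0 < e - s' by rewrite subr_gt0.
  have De : D e = 0 by rewrite /D !subrr.
  have Dbd t : s <= t <= s' -> `|D t| <= `|LD| * (e - a).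
    move=> tI; have := DL t e; rewrite De sub0r normrN => /(_ _ _ (lexx _)) H.
    have {}H : `|D t| <= LD * (e - t) by apply: H; [move: tI as_; cl|move: tI s'e; cl].
    apply: (le_trans H); apply: (le_trans (ler_norm _)); rewrite normrM; apply: ler_wpM2l => //.
    by rewrite ger0_norm; move: tI as_ s'e; cl.
  have wbd t : s <= t <= s' -> `|(e - t)^-1 + - C5| <= (e - s')^-1 + C5.
    move=> tI; apply: le_trans (ler_normD _ _) _; rewrite normrN (ger0_norm C50) lerD2r.
    have et : 0 < e - t by move: tI s'e; cl.
    rewrite gtr0_norm ?invr_gt0// lef_pV2 ?posrE//; move: tI; cl.
  have FL := lip_onM (lip_onW as_ (ltW s'e) (lexx _) DL) (lip_onD (lip_on_inv (a := s) s'e) (@lip_on_cst R s s' (- C5))) Dbd wbd.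
  have mono := ae_deriv_mono (ltW ss') FL.
  have {}mono : D s * ((e - s)^-1 + - C5) <= D s' * ((e - s')^-1 + - C5).
    apply: mono; apply: ae_impl ae1 => t H tI f' df.
    have [dl [dl0 dD Dge]] := H ltac:(by move: tI as_ s'e; cl).
    have te : t < e by move: tI s'e; cl.
    have := has_derivM dD (has_derivD (has_deriv_inv te) (has_deriv_cst (- C5) t)).
    move=> /(has_deriv_unique df) ->.
    have h0' : 0 < e - t by rewrite subr_gt0.
    have i0 : 0 <= (e - t)^-1 ^+ 2 by exact: sqr_ge0.
    have := ler_wpM2l i0 Dge.
    have -> : (e - t)^-1 ^+ 2 * ((e - t) * (1 - C5 * (e - t)) * dl) = ((e - t)^-1 - C5) * dl.
      by field; rewrite gt_eqF.
    by cl.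
  have Ds0 := D0 s as_ se; have Ds'0 := D0 s' as' s'e.
  have k1 : D s * (2 * (e - s))^-1 <= D s * ((e - s)^-1 + - C5).
    apply: ler_wpM2l => //.
    have : C5 <= 2^-1 / (e - s) by rewrite ler_pdivlMr// mulrC.
    have -> : (2 * (e - s))^-1 = 2^-1 / (e - s) by rewrite invfM.
    by cl.
  have k2 : D s' * ((e - s')^-1 + - C5) <= D s' * (e - s')^-1.
    by apply: ler_wpM2l => //; move: C50; cl.
  have k3 : D s' * (e - s')^-1 <= d.
    rewrite ler_pdivrMr//; apply: le_trans Ds' _; apply: ler_wpM2r; first exact: ltW.
    by rewrite ge_min lexx.
  by move: mono k1 k2 k3; cl.
have ws : 0 < (2 * (e - s))^-1 by rewrite invr_gt0 mulr_gt0.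
rewrite -(pmulr_lle0 _ ws); apply/ler_addgt0Pr => d d0; rewrite add0r; exact: main.
Qed.

(** * Consequences of differentiability at a point *)

Lemma diff_expand (R : realType) (E : normedModType R) (f : E -> R) (x : E) : differentiable f x ->
  forall e : R, 0 < e -> exists2 d : R, 0 < d & forall w, `|w| < d ->
    `|f (x + w) - f x - 'd f x w| <= e * `|w|.
Proof.
move=> df e e0; have /eqaddoP/(_ e e0) := diff_locally df.
move=> /nbhs_normP[d /= d0 H]; exists d => // w wd.
have := H w; rewrite /= sub0r normrN => /(_ wd).
by rewrite -[(f \o _ - _) w]/(f (w + x) - (f x + 'd f x w)) (addrC w x) opprD addrA.
Qed.

Lemma differentiable_remainder (R : realType) (E : normedModType R) (f : E -> R) (x : E) (d K : R) :
  0 < d -> f x = 0 -> (forall w, `|w| < d -> `|f (x + w)| <= K * `|w| ^+ 2) -> differentiable f x.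
Proof.
move=> d0 fx H.
have E1 : f \o shift x = cst (f x) + (\0 : E -> R) +o_ 0 id.
  apply/eqaddoP => e e0; have K1 : 0 < `|K| + 1 by rewrite ltr_wpDl.
  apply/nbhs_normP; exists (Num.min d (e / (`|K| + 1))) => /=; first by rewrite lt_min d0 divr_gt0.
  move=> w; rewrite /= sub0r normrN lt_min => /andP[wd we].
  rewrite fx -![(_ + _) w]/(_ w + _ w) /= addr0 subr0 addrC.
  apply: le_trans (H w wd) _; rewrite expr2 mulrA; apply: ler_wpM2r => //.
  apply: le_trans (_ : `|w| * (`|K| + 1) <= _); last by rewrite -ler_pdivlMr// ltW.
  by rewrite mulrC; apply: ler_wpM2l => //; have := ler_norm K; cl.
have c0 : continuous (\0 : E -> R) by exact: cst_continuous.
have dE := diff_unique (df := \0) c0 E1.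
by apply/diff_locallyP; rewrite dE; split.
Qed.

Lemma differentiable_quadratic (R : realType) (n : nat) (f : 'rV[R]_n -> R) (x p : 'rV[R]_n) (d K : R) :
  0 < d -> (forall w, `|w| < d -> `|f (x + w) - f x - dotp p w| <= K * `|w| ^+ 2) -> differentiable f x.
Proof.
move=> d0 H.
pose g y := f y - f x - dotp p (y - x).
have dg : differentiable g x.
  apply: (@differentiable_remainder _ _ _ _ d K) => // [|w wd].
    by rewrite /g !subrr dotp0r subr0.
  by rewrite /g [x + w - x]addrC addKr; exact: H.
have da : differentiable (fun y => f x + dotp p (y - x)) x.
  apply: differentiableD; first exact: differentiable_cst.
  rewrite /dotp; have -> : (fun z => \sum_(i < n) p 0 i * (z - x) 0 i) =
      \sum_(i < n) (fun z : 'rV[R]_n => p 0 i * (z - x) 0 i) by apply/funext => w; rewrite fct_sumE.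
  apply: differentiable_sum => i; apply: differentiableM; first exact: differentiable_cst.
  have -> : (fun z : 'rV[R]_n => (z - x) 0 i) = (fun z : 'rV[R]_n => z 0 i - x 0 i).
    by apply/funext => w; rewrite !mxE.
  by apply: differentiableB; [exact: differentiable_coord|exact: differentiable_cst].
have -> : f = (fun y => g y + (f x + dotp p (y - x))).
  by apply/funext => y; rewrite /g; ring.
exact: differentiableD.
Qed.

Lemma diff_expand_time (R : realType) (n : nat) (u : R * 'rV[R]_n -> R) (t : R) (x : 'rV[R]_n) :
  differentiable u (t, x) -> exists (tau : R) p, forall e : R, 0 < e -> exists2 d : R, 0 < d &
    forall (h : R) w, `|h| < d -> `|w| < d ->
      `|u (t + h, x + w) - u (t, x) - tau * h - dotp p w| <= e * (`|h| + `|w|).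
Proof.
move=> du; exists ('d u (t, x) (1, 0)), (\row_i 'd u (t, x) (0, delta_mx 0 i)) => e e0.
have [d d0 hd] := diff_expand du e0.
exists d => // h w hh ww.
have := hd (h, w) (prod_norm_lt _ _) => /(_ hh ww) h1.
have E : 'd u (t, x) (h, w) = 'd u (t, x) (1, 0) * h + dotp (\row_i 'd u (t, x) (0, delta_mx 0 i)) w.
  rewrite {1}(pcoord_dec (h, w)) linear_sum big_ord_recl /pcoord /pbasis unlift_none linearZ /=.
  rewrite mulrC; congr (_ + _); apply: eq_bigr => i _.
  by rewrite liftK linearZ /= mxE mulrC.
rewrite E opprD addrA in h1; apply: le_trans h1 _.
by apply: ler_wpM2l; [exact: ltW|exact: prod_norm_le].
Qed.

(* A first-order expansion gives proximal subgradients at points near (t, x)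
   whose components are close to (tau, p). *)
Lemma supersolution_diff `(lr : @local_reg R n u A V ta tb x0 r c m C M K) (t tau : R) x p :
  ta < t < tb -> `|x - x0| < r -> `|p| <= K ->
  (forall e : R, 0 < e -> exists2 d : R, 0 < d &
    forall (h : R) w, `|h| < d -> `|w| < d ->
      `|u (t + h, x + w) - u (t, x) - tau * h - dotp p w| <= e * (`|h| + `|w|)) ->
  0 <= tau + ham A V t x p.
Proof.
move=> tI xr pK ex; have K0 := lr_K lr; have [Ch Ch0 hH] := ham_lip lr.
apply/ler_addgt0Pr => e e0.
pose Q := 4 + Ch * 6.
have Q0 : 0 < Q by rewrite /Q ltr_pwDl// mulr_ge0.
pose e1 := e / Q.
have e10 : 0 < e1 by rewrite divr_gt0.
have [d d0 hd] := ex e1 e10.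
have [|d' d'0 /= /and5P[l1 l2 l3 l4 /andP[l5 _]]] :=
    @exists_small R [:: d / 2; (t - ta) / 2; (tb - t) / 2; (r - `|x - x0|) / 2; e1].
  by move: tI => /andP[h1 h2]; rewrite /= e10 !divr_gt0 ?subr_gt0.
(* For a minimizer at distance mx the expansion gives k mx <= 2 e1 < 3 e1 = k d', so it is interior,
   and the slopes tau and p change by at most 4 e1. *)
pose k := 3 * e1 / d'.
have k0 : 0 < k by rewrite divr_gt0// mulr_gt0.
have kd : k * d' = 3 * e1 by rewrite /k divfK// gt_eqF.
have brho y : `|y - x| <= d' -> `|y - x0| < r.
  by move=> yx; have := ler_distD x y x0; move: yx l4 xr; cl.
pose g (z : R * 'rV[R]_n) := u z + qtest t x (- tau) (- p) k z.
have sub : box (t - d') (t + d') x d' `<=` box ta tb x0 r.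
  move=> [s y] [/= sI yx]; split => /=; first by move: sI l2 l3 tI; cl.
  by apply: ltW; exact: brho.
have cg : cont_on (box (t - d') (t + d') x d') g.
  apply: cont_onD; first exact: cont_onW sub (sd_cont (lr_sd lr)).
  apply: continuous_cont_on => z _; apply: differentiable_continuous.
  by have [h _] := @qtest_C1 R n setT t x (- tau) (- p) k; exact: h.
have [|[s y] [/= sI yx] zmin] := cont_on_min (@compact_box R n (t - d') (t + d') x d') _ cg.
  by exists (t, x); split => /=; [move: d'0; cl|rewrite subrr normr0 ltW].
pose h := s - t; pose w := y - x.
have hn : `|h| <= d' by rewrite ler_norml /h; move: sI; cl.
have := hd h w _ _; rewrite /h /w [t + _]addrC subrK [x + _]addrC subrK -/h -/w => hz.
have {}hz : `|u (s, y) - u (t, x) - tau * h - dotp p w| <= e1 * (`|h| + `|w|).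
  by apply: hz; [move: hn l1 d0; cl|move: yx l1 d0; rewrite /w; cl].
have q0 : g (t, x) = u (t, x).
  by rewrite /g /qtest/= !subrr !dotp0r; ring.
have zz : g (s, y) <= u (t, x).
  rewrite -q0; apply: zmin; split => /=; [move: d'0; cl|by rewrite subrr normr0 ltW].
have zz2 : k * (`|h| ^+ 2 + `|w| ^+ 2) <= e1 * (`|h| + `|w|).
  have h2 : `|h| ^+ 2 = h ^+ 2 by rewrite real_normK// num_real.
  have w2 := ler_wpM2l (ltW k0) (norm_sq_le w).
  move: hz zz; rewrite ler_norml /g /qtest/= dotpNl -/h -/w h2 => /andP[a1 _].
  by move: w2 a1; cl.
pose mx := Num.max `|h| `|w|.
have m1 : `|h| <= mx by rewrite /mx le_max lexx.
have m2 : `|w| <= mx by rewrite /mx le_max lexx orbT.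
have m0 : 0 <= mx by exact: le_trans m1.
have km : k * mx <= 2 * e1.
  have [->|mn0] := eqVneq mx 0; first by rewrite mulr0; move: e10; cl.
  have mp : 0 < mx by rewrite lt_neqAle eq_sym mn0.
  have a1 : k * mx * mx <= 2 * e1 * mx.
    have a2 : e1 * (`|h| + `|w|) <= e1 * (mx + mx) by apply: ler_wpM2l; [exact: ltW|exact: lerD].
    have a3 : mx ^+ 2 <= `|h| ^+ 2 + `|w| ^+ 2.
      by have := sqr_ge0 `|h|; have := sqr_ge0 `|w|; rewrite /mx; case: (leP `|h| `|w|) => _; cl.
    by have := ler_wpM2l (ltW k0) a3; move: zz2 a2; cl.
  by rewrite ler_pM2r in a1.
have md : mx < d'.
  by rewrite -(ltr_pM2l k0) kd; move: km e10; cl.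
have yx' : `|y - x| < d' by exact: le_lt_trans m2 md.
have st' : `|s - t| < d' by exact: le_lt_trans m1 md.
have yr : `|y - x0| < r by apply: brho; exact: ltW.
have sIab : ta < s < tb by move: st'; rewrite ltr_norml; move: l2 l3 tI; cl.
pose tau' := tau - 2 * k * h; pose p' := p - (2 * k) *: w.
pose dd := d' - mx.
have dd0 : 0 < dd by rewrite subr_gt0.
have prox s' y' : `|s' - s| < dd -> `|y' - y| < dd ->
  u (s, y) + tau' * (s' - s) + dotp p' (y' - y) - k * ((s' - s) ^+ 2 + dotp (y' - y) (y' - y)) <= u (s', y').
  move=> h1 h2.
  have : g (s, y) <= g (s', y').
    apply: zmin; split => /=.
      by move: h1; rewrite /dd ltr_norml; move: m1; rewrite /h ler_norml; cl.
    by have := ler_distD y y' x; move: h2 m2; rewrite /dd /w; cl.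
  rewrite /g /qtest/=.
  have -> : y' - x = (y' - y) + w by rewrite /w addrA subrK.
  have -> : s' - t = (s' - s) + h by rewrite /h; ring.
  rewrite /tau' /p' /h /w; move: (y' - y) (y - x) (s' - s) (s - t) => a w' b h'.
  rewrite !dotpDl !dotpDr !dotpNl dotpZl (dotpC a w'); cl.
have sup := sd_sup (lr_sd lr) sIab yr dd0 prox.
have sg' : sgrad (fun z => u (s, z)) x0 r K y p'.
  apply: (@sgrad_of_sub _ _ _ _ _ _ (k * n%:R) dd) => //; first by apply: (lr_sc lr); move: sIab; cl.
  move=> y' y'd; have := prox s y'; rewrite subrr normr0 => /(_ dd0 y'd).
  rewrite mulr0 expr0n/= add0r addr0.
  by have := ler_wpM2l (ltW k0) (dotp_self_le (y' - y)); cl.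
have sI2 : ta <= s <= tb by move: sIab; cl.
have p'K := sgrad_bnd lr sI2 yr sg'.
have K1 : box ta tb x0 r (s, y) by split => //=; exact: ltW.
have K2 : box ta tb x0 r (t, x) by split => /=; [move: tI; cl|exact: ltW].
have := hH _ _ _ _ _ _ K1 K2 p'K pK; rewrite ler_norml => /andP[_ hh].
have pp : `|p' - p| <= 4 * e1.
  have -> : p' - p = - ((2 * k) *: w) by rewrite /p'; vec.
  have k20 : 0 < 2 * k by exact: mulr_gt0.
  rewrite normrN normrZ (gtr0_norm k20).
  have : k * `|w| <= k * mx by apply: ler_wpM2l => //; exact: ltW.
  by move: km; cl.
have th : tau' - tau <= 4 * e1.
  have : k * `|h| <= k * mx by apply: ler_wpM2l => //; exact: ltW.
  have : - (k * `|h|) <= k * h.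
    by rewrite -mulrN; apply: ler_wpM2l; [exact: ltW|have := ler_norm (- h); rewrite normrN; cl].
  by rewrite /tau'; move: km; cl.
have gg : Ch * (`|s - t| + `|y - x| + `|p' - p|) <= Ch * (6 * e1).
  by apply: ler_wpM2l => //; move: st' yx' pp l5; cl.
have Qe : Q * e1 = e by rewrite /e1 mulrC divfK// gt_eqF.
by move: sup hh gg th Qe; rewrite /Q; cl.
Qed.

Lemma has_deriv_dotp (R : realType) (n : nat) (f : R -> 'rV[R]_n) (p v : 'rV[R]_n) (t : R) :
  has_deriv f t v -> has_deriv (fun s => dotp p (f s)) t (dotp p v).
Proof.
move=> df e e0; have n1 : 0 < n%:R * `|p| + 1 by rewrite ltr_wpDl// mulr_ge0.
have [d d0 hd] := df (e / (n%:R * `|p| + 1)) (divr_gt0 e0 n1).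
exists d => // h /hd h1.
have -> : dotp p (f (t + h)) - dotp p (f t) - h *: dotp p v = dotp p (f (t + h) - f t - h *: v).
  by rewrite !dotpBr dotpZr.
apply: le_trans (dotp_le _ _) _; rewrite mulrA.
apply: le_trans (_ : (n%:R * `|p| + 1) * (e / (n%:R * `|p| + 1) * `|h|) <= _).
  by apply: ler_pM => //; rewrite ?mulr_ge0// lerDl.
by rewrite mulrA mulrCA divff ?mulr1// gt_eqF.
Qed.

Lemma lip_on_dotp (R : realType) (n : nat) (f : R -> 'rV[R]_n) (p : 'rV[R]_n) (a b L : R) :
  lip_on f a b L -> lip_on (fun s => dotp p (f s)) a b (n%:R * `|p| * L).
Proof.
move=> fL x y ax xy yb; rewrite -dotpBr; apply: le_trans (dotp_le _ _) _.
by rewrite mulrA -[leRHS]mulrA; apply: ler_wpM2l; [rewrite mulr_ge0|exact: fL].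
Qed.

Lemma sgrad_unique_diff `(lr : @local_reg R n u A V ta tb x0 r c m C M K) (t : R) x p sg :
  `|x - x0| < r ->
  (forall e : R, 0 < e -> exists2 d : R, 0 < d & forall w, `|w| < d ->
      `|u (t, x + w) - u (t, x) - dotp p w| <= e * `|w|) ->
  sgrad (fun y => u (t, y)) x0 r K x sg -> sg = p.
Proof.
move=> xr ex ss; have K0 := lr_K lr.
apply/eqP; rewrite -subr_eq0; apply/eqP; apply: dotp_eq0.
apply/ler_addgt0Pr => e e0; rewrite add0r.
set q := sg - p.
have q1 : 0 < `|q| + 1 by rewrite ltr_wpDl.
have e1 : 0 < e / 2 / (`|q| + 1) by rewrite !divr_gt0.
have [d d0 hd] := ex _ e1.
have k1 : 0 < K * `|q| ^+ 2 + 1 by rewrite ltr_wpDl// mulr_ge0 ?sqr_ge0.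
have [|s s0 /= /and4P[l1 l2 l3 _]] := @exists_small R [:: d / 2 / (`|q| + 1); (r - `|x - x0|) / (`|q| + 1); e / 2 / (K * `|q| ^+ 2 + 1)].
  by rewrite /= !divr_gt0 ?subr_gt0.
have sq : s * (`|q| + 1) <= d / 2 by rewrite -ler_pdivlMr.
have sr : s * (`|q| + 1) <= r - `|x - x0| by rewrite -ler_pdivlMr.
have sk : s * (K * `|q| ^+ 2 + 1) <= e / 2 by rewrite -ler_pdivlMr.
have nw : `|- (s *: q)| = s * `|q| by rewrite normrN normrZ gtr0_norm.
have wr : `|x + - (s *: q) - x0| <= r.
  by rewrite addrAC; apply: le_trans (ler_normD _ _) _; rewrite nw; move: sr s0; cl.
have := ss _ wr; have := hd (- (s *: q)); rewrite nw => /(_ _) h1 h2.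
have {}h1 : `|u (t, x - s *: q) - u (t, x) - dotp p (- (s *: q))| <= e / 2 / (`|q| + 1) * (s * `|q|).
  by apply: h1; move: sq s0 d0; cl.
move: h1; rewrite ler_norml => /andP[h1 _].
have h3 : e / 2 / (`|q| + 1) * (s * `|q|) <= s * (e / 2).
  have -> : e / 2 / (`|q| + 1) * (s * `|q|) = s * (e / 2 / (`|q| + 1) * `|q|) by ring.
  apply: ler_wpM2l; first exact: ltW.
  by rewrite mulrAC ler_pdivrMr// ler_pM2l ?divr_gt0// lerDl.
have h4 : s * (s * (K * `|q| ^+ 2 + 1)) <= s * (e / 2) by rewrite ler_pM2l.
have ss0 : 0 <= s * s by rewrite mulr_ge0// ltW.
rewrite -(ler_pM2l s0); move: h1 h2 h3 h4 ss0.
have -> : dotp q q = dotp sg q - dotp p q by rewrite -dotpBl.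
rewrite !dotpNr !dotpZr; cl.
Qed.

(** Upper semicontinuity of the superdifferential, combined with its being the singleton {p} at a
    point of differentiability in x. *)
Lemma sgrad_near_diff `(lr : @local_reg R n u A V ta tb x0 r c m C M K) (t : R) x p (eta : R) :
  ta <= t <= tb -> `|x - x0| < r ->
  (forall e : R, 0 < e -> exists2 d : R, 0 < d & forall w, `|w| < d ->
      `|u (t, x + w) - u (t, x) - dotp p w| <= e * `|w|) ->
  0 < eta -> exists2 d : R, 0 < d & forall (s : R) y sg, `|s - t| < d -> `|y - x| < d ->
    ta <= s <= tb -> `|y - x0| < r -> sgrad (fun z => u (s, z)) x0 r K y sg -> `|sg - p| < eta.
Proof.
move=> tI xr ex eta0; apply: contrapT => H.
have [|d d0|sg ss hs] := sgrad_limit lr tI xr (P := fun d s y sg => eta <= `|sg - p|).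
- by [].
- apply: contrapT => H2; apply: H; exists d => // s y sg h1 h2 h3 h4 h5.
  by rewrite ltNge; apply/negP => h6; apply: H2; exists s, y, sg.
have sgp := sgrad_unique_diff lr xr ex ss.
have [s [y [sg' [h1 h2 h3 h4 [h5 h6 h7]]]]] := hs eta eta0.
by move: h3; rewrite sgp ltNge h7.
Qed.

(** Near (e, gam e) all supergradients are close to p, so L (gam, gam') is close to <p, gam'> - H
    (p), which is at most <p, gam'> + tau by [supersolution_diff]; the integral of the latter is the
    increment of u up to o (e - s). *)
Lemma small_defect_of_diff `(lr : @local_reg R n u A V ta tb x0 r c m C M K) (L C3 : R)
    (gam : R -> 'rV[R]_n) (a e : R) (Phi : R -> R) (v : R -> 'rV[R]_n) :
  0 <= L -> ta <= a -> a < e -> e < tb -> lip_on gam a e L ->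
  (forall s, a <= s <= e -> `|gam s - x0| <= r / 2) ->
  {ae @lebesgue_measure R, forall t, a < t < e -> exists2 p,
       sgrad (fun y => u (t, y)) x0 r K (gam t) p & has_deriv gam t (mxact (A (t, gam t)) p)} ->
  lip_on Phi a e C3 ->
  {ae @lebesgue_measure R, forall t, a < t < e -> has_deriv gam t (v t) /\
      has_deriv Phi t (lag A V t (gam t) (v t))} ->
  differentiable u (e, gam e) ->
  forall d : R, 0 < d -> exists s, [/\ a <= s, s < e, e - s < d &
      Phi e - Phi s - (u (e, gam e) - u (s, gam s)) <= d * (e - s)].
Proof.
move=> L0 taa ae_ etb gL gr char PL vP du d d0.
have r0 := lr_r lr; have K0 := lr_K lr; have C1 := lb_C (lr_lb lr).
have [tau [p ex]] := diff_expand_time du.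
set x := gam e in ex.
have xr : `|x - x0| < r by have := gr e; rewrite (ltW ae_) lexx => /(_ isT); rewrite -/x; move: r0; cl.
have eI : ta < e < tb by move: taa ae_ etb; cl.
have eI' : ta <= e <= tb by move: eI; cl.
have exx e' : 0 < e' -> exists2 d : R, 0 < d & forall w, `|w| < d ->
      `|u (e, x + w) - u (e, x) - dotp p w| <= e' * `|w|.
  move=> /ex[d' d'0 hd]; exists d' => // w ww.
  by have := hd 0 w; rewrite normr0 addr0 mulr0 subr0 add0r; apply.
have ps : sgrad (fun y => u (e, y)) x0 r K x p.
  apply: sgrad_of_small => //; [exact: (lr_sc lr)|exact: ltW|].
  move=> e' /exx[d' d'0 hd]; exists d' => // w /hd + _; rewrite ler_norml => /andP[_]; cl.
have pK := sgrad_bnd lr eI' xr ps.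
have sup := supersolution_diff lr eI xr pK ex.
have [Ch Ch0 hH] := ham_lip lr.
pose Q := n%:R * C * K + Ch * 3 + 1.
have Q0 : 0 < Q by rewrite /Q ltr_wpDl// addr_ge0 ?mulr_ge0//; move: C1; cl.
pose eta := d / 2 / Q.
have eta0 : 0 < eta by rewrite !divr_gt0.
have [d1 d10 near1] := sgrad_near_diff lr eI' xr exx eta0.
have L1 : 0 < 1 + L by rewrite ltr_pwDl.
have [d2 d20 near2] := ex (d / 2 / (1 + L)) ltac:(by rewrite !divr_gt0).
have [|h h0 /= /and5P[l1 l2 l3 l4 /andP[l5 _]]] :=
  @exists_small R [:: e - a; d / 2; d1 / 2 / (1 + L); d2 / 2 / (1 + L); eta / (1 + L)].
  by rewrite /= subr_gt0 ae_ !divr_gt0.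
have hd1 : h * (1 + L) <= d1 / 2 by rewrite -ler_pdivlMr.
have hd2 : h * (1 + L) <= d2 / 2 by rewrite -ler_pdivlMr.
have he : h * (1 + L) <= eta by rewrite -ler_pdivlMr.
have hL : 0 <= h * L by rewrite mulr_ge0// ltW.
pose s := e - h.
have as_ : a <= s by rewrite /s; move: l1; cl.
have se : s < e by rewrite /s; move: h0; cl.
have gx t : s <= t -> t <= e -> `|gam t - x| <= h * L.
  move=> st te; rewrite distrC; apply: le_trans (gL t e _ te (lexx _)) _; first exact: le_trans st.
  by rewrite mulrC; apply: ler_wpM2r => //; move: st; rewrite /s; cl.
exists s; split => //; first by rewrite /s; move: l2 d0; cl.
pose q := tau + d / 2.
have FL := lip_onD (@lip_on_affine R R s e e q) (lip_onD (lip_onZ (-1) (lip_onW as_ (lexx e) (lexx _) PL))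
    (lip_onZ 1 (lip_on_dotp p (lip_onW as_ (lexx e) (lexx _) gL)))).
have mono := ae_deriv_mono (ltW se) FL.
have {}mono : (s - e) *: q + (-1 *: Phi s + 1 *: dotp p (gam s)) <= (e - e) *: q + (-1 *: Phi e + 1 *: dotp p (gam e)).
  apply: mono; apply: ae_impl (ae_and char vP) => t [q1 q2] tI f' df.
  have tI' : a < t < e by move: tI as_; cl.
  have [pt pts dgp] := q1 tI'; have [dg dP] := q2 tI'.
  have vE : v t = mxact (A (t, gam t)) pt.
    by have [_ <-] := has_deriv_is_derive dg; have [_ <-] := has_deriv_is_derive dgp.
  have := has_derivD (has_deriv_affine q e t) (has_derivD (has_derivZ (-1) dP) (has_derivZ 1 (has_deriv_dotp p dg))).
  move=> /(has_deriv_unique df) ->; rewrite /GRing.scale/= vE.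
  have tb' : ta <= t <= tb by move: tI' taa etb; cl.
  have gtx : `|gam t - x| <= h * L by apply: gx; move: tI; cl.
  have txr : `|gam t - x0| < r by have := gr t; move=> /(_ ltac:(by move: tI'; cl)); move: r0; cl.
  have Kt : box ta tb x0 r (t, gam t) by split => //=; exact: ltW.
  have Ke : box ta tb x0 r (e, x) by split => //=; exact: ltW.
  have te : `|t - e| <= h by rewrite ler_norml; move: tI; rewrite /s; cl.
  have ptp : `|pt - p| < eta.
    apply: (near1 t (gam t)) => //; first by move: te hd1 hL d10; cl.
    by move: gtx hd1 h0 d10; cl.
  have ptK := sgrad_bnd lr tb' txr pts.
  have := hH _ _ _ _ _ _ Kt Ke ptK pK; rewrite ler_norml => /andP[hh _].
  rewrite (lag_conj (lr_cd lr) _ Kt).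
  have b1 : dotp (pt - p) (mxact (A (t, gam t)) pt) <= n%:R * C * K * eta.
    apply: le_trans (ler_norm _) _; apply: le_trans (dotp_le _ _) _.
    have -> : n%:R * C * K * eta = n%:R * (eta * (C * K)) by ring.
    apply: ler_wpM2l => //; apply: ler_pM => //; first exact: ltW.
    by apply: le_trans (lb_Abnd (lr_lb lr) pt Kt) _; apply: ler_wpM2l => //; move: C1; cl.
  have b2 : Ch * (`|t - e| + `|gam t - x| + `|pt - p|) <= Ch * (3 * eta).
    by apply: ler_wpM2l => //; move: te gtx ptp he eta0; cl.
  have Qe : Q * eta = d / 2 by rewrite /eta mulrC divfK// gt_eqF.
  by move: b1 b2 Qe hh sup eta0; rewrite /q /Q dotpBl; cl.
have dg : gam s - x = - (x - gam s) by rewrite opprB.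
have := near2 (- h) (gam s - x); rewrite -/s [x + _]addrC subrK normrN gtr0_norm// => n2.
have gs := gx s (lexx s) (ltW se).
have {}n2 : `|u (s, gam s) - u (e, x) - tau * (- h) - dotp p (gam s - x)| <= d / 2 / (1 + L) * (h + `|gam s - x|).
  by apply: n2; [move: hd2 hL d20; cl|move: gs hd2 h0 d20; cl].
have b3 : d / 2 / (1 + L) * (h + `|gam s - x|) <= d / 2 * h.
  apply: le_trans (_ : d / 2 / (1 + L) * (h * (1 + L)) <= _).
    by apply: ler_wpM2l; [rewrite !divr_ge0// ltW|move: gs; cl].
  by rewrite mulrCA mulrAC -mulrA divff ?gt_eqF// mulr1 mulrC.
move: n2; rewrite ler_norml dotpBr => /andP[_ n2].
have es : e - s = h by rewrite /s; ring.
move: mono n2 b3; rewrite es /GRing.scale/= subrr -/x /q (_ : s - e = - h); last by rewrite /s; ring.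
cl.
Qed.

(** * Persistence of singularities *)

Lemma gen_char_lip (R : realType) (n : nat) H (T : R) (Om : set 'rV[R]_n) u (a b : R) gam :
  gen_characteristic H T Om u a b gam -> exists2 L : R, 0 <= L &
    forall s t, a <= s <= b -> a <= t <= b -> `|gam s - gam t| <= L * `|s - t|.
Proof.
move=> [_ _ [M [_ HM]] _].
have M0 : M < Num.max M 0 + 1 by rewrite ltr_pwDr// le_max lexx.
exists (Num.max M 0 + 1); first by rewrite addr_ge0// le_max lexx orbT.
move=> s t sI tI; apply: (HM _ M0 (s, t)); split => /=; rewrite in_itv/=; [exact: sI|exact: tI].
Qed.

Lemma gen_char_sub (R : realType) (n : nat) H (T : R) (Om : set 'rV[R]_n) u (a b : R) gam (t : R) :
  gen_characteristic H T Om u a b gam -> a <= t <= b -> 0 <= t < T /\ Om (gam t).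
Proof. by move=> [_ h _ _] tI; have := h t; rewrite in_itv/= => /(_ tI). Qed.

Lemma gen_char_ae `(lr : @local_reg R n u A V ta tb x0 r c m C M K) (T : R) (Om : set 'rV[R]_n)
    (t0 t1 a e : R) gam :
  gen_characteristic (quadratic_ham A V) T Om u t0 t1 gam -> t0 <= a -> e <= t1 -> ta <= a -> e <= tb ->
  (forall s, a <= s <= e -> `|gam s - x0| < r) ->
  {ae @lebesgue_measure R, forall t, a < t < e -> exists2 p,
       sgrad (fun y => u (t, y)) x0 r K (gam t) p & has_deriv gam t (mxact (A (t, gam t)) p)}.
Proof.
move=> [_ _ _ ae1] t0a et1 taa etb gr; apply: ae_impl ae1 => t H tI.
have [dg hull] : derivable gam t 1 /\
        convex_hull (grad (quadratic_ham A V t (gam t)) @` superdiff_x u t (gam t)) (derive1 gam t).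
  by apply: H; rewrite in_itv/=; move: tI t0a et1; cl.
have tI2 : ta <= t <= tb by move: tI taa etb; cl.
have gtr : `|gam t - x0| < r by apply: gr; move: tI; cl.
have [p ps pE] := (char_velocity lr _ tI2 gtr).1 hull.
by exists p => //; rewrite -pE; exact: derivable_has_deriv.
Qed.

Lemma has_deriv_vec_unique (R : realType) (W : normedModType R) (f : R -> W) (t : R) v w :
  has_deriv f t v -> has_deriv f t w -> v = w.
Proof. by move=> /has_deriv_is_derive[_ <-] /has_deriv_is_derive[_ <-]. Qed.

Lemma has_deriv_local (R : realType) (f g : R -> R) (a e t v k : R) : a < t < e ->
  (forall s, a <= s <= e -> f s = g s + k) -> has_deriv g t v -> has_deriv f t v.
Proof.
move=> tI fg dg d d0; have [d1 d10 hd] := dg d d0.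
exists (Num.min d1 (Num.min (t - a) (e - t))).
  by rewrite !lt_min d10 !subr_gt0.
move=> h; rewrite !lt_min => /and3P[/hd h1 h2 h3]; move: h2 h3; rewrite !ltr_norml => h2 h3.
rewrite !fg; [|by move: tI; cl|by move: h2 h3; cl].
by rewrite (_ : _ + _ - (_ + _) = g (t + h) - g t) //; ring.
Qed.

(* Energy equality: u (., gam) grows at the maximal rate allowed by the
   subsolution property. *)
Definition calibrated (R : realType) (n : nat) (u V : R * 'rV[R]_n -> R) (A : R * 'rV[R]_n -> 'M[R]_n)
    (gam : R -> 'rV[R]_n) (a e : R) :=
  {ae @lebesgue_measure R, forall t, a < t < e -> exists v, has_deriv gam t v /\
     has_deriv (fun s => u (s, gam s)) t (lag A V t (gam t) v)}.

(** The gain [d] around tau does not depend on the length of the calibrated end interval, so the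
    step can be used at an infimum of times. The second conclusion is the action expansion at time a
    with zero defect: it bounds u (a, .) from below by a quadratic function. *)
Lemma calibrated_back (R : realType) (n : nat) (u V : R * 'rV[R]_n -> R) (A : R * 'rV[R]_n -> 'M[R]_n)
    (T : R) (Om : set 'rV[R]_n) (gam : R -> 'rV[R]_n) (t1 tau : R) :
  (forall th xh, 0 <= th < T -> Om xh -> regular_at u A V T Om th xh) ->
  gen_characteristic (quadratic_ham A V) T Om u 0 t1 gam -> 0 <= tau <= t1 ->
  exists2 d : R, 0 < d & forall a e : R, 0 <= a -> tau - d < a -> a < e -> e <= t1 -> e < tau + d ->
    (exists2 s, a <= s < e & calibrated u V A gam s e) \/ differentiable u (e, gam e) ->
    calibrated u V A gam a e /\
    exists mm (k beta : R), 0 < beta /\ forall b, `|b| <= beta ->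
      u (a, gam a) <= u (a, gam a - (e - a) *: b) + dotp mm b + k * `|b| ^+ 2.
Proof.
move=> reg gc tauI.
have [thI Omx] := gen_char_sub gc tauI.
have [ta [tb [r [c [m [C [M [K [[ta0 tbT /andP[tath thtb] tas] bR lr]]]]]]]]] := reg _ _ thI Omx.
have [L L0 gL] := gen_char_lip gc.
have r0 := lr_r lr.
have [h1 [C3 [beta [h10 C30 beta0 cal]]]] := calibration lr L0.
have L1 : 0 < 2 * (L + 1) by rewrite mulr_gt0// ltr_wpDl.
(* At tau = 0 the box starts at time 0 and a >= 0 is enough, so the last entry is then a dummy
   value. *)
have [|d d0 /= /and4P[l1 l2 l3 /andP[l4 _]]] := @exists_small R [:: (tb - tau) / 2; h1 / 2; r / (2 * (L + 1)); if 0 < tau then tau - ta else 1].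
  rewrite /= !divr_gt0 ?subr_gt0//=; case: ifPn => [/tas|_]; rewrite ?subr_gt0 ?ltr01//.
  by move=> ->.
exists d => // a e a0 ad ae_ et1 ed hyp.
have dL : d * (2 * (L + 1)) <= r by rewrite -ler_pdivlMr.
have taa : ta <= a.
  move: l4; case: ifPn => [t0|]; first by move: ad; cl.
  by rewrite -leNgt => t0 _; move: tath t0 a0 ta0; cl.
have etb : e < tb by move: l1 ed thtb; cl.
have inI s : a <= s <= e -> 0 <= s <= t1 by move: a0 et1; cl.
have gLip : lip_on gam a e L.
  move=> x y ax xy ye; have := gL y x _ _ => /(_ ltac:(by apply: inI; move: ax xy ye; cl) ltac:(by apply: inI; move: ax xy ye; cl)).
  by rewrite ger0_norm ?subr_ge0.
have gr s : a <= s <= e -> `|gam s - gam tau| <= r / 2.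
  move=> sI; apply: le_trans (gL s tau (inI s sI) tauI) _.
  have : `|s - tau| <= d by rewrite ler_norml; move: sI ad ed; cl.
  by move=> /(ler_wpM2l L0); move: dL d0; cl.
have gr' s : a <= s <= e -> `|gam s - gam tau| < r by move=> /gr; move: r0; cl.
have char := gen_char_ae lr gc a0 et1 taa (ltW etb) gr'.
have eah : e - a <= h1 by move: ad ed l2; cl.
have [Phi [v [PL vP exp conc]]] := cal gam a e taa ae_ etb eah gLip gr char.
have gr1 s : a <= s <= e -> `|gam s - gam tau| <= r by move=> /gr'/ltW.
have phiL := lip_u_curve lr taa (ltW etb) gLip gr1.
have {}conc : forall s, a <= s <= e -> u (e, gam e) - u (s, gam s) = Phi e - Phi s.
  (* Either hypothesis provides times s close to e with small defect: on a calibrated end interval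
     the defect is at most 0, at a point of differentiability it is o (e - s). *)
  apply: conc; case: hyp => [[s0 /andP[as0 s0e] cal0]|du]; last first.
    exact: (small_defect_of_diff lr L0 taa ae_ etb gLip gr char PL vP du).
  move=> dd dd0; pose s := Num.max s0 (e - dd / 2).
  have s0s : s0 <= s by rewrite /s le_max lexx.
  have as_ : a <= s by exact: le_trans s0s.
  have se : s < e by rewrite /s gt_max s0e/=; move: dd0; cl.
  have eds : e - dd / 2 <= s by rewrite /s le_max lexx orbT.
  exists s; split => //; first by move: eds dd0; cl.
  have FL := lip_onD (lip_onW as_ (lexx e) (lexx _) phiL) (lip_onZ (-1) (lip_onW as_ (lexx e) (lexx _) PL)).
  have mono := ae_deriv_mono (ltW se) FL.
  have {}mono : u (s, gam s) + -1 *: Phi s <= u (e, gam e) + -1 *: Phi e.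
    apply: mono; apply: ae_impl (ae_and cal0 vP) => t [q1 q2] tI f' df.
    have [w [dg1 dphi]] := q1 ltac:(by move: tI s0s; cl).
    have [dg2 dP] := q2 ltac:(by move: tI as_; cl).
    rewrite -(has_deriv_vec_unique dg1 dg2) in dP.
    have := has_derivD dphi (has_derivZ (-1) dP).
    by move=> /(has_deriv_unique df) ->; rewrite /GRing.scale/= mulN1r subrr.
  have : 0 <= dd * (e - s) by apply: mulr_ge0; [exact: ltW|rewrite subr_ge0; exact: ltW].
  by move: mono; rewrite /GRing.scale/=; cl.
split.
  apply: ae_impl vP => t H tI; have [dg dP] := H tI.
  exists (v t); split => //.
  apply: (has_deriv_local (k := u (e, gam e) - Phi e) tI) dP => s /conc; cl.
have [mm hm] := exp a (lexx a) ae_.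
have Ka : box ta tb (gam tau) r (a, gam a).
  by split => /=; [move: taa ae_ etb; cl|apply: gr1; rewrite lexx ltW].
exists mm, ((e - a) / 2 * C + C3 * (e - a) ^+ 2), beta; split => // b bb.
have := hm b bb; have := conc a; rewrite lexx (ltW ae_) => /(_ isT) ce.
have := lb_Bbnd (lr_lb lr) b Ka.
have ea0 : 0 <= (e - a) / 2 by rewrite divr_ge0// subr_ge0 ltW.
move=> /(ler_wpM2l ea0); move: ce; cl.
Qed.

Lemma calibrated_sub (R : realType) (n : nat) (u V : R * 'rV[R]_n -> R) (A : R * 'rV[R]_n -> 'M[R]_n)
    (gam : R -> 'rV[R]_n) (a e e' : R) : e' <= e ->
  calibrated u V A gam a e -> calibrated u V A gam a e'.
Proof. by move=> ee; apply: ae_impl => t H tI; apply: H; move: tI ee; cl. Qed.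

Lemma calibrated_join (R : realType) (n : nat) (u V : R * 'rV[R]_n -> R) (A : R * 'rV[R]_n -> 'M[R]_n)
    (gam : R -> 'rV[R]_n) (a s e e' : R) : s < e' ->
  calibrated u V A gam a e' -> calibrated u V A gam s e -> calibrated u V A gam a e.
Proof.
move=> se h1 h2; apply: ae_impl (ae_and h1 h2) => t [q1 q2] tI.
have [te|te] := ltP t e'; first by apply: q1; move: tI te; cl.
by apply: q2; move: tI te se; cl.
Qed.

(** Let s0 be the infimum of the times from which the curve is calibrated up to t1. The local step
    around s0 starts from a calibrated s close to s0 and reaches a time a which is below s0 unless a
    = 0; so the calibration extends to time 0. *)
Lemma touch_from_below (R : realType) (n : nat) (u V : R * 'rV[R]_n -> R) (A : R * 'rV[R]_n -> 'M[R]_n)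
    (T : R) (Om : set 'rV[R]_n) (gam : R -> 'rV[R]_n) (t1 : R) :
  (forall th xh, 0 <= th < T -> Om xh -> regular_at u A V T Om th xh) ->
  gen_characteristic (quadratic_ham A V) T Om u 0 t1 gam -> differentiable u (t1, gam t1) ->
  exists p (k d : R), 0 < d /\ forall w, `|w| < d ->
    u (0, gam 0) + dotp p w - k * `|w| ^+ 2 <= u (0, gam 0 + w).
Proof.
move=> reg gc du; have [t10 _ _ _] := gc.
pose S : set R := [set s | 0 <= s < t1 /\ calibrated u V A gam s t1].
have S0 : S !=set0.
  have [|d d0 H] := calibrated_back (tau := t1) reg gc; first by rewrite (ltW t10) lexx.
  pose a := Num.max 0 (t1 - d / 2).
  have a0 : 0 <= a by rewrite /a le_max lexx.
  have at1 : a < t1 by rewrite /a gt_max t10/=; move: d0; cl.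
  have ad : t1 - d < a by rewrite /a lt_max; apply/orP; right; move: d0; cl.
  have [|h _] := H a t1 a0 ad at1 (lexx _) _ (or_intror du); first by move: d0; cl.
  by exists a; split; first exact/andP.
have Slb : lbound S 0 by move=> s [/andP[]].
have hS : has_inf S by split => //; exists 0.
pose s0 := inf S.
have s00 : 0 <= s0 by exact: lb_le_inf.
have s0t : s0 <= t1.
  by have [s Ss] := S0; apply: le_trans (ge_inf (ex_intro _ 0 Slb) Ss) _; have [/andP[_ /ltW]] := Ss.
have [|d d0 H] := calibrated_back (tau := s0) reg gc; first by rewrite s00.
have [s Ss sd] := inf_adherent d0 hS.
have [/andP[sp st1] cals] := Ss.
have s0s : s0 <= s by apply: ge_inf Ss; exists 0.
rewrite -/s0 in sd.
pose e := Num.min t1 ((s + (s0 + d)) / 2).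
have et1 : e <= t1 by rewrite /e ge_min lexx.
have se : s < e by rewrite /e lt_min st1/=; move: sd; cl.
have ed : e < s0 + d by apply: (@le_lt_trans _ _ ((s + (s0 + d)) / 2)); [rewrite /e ge_min lexx orbT|move: sd; cl].
pose a := Num.max 0 (s0 - d / 2).
have a0 : 0 <= a by rewrite /a le_max lexx.
have as0 : a <= s0 by rewrite /a ge_max s00/=; move: d0; cl.
have ad : s0 - d < a by rewrite /a lt_max; apply/orP; right; move: d0; cl.
have ae_ : a < e by exact: le_lt_trans (le_trans as0 s0s) se.
have asI : a <= s < e by rewrite (le_trans as0 s0s).
have [cala [mm [k [beta [beta0 hb]]]]] := H a e a0 ad ae_ et1 ed
  (or_introl (ex_intro2 _ _ s asI (calibrated_sub et1 cals))).
have Sa : S a.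
  split; first by rewrite a0 (lt_le_trans ae_ et1).
  exact: calibrated_join se cala cals.
have s0a : s0 <= a by apply: ge_inf Sa; exists 0.
have aE : a = 0.
  move: s0a; rewrite /a; case: (leP 0 (s0 - d / 2)) => // h1 h2.
  by exfalso; move: h2 d0; cl.
rewrite aE subr0 in hb ae_.
(* The substitution b = - w / e turns the varied foot point gam 0 - e b into gam 0 + w. *)
exists (- (e^-1 *: (- mm))), (`|k| * e^-1 ^+ 2), (e * beta); split; first by rewrite mulr_gt0.
move=> w wd; pose b := - (e^-1 *: w).
have nb : `|b| = e^-1 * `|w| by rewrite normrN normrZ gtr0_norm// invr_gt0.
have bb : `|b| <= beta by rewrite nb mulrC ler_pdivrMr// mulrC ltW.
have := hb b bb; rewrite (_ : gam 0 - e *: b = gam 0 + w); last first.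
  by rewrite /b scalerN opprK scalerA mulfV ?gt_eqF// scale1r.
rewrite nb exprMn /b dotpNr dotpZr dotpNl dotpZl dotpNl.
have : k * (e^-1 ^+ 2 * `|w| ^+ 2) <= `|k| * (e^-1 ^+ 2 * `|w| ^+ 2).
  by apply: ler_wpM2r; [rewrite mulr_ge0 ?sqr_ge0|exact: ler_norm].
cl.
Qed.

(** The slope p of the touching function is a subgradient, hence a supergradient by semiconcavity;
    two quadratic bounds then squeeze u0 onto its affine part. *)
Lemma differentiable_of_touch (R : realType) (n : nat) (u V : R * 'rV[R]_n -> R) (A : R * 'rV[R]_n -> 'M[R]_n)
    (T : R) (Om : set 'rV[R]_n) (u0 : 'rV[R]_n -> R) (y p : 'rV[R]_n) (k d : R) :
  regular_at u A V T Om 0 y -> (forall x, Om x -> u (0, x) = u0 x) -> 0 < d ->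
  (forall w, `|w| < d -> u (0, y) + dotp p w - k * `|w| ^+ 2 <= u (0, y + w)) ->
  differentiable u0 y.
Proof.
move=> [ta [tb [r [c [m [C [M [K [[ta0 tbT /andP[tath thtb] tas] bR lr]]]]]]]]] init d0 H.
have r0 := lr_r lr; have K0 := lr_K lr.
have tI : ta <= 0 <= tb by rewrite tath ltW.
have Omw w : `|w| <= r -> Om (y + w).
  by move=> wr; have [] // := bR (0, y + w); split => //=; rewrite addrC addKr.
have sg : sgrad (fun z => u (0, z)) y r K y p.
  apply: (@sgrad_of_sub _ _ _ _ _ _ k d) => //; first exact: (lr_sc lr).
    by rewrite subrr normr0.
  by move=> z zd; have := H (z - y) zd; rewrite (addrC y) subrK.
apply: (@differentiable_quadratic _ _ _ _ p (Num.min d r) (`|k| + K)); first by rewrite lt_min d0.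
move=> w; rewrite lt_min => /andP[wd wr].
have yr : `|y + w - y| <= r by rewrite addrC addKr ltW.
have := sg w yr; have := H w wd.
have O0 : Om y by have := Omw 0; rewrite addr0; apply; rewrite normr0 ltW.
rewrite !init//; last by apply: Omw; exact: ltW.
have w0 : 0 <= `|w| ^+ 2 by exact: sqr_ge0.
have := ler_wpM2r w0 (ler_norm k); have := mulr_ge0 K0 w0; have := mulr_ge0 (normr_ge0 k) w0.
by rewrite ler_norml; cl.
Qed.

(** * Uniqueness of characteristics *)

Lemma bil_inv_abs_le `(lb : @lag_bounds R n A V ta tb x0 r C) z v w : box ta tb x0 r z ->
  `|bil (invmx (A z)) v w| <= n%:R * C * (`|v| * `|w|).
Proof.
move=> zB; apply: le_trans (dotp_le _ _) _; rewrite -mulrA.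
apply: ler_wpM2l; first exact: ler0n.
by rewrite mulrA; apply: ler_wpM2r; [exact: normr_ge0|exact: (lb_Bnorm lb)].
Qed.

(** A1 p1 - A2 p2 = A1 (p1 - p2) + (A1 - A2) p2. In the metric A1^-1 the first part pairs with x1 -
    x2 as <p1 - p2, x1 - x2>, bounded by [sgrad_mono]; the second part is O (|x1 - x2|). *)
Lemma char_velocity_gap `(lr : @local_reg R n u A V ta tb x0 r c m C M K) (t : R) x1 x2 p1 p2 :
  ta <= t <= tb -> `|x1 - x0| < r -> `|x2 - x0| < r ->
  sgrad (fun y => u (t, y)) x0 r K x1 p1 -> sgrad (fun y => u (t, y)) x0 r K x2 p2 ->
  bil (invmx (A (t, x1))) (x1 - x2) (mxact (A (t, x1)) p1 - mxact (A (t, x2)) p2) <=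
  (2 * K + n%:R * C ^+ 2 * K) * `|x1 - x2| ^+ 2.
Proof.
move=> tI x1r x2r s1 s2; have lb := lr_lb lr; have cd := lr_cd lr.
have B1 : box ta tb x0 r (t, x1) by split => //=; exact: ltW.
have B2 : box ta tb x0 r (t, x2) by split => //=; exact: ltW.
have Asym := cd_sym cd B1.
have -> : mxact (A (t, x1)) p1 - mxact (A (t, x2)) p2 =
    mxact (A (t, x1)) (p1 - p2) + mxact (A (t, x1) - A (t, x2)) p2.
  by rewrite mxactB mxactBm addrA subrK.
rewrite bilDr.
have -> : bil (invmx (A (t, x1))) (x1 - x2) (mxact (A (t, x1)) (p1 - p2)) = dotp (p1 - p2) (x1 - x2).
  rewrite /bil mxact_sym; last exact: invmx_sym.
  by rewrite (mxact_invKV (cd_c cd)); [exact: dotpC|exact: (cd_ell cd)].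
have h1 := sgrad_mono (ltW x1r) (ltW x2r) s1 s2.
have h2 := bil_inv_abs_le lb (x1 - x2) (mxact (A (t, x1) - A (t, x2)) p2) B1.
have h3 : `|mxact (A (t, x1) - A (t, x2)) p2| <= C * `|x1 - x2| * K.
  have := @lb_Alip _ _ _ _ _ _ _ _ _ lb _ _ p2 B1 B2.
  rewrite /= subrr normr0 add0r => /le_trans; apply; apply: ler_wpM2l.
    by apply: mulr_ge0; [have := lb_C lb; cl|exact: normr_ge0].
  exact: (@sgrad_bnd _ _ _ _ _ _ _ _ _ _ _ _ _ _ lr t x2).
have := ler_norm (bil (invmx (A (t, x1))) (x1 - x2) (mxact (A (t, x1) - A (t, x2)) p2)).
have h4 : n%:R * C * (`|x1 - x2| * `|mxact (A (t, x1) - A (t, x2)) p2|) <=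
    n%:R * C * (`|x1 - x2| * (C * `|x1 - x2| * K)).
  apply: ler_wpM2l; first by apply: mulr_ge0; [exact: ler0n|have := lb_C lb; cl].
  by apply: ler_wpM2l; [exact: normr_ge0|exact: h3].
move: h1 h2 h4; move: (bil _ _ _) (dotp _ _) `|mxact _ _| `|x1 - x2| => b d e w h1 h2 h4 h5.
have -> : (2 * K + n%:R * C ^+ 2 * K) * w ^+ 2 = 2 * K * w ^+ 2 + n%:R * C * (w * (C * w * K)) by ring.
by move: h1 h2 h4 h5; move: (_ * (w * (C * _ * _))) (2 * K * _) => ? ?; cl.
Qed.

Lemma deriv_ge_right (R : realType) (f : R -> R) (t v c k d : R) : 0 < d -> 0 <= k -> has_deriv f t v ->
  (forall h, 0 < h -> h < d -> f t - h * (c + k * h) <= f (t + h)) -> - c <= v.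
Proof.
move=> d0 k0 df fh; apply/ler_addgt0Pr => e e0.
have e20 : 0 < e / 2 by exact: divr_gt0.
have [d1 d10 hd] := df _ e20.
have [h h0 /= /and4P[h1 h2 h3 _]] := @exists_small _ [:: d / 2; d1 / 2; e / 2 / (k + 1)]
  ltac:(rewrite /= !divr_gt0//; move: k0; cl).
have hd' : h < d by move: h1 d0; cl.
have hd1 : `|h| < d1 by rewrite gtr0_norm//; move: h2 d10; cl.
have := fh h h0 hd'; have := hd h hd1; rewrite (gtr0_norm h0) ler_norml => /andP[_].
have -> : h *: (v : R^o) = h * v by [].
have kh : k * h <= e / 2.
  have k1 : 0 < k + 1 by move: k0; cl.
  move: h3; rewrite ler_pdivlMr// => h3.
  by apply: le_trans h3; rewrite mulrC; apply: ler_wpM2l; [exact: ltW|cl].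
have hkh : h * (k * h) <= h * (e / 2) by apply: ler_wpM2l kh; exact: ltW.
move=> g1 g2; rewrite -(ler_pM2l h0).
have -> : h * (v + e) = h * v + e / 2 * h + h * (e / 2) by field.
have g3 : f t - h * (c + k * h) = f t - h * c - h * (k * h) by ring.
rewrite g3 in g2.
have -> : h * - c = - (h * c) by ring.
by move: g1 g2 hkh; move: (f _) (f _) (h * v) (e / 2 * h) (h * (e / 2)) (h * (k * h)) (h * c) => ? ? ? ? ? ? ?; cl.
Qed.

(* d and d' are the values of gam1 - gam2 at times s and s', measured in the
   metric A^-1 along gam1, for which the difference of two velocities A p1, A p2
   pairs with d as <p1 - p2, d> up to a quadratic error. *)
Lemma gap_bilinear `(lr : @local_reg R n u A V ta tb x0 r c m C M K) (s s' L : R) y y' d d' :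
  0 <= L -> box ta tb x0 r (s, y) -> box ta tb x0 r (s', y') -> s <= s' ->
  `|y' - y| <= L * (s' - s) -> `|d| <= 2 * r -> `|d'| <= 2 * r -> `|d' - d| <= 2 * L * (s' - s) ->
  `|bil (invmx (A (s', y'))) d' d' - bil (invmx (A (s, y))) d d| <=
    (C * (1 + L) * (4 * r ^+ 2) + n%:R * C * (2 * L * (4 * r))) * (s' - s) /\
  bil (invmx (A (s', y'))) d' d' <= bil (invmx (A (s, y))) d d + 2 * bil (invmx (A (s, y))) d (d' - d) +
    (s' - s) * (C * (1 + L) * `|d| ^+ 2 +
      (C * (1 + L) * (8 * L * r) + n%:R * C * (4 * L ^+ 2)) * (s' - s)).
Proof.
move=> L0 zB zB' ss' yL dr dr' dL; have lb := lr_lb lr; have cd := lr_cd lr; have r0 := lr_r lr.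
have C0 : 0 <= C by have := lb_C lb; cl.
have h0 : 0 <= s' - s by rewrite subr_ge0.
have Bsym : (invmx (A (s, y)))^T = invmx (A (s, y)) by apply: invmx_sym; exact: (cd_sym cd).
have B1 : `|bil (invmx (A (s', y'))) d' d' - bil (invmx (A (s, y))) d' d'| <=
    C * (1 + L) * (s' - s) * `|d'| ^+ 2.
  apply: le_trans (@lb_Blip _ _ _ _ _ _ _ _ _ lb _ _ _ _ d' d' zB' zB) _.
  rewrite -expr2; apply: ler_wpM2r; first exact: sqr_ge0.
  rewrite -mulrA; apply: ler_wpM2l => //.
  by rewrite ger0_norm// mulrDl mul1r lerD2l.
have B2 := bil_inv_abs_le lb (d' - d) (d' + d) zB.
have B3 := bil_inv_abs_le lb (d' - d) (d' - d) zB.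
have nC : 0 <= n%:R * C by apply: mulr_ge0 => //; exact: ler0n.
have d'0 := normr_ge0 d'; have d0 := normr_ge0 d; have z0 := normr_ge0 (d' - d).
have CL : 0 <= C * (1 + L) * (s' - s).
  by apply: mulr_ge0 => //; apply: mulr_ge0 => //; move: L0; cl.
split.
- have E1 : bil (invmx (A (s', y'))) d' d' - bil (invmx (A (s, y))) d d =
     (bil (invmx (A (s', y'))) d' d' - bil (invmx (A (s, y))) d' d') +
      bil (invmx (A (s, y))) (d' - d) (d' + d).
    by rewrite bilBl !bilDr (bilC d' d Bsym); ring.
  rewrite E1; apply: le_trans (ler_normD _ _) _; rewrite mulrDl; apply: lerD.
    apply: le_trans B1 _; rewrite (mulrAC _ (4 * r ^+ 2)); apply: ler_wpM2l => //.
    by rewrite (_ : 4 * r ^+ 2 = (2 * r) ^+ 2); [rewrite lerXn2r// nnegrE// mulr_ge0// ltW|ring].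
  apply: le_trans B2 _; rewrite -!mulrA; apply: ler_wpM2l; first exact: ler0n.
  apply: ler_wpM2l => //.
  have -> : 2 * (L * (4 * (r * (s' - s)))) = (2 * L * (s' - s)) * (4 * r) by ring.
  apply: ler_pM => //; apply: le_trans (ler_normD _ _) _; move: dr dr'; cl.
have -> : bil (invmx (A (s', y'))) d' d' =
   (bil (invmx (A (s', y'))) d' d' - bil (invmx (A (s, y))) d' d') +
   (bil (invmx (A (s, y))) d d + 2 * bil (invmx (A (s, y))) d (d' - d) +
     bil (invmx (A (s, y))) (d' - d) (d' - d)).
  by rewrite bilBl !bilBr (bilC d' d Bsym); ring.
have D1 : `|d'| ^+ 2 <= `|d| ^+ 2 + 8 * L * r * (s' - s).
  have : `|d'| - `|d| <= 2 * L * (s' - s) by apply: le_trans dL; exact: lerB_dist.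
  move=> h1; have h2 : (`|d'| + `|d|) * (`|d'| - `|d|) <= 4 * r * (2 * L * (s' - s)).
    apply: le_trans (_ : (`|d'| + `|d|) * (2 * L * (s' - s)) <= _).
      by apply: ler_wpM2l => //; exact: addr_ge0.
    apply: ler_wpM2r; first by apply: mulr_ge0 => //; exact: mulr_ge0.
    by move: dr dr'; cl.
  rewrite -lerBlDl subr_sqr mulrC; apply: le_trans h2 _; by rewrite le_eqVlt; apply/orP; left; apply/eqP; ring.
have D2 : C * (1 + L) * (s' - s) * `|d'| ^+ 2 <=
    C * (1 + L) * (s' - s) * (`|d| ^+ 2 + 8 * L * r * (s' - s)) by exact: ler_wpM2l.
have D3 : n%:R * C * (`|d' - d| * `|d' - d|) <= n%:R * C * ((2 * L * (s' - s)) * (2 * L * (s' - s))).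
  by apply: ler_wpM2l => //; exact: ler_pM.
have := le_trans (ler_norm _) B1; have := le_trans (ler_norm _) B3.
have -> : (s' - s) * (C * (1 + L) * `|d| ^+ 2 +
      (C * (1 + L) * (8 * L * r) + n%:R * C * (4 * L ^+ 2)) * (s' - s)) =
   C * (1 + L) * (s' - s) * (`|d| ^+ 2 + 8 * L * r * (s' - s)) +
   n%:R * C * ((2 * L * (s' - s)) * (2 * L * (s' - s))) by ring.
move: D2 D3; move: (_ * `|d'| ^+ 2) (_ * (`|d' - d| * _)) (_ * (2 * L * _ * _)) (_ * (_ + 8 * L * r * _)).
move: (bil _ _ (d' - d)) (bil _ (d' - d) _) (bil _ d d) (bil _ d' d' - _) => ? ? ? ? ? ? ? ?; cl.
Qed.

(** Gronwall's argument for the squared distance [E] in the metric A^-1 along gam1. A weight affine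
    in time replaces the exponential, which is enough on an interval of length 1 / (2 k). *)
Lemma unique_local `(lr : @local_reg R n u A V ta tb x0 r c m C M K) (L : R) : 0 <= L ->
  exists2 h0 : R, 0 < h0 & forall (gam1 gam2 : R -> 'rV[R]_n) (a e : R),
    ta <= a -> a < e -> e <= tb -> e - a <= h0 -> lip_on gam1 a e L -> lip_on gam2 a e L ->
    (forall s, a <= s <= e -> `|gam1 s - x0| < r) -> (forall s, a <= s <= e -> `|gam2 s - x0| < r) ->
    {ae @lebesgue_measure R, forall t, a < t < e -> exists2 p,
       sgrad (fun y => u (t, y)) x0 r K (gam1 t) p & has_deriv gam1 t (mxact (A (t, gam1 t)) p)} ->
    {ae @lebesgue_measure R, forall t, a < t < e -> exists2 p,
       sgrad (fun y => u (t, y)) x0 r K (gam2 t) p & has_deriv gam2 t (mxact (A (t, gam2 t)) p)} ->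
    gam1 a = gam2 a -> gam1 e = gam2 e.
Proof.
move=> L0; have lb := lr_lb lr; have cd := lr_cd lr; have r0 := lr_r lr; have K0 := lr_K lr.
have C0 : 0 < C by have := lb_C lb; cl.
pose k0 := (2 * (2 * K + n%:R * C ^+ 2 * K) + C * (1 + L)) * C.
have k0_ge : 0 <= k0.
  apply: mulr_ge0; last exact: ltW.
  apply: addr_ge0; [apply: mulr_ge0 => //; apply: addr_ge0|].
  - exact: mulr_ge0.
  - by apply: mulr_ge0 => //; apply: mulr_ge0; [exact: ler0n|exact: sqr_ge0].
  - by apply: mulr_ge0; [exact: ltW|move: L0; cl].
pose k := k0 + 1; have k_gt0 : 0 < k by rewrite /k; move: k0_ge; cl.
exists (2 * k)^-1; first by rewrite invr_gt0 mulr_gt0.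
move=> gam1 gam2 a e taa ae etb eah lip1 lip2 g1r g2r ae1 ae2 ga.
pose d (s : R) : 'rV[R]_n := gam1 s - gam2 s.
pose E (s : R) : R := bil (invmx (A (s, gam1 s))) (d s) (d s).
have zB (s : R) : a <= s <= e -> box ta tb x0 r (s, gam1 s).
  by move=> sI; split => /=; [move: sI taa etb; cl|exact: ltW (g1r _ sI)].
have dr (s : R) : a <= s <= e -> `|d s| <= 2 * r.
  move=> sI; have -> : d s = (gam1 s - x0) - (gam2 s - x0) by rewrite /d; vec.
  apply: le_trans (ler_normB _ _) _.
  by have := ltW (g1r _ sI); have := ltW (g2r _ sI); cl.
have dL (s s' : R) : a <= s -> s <= s' -> s' <= e -> `|d s' - d s| <= 2 * L * (s' - s).
  move=> as_ ss' s'e.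
  have -> : d s' - d s = (gam1 s' - gam1 s) - (gam2 s' - gam2 s) by rewrite /d; vec.
  apply: le_trans (ler_normB _ _) _.
  by have := lip1 _ _ as_ ss' s'e; have := lip2 _ _ as_ ss' s'e; cl.
have gap (s s' : R) : a <= s -> s <= s' -> s' <= e -> _ :=
  fun as_ ss' s'e => @gap_bilinear _ _ _ _ _ _ _ _ _ _ _ _ _ _ lr s s' L _ _ _ _ L0
    (zB s ltac:(move: as_ ss' s'e; cl)) (zB s' ltac:(move: as_ ss' s'e; cl)) ss' (lip1 _ _ as_ ss' s'e)
    (dr s ltac:(move: as_ ss' s'e; cl)) (dr s' ltac:(move: as_ ss' s'e; cl)) (dL _ _ as_ ss' s'e).
have E_ge0 (s : R) : a <= s <= e -> 0 <= E s.
  by move=> sI; apply: (bil_inv_ge0 (cd_c cd)); [exact: (cd_sym cd (zB _ sI))|exact: (cd_ell cd (zB _ sI))].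
have lipE : lip_on E a e (C * (1 + L) * (4 * r ^+ 2) + n%:R * C * (2 * L * (4 * r))).
  by move=> s s' as_ ss' s'e; exact: (gap s s' as_ ss' s'e).1.
have E_bnd (s : R) : a <= s <= e -> `|E s| <= C * (2 * r) ^+ 2.
  move=> sI; rewrite ger0_norm ?E_ge0//; apply: le_trans (lb_Bbnd lb _ (zB _ sI)) _.
  apply: ler_wpM2l; first exact: ltW.
  by rewrite lerXn2r// ?nnegrE ?dr// mulr_ge0// ltW.
(* The values lie in [-1, -1/2], so (E g)' = k E + g E' >= (k - k0) E = E >= 0. From E a = 0 it
   follows that E e * g e >= 0 with g e < 0, hence E e <= 0. *)
pose g (s : R) : R := (s - a) * k - 1.
have lipg : lip_on g a e (`|k| + 0).
  by apply: lip_onD; [exact: (@lip_on_affine _ R^o a e a k)|exact: lip_on_cst].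
have g_bnd (s : R) : a <= s <= e -> - 1 <= g s <= - 2^-1.
  move=> sI; have h1 : (s - a) * k <= 2^-1.
    have : (s - a) * k <= (2 * k)^-1 * k.
      by apply: ler_wpM2r; [exact: ltW|move: sI eah; cl].
    by rewrite invfM -mulrA mulVf ?mulr1// gt_eqF.
  have h2 : 0 <= (s - a) * k by apply: mulr_ge0; [rewrite subr_ge0; move: sI; cl|exact: ltW].
  by rewrite /g; move: h1 h2; cl.
have lipEg : lip_on (fun s => E s * g s) a e (C * (2 * r) ^+ 2 * (`|k| + 0) + 1 *
    (C * (1 + L) * (4 * r ^+ 2) + n%:R * C * (2 * L * (4 * r)))).
  apply: lip_onM lipE lipg E_bnd _ => s sI.
  by rewrite ler_norml; have := g_bnd _ sI; cl.
have mono : E a * g a <= E e * g e.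
  apply: ae_deriv_mono lipEg _; first exact: ltW.
  apply: ae_impl (ae_and ae1 (ae_and ae2 (lip_ae_has_deriv ae lipE))) => t [h1 [h2 h3]] tI f' df'.
  have [p1 s1 D1] := h1 tI; have [p2 s2 D2] := h2 tI; have [E' DE] := h3 tI.
  have Dd : has_deriv d t (mxact (A (t, gam1 t)) p1 - mxact (A (t, gam2 t)) p2) by exact: has_derivB.
  have Dg : has_deriv g t (k + 0 : R).
    by apply: has_derivD; [exact: (@has_deriv_affine _ R^o)|exact: has_deriv_cst].
  rewrite (has_deriv_unique df' (has_derivM DE Dg)) addr0.
  have tI' : a <= t <= e by move: tI; cl.
  have EE : E' <= k0 * E t.
    (* [E] is compared with the function s |-> 2 <A^-1 d t, d s>, the metric being frozen at t: by
       [gap_bilinear] the difference has a one-sided expansion, so the matrix need not be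
       differentiated along the curve. *)
    pose q := mxact (invmx (A (t, gam1 t))) (d t).
    have D3 := has_derivB (has_deriv_dotp (2 *: q) Dd) DE.
    have D4 := @deriv_ge_right _ _ _ _ (C * (1 + L) * `|d t| ^+ 2)
      (C * (1 + L) * (8 * L * r) + n%:R * C * (4 * L ^+ 2)) (e - t) _ _ D3.
    have : - (C * (1 + L) * `|d t| ^+ 2) <=
       dotp (2 *: q) (mxact (A (t, gam1 t)) p1 - mxact (A (t, gam2 t)) p2) - E'.
      apply: D4.
      - by rewrite subr_gt0; move: tI; cl.
      - apply: addr_ge0.
          apply: mulr_ge0; first by apply: mulr_ge0; [exact: ltW|move: L0; cl].
          by apply: mulr_ge0; [exact: mulr_ge0|exact: ltW].
        apply: mulr_ge0; first by apply: mulr_ge0; [exact: ler0n|exact: ltW].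
        by apply: mulr_ge0 => //; exact: sqr_ge0.
      - move=> h h_gt0 he.
        have := (gap t (t + h) ltac:(move: tI; cl) ltac:(move: h_gt0; cl) ltac:(move: he; cl)).2.
        rewrite -/(E t) -/(E (t + h)) (addrC t h) addrK (addrC h t).
        have -> : bil (invmx (A (t, gam1 t))) (d t) (d (t + h) - d t) = dotp q (d (t + h)) - dotp q (d t).
          by rewrite /bil dotpBr.
        rewrite !dotpZl mulrBr => h4.
        by rewrite !mulrDr; move: h4; rewrite !mulrDr; cl.
    rewrite dotpZl.
    have := @char_velocity_gap _ _ _ _ _ _ _ _ _ _ _ _ _ _ lr t (gam1 t) (gam2 t) p1 p2
      ltac:(move: tI taa etb; cl) (g1r _ tI') (g2r _ tI') s1 s2.
    rewrite -/(d t) -/(bil _ _ _).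
    have := lb_coer lb (d t) (zB _ tI'); rewrite -/(E t) => h6 h5 h7.
    apply: le_trans (_ : (2 * (2 * K + n%:R * C ^+ 2 * K) + C * (1 + L)) * `|d t| ^+ 2 <= _).
      rewrite mulrDl; move: h5 h7.
      by rewrite -(mulrA 2); move: (_ * `|d t| ^+ 2) (_ * `|d t| ^+ 2) (bil _ _ _) => ? ? ?; cl.
    rewrite /k0 -[leRHS]mulrA; apply: ler_wpM2l => //.
    by move: k0_ge; rewrite /k0 pmulr_lge0.
  have E0 := E_ge0 _ tI'; have := g_bnd _ tI' => /andP[gl gu].
  have h8 : - g t * E' <= - g t * (k0 * E t) by apply: ler_wpM2l; [move: gu; cl|exact: EE].
  have h9 : - g t * (k0 * E t) <= 1 * (k0 * E t).
    by apply: ler_wpM2r; [exact: mulr_ge0|move: gl; cl].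
  move: h8 h9; rewrite mul1r !mulNr /k mulrDr mulr1 (mulrC (E t) k0).
  by move: E0; move: (E t) (k0 * _) (g t * (k0 * _)) (g t * E') => ? ? ? ?; cl.
have Ea : E a = 0 by rewrite /E /d ga subrr /bil dotp0r.
have eI : a <= e <= e by rewrite lexx ltW.
have Ee : E e <= 0.
  have := g_bnd _ eI; move: mono; rewrite Ea mul0r => h1 h2.
  rewrite leNgt; apply/negP => h3; have : E e * g e < 0 by rewrite pmulr_rlt0//; move: h2; cl.
  by move: h1; cl.
have := lb_coer lb (d e) (zB _ eI); rewrite -/(E e) => h1.
have : `|d e| ^+ 2 <= 0 by apply: le_trans h1 _; rewrite pmulr_rle0.
move=> h2; apply/eqP; rewrite -subr_eq0 -/(d e) -normr_eq0 -sqrf_eq0 eq_le sqr_ge0 andbT; exact: h2.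
Qed.

(** The supremum of the times up to which the curves coincide cannot lie before t1: by continuity
    they agree there, and [unique_local] prolongs the agreement. *)
Lemma unique_characteristic (R : realType) (n : nat) (u V : R * 'rV[R]_n -> R) (A : R * 'rV[R]_n -> 'M[R]_n)
    (T : R) (Om : set 'rV[R]_n) (gam1 gam2 : R -> 'rV[R]_n) (t1 : R) :
  (forall th xh, 0 <= th < T -> Om xh -> regular_at u A V T Om th xh) ->
  gen_characteristic (quadratic_ham A V) T Om u 0 t1 gam1 ->
  gen_characteristic (quadratic_ham A V) T Om u 0 t1 gam2 -> gam1 0 = gam2 0 -> gam1 t1 = gam2 t1.
Proof.
move=> reg gc1 gc2 g0; have [t10 _ _ _] := gc1.
have [L1 L10 gL1] := gen_char_lip gc1; have [L2 L20 gL2] := gen_char_lip gc2.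
pose S : set R := [set s | 0 <= s <= t1 /\ forall s', 0 <= s' <= s -> gam1 s' = gam2 s'].
have S0 : S 0.
  split; first by rewrite lexx ltW.
  by move=> s' h; have -> : s' = 0 by apply/eqP; rewrite eq_le andbC.
have Sub : ubound S t1 by move=> s [/andP[]].
have hS : has_sup S by split; [exists 0|exists t1].
pose sg := sup S.
have sg0 : 0 <= sg by exact: (ub_le_sup (ex_intro _ t1 Sub)).
have sgt : sg <= t1 by apply: ge_sup => //; exists 0.
have agree s : 0 <= s -> s < sg -> gam1 s = gam2 s.
  move=> s0 ss; have [s1 Ss1 ss1] := sup_adherent (eps := sg - s) ltac:(by rewrite subr_gt0) hS.
  by apply: Ss1.2; move: ss1; rewrite -/sg s0 /=; cl.
have agsg : gam1 sg = gam2 sg.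
  have [->//|sgn0] := eqVneq sg 0; have {sgn0} sgp : 0 < sg by rewrite lt_neqAle eq_sym sgn0.
  apply/eqP; rewrite -subr_eq0 -normr_eq0; apply/eqP/le_anti; rewrite normr_ge0 andbT.
  apply/ler_addgt0Pr => e e0; rewrite add0r.
  have LL : 0 < L1 + L2 + 1 by move: L10 L20; cl.
  pose s := Num.max 0 (sg - e / (L1 + L2 + 1)).
  have s0 : 0 <= s by rewrite /s le_max lexx.
  have ss : s < sg by rewrite /s gt_max sgp/= gtrBl divr_gt0.
  have sb : sg - s <= e / (L1 + L2 + 1).
    have : sg - e / (L1 + L2 + 1) <= s by rewrite /s le_max lexx orbT.
    by move: (e / _) => ?; cl.
  have sI : 0 <= s <= t1 by move: s0 ss sgt; cl.
  have sgI : 0 <= sg <= t1 by rewrite sg0.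
  have -> : gam1 sg - gam2 sg = (gam1 sg - gam1 s) - (gam2 sg - gam2 s).
    by rewrite (agree s s0 ss); vec.
  apply: le_trans (ler_normB _ _) _.
  have := gL1 _ _ sgI sI; have := gL2 _ _ sgI sI; rewrite gtr0_norm ?subr_gt0//.
  move: sb; rewrite ler_pdivlMr//; move: ss; rewrite -subr_gt0; move: (sg - s) => z.
  by move=> z0; rewrite mulrDr mulrDr mulr1 !(mulrC z); move: (L1 * z) (L2 * z) => ? ?; move: z0; cl.
have [sgE|sgn] := eqVneq sg t1; first by rewrite -sgE.
have {sgn} sglt : sg < t1 by rewrite lt_neqAle sgn.
have sgI : 0 <= sg <= t1 by rewrite sg0.
have [sgT sgOm] := gen_char_sub gc1 sgI.
have [ta [tb [r [c [m [C [M [K [[ta0 tbT /andP[tas stb] _] _ lr]]]]]]]]] := reg _ _ sgT sgOm.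
pose L := L1 + L2; have L0 : 0 <= L by exact: addr_ge0.
have [h0 h00 uniq] := unique_local lr L0; have r0 := lr_r lr.
have LL : 0 < L + 1 by move: L0; cl.
have [d d0 /= /and5P[d1 d2 d3 d4 _]] := @exists_small _ [:: h0; tb - sg; t1 - sg; r / 2 / (L + 1)]
  ltac:(rewrite /= h00 !subr_gt0 stb sglt !divr_gt0//).
have in01 s : sg <= s <= sg + d -> 0 <= s <= t1 by move: sg0 d3; cl.
have lip gam Lg : Lg <= L -> (forall s t, 0 <= s <= t1 -> 0 <= t <= t1 -> `|gam s - gam t| <= Lg * `|s - t|) ->
    forall e, e <= sg + d -> lip_on (gam : R -> 'rV[R]_n) sg e L.
  move=> LgL gl e ed s s' h1 h2 h3.
  apply: le_trans (gl s' s (in01 s' ltac:(move: h1 h2 h3 ed; cl)) (in01 s ltac:(move: h1 h2 h3 ed; cl))) _.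
  by rewrite ger0_norm ?subr_ge0//; apply: ler_wpM2r => //; rewrite subr_ge0.
have near gam : (forall e, e <= sg + d -> lip_on (gam : R -> 'rV[R]_n) sg e L) ->
    gam sg = gam1 sg -> forall s, sg <= s <= sg + d -> `|gam s - gam1 sg| < r.
  move=> gl <- s sI; apply: le_lt_trans (gl (sg + d) (lexx _) sg s _ _ _) _; [by []|by move: sI; cl|by move: sI; cl|].
  apply: (@le_lt_trans _ _ (L * d)); first by apply: ler_wpM2l => //; move: sI; cl.
  move: d4; rewrite ler_pdivlMr// mulrDr mulr1 mulrC; move: (L * d) => ?; move: d0 r0; cl.
have L1L : L1 <= L by rewrite /L lerDl.
have L2L : L2 <= L by rewrite /L lerDr.
have lip1 := lip gam1 L1 L1L gL1; have lip2 := lip gam2 L2 L2L gL2.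
have near1 := near gam1 lip1 erefl; have near2 := near gam2 lip2 (esym agsg).
have agr e : sg < e -> e <= sg + d -> gam1 e = gam2 e.
  move=> se ed; have etb : e <= tb by move: ed d2; cl.
  have et1 : e <= t1 by move: ed d3; cl.
  have n1 s : sg <= s <= e -> `|gam1 s - gam1 sg| < r by move=> sI; apply: near1; move: sI ed; cl.
  have n2 s : sg <= s <= e -> `|gam2 s - gam1 sg| < r by move=> sI; apply: near2; move: sI ed; cl.
  apply: (uniq gam1 gam2 sg e tas se etb _ (lip1 _ ed) (lip2 _ ed) n1 n2 _ _ agsg).
  - by move: ed d1; cl.
  - exact: (gen_char_ae lr gc1 sg0 et1 tas etb n1).
  - exact: (gen_char_ae lr gc2 sg0 et1 tas etb n2).
have : S (sg + d).
  split; first by move: sg0 d0 d3; cl.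
  move=> s /andP[s0 sd]; case: (ltrgtP s sg) => [|h|->//]; first exact: agree.
  exact: agr.
move=> /(ub_le_sup (ex_intro _ t1 Sub)); rewrite -/sg => h.
by exfalso; move: h d0; cl.
Qed.

(** * Existence of characteristics *)

(** An ultrafilter refining the filter at infinity selects a limit at every t at once, in place of
    the extraction of a subsequence. Two points at a time are what increments of the limit
    require. *)
Lemma pointwise_limit (R : realType) (n : nat) (X : Type) (f : nat -> X -> 'rV[R]_n) (x0 : 'rV[R]_n)
    (r : X -> R) :
  (forall N t, `|f N t - x0| <= r t) ->
  exists g : X -> 'rV[R]_n, forall t1 t2 (e : R) (N0 : nat), 0 < e -> exists N, [/\ (N0 <= N)%N,
    `|f N t1 - g t1| < e & `|f N t2 - g t2| < e].
Proof.
move=> fr; have [U [UU UN]] := @ultraFilterLemma _ (nbhs (\oo : set_system nat)) _.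
have lim_t t : exists p : 'rV[R]_n, forall e : R, 0 < e -> U [set N | `|f N t - p| < e].
  have [|p [_ clp]] := @compact_cball R n x0 (r t) ((fun N => f N t) @ U) _.
    suff : U [set N | `|f N t - x0| <= r t] by [].
    by apply: (@filterS _ _ _ setT _); [move=> N _; exact: fr|exact: filterT].
  exists p => e e0; case: (in_ultra_setVsetC [set N | `|f N t - p| < e] UU) => // Uc.
  have [|y []] := clp (~` [set y : 'rV[R]_n | `|y - p| < e] : set 'rV[R]_n) (ball p e) _ (nbhsx_ballx _ _ e0).
    exact: Uc.
  by rewrite -ball_normE /= distrC => h /h.
have [g near_t] := choice lim_t; exists g => t1 t2 e N0 e0.
have largeN : U [set N | (N0 <= N)%N] by apply: UN; exact: nbhs_infty_ge.
have [N [[h1 h2] h3]] := filter_ex (filterI (filterI largeN (near_t t1 e e0)) (near_t t2 e e0)).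
by exists N.
Qed.

Fixpoint euler_node (R : realType) (n : nat) (vel : R -> 'rV[R]_n -> 'rV[R]_n) (ta : R) (x0 : 'rV[R]_n)
    (eta : R) (i : nat) : 'rV[R]_n :=
  if i is k.+1 then
    let y := euler_node vel ta x0 eta k in y + eta *: vel (ta + eta * k%:R) y
  else x0.

Lemma euler_node_le (R : realType) (n : nat) (vel : R -> 'rV[R]_n -> 'rV[R]_n) (L ta : R) (x0 : 'rV[R]_n) (eta : R) i j :
  (forall t x, `|vel t x| <= L) -> 0 <= eta -> (i <= j)%N ->
  `|euler_node vel ta x0 eta j - euler_node vel ta x0 eta i| <= L * (eta * (j%:R - i%:R)).
Proof.
move=> vel_le eta0; elim: j => [|j IH]; first by rewrite leqn0 => /eqP ->; rewrite !subrr normr0 !mulr0.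
rewrite leq_eqVlt => /predU1P[->|]; first by rewrite !subrr normr0 !mulr0.
rewrite ltnS => /IH {}IH /=; rewrite addrAC; apply: le_trans (ler_normD _ _) _.
rewrite normrZ ger0_norm//; apply: le_trans (lerD IH (ler_wpM2l eta0 (vel_le _ _))) _.
by rewrite -natr1 le_eqVlt; apply/orP; left; apply/eqP; ring.
Qed.

Lemma euler_node_dotp (R : realType) (n : nat) (vel : R -> 'rV[R]_n -> 'rV[R]_n) (ta : R) (x0 : 'rV[R]_n) (eta : R)
    (q : 'rV[R]_n) (c : R) i j : 0 <= eta -> (i <= j)%N ->
  (forall k, (i <= k)%N -> (k < j)%N -> c <= dotp q (vel (ta + eta * k%:R) (euler_node vel ta x0 eta k))) ->
  c * (eta * (j%:R - i%:R)) <= dotp q (euler_node vel ta x0 eta j - euler_node vel ta x0 eta i).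
Proof.
move=> eta0; elim: j => [|j IH]; first by rewrite leqn0 => /eqP -> _; rewrite !subrr dotp0r !mulr0.
rewrite leq_eqVlt => /predU1P[->|]; first by rewrite !subrr dotp0r !mulr0.
rewrite ltnS => ij hk.
have h1 := IH ij (fun k ik kj => hk k ik (leqW kj)).
have := ler_wpM2l eta0 (hk j ij (leqnn _)).
rewrite /= addrAC dotpDr dotpZr -natr1; move: h1.
have -> : c * (eta * (j%:R + 1 - i%:R)) = c * (eta * (j%:R - i%:R)) + eta * c by ring.
by move: (c * _) (eta * c) (dotp _ _) (eta * dotp _ _) => ? ? ? ?; cl.
Qed.

(* A limit of Euler polygons. The velocity field need not be continuous, so
   what survives in the limit are the one-sided linear inequalities that it
   satisfies near a point. *)
Lemma euler_curve (R : realType) (n : nat) (vel : R -> 'rV[R]_n -> 'rV[R]_n) (L ta : R) (x0 : 'rV[R]_n) :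
  (forall t x, `|vel t x| <= L) -> 0 <= L -> exists gam : R -> 'rV[R]_n, [/\ gam ta = x0,
  forall s t, ta <= s -> s <= t -> `|gam t - gam s| <= L * (t - s) &
  forall t h d q c, ta <= t -> 0 < h -> 0 < d ->
    (forall s y, ta <= s -> t - d <= s <= t + h -> `|y - gam t| <= L * h + d -> c <= dotp q (vel s y)) ->
    c * h <= dotp q (gam (t + h) - gam t)].
Proof.
move=> vel_le L0; pose eta (N : nat) : R := N.+1%:R^-1.
have eta_gt0 N : 0 < eta N by rewrite /eta invr_gt0.
pose idx N (t : R) := Num.truncn ((t - ta) / eta N).
(* A step function, constant between nodes, instead of the polygon: it is Lipschitz up to an error L
   eta, which vanishes in the limit. *)
pose f N t := euler_node vel ta x0 (eta N) (idx N t).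
have idxP N t : ta <= t -> t - eta N < ta + eta N * (idx N t)%:R <= t.
  move=> tat; have x0' : 0 <= (t - ta) / eta N by rewrite divr_ge0 ?subr_ge0// ltW.
  have /andP[] := truncn_itv x0'; rewrite -/(idx N t) ler_pdivlMr// ltr_pdivrMr// -natr1 mulrDl mul1r mulrC.
  by move: (eta N) (eta N * (idx N t)%:R) => ? ?; cl.
have idx_le N s t : s <= t -> (idx N s <= idx N t)%N.
  by move=> st; apply: le_truncn; apply: ler_wpM2r; [rewrite invr_ge0 ltW|rewrite lerD2r].
have idx_ta N : idx N ta = 0%N by rewrite /idx subrr mul0r truncn0.
have f_ta N : f N ta = x0 by rewrite /f idx_ta.
have f_lip N s t : ta <= s -> s <= t -> `|f N t - f N s| <= L * (t - s + eta N).
  move=> tas st; apply: le_trans (euler_node_le ta x0 vel_le (ltW (eta_gt0 N)) (idx_le N _ _ st)) _.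
  apply: ler_wpM2l => //; have := idxP N s tas; have := idxP N t (le_trans tas st).
  by rewrite mulrBr; move: (eta N * _) (eta N * _) => ? ?; cl.
have f_bnd N t : `|f N t - x0| <= L * (`|t - ta| + 1).
  have [tat|tat] := leP ta t.
    rewrite -(f_ta N); apply: le_trans (f_lip N _ _ (lexx _) tat) _; apply: ler_wpM2l => //.
    rewrite ger0_norm ?subr_ge0// lerD2l /eta invf_le1 ?ltr0n// ler1n//.
  have -> : f N t = x0.
    have /eqP : idx N t = 0%N; last by rewrite /f => /eqP ->.
    by apply/eqP; rewrite -leqn0 -(idx_ta N); apply: idx_le; exact: ltW.
  by rewrite subrr normr0; apply: mulr_ge0 => //; apply: addr_ge0.
have [gam hg] := pointwise_limit f_bnd.
have eta_small (e : R) : 0 < e -> exists N0, forall N, (N0 <= N)%N -> eta N < e.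
  move=> e0; exists (Num.truncn e^-1) => N NN.
  rewrite /eta invf_plt ?posrE ?ltr0n//.
  have /andP[_ h] := @truncn_itv _ e^-1 ltac:(by rewrite invr_ge0 ltW).
  by apply: lt_le_trans h _; rewrite ler_nat.
exists gam; split.
- apply/eqP; rewrite -subr_eq0 -normr_eq0; apply/eqP/le_anti; rewrite normr_ge0 andbT.
  apply/ler_addgt0Pr => e e0; rewrite add0r.
  by have [N [_ h _]] := hg ta ta e 0%N e0; rewrite distrC; move: h; rewrite f_ta => /ltW.
- move=> s t tas st; apply/ler_addgt0Pr => e e0.
  have e30 : 0 < e / 3 by exact: divr_gt0.
  have L1 : 0 < L + 1 by move: L0; cl.
  have [N0 hN0] := eta_small (e / 3 / (L + 1)) (divr_gt0 e30 L1).
  have [N [NN h1 h2]] := hg s t (e / 3) N0 e30.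
  have -> : gam t - gam s = (f N t - f N s) - (f N t - gam t) + (f N s - gam s) by vec.
  apply: le_trans (ler_normD _ _) _; apply: le_trans (lerD (ler_normB _ _) (lexx _)) _.
  have := f_lip N _ _ tas st; rewrite mulrDr.
  have : L * eta N <= e / 3.
    have := ltW (hN0 N NN); rewrite ler_pdivlMr// mulrDr mulr1 mulrC.
    by have := ltW (eta_gt0 N); move: (eta N) (L * eta N) => ? ?; cl.
  by move: h1 h2 e0; move: (L * eta N) (L * (t - s)) => ? ?; cl.
move=> t h d q c tat h0 d0 hc; apply/ler_addgt0Pr => e e0.
pose Q := `|c| + 2 * (n%:R * `|q|) + 1.
have nq : 0 <= n%:R * `|q| by apply: mulr_ge0.
have Q0 : 0 < Q by rewrite /Q; have := normr_ge0 c; move: nq; cl.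
have [z z0 /= /and3P[z1 z2 _]] := @exists_small _ [:: d / (L + 1); e / Q]
  ltac:(rewrite /= !divr_gt0//; move: L0; cl).
have L1 : 0 < L + 1 by move: L0; cl.
have [N0 hN0] := eta_small z z0.
have [N [NN h1 h2]] := hg t (t + h) z N0 z0.
have etaz := hN0 N NN; have eta0 := eta_gt0 N.
have zd : L * z + z <= d by move: z1; rewrite ler_pdivlMr// mulrDr mulr1 mulrC.
have Lz : 0 <= L * z by apply: mulr_ge0 => //; exact: ltW.
have Le : L * eta N <= L * z by apply: ler_wpM2l => //; exact: ltW.
have tth : t <= t + h by move: h0; cl.
have i1 := idxP N t tat; have i2 := idxP N (t + h) (le_trans tat tth).
have ij := idx_le N _ _ tth.
have main := euler_node_dotp (vel := vel) (x0 := x0) (q := q) (c := c) (ltW eta0) ij.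
have {}main : c * (eta N * ((idx N (t + h))%:R - (idx N t)%:R)) <= dotp q (f N (t + h) - f N t).
  apply: main => k ik kj; apply: hc.
  - by rewrite lerDl; apply: mulr_ge0; [exact: ltW|exact: ler0n].
  - have k1 : eta N * (idx N t)%:R <= eta N * k%:R by apply: ler_wpM2l; [exact: ltW|rewrite ler_nat].
    have k2 : eta N * k%:R <= eta N * (idx N (t + h))%:R.
      by apply: ler_wpM2l; [exact: ltW|rewrite ler_nat ltnW].
    move: i1 i2 k1 k2 zd etaz Lz; move: (eta N) (eta N * _) (eta N * _) (eta N * _) (L * z) => ? ? ? ? ?; cl.
  - have -> : euler_node vel ta x0 (eta N) k - gam t = (euler_node vel ta x0 (eta N) k - f N t) + (f N t - gam t) by vec.
    apply: le_trans (ler_normD _ _) _; have := euler_node_le ta x0 vel_le (ltW eta0) ik; rewrite -/(f N t) => k3.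
    have k4 : eta N * (k%:R - (idx N t)%:R) <= h + eta N.
      have k2 : eta N * k%:R <= eta N * (idx N (t + h))%:R.
        by apply: ler_wpM2l; [exact: ltW|rewrite ler_nat ltnW].
      rewrite mulrBr; move: i1 i2 k2; move: (eta N) (eta N * _) (eta N * _) (eta N * _) => ? ? ? ?; cl.
    have := ler_wpM2l L0 k4; rewrite [L * (h + _)]mulrDr; move: k3 h1 zd Le.
    by move: (L * (eta N * _)) (L * h) (L * z) (L * eta N) => ? ? ? ?; cl.
have h3 : `|eta N * ((idx N (t + h))%:R - (idx N t)%:R) - h| <= z.
  rewrite mulrBr ler_norml; move: i1 i2 etaz; move: (eta N) (eta N * _) (eta N * _) => ? ? ?; cl.
have h4 : c * h <= c * (eta N * ((idx N (t + h))%:R - (idx N t)%:R)) + `|c| * z.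
  have : c * h - c * (eta N * ((idx N (t + h))%:R - (idx N t)%:R)) <= `|c| * z.
    rewrite -mulrBr; apply: le_trans (ler_norm _) _; rewrite normrM distrC.
    by apply: ler_wpM2l.
  by move: (c * _) (c * _) (`|c| * _) => ? ? ?; cl.
have h5 (v : 'rV[R]_n) : `|v| < z -> `|dotp q v| <= n%:R * `|q| * z.
  move=> vz; apply: le_trans (dotp_le _ _) _; rewrite mulrA.
  by apply: ler_wpM2l => //; exact: ltW.
have := h5 _ h1; have := h5 _ h2.
have -> : dotp q (gam (t + h) - gam t) =
   dotp q (f N (t + h) - f N t) - dotp q (f N (t + h) - gam (t + h)) + dotp q (f N t - gam t).
  by rewrite -dotpBr -dotpDr; congr dotp; vec.
have Qz : `|c| * z + 2 * (n%:R * `|q| * z) + z <= e.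
  move: z2; rewrite ler_pdivlMr// /Q; congr (_ <= _); ring.
rewrite !ler_norml; move: Qz h4 main z0; move: (n%:R * _ * z) (`|c| * z) (c * (_ * _)) (c * h).
by move: (dotp _ _) (dotp _ _) (dotp _ _) => ? ? ? ? ? ? ?; cl.
Qed.

(** The supergradient inequality in the direction w is a linear inequality on the velocity A p, with
    normal A^-1 w; it is moved from (s, y) to the fixed point (t, x) at a cost O (d). In this form
    it survives the limit in [euler_curve]. *)
Lemma velocity_ge `(lr : @local_reg R n u A V ta tb x0 r c m C M K) (t s d : R) x y p w :
  ta <= t <= tb -> ta <= s <= tb -> `|x - x0| < r -> `|y - x0| < r -> `|s - t| <= d -> `|y - x| <= d ->
  sgrad (fun y => u (s, y)) x0 r K y p -> `|x + w - x0| <= r ->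
  u (t, x + w) - u (t, x) - K * `|w| ^+ 2 - (3 * K + n%:R * K + 6 * K * r + 4 * C ^+ 2 * K * r) * d <=
  dotp (mxact (invmx (A (t, x))) w) (mxact (A (s, y)) p).
Proof.
move=> tI sI xr yr std yxd sp wr; have lb := lr_lb lr; have cd := lr_cd lr; have K0 := lr_K lr.
have C0 : 0 <= C by have := lb_C lb; cl.
have r0 := lr_r lr.
have d0 : 0 <= d := le_trans (normr_ge0 _) std.
have xB : box ta tb x0 r (t, x) by split => //=; exact: ltW.
have yB : box ta tb x0 r (s, y) by split => //=; exact: ltW.
have zB : box ta tb x0 r (s, x + w) by [].
have zB' : box ta tb x0 r (t, x + w) by [].
have nw : `|w| <= 2 * r.
  have -> : w = (x + w - x0) - (x - x0) by vec.
  by apply: le_trans (ler_normB _ _) _; move: (ltW xr) wr; cl.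
have nxy : `|x - y| <= 2 * r.
  have -> : x - y = (x - x0) - (y - x0) by vec.
  by apply: le_trans (ler_normB _ _) _; move: (ltW xr) (ltW yr); cl.
have pK : `|p| <= K by exact: (@sgrad_bnd _ _ _ _ _ _ _ _ _ _ _ _ _ _ lr s y).
have h1 := sp (x + w - y); rewrite (addrC y) subrK in h1.
have {}h1 := h1 wr.
have h2 : u (t, x + w) <= u (s, x + w) + K * d.
  rewrite -lerBlDl; apply: le_trans (ler_norm _) _; apply: le_trans (lr_lip lr zB' zB) _.
  by rewrite subrr normr0 addr0 distrC; apply: ler_wpM2l.
have h3 : u (s, y) <= u (t, x) + K * (2 * d).
  rewrite -lerBlDl; apply: le_trans (ler_norm _) _; apply: le_trans (lr_lip lr yB xB) _.
  by apply: ler_wpM2l => //; move: std yxd; cl.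
have h4 : dotp p (x + w - y) <= dotp p w + n%:R * K * d.
  have -> : x + w - y = w + (x - y) by vec.
  rewrite dotpDr lerD2l; apply: le_trans (ler_norm _) _; apply: le_trans (dotp_le _ _) _.
  rewrite -mulrA; apply: ler_wpM2l; first exact: ler0n.
  by apply: ler_pM => //; rewrite distrC.
have h5 : K * `|x + w - y| ^+ 2 <= K * `|w| ^+ 2 + 6 * K * r * d.
  have -> : K * `|w| ^+ 2 + 6 * K * r * d = K * (`|w| ^+ 2 + 6 * r * d) by ring.
  apply: ler_wpM2l => //.
  have : `|x + w - y| <= `|w| + `|x - y|.
    by have -> : x + w - y = w + (x - y); [vec|exact: ler_normD].
  move=> /(lerXn2r 2); rewrite !nnegrE => /(_ (normr_ge0 _) (addr_ge0 (normr_ge0 _) (normr_ge0 _))) /le_trans.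
  apply; have yxd' : `|x - y| <= d by rewrite distrC.
  have q0 := normr_ge0 (x - y); have w0 := normr_ge0 w.
  have : `|x - y| * (2 * `|w| + `|x - y|) <= d * (6 * r).
    by apply: ler_pM => //; move: nw nxy; cl.
  move: `|w| `|x - y| => a b.
  have -> : (a + b) ^+ 2 = a ^+ 2 + b * (2 * a + b) by ring.
  by have -> : 6 * r * d = d * (6 * r); [ring|rewrite lerD2l].
have h6 : dotp p w = bil (invmx (A (s, y))) w (mxact (A (s, y)) p).
  rewrite /bil mxact_sym; last by apply: invmx_sym; exact: (cd_sym cd yB).
  by rewrite (mxact_invKV (cd_c cd)); [exact: dotpC|exact: (cd_ell cd yB)].
have nv : `|mxact (A (s, y)) p| <= C * K.
  by apply: le_trans (lb_Abnd lb p yB) _; apply: ler_wpM2l.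
have h7 : dotp p w <= bil (invmx (A (t, x))) w (mxact (A (s, y)) p) + 4 * C ^+ 2 * K * r * d.
  rewrite h6 -lerBlDl; apply: le_trans (ler_norm _) _.
  apply: le_trans (@lb_Blip _ _ _ _ _ _ _ _ _ lb _ _ _ _ w _ yB xB) _.
  have -> : 4 * C ^+ 2 * K * r * d = (C * (2 * d)) * ((2 * r) * (C * K)) by ring.
  apply: ler_pM.
  - by apply: mulr_ge0 => //; apply: addr_ge0.
  - exact: mulr_ge0.
  - by apply: ler_wpM2l => //; move: std yxd; cl.
  - exact: ler_pM.
rewrite -[dotp (mxact _ w) _]/(bil (invmx (A (t, x))) w (mxact (A (s, y)) p)).
have -> : (3 * K + n%:R * K + 6 * K * r + 4 * C ^+ 2 * K * r) * d =
  3 * (K * d) + n%:R * K * d + 6 * K * r * d + 4 * C ^+ 2 * K * r * d by ring.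
have Kd : K * (2 * d) = 2 * (K * d) by ring.
rewrite Kd in h3; move: h1 h2 h3 h4 h5 h7.
move: (4 * C ^+ 2 * K * r * d) (6 * K * r * d) (n%:R * K * d) (K * d) (K * `|w| ^+ 2) (K * `|x + w - y| ^+ 2).
move: (u _) (u _) (u _) (u _) (bil _ _ _) (dotp _ _) (dotp _ _) => ? ? ? ? ? ? ? ? ? ? ? ? ?; cl.
Qed.

(** The velocity field picks some supergradient at each point, without continuity. The limit curve
    satisfies the linear inequalities of [velocity_ge] for every w, and together they say that A^-1
    gam' is a supergradient. *)
Lemma local_characteristic `(lr : @local_reg R n u A V ta tb x0 r c m C M K) :
  exists (s L : R) (gam : R -> 'rV[R]_n), [/\ 0 < s, ta + s <= tb, 0 <= L, gam ta = x0 &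
   [/\ lip_on gam ta (ta + s) L, forall t : R, ta <= t <= ta + s -> `|gam t - x0| < r &
     forall (t : R) v, ta < t < ta + s -> has_deriv gam t v ->
       exists2 p, sgrad (fun y => u (t, y)) x0 r K (gam t) p & v = mxact (A (t, gam t)) p]].
Proof.
have lb := lr_lb lr; have cd := lr_cd lr; have r0 := lr_r lr; have K0 := lr_K lr; have tatb := lr_lt lr.
have C0 : 0 <= C by have := lb_C lb; cl.
pose L := C * K; have L0 : 0 <= L by exact: mulr_ge0.
have sel (z : R * 'rV[R]_n) : exists v : 'rV[R]_n, `|v| <= L /\
    (ta <= z.1 <= tb -> `|z.2 - x0| < r ->
     exists2 p, sgrad (fun y => u (z.1, y)) x0 r K z.2 p & v = mxact (A z) p).
  have [[zI zr]|nz] := pselect ((ta <= z.1 <= tb) /\ `|z.2 - x0| < r); last first.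
    exists 0; split; first by rewrite normr0.
    by move=> h1 h2; exfalso; apply: nz.
  have [p sp] := @sgrad_exists _ _ (fun y => u (z.1, y)) x0 r K K z.2
    (fun x y => @lr_lipx _ _ _ _ _ _ _ _ _ _ _ _ _ _ lr z.1 x y zI) (lr_sc lr zI) K0 K0 zr.
  exists (mxact (A z) p); split; last by move=> _ _; exists p.
  have zB : box ta tb x0 r z by split => //; exact: ltW.
  apply: le_trans (lb_Abnd lb p zB) _; apply: ler_wpM2l => //.
  exact: (@sgrad_bnd _ _ _ _ _ _ _ _ _ _ _ _ _ _ lr z.1 z.2).
have [vel hvel] := choice sel.
have [gam [g0 gL gV]] := @euler_curve _ _ (fun t x => vel (t, x)) L ta x0 (fun t x => (hvel (t, x)).1) L0.
have L1 : 0 < L + 1 by move: L0; cl.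
have [s s0 /= /and3P[s1 s2 _]] := @exists_small _ [:: tb - ta; r / 2 / (L + 1)]
  ltac:(by rewrite /= subr_gt0 tatb !divr_gt0).
have Lsr : L * s <= r / 2.
  by move: s2; rewrite ler_pdivlMr// mulrDr mulr1 mulrC; move: s0; move: (L * s) => ?; cl.
have gr (t : R) : ta <= t <= ta + s -> `|gam t - x0| < r.
  move=> tI; rewrite -g0; apply: le_lt_trans (gL ta t (lexx _) _) _; first by move: tI; cl.
  apply: (@le_lt_trans _ _ (L * s)); first by apply: ler_wpM2l => //; move: tI; cl.
  by move: Lsr r0; cl.
exists s, L, gam; split => //; first by move: s1; cl.
split => //; first by move=> x y ax xy yb; exact: gL.
move=> t v tI dv.
have tI' : ta <= t <= tb by move: tI s1; cl.
have gtr : `|gam t - x0| < r by apply: gr; move: tI; cl.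
have tB : box ta tb x0 r (t, gam t) by split => //=; exact: ltW.
have Asym := cd_sym cd tB; have Aell := cd_ell cd tB.
exists (mxact (invmx (A (t, gam t))) v); last by rewrite (mxact_invK (cd_c cd)).
move=> w wr.
have -> : dotp (mxact (invmx (A (t, gam t))) v) w = dotp (mxact (invmx (A (t, gam t))) w) v.
  by rewrite -/(bil _ v w) (bilC _ _ (invmx_sym Asym)).
set q := mxact _ w.
pose k0 := 3 * K + n%:R * K + 6 * K * r + 4 * C ^+ 2 * K * r.
have k00 : 0 <= k0.
  rewrite /k0; apply: addr_ge0; last first.
    by apply: mulr_ge0; [apply: mulr_ge0 => //; apply: mulr_ge0 => //; exact: sqr_ge0|exact: ltW].
  apply: addr_ge0; first by apply: addr_ge0; apply: mulr_ge0.
  by apply: mulr_ge0; [exact: mulr_ge0|exact: ltW].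
pose c0 := u (t, gam t + w) - u (t, gam t) - K * `|w| ^+ 2.
suff : c0 <= dotp q v by rewrite /c0; move: (u _) (u _) (K * _) (dotp _ _) => ? ? ? ?; cl.
have L2 : 0 < L + 2 by move: L0; cl.
have rg : 0 < (r - `|gam t - x0|) / (L + 2) by apply: divr_gt0 => //; rewrite subr_gt0.
have tas : 0 < ta + s - t by move: tI; cl.
have [h0 h00 /= /and3P[h1 h2 _]] := @exists_small _ [:: ta + s - t; (r - `|gam t - x0|) / (L + 2)]
  ltac:(by rewrite /= tas rg).
rewrite -[c0]opprK.
apply: (@deriv_ge_right _ (fun s => dotp q (gam s)) t _ _ (k0 * (L + 1)) h0 h00 _ (has_deriv_dotp q dv)).
  by apply: mulr_ge0 => //; exact: ltW.
move=> h h_gt0 hh.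
have Lh : 0 <= L * h by apply: mulr_ge0 => //; exact: ltW.
have key : (c0 - k0 * (L * h + h)) * h <= dotp q (gam (t + h) - gam t).
  apply: (gV t h h q (c0 - k0 * (L * h + h))) => //; first by move: tI; cl.
  move=> z y taz zI yg.
  have zI' : ta <= z <= tb.
    by rewrite taz /=; move: zI hh h1 s1; cl.
  have yr : `|y - x0| < r.
    have -> : y - x0 = (y - gam t) + (gam t - x0) by vec.
    apply: le_lt_trans (ler_normD _ _) _; rewrite -ltrBrDr; apply: le_lt_trans yg _.
    move: h2; rewrite ler_pdivlMr// => h2; apply: lt_le_trans h2.
    have -> : h0 * (L + 2) = L * h0 + 2 * h0 by ring.
    have : L * h <= L * h0 by apply: ler_wpM2l => //; exact: ltW.
    by move: hh h_gt0; move: (L * h) (L * h0) => ? ?; cl.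
  have [p sp ->] := (hvel (z, y)).2 zI' yr.
  apply: (@velocity_ge _ _ _ _ _ _ _ _ _ _ _ _ _ _ lr t z (L * h + h)) => //.
  by rewrite ler_norml; move: zI Lh; move: (L * h) => ?; cl.
move: key; rewrite dotpBr.
have -> : (c0 - k0 * (L * h + h)) * h = - (h * (- c0 + k0 * (L + 1) * h)) by ring.
by move: (dotp _ _) (dotp _ _) (h * _) => ? ? ?; cl.
Qed.

Lemma ae_neq (R : realType) (a : R) : {ae @lebesgue_measure R, forall t, t != a}.
Proof.
exists [set a]; split; [exact: measurable_set1|exact: lebesgue_measure_set1|].
by move=> t /= h; apply: contrapT => ta; apply: h; apply/eqP.
Qed.

Lemma exists_characteristic (R : realType) (n : nat) (u V : R * 'rV[R]_n -> R) (A : R * 'rV[R]_n -> 'M[R]_n)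
    (T : R) (Om : set 'rV[R]_n) (y : 'rV[R]_n) :
  regular_at u A V T Om 0 y -> exists J gam, gen_characteristic_from (quadratic_ham A V) T Om u y J gam.
Proof.
move=> [ta [tb [r [c [m [C [M [K [[ta0 tbT /andP[tale0 tb0] _] cyl lr]]]]]]]]].
(* A regular box at time 0 starts exactly at time 0, so the curve built from its initial face starts
   there too. *)
have taE : ta = 0 by apply/eqP; rewrite eq_le tale0.
move: lr cyl; rewrite taE => {ta taE ta0 tale0} lr cyl.
have [s [L [gam [s0 stb L0 g0 [gL gr gV]]]]] := local_characteristic lr.
rewrite add0r in stb gL gr gV.
exists `[0, s], gam; split => //; first by exists s => //; left.
move=> a b ab abJ.
have a0 : 0 <= a by have /andP[] : 0 <= a <= s by have := abJ a; rewrite /= !in_itv/= lexx (ltW ab); apply.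
have bs : b <= s by have /andP[] : 0 <= b <= s by have := abJ b; rewrite /= !in_itv/= lexx (ltW ab); apply.
split => //.
- move=> t; rewrite in_itv/= => tI; apply: cyl; split => /=; first by move: tI a0 bs stb; cl.
  by apply: ltW; apply: gr; move: tI a0 bs; cl.
- exists L; split; first exact: num_real.
  move=> k Lk [x x'] /= []; rewrite !in_itv/= => xI x'I.
  have kk (z z' : R) : a <= z -> z <= z' -> z' <= b -> `|gam z' - gam z| <= k * `|z' - z|.
    move=> az zz' z'b; apply: le_trans (gL z z' (le_trans a0 az) zz' (le_trans z'b bs)) _.
    by rewrite ger0_norm ?subr_ge0//; apply: ler_wpM2r; [rewrite subr_ge0|exact: ltW].
  have [xx'|xx'] := leP x x'.
    by rewrite distrC [`|x - x'|]distrC; apply: kk => //; [move: xI; cl|move: x'I; cl].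
  by apply: kk; [move: x'I; cl|exact: ltW|move: xI; cl].
have [h [_ _ hd]] := curve_velocity s0 L0 gL.
(* The endpoints 0 and s, where the two-sided derivative is not controlled, are removed as a null
   set. *)
apply: ae_impl (ae_and hd (ae_and (ae_neq 0) (ae_neq s))) => t [dt [tn0 tns]].
rewrite in_itv/= => tI.
have tI' : 0 < t < s by rewrite !lt_neqAle [0 == t]eq_sym tn0 tns; move: tI a0 bs; cl.
have {}dt := dt tI'; have [dg dv] := has_deriv_is_derive dt.
split; first exact: dg.
rewrite derive1E dv; apply/(char_velocity lr).
- by move: tI' stb; cl.
- by apply: gr; move: tI'; cl.
by have [p sp ->] := gV t _ tI' dt; exists p.
Qed.

Theorem theorem8 (R : realType) (n : nat) (Om : set 'rV[R]_n) (T c1 c2 : R)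
    (A : R * 'rV[R]_n -> 'M[R]_n) (V : R * 'rV[R]_n -> R)
    (u0 : 'rV[R]_n -> R) (u : R * 'rV[R]_n -> R) (y0 : 'rV[R]_n)
    (Om_open : open Om) (T_gt0 : 0 < T)
    (V_C2 : C2_near (closed_cylinder T Om) V)
    (A_C2 : forall i j, C2_near (closed_cylinder T Om) (fun z => A z i j))
    (A_sym : forall z, closed_cylinder T Om z -> (A z)^T = A z)
    (c1_gt0 : 0 < c1) (c2_gt0 : 0 < c2)
    (A_bounds : forall z, closed_cylinder T Om z -> forall p, p != 0 ->
       c1 * dotp p p < dotp (mxact (A z) p) p < c2 * dotp p p)
    (u0_semiconcave : locally_semiconcave Om u0)
    (u_cont : {within ropen_cylinder T Om, continuous u})
    (u_visc : viscosity_solution (quadratic_ham A V) (open_cylinder T Om) u)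
    (u_init : forall x, Om x -> u (0, x) = u0 x)
    (Om_y0 : Om y0) (y0_singular : ~ differentiable u0 y0) :
  let char := gen_characteristic_from (quadratic_ham A V) T Om u y0 in
  [/\ exists J gam, char J gam,
      forall J1 gam1 J2 gam2, char J1 gam1 -> char J2 gam2 ->
        forall t, t \in J1 -> t \in J2 -> gam1 t = gam2 t
    & forall J gam, char J gam -> forall t, t \in J -> 0 < t ->
        ~ differentiable u (t, gam t)].
Proof.
move=> char.
have reg th xh : 0 <= th < T -> Om xh -> regular_at u A V T Om th xh.
  exact: (local_regularity Om_open V_C2 A_C2 A_sym c1_gt0 A_bounds u0_semiconcave u_cont u_visc u_init).
have regy : regular_at u A V T Om 0 y0 by apply: reg => //; rewrite lexx.
have restrict J gam t : char J gam -> t \in J -> 0 < t ->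
    gen_characteristic (quadratic_ham A V) T Om u 0 t gam.
  move=> [[s s0 JE] _ gc] tJ t0; apply: gc => // z /=.
  case: JE tJ => ->; rewrite !in_itv/= => /andP[_ ts] /andP[-> zt]; first exact: le_trans ts.
  exact: le_lt_trans ts.
split.
- exact: exists_characteristic.
- move=> J1 gam1 J2 gam2 ch1 ch2 t t1 t2.
  have [[s1 _ JE] g1 _] := ch1; have [_ g2 _] := ch2.
  have [t0|t0] := ltP 0 t.
    apply: (unique_characteristic reg (restrict _ _ _ ch1 t1 t0) (restrict _ _ _ ch2 t2 t0)).
    by rewrite g1 g2.
  have -> : t = 0; last by rewrite g1 g2.
  by apply/eqP; rewrite eq_le t0 /=; case: JE t1 => ->; rewrite in_itv/= => /andP[].
move=> J gam ch t tJ t0 du; apply: y0_singular.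
have [_ g0 _] := ch.
have [p [k [d [d0 touch]]]] := touch_from_below reg (restrict _ _ _ ch tJ t0) du.
by rewrite g0 in touch; exact: (differentiable_of_touch regy u_init d0 touch).
Qed.
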